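(* Let $\mathcal{V}\in\mathcal{T}_K(U_1)$ with $U_1=\mathbb{A}^1\setminus\{x_1,\dots,x_p\}$, and let $\mathbf{A}=(A_1,\ldots,A_{p+1})\in\mathrm{GL}(V)^{p+1}$ be the monodromy tuple of $\mathcal{V}$ with respect to $\alpha_1,\ldots,\alpha_p$. Let $\chi:\pi_1(\mathbb{G}_m)\to K^\times$ be the character sending the counterclockwise generator to $\lambda\neq 1$. Then the stalk of $\mathrm{MC}_\chi(\mathcal{V})$ at $y_0$ is canonically isomorphic to $W$, and the monodromy tuple of $\mathrm{MC}_\chi(\mathcal{V})$ with respect to the homotopy base $\delta_1,\ldots,\delta_p$ is given by $\mathrm{MC}_\lambda(\mathbf{A})\in\mathrm{GL}(W)^{p+1}$.
   Context: Spaces are complex points with the complex analytic topology; $K$ is a field; $\mathrm{LS}_K(X)$ denotes local systems of finite-dimensional $K$-vector spaces on $X$. Path product: $\gamma\gamma'$ means first $\gamma'$, then $\gamma$. Endomorphisms act from the right (on row vectors). $\mathcal{T}_K(U_1)$ is the category of $\mathcal{V}\in\mathrm{LS}_K(U_1)$ which are irreducible and for which at least two of the local monodromies $A_1,\ldots,A_p$ at the finite punctures are not the identity. Middle convolution with a Kummer sheaf: $\mathcal{V}_\chi\in\mathrm{LS}_K(\mathbb{G}_m)$, $\mathbb{G}_m=\mathbb{A}^1\setminus\{0\}$, is the rank one local system given by $\chi$. Put $S=\mathbb{A}^1\setminus\{x_1,\dots,x_p\}$ ($=U_1$, with coordinate $y$), $U=\{(x,y): x\ne x_i,\ y\neq x_i\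 \forall i,\ y\ne x\}$, $\mathrm{pr}_1(x,y)=x$, $\mathrm{pr}_2(x,y)=y\in S$, $\mathrm{d}(x,y)=y-x\in\mathbb{G}_m$, $j:U\to\mathbb{P}^1\times S$ the inclusion and $\overline{\mathrm{pr}}_2:\mathbb{P}^1\times S\to S$ the projection. Then $\mathrm{MC}_\chi(\mathcal{V}):=\mathcal{V}\ast\mathcal{V}_\chi=R^1(\overline{\mathrm{pr}}_2)_*(j_*(\mathrm{pr}_1^*\mathcal{V}\otimes\mathrm{d}^*\mathcal{V}_\chi))$. Homotopy bases: after a suitable homeomorphism, the $x_i$ and $y_0$ are real with $0<x_1<\cdots<x_p<y_0$. Let $(x_0,y_0)\in U$ be a base point, $U_0=\mathrm{pr}_2^{-1}(y_0)\cong\mathbb{A}^1\setminus\{x_1,\ldots,x_p,y_0\}$, and let $\alpha_1,\ldots,\alpha_{p+1}$ be free generators of $\pi_1(U_0,(x_0,y_0))$ which are simple counterclockwise loops around $x_1,\ldots,x_p,y_0$ such that $(\alpha_1\cdots\alpha_{p+1})^{-1}$ is a simple loop around $\infty$. Via $\mathrm{pr}_1$ the classes $\alpha_1,\dots,\alpha_p$ yield generators of $\pi_1(U_1,x_0)$; $V$ is the stalk of $\mathcal{V}$ at $x_0$, $A_i$ is the image of $\alpha_i$ ($i\le p$) under the monodromy representation of $\mathcal{V}$, and $A_{p+1}=(A_1\cdots A_p)^{-1}$. Let $\delta_1,\ldots,\delta_p$ be the generators of $\pi_1(S,y_0)$ which are simple loops $\delta_i$ around $x_i$ (not winding around $x_0$),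 such that, regarded as loops in $U$ via $y\mapsto(x_0,y)$, conjugation ${}^{\delta_i}\alpha:=\delta_i\alpha\delta_i^{-1}$ in $\pi_1(U,(x_0,y_0))$ is given by $$({}^{\delta_i}\alpha_1,\ldots,{}^{\delta_i}\alpha_{p+1})=(\alpha_1,\ldots,\alpha_{i-1},\alpha_i^{\alpha_{p+1}},\alpha_{i+1}^{[\alpha_i,\alpha_{p+1}]},\ldots,\alpha_p^{[\alpha_i,\alpha_{p+1}]},\alpha_{p+1}^{\alpha_i\alpha_{p+1}}),$$ where $a^b=b^{-1}ab$, $[a,b]=a^{-1}b^{-1}ab$. Tuple transformation $\mathrm{MC}_\lambda$: for $i=1,\ldots,p$ let $\tilde D_i\in\mathrm{GL}(V^p)$ be the block matrix which is the identity block matrix outside the $i$-th block row and whose $i$-th block row is $(\lambda(A_1-1),\ldots,\lambda(A_{i-1}-1),\lambda A_i,(A_{i+1}-1),\ldots,(A_p-1))$. Let $$\mathcal{K}=\{(w_1,\ldots,w_p)\mid w_i\in\mathrm{Im}(A_i-1)\}\subseteq V^p,$$ $$\mathcal{L}=\{(w_1A_2\cdots A_p,\ w_2A_3\cdots A_p,\ \ldots,\ w_p)\mid w_i\in\mathrm{Im}(A_1\cdots A_p\lambda-1)\}\subseteq V^p,$$ and $W=\mathcal{K}\cap\mathcal{L}\subseteq V^p$. The automorphisms $\tilde D_i$ stabilize the subspaces $\mathcal{K}$ and $\mathcal{L}$, hence $W$. Let $D_i\in\mathrm{GL}(W)$ be induced by $\tilde D_i$ ($i\le p$), $D_{p+1}=(D_1\cdots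 D_p)^{-1}$, and $\mathrm{MC}_\lambda(\mathbf{A})=(D_1,\ldots,D_{p+1})\in\mathrm{GL}(W)^{p+1}$.
   Formalization: The subspace L is corrected: as printed the claim fails (rank one, p=2, λA_1A_2=1 gives W=0 but a 1-dimensional stalk). L is taken to be all (w_1,…,w_p) with w_1A_2⋯A_p + w_2A_3⋯A_p + ⋯ + w_p in Im(A_1⋯A_pλ−1). *)

(* Defs.v *)
From HB Require Import structures.
From mathcomp Require Import all_boot all_order all_algebra.
From mathcomp Require Import all_classical all_reals all_analysis.
From mathcomp Require Import complex freeg.

Set Implicit Arguments.
Unset Strict Implicit.
Unset Printing Implicit Defensive.
Import Order.TTheory GRing.Theory Num.Theory numFieldNormedType.Exports.
Local Open Scope classical_set_scope.
Local Open Scope ring_scope.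

Definition prodM (K : fieldType) (I : Type) (F : I -> lmodType K) : Type :=
  forall i, F i.

Section ProdM.
Variables (K : fieldType) (I : Type) (F : I -> lmodType K).
Notation P := (prodM F).
HB.instance Definition _ := gen_eqMixin P.
HB.instance Definition _ := gen_choiceMixin P.
Definition prodM_add (s t : P) : P := fun i => s i + t i.
Definition prodM_opp (s : P) : P := fun i => - s i.
Definition prodM_zero : P := fun i => 0.
Definition prodM_scale (a : K) (s : P) : P := fun i => a *: s i.
Fact prodM_addA : associative prodM_add.
Proof. by move=> s t u; apply: functional_extensionality_dep => i; apply: addrA. Qed.
Fact prodM_addC : commutative prodM_add.
Proof. by move=> s t; apply: functional_extensionality_dep => i; apply: addrC. Qed.
Fact prodM_add0 : left_id prodM_zero prodM_add.
Proof. by move=> s; apply: functional_extensionality_dep => i; apply: add0r. Qed.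
Fact prodM_addN : left_inverse prodM_zero prodM_opp prodM_add.
Proof. by move=> s; apply: functional_extensionality_dep => i; apply: addNr. Qed.
HB.instance Definition _ :=
  GRing.isZmodule.Build P prodM_addA prodM_addC prodM_add0 prodM_addN.
Fact prodM_scaleA a b s : prodM_scale a (prodM_scale b s) = prodM_scale (a * b) s.
Proof. by apply: functional_extensionality_dep => i; apply: scalerA. Qed.
Fact prodM_scale1 : left_id 1 prodM_scale.
Proof. by move=> s; apply: functional_extensionality_dep => i; apply: scale1r. Qed.
Fact prodM_scaleDr : right_distributive prodM_scale +%R.
Proof. by move=> a s t; apply: functional_extensionality_dep => i; apply: scalerDr. Qed.
Fact prodM_scaleDl s : {morph prodM_scale^~ s : a b / a + b}.
Proof. by move=> a b; apply: functional_extensionality_dep => i; apply: scalerDl. Qed.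
HB.instance Definition _ := GRing.Zmodule_isLmodule.Build K P
  prodM_scaleA prodM_scale1 prodM_scaleDr prodM_scaleDl.
End ProdM.

Section ProdMap.
Variables (K : fieldType) (I : Type) (F G : I -> lmodType K).
Variable phi : forall i, {linear F i -> G i}.
Definition prod_map (s : prodM F) : prodM G := fun i => phi i (s i).
Fact prod_map_linear : linear prod_map.
Proof. by move=> a s t; apply: functional_extensionality_dep => i; apply: linearP. Qed.
HB.instance Definition _ :=
  GRing.isLinear.Build K (prodM F) (prodM G) *:%R prod_map prod_map_linear.
End ProdMap.

Record submod (K : fieldType) (P : lmodType K) := Submod {
  sub_set :> P -> Prop;
  sub0 : sub_set 0;
  subP : forall a u v, sub_set u -> sub_set v -> sub_set (a *: u + v) }.

Section SubmodTheory.
Variables (K : fieldType) (P : lmodType K) (A : submod P).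
Lemma subD u v : A u -> A v -> A (u + v).
Proof. by move=> Au Av; rewrite -[u]scale1r; apply: subP. Qed.
Lemma subZ a u : A u -> A (a *: u).
Proof. by move=> Au; rewrite -[_ *: _]addr0; apply: subP => //; apply: sub0. Qed.
Lemma subN u : A u -> A (- u).
Proof. by rewrite -scaleN1r; apply: subZ. Qed.
Lemma subB u v : A u -> A v -> A (u - v).
Proof. by move=> Au Av; apply/subD/subN. Qed.

Definition sub_pred : {pred P} := fun u => `[< A u >].
Definition submodT : Type := {u : P | sub_pred u}.
HB.instance Definition _ := SubChoice.on submodT.
Fact sub_pred_closed : submod_closed sub_pred.
Proof.
split; first exact/asboolP/sub0.
by move=> a u v /asboolP Au /asboolP Av; apply/asboolP/subP.
Qed.
HB.instance Definition _ := GRing.isSubmodClosed.Build K P sub_pred sub_pred_closed.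
HB.instance Definition _ := [SubChoice_isSubLmodule of submodT by <:].
End SubmodTheory.

Inductive span (K : fieldType) (P : lmodType K) (G : set P) : P -> Prop :=
| span0 : span G 0
| spanD a u v : G u -> span G v -> span G (a *: u + v).

Lemma span_closed (K : fieldType) (P : lmodType K) (G : set P) a u v :
  span G u -> span G v -> span G (a *: u + v).
Proof.
move=> Gu Gv; elim: Gu => [|b w z Gw _ IH]; first by rewrite scaler0 add0r.
by rewrite scalerDr scalerA -addrA; apply: spanD.
Qed.

Definition span_submod (K : fieldType) (P : lmodType K) (G : set P) : submod P :=
  Submod (span0 G) (@span_closed K P G).

Lemma span_gen (K : fieldType) (P : lmodType K) (G : set P) u : G u -> span G u.
Proof. by move=> Gu; rewrite -[u]addr0 -[u]scale1r; apply: spanD => //; exact: span0. Qed.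

Section Subquotient.
Variables (K : fieldType) (P : lmodType K) (A B : submod P).

Definition coset (s : P) : set P := [set t | A t /\ B (t - s)].

(** [A / (A `&` B)], its elements being the cosets [coset s] with [s] in [A] *)
Definition subquot : Type := {C : set P | exists2 s, A s & C = coset s}.

HB.instance Definition _ := gen_eqMixin subquot.
HB.instance Definition _ := gen_choiceMixin subquot.

Definition cls_in s (As : A s) : subquot := exist _ (coset s) (ex_intro2 _ _ s As erefl).
Definition cls (s : P) : subquot :=
  if pselect (A s) is left As then cls_in As else cls_in (sub0 A).
Definition rep (c : subquot) : P := projT1 (cid2 (svalP c)).

Lemma repA c : A (rep c).
Proof. by rewrite /rep; case: cid2. Qed.

Lemma clsE s (As : A s) : sval (cls s) = coset s.
Proof. by rewrite /cls; case: pselect. Qed.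

Lemma subquot_inj (c d : subquot) : sval c = sval d -> c = d.
Proof. by case: c d => [C HC] [D HD] /= E; subst D; congr exist; apply: Prop_irrelevance. Qed.

Lemma repK c : cls (rep c) = c.
Proof.
apply: subquot_inj; rewrite clsE; last exact: repA.
by rewrite /rep; case: cid2 => s.
Qed.

Lemma cls_eq s t : A s -> A t -> cls s = cls t <-> B (s - t).
Proof.
move=> As At; split=> [/(congr1 sval)|Bst].
  rewrite !clsE // => E; have : coset s s by split=> //; rewrite subrr; apply: sub0.
  by rewrite E => -[].
apply: subquot_inj; rewrite !clsE //; apply/seteqP; split=> u [Au Bu]; split=> //.
  by rewrite -[u](subrK s) -addrA; apply: subD.
by rewrite -[u](subrK t) -addrA; apply: subD => //; rewrite -opprB; apply: subN.
Qed.

Lemma rep_cls s : A s -> B (rep (cls s) - s).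
Proof. by move=> As; apply/cls_eq; rewrite ?repK //; apply: repA. Qed.

Definition sq_add (c d : subquot) := cls (rep c + rep d).
Definition sq_opp (c : subquot) := cls (- rep c).
Definition sq_zero : subquot := cls 0.
Definition sq_scale (a : K) (c : subquot) := cls (a *: rep c).

Lemma sq_addE s t : A s -> A t -> sq_add (cls s) (cls t) = cls (s + t).
Proof.
move=> As At; apply/cls_eq; try by apply: subD => //; apply: repA.
by rewrite opprD addrACA; apply: subD; apply: rep_cls.
Qed.
Lemma sq_oppE s : A s -> sq_opp (cls s) = cls (- s).
Proof.
move=> As; apply/cls_eq; try by apply: subN => //; apply: repA.
by rewrite -opprD; apply/subN/rep_cls.
Qed.
Lemma sq_scaleE a s : A s -> sq_scale a (cls s) = cls (a *: s).
Proof.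
move=> As; apply/cls_eq; try by apply: subZ => //; apply: repA.
by rewrite -scalerBr; apply/subZ/rep_cls.
Qed.

Let repP (c : subquot) : exists2 s, A s & c = cls s.
Proof. by exists (rep c); [exact: repA | rewrite repK]. Qed.

Fact sq_addA : associative sq_add.
Proof.
move=> c d e; have [[s As ->] [t At ->] [u Au ->]] := And3 (repP c) (repP d) (repP e).
by rewrite !sq_addE ?addrA //; apply: subD.
Qed.
Fact sq_addC : commutative sq_add.
Proof. by move=> c d; rewrite /sq_add addrC. Qed.
Fact sq_add0 : left_id sq_zero sq_add.
Proof. by move=> c; have [s As ->] := repP c; rewrite sq_addE ?add0r //; apply: sub0. Qed.
Fact sq_addN : left_inverse sq_zero sq_opp sq_add.
Proof.
move=> c; have [s As ->] := repP c.
by rewrite sq_oppE // sq_addE ?addNr //; apply: subN.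
Qed.
HB.instance Definition _ := GRing.isZmodule.Build subquot sq_addA sq_addC sq_add0 sq_addN.

Fact sq_scaleA a b c : sq_scale a (sq_scale b c) = sq_scale (a * b) c.
Proof.
have [s As ->] := repP c.
by rewrite !sq_scaleE ?scalerA //; apply: subZ.
Qed.
Fact sq_scale1 : left_id 1 sq_scale.
Proof. by move=> c; have [s As ->] := repP c; rewrite sq_scaleE ?scale1r. Qed.
Fact sq_scaleDr : right_distributive sq_scale +%R.
Proof.
move=> a c d; have [s As ->] := repP c; have [t At ->] := repP d.
rewrite -[cls s + _]/(sq_add _ _) -[RHS]/(sq_add _ _).
by rewrite sq_addE // !sq_scaleE ?sq_addE ?scalerDr //; first [apply: subZ|apply: subD].
Qed.
Fact sq_scaleDl c : {morph sq_scale^~ c : a b / a + b}.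
Proof.
move=> a b; have [s As ->] := repP c; rewrite -[RHS]/(sq_add _ _).
by rewrite !sq_scaleE // sq_addE ?scalerDl //; apply: subZ.
Qed.
HB.instance Definition _ := GRing.Zmodule_isLmodule.Build K subquot
  sq_scaleA sq_scale1 sq_scaleDr sq_scaleDl.

Lemma clsP a s t : A s -> A t -> cls (a *: s + t) = a *: cls s + cls t.
Proof.
move=> As At; rewrite -[RHS]/(sq_add (sq_scale _ _) _) sq_scaleE // sq_addE //.
exact: subZ.
Qed.
Lemma cls0 s : A s -> cls s = 0 <-> B s.
Proof. by move=> As; rewrite -[0]/(cls 0) cls_eq ?subr0 //; apply: sub0. Qed.
End Subquotient.

Section SubquotientMap.
Variables (K : fieldType) (P P' : lmodType K) (A B : submod P) (A' B' : submod P').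
Variables (L : {linear P -> P'}) (LA : forall s, A s -> A' (L s))
  (LB : forall s, A s -> B s -> B' (L s)).
Definition subquot_map (_ : forall s, A s -> A' (L s))
    (_ : forall s, A s -> B s -> B' (L s)) (c : subquot A B) : subquot A' B' :=
  cls A' B' (L (rep c)).
Notation f := (subquot_map LA LB).
Lemma subquot_map_cls s : A s -> f (cls A B s) = cls A' B' (L s).
Proof.
move=> As; apply/cls_eq; [exact/LA/repA | exact: LA |].
rewrite -linearB; apply: LB; last exact: rep_cls.
by apply: subB => //; apply: repA.
Qed.
Fact subquot_map_linear : linear f.
Proof.
move=> a c d; rewrite -[c]repK -[d]repK -clsP; try exact: repA.
rewrite !subquot_map_cls ?linearP ?clsP //; try exact: repA; try exact/LA/repA.
by apply: subP; apply: repA.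
Qed.
HB.instance Definition _ :=
  GRing.isLinear.Build K (subquot A B) (subquot A' B') *:%R f subquot_map_linear.
End SubquotientMap.

(** linear automorphisms, acting from the right: [u (f g) = (u f) g] *)
Record GL (K : fieldType) (V : lmodType K) := MkGL {
  gl_fun :> {linear V -> V};
  gl_inv : {linear V -> V};
  gl_funK : cancel gl_fun gl_inv;
  gl_invK : cancel gl_inv gl_fun }.

Definition gl1 (K : fieldType) (V : lmodType K) : GL V :=
  @MkGL K V idfun idfun (fun=> erefl) (fun=> erefl).
Definition glV (K : fieldType) (V : lmodType K) (f : GL V) : GL V :=
  MkGL (@gl_invK _ _ f) (@gl_funK _ _ f).
Definition glM (K : fieldType) (V : lmodType K) (f g : GL V) : GL V :=
  @MkGL K V (g \o f) (gl_inv f \o gl_inv g)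
    (can_comp (@gl_funK _ _ g) (@gl_funK _ _ f))
    (can_comp (@gl_invK _ _ f) (@gl_invK _ _ g)).
Definition gl_prod (K : fieldType) (V : lmodType K) (s : seq (GL V)) : GL V :=
  foldr (@glM K V) (gl1 V) s.

(** A sheaf of K-vector spaces on [X], presented by its etale space: the
    stalks, together with the predicate "the (set-theoretic) section [s] is a
    section of the sheaf in a neighbourhood of [x]".  The sections over an open
    set [V] are the families [s] with [secat s x] for all [x] in [V]. *)
Record sheaf (K : fieldType) (X : topologicalType) := Sheaf {
  stalk :> X -> lmodType K;
  secat : prodM stalk -> X -> Prop;
  secat_near : forall s x, secat s x -> \forall y \near x, secat s y;
  secat_local : forall s t x,
    (\forall y \near x, s y = t y) -> secat s x -> secat t x;
  secat0 : forall x, secat 0 x;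
  secatP : forall a s t x, secat s x -> secat t x -> secat (a *: s + t) x;
  secat_germ : forall x (v : stalk x), exists2 s, secat s x & s x = v;
  secat_sep : forall s x, secat s x -> s x = 0 -> \forall y \near x, s y = 0 }.

Section SheafTheory.
Variables (K : fieldType) (X : topologicalType).
Implicit Types F G : sheaf K X.

Definition sections F : lmodType K := prodM (stalk F).

Definition secat_submod F x : submod (sections F) :=
  Submod (secat0 F x) (fun a s t => @secatP _ _ F a s t x).

Lemma secat_sub_near F x s : secat_submod F x s ->
  \forall y \near x, secat_submod F y s.
Proof. exact: secat_near. Qed.

Record shom F G := MkShom {
  shom_fun :> forall x, {linear F x -> G x};
  shom_sec : forall (s : sections F) x,
    secat s x -> secat (prod_map shom_fun s) x }.

Definition shom1 F : shom F F := @MkShom F F (fun x => idfun) (fun s x => id).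

Definition near_zero_sub F (x : X) : submod (sections F).
Proof.
refine (@Submod K (sections F) (fun s => \forall y \near x, s y = 0) _ _).
  exact: nearW.
move=> a s t Hs Ht; near=> y; rewrite -[LHS]/(a *: s y + t y).
by rewrite (near Hs y) // (near Ht y) // scaler0 addr0.
Unshelve. all: by end_near. Defined.

Definition trivial_near F n (x : X) := exists e : 'I_n -> sections F,
  \forall y \near x, (forall i, secat (e i) y) /\
    (forall v : F y, exists! c : 'I_n -> K, v = \sum_i c i *: e i y).

Definition local_system F := forall x : X, exists n, trivial_near F n x.

Definition rank_one_local_system F := forall x : X, trivial_near F 1 x.

Definition irreducible F :=
  (exists x, exists v : F x, v != 0) /\
  forall (G : sheaf K X) (i : shom G F), local_system G ->
    (forall x, injective (i x)) ->
    (forall x (v : G x), v = 0) \/ (forall x (v : F x), exists u, i x u = v).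
End SheafTheory.

(** The sheaf associated with the presheaf whose germs at [x] are the elements
    of [A x] modulo those of [B x]. *)
Section GermSheaf.
Variables (K : fieldType) (X : topologicalType) (P : lmodType K).
Variables A B : X -> submod P.
Hypothesis An : forall x u, A x u -> \forall y \near x, A y u.
Hypothesis Bn : forall x u, B x u -> \forall y \near x, B y u.

Notation stk := (fun x => subquot (A x) (B x) : lmodType K).
Definition germ_secat (s : prodM stk) x := exists2 u,
  A x u & \forall y \near x, s y = cls (A y) (B y) u.

Fact germ_secat_near s x : germ_secat s x -> \forall y \near x, germ_secat s y.
Proof.
move=> [u Au /near_join su]; near=> y; exists u; first exact: (near (An Au) y).
exact: (near su y).
Unshelve. all: by end_near. Qed.
Fact germ_secat_local s t x :
  (\forall y \near x, s y = t y) -> germ_secat s x -> germ_secat t x.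
Proof.
move=> st [u Au su]; exists u => //; near=> y.
by rewrite -(near st y) // (near su y).
Unshelve. all: by end_near. Qed.
Fact germ_secat0 x : germ_secat 0 x.
Proof. by exists 0; [exact: sub0 | exact: nearW]. Qed.
Fact germ_secatP a s t x :
  germ_secat s x -> germ_secat t x -> germ_secat (a *: s + t) x.
Proof.
move=> [u Au su] [v Av tv]; exists (a *: u + v); first exact: subP.
near=> y; rewrite -[LHS]/(a *: s y + t y) clsP.
- by rewrite (near su y) // (near tv y).
- exact: (near (An Au) y).
- exact: (near (An Av) y).
Unshelve. all: by end_near. Qed.
Fact germ_secat_germ x (c : stk x) : exists2 s, germ_secat s x & s x = c.
Proof.
exists (fun y => cls (A y) (B y) (rep c)); last exact: repK.
by exists (rep c); [exact: repA | exact: nearW].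
Qed.
Fact germ_secat_sep s x : germ_secat s x -> s x = 0 -> \forall y \near x, s y = 0.
Proof.
move=> [u Au su] sx0; have Bu : B x u.
  by apply/(cls0 (B x) Au); rewrite -sx0 (nbhs_singleton su).
near=> y; rewrite (near su y) //; apply/cls0; first exact: (near (An Au) y).
exact: (near (Bn Bu) y).
Unshelve. all: by end_near. Qed.

Definition germ_sheaf : sheaf K X := Sheaf germ_secat_near germ_secat_local
  germ_secat0 germ_secatP germ_secat_germ germ_secat_sep.
End GermSheaf.

Section GermHom.
Variables (K : fieldType) (X : topologicalType) (P P' : lmodType K).
Variables (A B : X -> submod P) (A' B' : X -> submod P').
Hypothesis An : forall x u, A x u -> \forall y \near x, A y u.
Hypothesis Bn : forall x u, B x u -> \forall y \near x, B y u.
Hypothesis A'n : forall x u, A' x u -> \forall y \near x, A' y u.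
Hypothesis B'n : forall x u, B' x u -> \forall y \near x, B' y u.
Variable L : {linear P -> P'}.
Hypothesis LA : forall x u, A x u -> A' x (L u).
Hypothesis LB : forall x u, A x u -> B x u -> B' x (L u).

Fact germ_hom_sec (s : sections (germ_sheaf An Bn)) x : secat s x ->
  @secat _ _ (germ_sheaf A'n B'n) (prod_map (fun x =>
    subquot_map (@LA x) (@LB x) : {linear germ_sheaf An Bn x -> germ_sheaf A'n B'n x}) s) x.
Proof.
move=> [u Au su]; exists (L u); first exact: LA.
near=> y; rewrite /prod_map (near su y) //= subquot_map_cls //.
exact: (near (An Au) y).
Unshelve. all: by end_near. Qed.
Definition germ_hom : shom (germ_sheaf An Bn) (germ_sheaf A'n B'n) :=
  MkShom germ_hom_sec.
End GermHom.

Section Pull.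
Variables (K : fieldType) (X Y : topologicalType) (f : X -> Y).
Hypothesis cf : continuous f.

Section PullSheaf.
Variable F : sheaf K Y.
Notation stk := (fun x => F (f x)).
Definition pull_secat (s : prodM stk) x := exists2 t : sections F,
  secat t (f x) & \forall y \near x, s y = t (f y).
Fact pull_secat_near s x : pull_secat s x -> \forall y \near x, pull_secat s y.
Proof.
move=> [t Ht /near_join st].
have tn : \forall y \near x, secat t (f y) by have := secat_near Ht; apply: cf.
by near=> y; exists t; [exact: (near tn y) | exact: (near st y)].
Unshelve. all: by end_near. Qed.
Fact pull_secat_local s t x :
  (\forall y \near x, s y = t y) -> pull_secat s x -> pull_secat t x.
Proof.
move=> st [u Au su]; exists u => //; near=> y.
by rewrite -(near st y) // (near su y).
Unshelve. all: by end_near. Qed.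
Fact pull_secat0 x : pull_secat 0 x.
Proof. by exists 0; [exact: secat0 | exact: nearW]. Qed.
Fact pull_secatP a s t x :
  pull_secat s x -> pull_secat t x -> pull_secat (a *: s + t) x.
Proof.
move=> [u Au su] [v Av tv]; exists (a *: u + v); first exact: secatP.
near=> y; rewrite -[LHS]/(a *: s y + t y).
by rewrite (near su y) // (near tv y).
Unshelve. all: by end_near. Qed.
Fact pull_secat_germ x (v : stk x) : exists2 s, pull_secat s x & s x = v.
Proof.
have [t Ht tv] := secat_germ v; exists (fun y => t (f y)) => //.
by exists t => //; exact: nearW.
Qed.
Fact pull_secat_sep s x : pull_secat s x -> s x = 0 -> \forall y \near x, s y = 0.
Proof.
move=> [t Ht st] sx0; have tx0 : t (f x) = 0 by rewrite -(nbhs_singleton st).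
have tn : \forall y \near x, t (f y) = 0 by have := secat_sep Ht tx0; apply: cf.
by near=> y; rewrite (near st y) // (near tn y).
Unshelve. all: by end_near. Qed.
Definition pull : sheaf K X := Sheaf pull_secat_near pull_secat_local
  pull_secat0 pull_secatP pull_secat_germ pull_secat_sep.
End PullSheaf.

Section PullHom.
Variables (F G : sheaf K Y) (phi : shom F G).
Fact pull_hom_sec (s : sections (pull F)) x : secat s x ->
  @secat _ _ (pull G) (prod_map (fun x => phi (f x)) s) x.
Proof.
move=> [t Ht st]; exists (prod_map phi t); first exact: shom_sec.
by near=> y; rewrite /prod_map (near st y).
Unshelve. all: by end_near. Qed.
Definition pull_hom : shom (pull F) (pull G) := MkShom pull_hom_sec.
End PullHom.
End Pull.

Section Tensor.
Variables (K : fieldType) (X : topologicalType).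

Section TensorSheaf.
Variables F G : sheaf K X.
Notation pairs := (sections F * sections G)%type.
Definition tensor_gen x (u : {freeg pairs / K}) :=
  exists s t, [/\ secat s x, secat t x & u = << (s, t) >>].
Inductive tensor_rel x : {freeg pairs / K} -> Prop :=
| tensor_rel_l a s s' t : secat s x -> secat s' x -> secat t x ->
    tensor_rel x (<< (a *: s + s', t) >> - (a *: << (s, t) >> + << (s', t) >>))
| tensor_rel_r a s t t' : secat s x -> secat t x -> secat t' x ->
    tensor_rel x (<< (s, a *: t + t') >> - (a *: << (s, t) >> + << (s, t') >>))
| tensor_rel_germ s s' t t' :
    secat s x -> secat s' x -> secat t x -> secat t' x ->
    (\forall y \near x, s y = s' y) -> (\forall y \near x, t y = t' y) ->
    tensor_rel x (<< (s, t) >> - << (s', t') >>).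

Fact span_near (P : lmodType K) (H : X -> set P) x u :
  (forall u, H x u -> \forall y \near x, H y u) ->
  span (H x) u -> \forall y \near x, span (H y) u.
Proof.
move=> Hn; elim=> [|a v w Hv _ IH]; first by apply: nearW => y; exact: span0.
near=> y; apply: spanD; first exact: (near (Hn _ Hv) y).
exact: (near IH y).
Unshelve. all: by end_near. Qed.
Fact tensor_gen_near x u : span_submod (tensor_gen x) u ->
  \forall y \near x, span_submod (tensor_gen y) u.
Proof.
apply: span_near => {}u [s [t [Hs Ht ->]]]; near=> y; exists s, t; split=> //.
  exact: (near (secat_near Hs) y).
exact: (near (secat_near Ht) y).
Unshelve. all: by end_near. Qed.
Fact tensor_rel_near x u : span_submod (tensor_rel x) u ->
  \forall y \near x, span_submod (tensor_rel y) u.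
Proof.
apply: span_near => _ [a s s' t Hs Hs' Ht|a s t t' Hs Ht Ht'|s s' t t' Hs Hs' Ht Ht'].
- by near=> y; apply: tensor_rel_l; near: y; exact: secat_near.
- by near=> y; apply: tensor_rel_r; near: y; exact: secat_near.
move=> /near_join ss /near_join tt.
near=> y; apply: tensor_rel_germ; near: y => //; exact: secat_near.
Unshelve. all: by end_near. Qed.

(** the sheaf associated with [V |-> F(V) \otimes_K G(V)] *)
Definition tensor : sheaf K X := germ_sheaf tensor_gen_near tensor_rel_near.
End TensorSheaf.
End Tensor.

Section TensorHom.
Variables (K : fieldType) (X : topologicalType) (F F' G G' : sheaf K X).
Variables (phi : shom F F') (psi : shom G G').
Notation pairs := (sections F * sections G)%type.
Notation pairs' := (sections F' * sections G')%type.
Definition tensor_lift (u : {freeg pairs / K}) : {freeg pairs' / K} :=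
  fglift (fun st : pairs =>
    << (prod_map phi st.1 : sections F', prod_map psi st.2 : sections G') >>) u.
Fact tensor_lift_linear : linear tensor_lift.
Proof.
pose f st : {freeg pairs' / K} :=
  << (prod_map phi st.1 : sections F', prod_map psi st.2 : sections G') >>.
have addl : additive (fglift f) by exact: lift_is_additive.
pose g := HB.pack_for {additive {freeg pairs / K} -> {freeg pairs' / K}} (fglift f)
  (GRing.isAdditive.Build {freeg pairs / K} {freeg pairs' / K} (fglift f) addl).
have gU k st : g << k *g st >> = k *: f st by exact: liftU.
move=> a u v; rewrite -[tensor_lift]/(g : _ -> _) raddfD; congr (_ + _).
rewrite -[in RHS](freeg_sumE u) -[a *: u]/(fgscale a u) /fgscale !raddf_sum.
by apply: eq_bigr => st _; rewrite gU -scalerA -gU.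
Qed.
HB.instance Definition _ := GRing.isLinear.Build K {freeg pairs / K}
  {freeg pairs' / K} *:%R tensor_lift tensor_lift_linear.

Lemma tensor_liftE s t : tensor_lift << (s, t) >> =
  << (prod_map phi s : sections F', prod_map psi t : sections G') >>.
Proof. by rewrite /tensor_lift liftU scale1r. Qed.

Fact tensor_lift_gen x u : span_submod (@tensor_gen _ _ F G x) u ->
  span_submod (@tensor_gen _ _ F' G' x) (tensor_lift u).
Proof.
elim=> [|a v w [s [t [Hs Ht ->]]] _ IH]; first by rewrite linear0; exact: span0.
rewrite linearP /= tensor_liftE; apply: spanD => //.
by exists (prod_map phi s), (prod_map psi t); split=> //; exact: shom_sec.
Qed.
Fact tensor_lift_rel x u : span_submod (@tensor_rel _ _ F G x) u ->
  span_submod (@tensor_rel _ _ F' G' x) (tensor_lift u).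
Proof.
elim=> [|a v w Hv _ IH]; first by rewrite linear0; exact: span0.
rewrite linearP; apply: spanD => // {IH w u}; case: Hv.
- move=> b s s' t Hs Hs' Ht; rewrite linearB linearP /= !tensor_liftE linearP.
  by apply: tensor_rel_l; exact: shom_sec.
- move=> b s t t' Hs Ht Ht'; rewrite linearB linearP /= !tensor_liftE linearP.
  by apply: tensor_rel_r; exact: shom_sec.
move=> s s' t t' Hs Hs' Ht Ht' ss tt; rewrite linearB /= !tensor_liftE.
apply: tensor_rel_germ; try exact: shom_sec.
  by near=> y; rewrite /prod_map (near ss y).
by near=> y; rewrite /prod_map (near tt y).
Unshelve. all: by end_near. Qed.

Definition tensor_hom : shom (tensor F G) (tensor F' G') :=
  germ_hom (@tensor_gen_near _ _ F G) (@tensor_rel_near _ _ F G)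
    (@tensor_gen_near _ _ F' G') (@tensor_rel_near _ _ F' G')
    tensor_lift_gen (fun x u _ => @tensor_lift_rel x u).
End TensorHom.

(** [f_* F], the sheaf associated with [V |-> F(f^-1 V)] *)
Section Push.
Variables (K : fieldType) (X Y : topologicalType) (f : X -> Y).

Section PushSheaf.
Variable F : sheaf K X.
Definition push_num (y : Y) : submod (sections F).
Proof.
refine (@Submod K (sections F)
  (fun s => \forall z \near y, forall x, f x = z -> secat s x) _ _).
  by apply: nearW => z x _; exact: secat0.
move=> a s t Hs Ht; near=> z => x fx; apply: secatP.
  exact: (near Hs z).
exact: (near Ht z).
Unshelve. all: by end_near. Defined.
Definition push_den (y : Y) : submod (sections F).
Proof.
refine (@Submod K (sections F)
  (fun s => \forall z \near y, forall x, f x = z -> s x = 0) _ _).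
  exact: nearW.
move=> a s t Hs Ht; near=> z => x fx; rewrite -[LHS]/(a *: s x + t x).
by rewrite (near Hs z) // (near Ht z) // scaler0 addr0.
Unshelve. all: by end_near. Defined.
Fact push_num_near y s : push_num y s -> \forall z \near y, push_num z s.
Proof. by move/near_join. Qed.
Fact push_den_near y s : push_den y s -> \forall z \near y, push_den z s.
Proof. by move/near_join. Qed.
Definition push : sheaf K Y := germ_sheaf push_num_near push_den_near.
End PushSheaf.

Section PushHom.
Variables (F G : sheaf K X) (phi : shom F G).
Fact push_hom_num y s : push_num F y s -> push_num G y (prod_map phi s).
Proof.
by move=> Hs; near=> z => x fx; apply: shom_sec; exact: (near Hs z).
Unshelve. all: by end_near. Qed.
Fact push_hom_den y s : push_num F y s -> push_den F y s ->
  push_den G y (prod_map phi s).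
Proof.
move=> _ Hs; near=> z => x fx; rewrite /prod_map.
by rewrite (near Hs z) // linear0.
Unshelve. all: by end_near. Qed.
Definition push_hom : shom (push F) (push G) :=
  germ_hom (@push_num_near F) (@push_den_near F) (@push_num_near G) (@push_den_near G)
    push_hom_num push_hom_den.
End PushHom.

Lemma push_hom_square (F G F' G' : sheaf K X) (phi : shom F G) (psi : shom G G')
    (theta : shom F F') (phi' : shom F' G') :
  (forall x v, psi x (phi x v) = phi' x (theta x v)) ->
  forall y v, push_hom psi y (push_hom phi y v) = push_hom phi' y (push_hom theta y v).
Proof.
move=> E y v; have Av := repA v; rewrite -[v]repK /= !subquot_map_cls //; try exact: push_hom_num.
congr cls; apply: functional_extensionality_dep => x; exact: E.
Qed.
End Push.

Section Coker.
Variables (K : fieldType) (X : topologicalType).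

Section CokerSheaf.
Variables (F G : sheaf K X) (phi : shom F G).
Definition coker_den (x : X) : submod (sections G).
Proof.
refine (@Submod K (sections G) (fun s => exists2 t : sections F,
  secat t x & \forall y \near x, s y = phi y (t y)) _ _).
  by exists 0; [exact: secat0 | apply: nearW => y; rewrite linear0].
move=> a u v [s Hs us] [t Ht vt]; exists (a *: s + t); first exact: secatP.
near=> y; rewrite -[LHS]/(a *: u y + v y) (near us y) // (near vt y) //.
by rewrite -linearP.
Unshelve. all: by end_near. Defined.
Fact coker_den_near x s : coker_den x s -> \forall y \near x, coker_den y s.
Proof.
move=> [t /secat_near Ht /near_join st]; near=> y; exists t.
  exact: (near Ht y).
exact: (near st y).
Unshelve. all: by end_near. Qed.
Definition coker : sheaf K X := germ_sheaf
  (@secat_sub_near _ _ G) coker_den_near.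
End CokerSheaf.

Section CokerHom.
Variables (F G F' G' : sheaf K X) (phi : shom F G) (phi' : shom F' G').
Variables (theta : shom F F') (psi : shom G G').
Hypothesis sq : forall x v, psi x (phi x v) = phi' x (theta x v).
Fact coker_hom_den x s : secat_submod G x s -> coker_den phi x s ->
  coker_den phi' x (prod_map psi s).
Proof.
move=> _ [t Ht st]; exists (prod_map theta t); first exact: shom_sec.
by near=> y; rewrite /prod_map (near st y) // sq.
Unshelve. all: by end_near. Qed.
Definition coker_hom : shom (coker phi) (coker phi') :=
  germ_hom (@secat_sub_near _ _ G) (@coker_den_near _ _ phi)
    (@secat_sub_near _ _ G') (@coker_den_near _ _ phi')
    (fun x s => @shom_sec _ _ _ _ psi s x) coker_hom_den.
End CokerHom.
End Coker.

(** The beginning [0 -> F -> C^0 F -> C^0 F / F -> 0] of the Godement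
    resolution: [C^0 F] is the sheaf of all set-theoretic sections. *)
Section Godement.
Variables (K : fieldType) (X : topologicalType).

Section GodementSheaf.
Variable F : sheaf K X.
Definition all_sections : submod (sections F) :=
  @Submod K (sections F) (fun=> True) I (fun _ _ _ _ _ => I).
Fact all_sections_near (x : X) s : all_sections s -> \forall y \near x, all_sections s.
Proof. by move=> _; exact: nearW. Qed.
Fact near_zero_near x s : near_zero_sub F x s -> \forall y \near x, near_zero_sub F y s.
Proof. by move/near_join. Qed.
Definition gode0 : sheaf K X := germ_sheaf all_sections_near near_zero_near.
Definition gode1 : sheaf K X := germ_sheaf all_sections_near
  (@secat_sub_near _ _ F).
Fact gode_proj_den x s : all_sections s -> near_zero_sub F x s -> secat_submod F x s.
Proof.
by move=> _ Hs; apply: (secat_local _ (secat0 F x)); near=> y; rewrite (near Hs y).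
Unshelve. all: by end_near. Qed.
Definition gode_proj : shom gode0 gode1 :=
  germ_hom (L := idfun) all_sections_near near_zero_near all_sections_near
    (@secat_sub_near _ _ F) (fun _ _ => id) gode_proj_den.
End GodementSheaf.

Section GodementHom.
Variables (F G : sheaf K X) (phi : shom F G).
Fact gode0_hom_den x s : all_sections F s -> near_zero_sub F x s ->
  near_zero_sub G x (prod_map phi s).
Proof.
by move=> _ Hs; near=> y; rewrite /prod_map (near Hs y) // linear0.
Unshelve. all: by end_near. Qed.
Definition gode0_hom : shom (gode0 F) (gode0 G) :=
  germ_hom (L := prod_map phi) (@all_sections_near F) (@near_zero_near F)
    (@all_sections_near G) (@near_zero_near G) (fun _ _ _ => I) gode0_hom_den.
Definition gode1_hom : shom (gode1 F) (gode1 G) :=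
  germ_hom (L := prod_map phi) (@all_sections_near F) (@secat_sub_near _ _ F)
    (@all_sections_near G) (@secat_sub_near _ _ G) (fun _ _ _ => I)
    (fun x s _ => @shom_sec _ _ _ _ phi s x).
Lemma gode_square x v :
  gode1_hom x (gode_proj F x v) = gode_proj G x (gode0_hom x v).
Proof. by rewrite -[v]repK /= !subquot_map_cls. Qed.
End GodementHom.
End Godement.

Section R1.
Variables (K : fieldType) (X Y : topologicalType) (f : X -> Y).
(** [R^1 f_* F = coker (f_* C^0 F -> f_* (C^0 F / F))] *)
Definition R1 (F : sheaf K X) : sheaf K Y := coker (push_hom f (gode_proj F)).
Definition R1_hom (F G : sheaf K X) (phi : shom F G) : shom (R1 F) (R1 G) :=
  coker_hom (push_hom_square (f := f) (gode_square phi)).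
End R1.

Section SubGL.
Variables (K : fieldType) (P : lmodType K) (A : submod P) (g : GL P).
Hypotheses (gA : forall u, A u -> A (g u)) (gVA : forall u, A u -> A (gl_inv g u)).
Fact subgl_proof (h : {linear P -> P}) : (forall u, A u -> A (h u)) ->
  forall w : submodT A, sub_pred A (h (val w)).
Proof. by move=> hA w; apply/asboolP/hA/asboolP; exact: (valP w). Qed.
Definition subgl_fun (h : {linear P -> P}) (hA : forall u, A u -> A (h u))
  (w : submodT A) : submodT A := Sub (h (val w)) (subgl_proof hA w).
Fact subgl_fun_linear h hA : linear (@subgl_fun h hA).
Proof. by move=> a u v; apply: val_inj; rewrite /= linearP. Qed.
HB.instance Definition _ h hA := GRing.isLinear.Build K (submodT A) (submodT A) *:%R
  (@subgl_fun h hA) (@subgl_fun_linear h hA).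
Fact subgl_funK : cancel (subgl_fun gA) (subgl_fun gVA).
Proof. by move=> u; apply: val_inj; rewrite /= gl_funK. Qed.
Fact subgl_invK : cancel (subgl_fun gVA) (subgl_fun gA).
Proof. by move=> u; apply: val_inj; rewrite /= gl_invK. Qed.
Definition subgl : GL (submodT A) := MkGL subgl_funK subgl_invK.
End SubGL.

Section MCTuple.
Variables (K : fieldType) (V : lmodType K) (p : nat) (lambda : K).
Hypothesis lambda0 : lambda != 0.
Variable A : 'I_p.+1 -> GL V.
Notation Vp := (prodM (fun _ : 'I_p => V)).
Let A_ (i : 'I_p) : GL V := A (fintype.lift ord_max i).

(** [v A_{m+1} ... A_p] (indices starting from 1) *)
Definition tail_prod (m : nat) (v : V) : V :=
  foldl (fun v i => A_ i v) v (drop m (enum 'I_p)).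

Fact tail_prodP m a u v :
  tail_prod m (a *: u + v) = a *: tail_prod m u + tail_prod m v.
Proof.
rewrite /tail_prod; elim: (drop _ _) a u v => //= i s IH a u v.
by rewrite linearP IH.
Qed.
HB.instance Definition _ m :=
  GRing.isLinear.Build K V V *:%R (tail_prod m) (@tail_prodP m).

Lemma tail_prodS (i : 'I_p) v : tail_prod i v = tail_prod i.+1 (A_ i v).
Proof.
by rewrite /tail_prod (drop_nth i) ?size_enum_ord // nth_ord_enum.
Qed.
Lemma tail_prod_all v : tail_prod p v = v.
Proof. by rewrite /tail_prod drop_oversize // size_enum_ord. Qed.

Definition MC_K : submod Vp.
Proof.
refine (@Submod K Vp (fun w => forall i, exists u, w i = A_ i u - u) _ _).
  by move=> i; exists 0; rewrite linear0 subrr.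
move=> a w w' Hw Hw' i; have [u E] := Hw i; have [u' E'] := Hw' i.
exists (a *: u + u'); rewrite -[LHS]/(a *: w i + w' i) E E' linearP.
by rewrite scalerBr addrACA opprD.
Defined.

(** The parabolic condition at infinity
    [w_1 A_2 ... A_p + w_2 A_3 ... A_p + ... + w_p \in Im (A_1 ... A_p lambda - 1)].
    Pitfall: the space of all [(w_1 A_2 ... A_p, w_2 A_3 ... A_p, ..., w_p)] with
    every [w_i] in [Im (A_1 ... A_p lambda - 1)] is a different one as soon as
    [A_1 ... A_p lambda - 1] is not invertible, and neither it nor its
    intersection with [MC_K] is stable under the automorphisms [mcD]. *)
Definition MC_L : submod Vp.
Proof.
refine (@Submod K Vp (fun w => exists u : V,
  \sum_(i < p) tail_prod i.+1 (w i) = lambda *: tail_prod 0 u - u) _ _).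
  by exists 0; rewrite linear0 scaler0 subrr big1 // => i _; rewrite linear0.
move=> a w w' [u E] [u' E']; exists (a *: u + u').
rewrite linearP scalerDr opprD addrACA scalerA mulrC -scalerA -scalerBr -E -E'.
by rewrite scaler_sumr -big_split /=; apply: eq_bigr => i _; rewrite -tail_prodP.
Defined.

Definition MC_W : submod Vp.
Proof.
refine (@Submod K Vp (fun w => MC_K w /\ MC_L w) _ _).
  by split; exact: sub0.
by move=> a u v [Ku Lu] [Kv Lv]; split; exact: subP.
Defined.

Definition mc_coef (i j : 'I_p) : K := if (j < i)%N then lambda else 1.

(** the block matrix with i-th block row [(lambda (A_1 - 1), ...,
    lambda (A_{i-1} - 1), lambda A_i, A_{i+1} - 1, ..., A_p - 1)], acting on
    row vectors *)
Definition mcD_fun i (v : Vp) : Vp := fun j =>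
  if j == i then lambda *: A_ i (v i)
  else v j + mc_coef i j *: (A_ j (v i) - v i).
Definition mcD_inv i (v : Vp) : Vp := fun j =>
  let u := lambda^-1 *: gl_inv (A_ i) (v i) in
  if j == i then u else v j - mc_coef i j *: (A_ j u - u).

Fact mcD_fun_linear i : linear (mcD_fun i).
Proof.
move=> a u v; apply: functional_extensionality_dep => j.
rewrite -[RHS]/(a *: mcD_fun i u j + mcD_fun i v j) /mcD_fun.
rewrite -[(a *: u + v) i]/(a *: u i + v i) -[(a *: u + v) j]/(a *: u j + v j).
case: eqP => _; first by rewrite linearP scalerDr !scalerA mulrC.
rewrite linearP opprD [in LHS](addrACA (a *: _)) -scalerBr scalerDr scalerA mulrC.
by rewrite addrACA [in RHS]scalerDr scalerA.
Qed.
HB.instance Definition _ i :=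
  GRing.isLinear.Build K Vp Vp *:%R (mcD_fun i) (mcD_fun_linear i).
Fact mcD_funK i : cancel (mcD_fun i) (mcD_inv i).
Proof.
move=> v; apply: functional_extensionality_dep => j.
have Ei : mcD_fun i v i = lambda *: A_ i (v i) by rewrite /mcD_fun eqxx.
rewrite /mcD_inv Ei.
have -> : lambda^-1 *: gl_inv (A_ i) (lambda *: A_ i (v i)) = v i.
  by rewrite linearZ /= gl_funK scalerA mulVf // scale1r.
by case: eqP => [->//|/eqP ji]; rewrite /mcD_fun (negPf ji) addrK.
Qed.
Fact mcD_invK i : cancel (mcD_inv i) (mcD_fun i).
Proof.
move=> v; apply: functional_extensionality_dep => j.
have Ei : mcD_inv i v i = lambda^-1 *: gl_inv (A_ i) (v i).
  by rewrite /mcD_inv eqxx.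
rewrite /mcD_fun Ei.
case: eqP => [->|/eqP ji].
  by rewrite linearZ /= gl_invK scalerA mulfV // scale1r.
by rewrite /mcD_inv (negPf ji) subrK.
Qed.
Fact mcD_inv_linear i : linear (mcD_inv i).
Proof. exact: can2_linear (mcD_funK i) (mcD_invK i). Qed.
HB.instance Definition _ i :=
  GRing.isLinear.Build K Vp Vp *:%R (mcD_inv i) (mcD_inv_linear i).
Definition mcD i : GL Vp := MkGL (mcD_funK i) (mcD_invK i).

Lemma mcD_sum i v : \sum_(j < p) tail_prod j.+1 (mcD i v j) =
  \sum_(j < p) tail_prod j.+1 (v j) + (lambda *: tail_prod 0 (v i) - v i).
Proof.
set u := v i; pose E m := tail_prod m u.
pose c (j : 'I_p) : V := if (j < i)%N then lambda *: (E j - E j.+1)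
  else if j == i then lambda *: E j - E j.+1 else E j - E j.+1.
have step (j : 'I_p) : tail_prod j.+1 (mcD i v j) = tail_prod j.+1 (v j) + c j.
  rewrite /c /E /= /mcD_fun /mc_coef; case: eqP => [->|/eqP ji].
    by rewrite ltnn linearZ /= -tail_prodS addrC subrK.
  by case: ifP => _; rewrite linearD ?scale1r ?linearZ /= linearB /= -?tail_prodS.
rewrite (eq_bigr _ (fun j _ => step j)) big_split /=; congr (_ + _).
pose e (m : nat) : V := if (m <= i)%N then lambda *: (E 0 - E m)
  else lambda *: E 0 - E m.
have -> : \sum_(j < p) c j = \sum_(0 <= j < p) (e j.+1 - e j).
  rewrite big_mkord; apply: eq_bigr => j _; rewrite /c /e.
  case: ltngtP => [ji|ij|/val_inj ->]; rewrite ?eqxx.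
  - by rewrite -scalerBr; congr (_ *: _); rewrite opprB [RHS]addrC subrKA.
  - by rewrite -[j == i]/(val j == val i) gtn_eqF // opprB [RHS]addrC subrKA.
  by rewrite scalerBr opprB [RHS]addrC subrKA.
by rewrite telescope_sumr // /e leqNgt ltn_ord /= subrr scaler0 subr0 /E tail_prod_all.
Qed.

Fact mcD_K i w : MC_K w -> MC_K (mcD i w).
Proof.
move=> Kw j; rewrite /= /mcD_fun; case: eqP => [->|_].
  by have [u ->] := Kw i; exists (lambda *: A_ i u); rewrite linearZ /= linearB scalerBr.
have [u ->] := Kw j; exists (u + mc_coef i j *: w i).
by rewrite linearD linearZ /= opprD addrACA scalerBr.
Qed.
Fact mcD_V_K i w : MC_K w -> MC_K (gl_inv (mcD i) w).
Proof.
move=> Kw j; rewrite /= /mcD_inv; set t := lambda^-1 *: _.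
case: eqP => [->|_].
  have [u E] := Kw i; exists (lambda^-1 *: gl_inv (A_ i) u).
  rewrite /t E.
  have -> : gl_inv (A_ i) (A_ i u - u) = u - gl_inv (A_ i) u.
    by rewrite linearB /= gl_funK.
  by rewrite [A_ i _]linearZ /= gl_invK scalerBr.
have [u ->] := Kw j; exists (u - mc_coef i j *: t).
have -> : A_ j (u - mc_coef i j *: t) = A_ j u - mc_coef i j *: A_ j t.
  by rewrite [LHS]linearB [X in _ - X]linearZ.
rewrite scalerBr !opprB.
by rewrite [in LHS](addrC (_ *: t)) addrACA [- u + _]addrC.
Qed.
Fact mcD_L i w : MC_L w -> MC_L (mcD i w).
Proof.
move=> [u E]; exists (u + w i); rewrite mcD_sum E linearD scalerDr opprD.
by rewrite addrACA.
Qed.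
Fact mcD_V_L i w : MC_L w -> MC_L (gl_inv (mcD i) w).
Proof.
move=> [u E]; have := mcD_sum i (gl_inv (mcD i) w); rewrite gl_invK E.
pose t : V := (gl_inv (mcD i) w : Vp) i.
rewrite -/t => H; exists (u - t).
transitivity (lambda *: tail_prod 0 u - u - (lambda *: tail_prod 0 t - t)).
  by rewrite H addrK.
by rewrite [tail_prod 0 (_ - _)]linearB scalerBr !opprB [in LHS](addrC t) addrACA [- u + _]addrC.
Qed.
Fact mcD_W i w : MC_W w -> MC_W (mcD i w).
Proof. by move=> [Kw Lw]; split; [exact: mcD_K | exact: mcD_L]. Qed.
Fact mcD_V_W i w : MC_W w -> MC_W (gl_inv (mcD i) w).
Proof. by move=> [Kw Lw]; split; [exact: mcD_V_K | exact: mcD_V_L]. Qed.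

(** [(D_1, ..., D_p, (D_1 ... D_p)^-1)] in [GL(W)^(p+1)] *)
Definition MC_tuple (j : 'I_p.+1) : GL (submodT MC_W) :=
  let D i := subgl (mcD_W i) (mcD_V_W i) in
  if unlift ord_max j is Some i then D i
  else glV (gl_prod [seq D i | i <- enum 'I_p]).
End MCTuple.

Section Paths.
Variables (R : realType) (X : topologicalType).
Implicit Types (g h : R -> X) (a b : X).

(** only the values on [[0, 1]] matter *)
Definition is_path g a b :=
  [/\ {within `[0, 1], continuous g}, g 0 = a & g 1 = b].

Definition homotopic g h := exists H : R * R -> X,
  [/\ {within `[0, 1] `*` `[0, 1], continuous H},
      (forall t, 0 <= t <= 1 -> H (t, 0) = g t /\ H (t, 1) = h t)
    & (forall s, 0 <= s <= 1 -> H (0, s) = g 0 /\ H (1, s) = g 1)].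

(** [path_mul g h]: first [h], then [g] *)
Definition path_mul g h : R -> X :=
  fun t => if t <= 2^-1 then h (2 * t) else g (2 * t - 1).
Definition path_inv g : R -> X := fun t => g (1 - t).
Definition path_prod a (s : seq (R -> X)) : R -> X := foldr path_mul (cst a) s.
Definition path_conj g h := path_mul (path_inv h) (path_mul g h).
Definition path_comm g h :=
  path_mul (path_inv g) (path_mul (path_inv h) (path_mul g h)).

Definition word_path n (g : 'I_n -> R -> X) a (w : seq ('I_n * bool)) : R -> X :=
  path_prod a [seq if l.2 then path_inv (g l.1) else g l.1 | l <- w].
Definition reduced_word n (w : seq ('I_n * bool)) : bool :=
  sorted (fun l m => ~~ ((l.1 == m.1) && (l.2 != m.2))) w.

Definition generators n (g : 'I_n -> R -> X) a :=
  (forall i, is_path (g i) a a) /\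
  forall h, is_path h a a -> exists w, homotopic h (word_path g a w).
Definition free_generators n (g : 'I_n -> R -> X) a :=
  generators g a /\
  forall w, reduced_word w -> homotopic (word_path g a w) (cst a) -> w = [::].

Variable (K : fieldType) (F : sheaf K X).

(** [s] is a continuous lift of [g] to the etale space of [F] *)
Definition is_lift g (s : R -> {x : X & F x}) := forall t, 0 <= t <= 1 ->
  projT1 (s t) = g t /\
  exists2 sigma : sections F, secat sigma (g t) &
    \forall t' \near within `[0, 1] (nbhs t), s t' = existT _ (g t') (sigma (g t')).

(** [v g = w] for the monodromy action from the right of a loop [g] at [a].
    With the above product of paths, [v (g h) = (v g) h] forces [v g] to be the
    transport of [v] backwards along [g]. *)
Definition monodromy g a (v w : F a) := exists s : R -> {x : X & F x},
  [/\ is_lift g s, s 1 = existT _ a v & s 0 = existT _ a w].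

Definition monodromy_tuple p (g : 'I_p -> R -> X) a (A : 'I_p.+1 -> GL (F a)) :=
  (forall i v, monodromy (g i) v (A (fintype.lift ord_max i) v)) /\
  A ord_max =1
    glV (gl_prod [seq A (fintype.lift ord_max i) | i <- enum 'I_p]).
End Paths.

Section Corestriction.
Variables (X T : topologicalType) (f : X -> T) (A : set T) (fA : forall x, A (f x)).
Definition corestr (x : X) : A := exist _ (f x) (mem_set (fA x)).
Lemma corestr_continuous : continuous f -> continuous corestr.
Proof. by move=> cf; apply: continuous_comp_initial. Qed.
End Corestriction.

Lemma val_continuous (T : topologicalType) (A : set T) : continuous (fun a : A => \val a).
Proof. exact: initial_continuous. Qed.
Lemma setP_val (T : Type) (A : set T) (a : A) : A (\val a).
Proof. exact: set_mem (valP a). Qed.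

Section Plane.
Variable R : realType.
Local Notation C := (R[i])^o.

Definition expi (t : R) : C := Complex (cos (2 * pi * t)) (sin (2 * pi * t)).

(** [g], based at [a], runs along some path [c], then once around the
    boundary circle [k] of a small disc centred at [b] (counterclockwise),
    then back along [c]. *)
Definition simple_loop (D : set C) (a : D) (b : C) (g : R -> D) :=
  exists (r : R) (k c : R -> D),
    [/\ 0 < r /\ (forall z : C, 0 < `|z - b| <= r%:C%C -> D z),
        `|\val (k 0) - b| = r%:C%C,
        (forall t, 0 <= t <= 1 -> \val (k t) = b + (\val (k 0) - b) * expi t),
        is_path c a (k 0)
      & homotopic g (path_mul (path_inv c) (path_mul k c))].

(** counterclockwise around infinity is clockwise on a large circle *)
Definition simple_loop_infty (D : set C) (a : D) (g : R -> D) :=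
  exists (r : R) (k c : R -> D),
    [/\ 0 < r /\ (forall z : C, r%:C%C <= `|z| -> D z),
        `|\val (k 0)| = r%:C%C,
        (forall t, 0 <= t <= 1 -> \val (k t) = \val (k 0) * expi (- t)),
        is_path c a (k 0)
      & homotopic g (path_mul (path_inv c) (path_mul k c))].

Definition Gm : set C := [set z | z != 0].

Definition kummer (K : fieldType) (lambda : K) (L : sheaf K Gm) :=
  rank_one_local_system L /\
  forall (a : Gm) (k : R -> Gm),
    (forall t, 0 <= t <= 1 -> \val (k t) = \val a * expi t) ->
    forall v : L a, monodromy k v (lambda *: v).

Variables (p : nat) (x : 'I_p -> C).

(** both the space carrying the local system and the parameter space *)
Definition U1 : set C := [set z | forall i, z != x i].
Definition U1minus (b : C) : set C := [set z | (forall i, z != x i) /\ z != b].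
Definition U : set (C * C) := [set u |
  [/\ forall i, u.1 != x i, forall i, u.2 != x i & u.2 != u.1]].
Definition P1 : topologicalType := one_point_compactification C.

Fact pr1_subproof (u : U) : U1 (\val u).1. Proof. by case: (setP_val u). Qed.
Fact pr2_subproof (u : U) : U1 (\val u).2. Proof. by case: (setP_val u). Qed.
Fact dif_subproof (u : U) : Gm ((\val u).2 - (\val u).1).
Proof. by case: (setP_val u) => _ _; rewrite /Gm /= subr_eq0. Qed.
Definition pr1 : U -> U1 := corestr pr1_subproof.
Definition pr2 : U -> U1 := corestr pr2_subproof.
Definition dif : U -> Gm := corestr dif_subproof.
Definition emb (u : U) : P1 * U1 := (Some (\val u).1, pr2 u).
Definition pr2bar (u : P1 * U1) : U1 := u.2.

Lemma pr1_continuous : continuous pr1.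
Proof.
apply: corestr_continuous => u; apply: continuous_comp; first exact: val_continuous.
exact: cvg_fst.
Qed.
Lemma dif_continuous : continuous dif.
Proof.
have c : continuous (fun w : C * C => w.2 - w.1).
  by move=> w; apply: cvgB; [exact: cvg_snd | exact: cvg_fst].
apply: corestr_continuous => u.
exact: (continuous_comp (@val_continuous _ U u) (c (\val u))).
Qed.

Section MC.
Variables (K : fieldType) (L : sheaf K Gm).
Definition MC (V : sheaf K U1) : sheaf K U1 :=
  R1 pr2bar (push emb (tensor (pull pr1_continuous V) (pull dif_continuous L))).
Definition MC_hom (V V' : sheaf K U1) (f : shom V V') : shom (MC V) (MC V') :=
  R1_hom pr2bar (push_hom emb (tensor_hom (pull_hom pr1_continuous f) (shom1 _))).
End MC.

Section Bases.
Variable u0 : U.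
Let x0 : C := (\val u0).1.
Let y0 : C := (\val u0).2.

Definition U0 : set C := U1minus y0.
Definition S0 : set C := U1minus x0.

Fact baseU0_subproof : U0 x0.
Proof. by case: (setP_val u0) => h1 _ h; split=> //; rewrite eq_sym. Qed.
Definition baseU0 : U0 := exist _ x0 (mem_set baseU0_subproof).
Fact baseS0_subproof : S0 y0.
Proof. by case: (setP_val u0) => _ h2 h; split. Qed.
Definition baseS0 : S0 := exist _ y0 (mem_set baseS0_subproof).

Fact U1minus_sub b (z : U1minus b) : U1 (\val z).
Proof. by case: (setP_val z). Qed.
Definition to_U1 b : U1minus b -> U1 := corestr (@U1minus_sub b).
Fact U1minus_neq b (z : U1minus b) : [set w : C | w != b] (\val z).
Proof. by case: (setP_val z). Qed.
Definition to_C b : U1minus b -> [set w : C | w != b] := corestr (@U1minus_neq b).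

Fact fib_x_subproof (z : U0) : U (\val z, y0).
Proof.
have [h1 h2] := setP_val z; have [_ h3 _] := setP_val u0.
by split=> //=; rewrite eq_sym.
Qed.
Definition fib_x : U0 -> U := corestr fib_x_subproof.
Fact fib_y_subproof (z : S0) : U (x0, \val z).
Proof. by have [h1 h2] := setP_val z; have [h3 _ _] := setP_val u0. Qed.
Definition fib_y : S0 -> U := corestr fib_y_subproof.

Variables (alpha : 'I_p.+1 -> R -> U0) (delta : 'I_p -> R -> S0).

Definition alphaU1 (i : 'I_p) : R -> U1 :=
  @to_U1 y0 \o alpha (fintype.lift ord_max i).
Definition deltaU1 (i : 'I_p) : R -> U1 := @to_U1 x0 \o delta i.

Definition alpha_base :=
  [/\ free_generators alpha baseU0,
      (forall i, simple_loop baseU0 (x i) (alpha (fintype.lift ord_max i))),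
      simple_loop baseU0 y0 (alpha ord_max)
    & simple_loop_infty baseU0
        (path_inv (path_prod baseU0 [seq alpha j | j <- enum 'I_p.+1]))].

(** the entries of
    [(alpha_1, ..., alpha_{i-1}, alpha_i^alpha_{p+1},
      alpha_{i+1}^[alpha_i, alpha_{p+1}], ..., alpha_p^[alpha_i, alpha_{p+1}],
      alpha_{p+1}^(alpha_i alpha_{p+1}))] *)
Definition braided (i : 'I_p) (j : 'I_p.+1) : R -> U0 :=
  let ai := alpha (fintype.lift ord_max i) in
  let aq := alpha ord_max in
  if (j < i)%N then alpha j
  else if j == i :> nat then path_conj (alpha j) aq
  else if j == ord_max then path_conj aq (path_mul ai aq)
  else path_conj (alpha j) (path_comm ai aq).

Definition delta_base :=
  [/\ generators deltaU1 (pr2 u0),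
      (forall i, is_path (delta i) baseS0 baseS0),
      (forall i, simple_loop (pr2 u0) (x i) (deltaU1 i)),
      (forall i, homotopic (@to_C x0 \o delta i) (cst (@to_C x0 baseS0)))
    & (forall i j, homotopic
        (path_mul (fib_y \o delta i)
          (path_mul (fib_x \o alpha j) (path_inv (fib_y \o delta i))))
        (fib_x \o braided i j))].

(** [V] belongs to [T_K(U_1)], where [A] is its monodromy tuple *)
Definition in_T (K : fieldType) (V : sheaf K U1) (A : 'I_p.+1 -> GL (V (pr1 u0))) :=
  [/\ local_system V, irreducible V & exists i j : 'I_p,
    [/\ i != j, ~ A (fintype.lift ord_max i) =1 id
      & ~ A (fintype.lift ord_max j) =1 id]].
End Bases.
End Plane.

Arguments Gm R : clear implicits.

(* Main.v *)
(** Write F for the sheaf pr_1^* V tensored with d^* V_chi on U.  A germ of the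
    direct image at y is represented by a torsor under F restricted to the
    slice over y which has sections near every point of the complement of the
    slice in P^1, i.e. which is trivial on small circles around the punctures
    and infinity.  The stalk at y0 is computed from the affine action of the
    free generators alpha_j on the points of such a torsor over the base
    point.  As alpha_(p+1) acts on the stalk of F by lambda <> 1, it has exactly
    one fixed point f, and f alpha_j = f + w_j (j <= p) defines a vector w in
    V^p.  The torsor is trivial around x_j iff w_j is in Im(A_j - 1), around
    infinity iff w is in L, and around y0 because f is fixed; it has a global
    section iff w = 0; and every w in W arises since the alpha_j are free.

    For the monodromy, the pairs (class, point of its torsor) form a locally
    constant sheaf of sets on all of U.  Moving (f + lambda w_i), which is
    f alpha_i alpha_(p+1), along delta_i gives the fixed point of the
    transported class, and the conjugation formula for delta_i alpha_j
    delta_i^-1 shows that its cocycle is w D_i. *)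

Require Import Defs.
From HB Require Import structures.
From mathcomp Require Import all_boot all_order all_algebra.
From mathcomp Require Import all_classical all_reals all_analysis.
From mathcomp Require Import complex freeg ring lra.

Set Implicit Arguments.
Unset Strict Implicit.
Unset Printing Implicit Defensive.
Import Order.TTheory GRing.Theory Num.Theory numFieldNormedType.Exports.
Local Open Scope classical_set_scope.
Local Open Scope ring_scope.

(** * Etale spaces and transport along paths *)

(** A stalk of the direct image sees all neighbourhoods of a fibre of $\mathbb{P}^1\times S$,
    whereas a cocycle lives on one slice. The bridge is a retraction of a slab, the part over a
    small disc, onto one slice. It has to carry the moving puncture $y$ along, leave the $x_i$ and
    infinity in place and extend to $\mathbb{P}^1$; therefore it moves only points close to the
    diagonal. Along it, parabolic torsors extend from a slice to the slab and trivializations spread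
    to nearby slices, which also shows that the direct image is locally constant.

    The condition $\lambda\neq 1$ has a second effect: F has no nonzero sections along a slice.
    Hence potentials of two representatives of one class are matched in a unique way, without which
    the pairs of a class and a point of its torsor would not form a sheaf.

    Cocycles are attached to classes by a relation that admits every representative. Linearity,
    uniqueness and naturality are properties of this relation; the one choice that enters the
    isomorphism, a generator of a stalk of the Kummer sheaf, is common to all V. *)

Definition tot (K : fieldType) (X : Type) (F : X -> lmodType K) : Type := {x & F x}.

Notation PT F z v := (existT (fun y => GRing.Lmodule.sort (F y)) z v).

Section TotalValue.
Variables (K : fieldType) (X : Type) (F : X -> lmodType K).

(** A total substitute for a cast along an equality of base points; 0 over other base points is a
    mere default. *)
Definition tot_at (a : tot F) (x : X) : F x :=
  match pselect (projT1 a = x) with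
  | left e => eq_rect _ (fun x => F x : Type) (projT2 a) _ e
  | right _ => 0
  end.

Lemma tot_atE x (v : F x) : tot_at (existT _ x v) x = v.
Proof.
rewrite /tot_at; case: pselect => //= e.
by rewrite (Prop_irrelevance e erefl).
Qed.

Lemma tot_inj x (v w : F x) :
  existT (fun x => F x : Type) x v = existT _ x w -> v = w.
Proof. by move=> /(congr1 (tot_at^~ x)); rewrite !tot_atE. Qed.

Lemma tot_tot_at (a : tot F) x : projT1 a = x -> a = existT _ x (tot_at a x).
Proof. by case: a => y v /= e; subst y; rewrite tot_atE. Qed.
End TotalValue.

Lemma near_all (T : topologicalType) (a : T) (P : T -> Prop) :
  (forall b, P b) -> \forall b \near a, P b.
Proof. by move=> H; apply: nearW. Qed.

(** [P] and its negation both hold on open sets, and the line is connected. This serves as induction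
    along a real parameter, for the uniqueness of lifts as well as for their existence. *)
Lemma locally_constant_pred (R : realType) (P : R -> Prop) :
  (forall t, \forall u \near t, P u <-> P t) -> forall a b, P a -> P b.
Proof.
move=> lcP a b Pa; apply: contrapT => nPb.
have : connected [set: R] by apply/connected_intervalP => ? ? ? ?.
apply/connectedPn; exists (fun c => if c then [set t | P t] else [set t | ~ P t]).
split.
- by case; [exists a | exists b].
- by apply/seteqP; split=> t // _; have [] := pselect (P t); [right | left].
split; apply/seteqP; split=> t // [].
- by move=> Ct Pt; have [u [/= nPu [_ /(_ Pt)]]] := Ct _ (lcP t).
- by move=> nPt Ct; have [u [/= Pu [/(_ Pu)]]] := Ct _ (lcP t).
Qed.

(** A sheaf of sets, given like a [sheaf] by its stalks and its germs of
    sections; it need not be a sheaf of vector spaces, as it serves for torsors. *)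
Record et (K : fieldType) (X : topologicalType) := Et {
  st :> X -> lmodType K;
  sc : prodM st -> X -> Prop;
  sc_near : forall s x, sc s x -> \forall y \near x, sc s y;
  sc_loc : forall s t x, (\forall y \near x, s y = t y) -> sc s x -> sc t x }.

Arguments sc {K X} e s x.

Section Flat.
Variables (K : fieldType) (X : topologicalType) (S : et K X).

(** Near [x] the etale space is a covering: one neighbourhood serves every value over each of its
    points, so lifts can be continued by a uniform step. The second half makes agreement of sections
    both open and closed. *)
Definition lc (x : X) :=
  (exists2 O, nbhs x O & forall y (v : S y), O y ->
     exists s, s y = v /\ forall z, O z -> sc S s z) /\
  (forall s t, sc S s x -> sc S t x -> \forall y \near x, (s y = t y <-> s x = t x)).

(** Agreement with a section is asked on a neighbourhood in all of [E], even if [Q] is not open: a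
    lift over a closed half strip reaches a little beyond it, which leaves room for gluing. *)
Definition flat (E : topologicalType) (Q : set E) (q : E -> X) (s : E -> tot S) :=
  forall e, Q e -> exists2 sg, sc S sg (q e) &
    \forall e' \near e, s e' = existT _ (q e') (sg (q e')).

Lemma flat_base (E : topologicalType) (Q : set E) (q : E -> X) s e :
  flat Q q s -> Q e -> projT1 (s e) = q e.
Proof. by move=> fs /fs[sg _ /nbhs_singleton ->]. Qed.

Lemma flat_comp (E E' : topologicalType) (Q : set E) (Q' : set E') q s (f : E' -> E) :
  flat Q q s -> (forall e, Q' e -> Q (f e)) ->
  (forall e, Q' e -> {for e, continuous f}) -> flat Q' (q \o f) (s \o f).
Proof.
move=> fs QQ cf e Qe; have [sg H1 H2] := fs _ (QQ _ Qe); exists sg => //.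
exact: (cf e Qe _ H2).
Qed.

Lemma flat_sub (E : topologicalType) (Q Q' : set E) q s :
  Q' `<=` Q -> flat Q q s -> flat Q' q s.
Proof. by move=> QQ fs e /QQ /fs. Qed.

Lemma flat_ext (E : topologicalType) (Q : set E) q q' s s' :
  (forall e, Q e -> \forall e' \near e, q e' = q' e' /\ s e' = s' e') ->
  flat Q q s -> flat Q q' s'.
Proof.
move=> H fs e Qe; have [sg sg1 sg2] := fs _ Qe; have He := H _ Qe; exists sg.
  by have [<- _] := nbhs_singleton He.
near=> e'; have [<- <-] : q e' = q' e' /\ s e' = s' e' by near: e'.
by near: e'.
Unshelve. all: by end_near. Qed.

Lemma flat_const (E : topologicalType) (Q : set E) x (v : S x) : lc x ->
  flat Q (fun=> x) (fun=> existT _ x v).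
Proof.
move=> [[N Ox /(_ x v (nbhs_singleton Ox))[s [sx sO]]] _] e _.
exists s; first by apply: sO; exact: nbhs_singleton.
by apply: nearW => e'; rewrite sx.
Qed.

Lemma flat_agree (E : topologicalType) (q : E -> X) s s' e :
  {for e, continuous q} -> lc (q e) -> flat [set e] q s -> flat [set e] q s' ->
  \forall e' \near e, s e' = s' e' <-> s e = s' e.
Proof.
move=> cq [_ lq] /(_ e erefl)[sg sg1 sg2] /(_ e erefl)[sg' sg1' sg2'].
have Hc := cq _ (lq _ _ sg1 sg1').
rewrite (nbhs_singleton sg2) (nbhs_singleton sg2').
near=> e'.
have -> : s e' = existT _ (q e') (sg (q e')) by near: e'.
have -> : s' e' = existT _ (q e') (sg' (q e')) by near: e'.
have H : sg (q e') = sg' (q e') <-> sg (q e) = sg' (q e) by near: e'.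
by split=> eqs; congr existT; apply/H; exact: tot_inj eqs.
Unshelve. all: by end_near. Qed.

Variable R : realType.

Lemma flat_uniq (q : R -> X) s s' a b :
  continuous q -> (forall t, lc (q t)) -> flat setT q s -> flat setT q s' ->
  s a = s' a -> s b = s' b.
Proof.
move=> cq lq fs fs'; apply: (@locally_constant_pred R (fun t => s t = s' t)) => t.
by apply: flat_agree => //; [exact: cq | exact: flat_sub fs | exact: flat_sub fs'].
Qed.

Lemma near_prodP (Y Z : topologicalType) (P : Y * Z -> Prop) (y : Y) (z : Z) :
  (\forall e \near (y, z), P e) -> exists2 A, nbhs y A &
    exists2 B, nbhs z B & forall a b, A a -> B b -> P (a, b).
Proof. by move=> [[A B] [/= Ay Bz] AB]; exists A => //; exists B => // a b Aa Bb; exact: AB. Qed.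

Lemma near_continuous (Y Z : topologicalType) (f : Y -> Z) (y : Y) (P : Z -> Prop) :
  {for y, continuous f} -> (\forall z \near f y, P z) -> \forall y' \near y, P (f y').
Proof. by move=> cf H; exact: (cf _ H). Qed.

Lemma for_continuous_pair (Y Z T : topologicalType) (f : Y -> Z) (g : Y -> T) (y : Y) :
  {for y, continuous f} -> {for y, continuous g} ->
  {for y, continuous (fun y => (f y, g y))}.
Proof.
move=> cf cg P [[B C] [/= fB gC] BC].
change (\forall z \near y, P (f z, g z)).
have H : \forall z \near y, B (f z) /\ C (g z) by apply: filterI; [exact: cf | exact: cg].
by apply: filterS H => z [? ?]; exact: (BC (_, _)).
Qed.

Lemma for_continuous_comp (Y Z T : topologicalType) (f : Y -> Z) (g : Z -> T) (y : Y) :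
  {for y, continuous f} -> {for f y, continuous g} ->
  {for y, continuous (fun y => g (f y))}.
Proof. exact: continuous_comp. Qed.

Lemma for_continuous_fst (Y Z : topologicalType) (e : Y * Z) :
  {for e, continuous (fun e : Y * Z => e.1)}.
Proof. exact: cvg_fst. Qed.

Lemma for_continuous_snd (Y Z : topologicalType) (e : Y * Z) :
  {for e, continuous (fun e : Y * Z => e.2)}.
Proof. exact: cvg_snd. Qed.

Lemma for_continuous_cst (Y Z : topologicalType) (z : Z) (y : Y) :
  {for y, continuous (fun _ : Y => z)}.
Proof. exact: cvg_cst. Qed.

Lemma for_continuous_id (Y : topologicalType) (y : Y) : {for y, continuous (fun y : Y => y)}.
Proof. exact: cvg_id. Qed.

Lemma continuous_pairr (Y Z : topologicalType) (z : Z) (y : Y) :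
  {for y, continuous (fun y : Y => (y, z))}.
Proof. by apply: for_continuous_pair; [exact: for_continuous_id | exact: for_continuous_cst]. Qed.

Lemma continuous_pairl (Y Z : topologicalType) (z : Z) (y : Y) :
  {for z, continuous (fun z : Z => (y, z))}.
Proof. by apply: for_continuous_pair; [exact: for_continuous_cst | exact: for_continuous_id]. Qed.

Lemma near_fst (Y Z : topologicalType) (P : Y -> Prop) (y : Y) (z : Z) :
  (\forall a \near y, P a) -> \forall e \near (y, z), P e.1.
Proof. by move=> H; apply: (@cvg_fst _ _ (nbhs y) (nbhs z)). Qed.

Lemma near_snd (Y Z : topologicalType) (P : Z -> Prop) (y : Y) (z : Z) :
  (\forall b \near z, P b) -> \forall e \near (y, z), P e.2.
Proof. by move=> H; apply: (@cvg_snd _ _ (nbhs y) (nbhs z)). Qed.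

(** * Homotopy lifting *)

Section HomotopyLifting.
Variables (Y : topologicalType) (Q : set Y) (q : R * Y -> X) (s0 : Y -> tot S).
Hypotheses (Qo : forall y, Q y -> nbhs y Q)
  (cq : forall (t : R) (y : Y), Q y -> {for (t, y), continuous q})
  (lq : forall t y, Q y -> lc (q (t, y)))
  (q0 : forall (t : R) (y : Y), t <= 0 -> q (t, y) = q (0, y))
  (q1 : forall (t : R) (y : Y), 1 <= t -> q (t, y) = q (1, y))
  (fs0 : flat Q (fun y => q (0, y)) s0).

(** A lift near [y] for the times up to [t]. Its existence is shown to be locally constant in [t],
    so it passes from time -1, where [q] does not depend on time yet, to time 2, where it no longer
    does. *)
Let part (y : Y) (t : R) (W : set Y) (s : R * Y -> tot S) : Prop := [/\ nbhs y W,
  flat [set e | e.1 <= t /\ W e.2] q s & forall t' y', t' <= t -> t' <= 0 -> W y' -> s (t', y') = s0 y'].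

Let part_start y : Q y -> exists W s, part y (-1) W s.
Proof.
move=> Qy; exists Q, (fun e => s0 e.2); split=> //; first exact: Qo.
move=> [t y'] /= [t1 Qy']; have [sg sg1 sg2] := fs0 Qy'; exists sg.
  by rewrite q0 // (le_trans t1) // oppr_le0.
have : \forall e \near (t, y'), e.1 <= 0 /\ s0 e.2 = existT _ (q (0, e.2)) (sg (q (0, e.2))).
  apply: filterI; last exact: (near_snd t sg2).
  have H : \forall u \near t, u <= 0 by apply: lt_le_nbhsl; rewrite (le_lt_trans t1) // oppr_lt0.
  exact: near_fst H.
by apply: filterS => -[t' z] /= [/q0 -> ->].
Unshelve. all: by end_near. Qed.

Let part_step (y : Y) (t : R) : Q y -> exists2 I, nbhs t I & forall t1 t2, I t1 -> I t2 ->
  (exists W s, part y t1 W s) -> exists W s, part y t2 W s.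
Proof.
move=> Qy; have [[N Oq lO] _] := lq t Qy.
have [I0 I0t [W0 W0y IW0]] := near_prodP (cq Qy Oq).
have [e /= e0 eI] := (nbhs_ballP _ _).1 I0t.
exists (ball t e); first exact: nbhsx_ballx.
move=> t1 t2 It1 It2 [W [s [Wy fs s1]]].
set I := ball t e in It1 It2.
have IW a b : I a -> W0 b -> N (q (a, b)) by move=> /eI; exact: IW0.
have [lt12|le21] := ltP t1 t2; last first.
  exists W, s; split=> // [|t' y' h]; last exact/s1/(le_trans h).
  apply: flat_sub fs => -[t' y'] /= [? ?]; split=> //; exact: le_trans le21.
have Ibt t' : t1 <= t' <= t2 -> I t'.
  move=> /andP[a b]; move: It1 It2; rewrite /I /ball /= !ltr_norml.
  move=> /andP[h1 h2] /andP[h3 h4]; apply/andP; split.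
    by rewrite (lt_le_trans h3) // lerD2l lerN2.
  by rewrite (le_lt_trans _ h2) // lerD2l lerN2.
have W0y' := nbhs_singleton W0y; have Wy' := nbhs_singleton Wy.
have [sg0 sg01 sg02] := fs (t1, y) (conj (lexx t1) Wy').
have [sg [sgE sgO]] := lO _ (sg0 (q (t1, y))) (IW _ _ It1 W0y').
have Ag : \forall e \near (t1, y), sg0 (q e) = sg (q e).
  have [_ /(_ _ _ sg01 (sgO _ (IW _ _ It1 W0y')))/(near_continuous (cq Qy))] := lq t1 Qy.
  by apply: filterS => e1 H; apply/H; rewrite sgE.
have [A At1 [W1 W1y AW1]] := near_prodP (filterI sg02 Ag).
have W01 : nbhs y (Q `&` W `&` W0 `&` W1).
  by do 3?[apply: filterI => //]; exact: Qo.
(* Up to [t1] the old lift is kept; afterwards the local section through the value reached at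
   [(t1, y)] takes over. Over [W1] the two agree around time [t1]. *)
exists (interior (Q `&` W `&` W0 `&` W1)), (fun e => if e.1 <= t1 then s e else existT _ (q e) (sg (q e))).
split; first exact/nbhs_interior.
  move=> [t' y'] /= [t't2 Wy'2].
  have [[[Qy2 Wy2] W0y2] W1y2] := interior_subset Wy'2.
  have [t't1|t't1|tt1] := ltgtP t' t1.
  - have [sg' ? H] := fs (t', y') (conj (ltW t't1) Wy2); exists sg' => //.
    near=> e1; rewrite ifT; first by near: e1; exact: H.
    near: e1; have H' : \forall u \near t', u <= t1 by exact: lt_le_nbhsl.
    exact: near_fst H'.
  - have It' : I t' by apply: Ibt; rewrite ltW.
    exists sg; first exact/sgO/IW.
    near=> e1; rewrite ifF //; apply/negbTE; rewrite -ltNge.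
    near: e1; have H' : \forall u \near t', t1 < u by exact: lt_nbhsr.
    exact: near_fst H'.
  rewrite tt1; exists sg; first exact/sgO/IW.
  near=> e1; case: ifP => // _.
  have [-> <- //] : s e1 = existT _ (q e1) (sg0 (q e1)) /\ sg0 (q e1) = sg (q e1).
    near: e1; exists (A, Q `&` W `&` W0 `&` W1).
      by split.
    by move=> [a b] /= [Aa [_ W1b]]; apply: AW1.
move=> t' y' t't2 t'0 /interior_subset[[[Qy2 Wy2] W0y2] W1y2] /=.
case: (leP t' t1) => [h|/ltW h]; first exact: s1.
have t10 := le_trans h t'0.
rewrite q0 // -(q0 y' t10) -(s1 t1 y') //.
have [E1 E2] := AW1 t1 y' (nbhs_singleton At1) W1y2.
by rewrite E1 E2.
Unshelve. all: by end_near. Qed.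

Let part_all (y : Y) (t : R) : Q y -> exists W s, part y t W s.
Proof.
move=> Qy; apply: (@locally_constant_pred R (fun t => exists W s, part y t W s) _ (-1)).
  move=> u; have [I Iu H] := part_step u Qy; near=> v.
  have Iv : I v by near: v.
  by split; apply: H => //; exact: nbhs_singleton.
exact: part_start.
Unshelve. all: by end_near. Qed.

Lemma homotopy_lifting : exists s : R * Y -> tot S,
  flat [set e | Q e.2] q s /\ forall y, Q y -> s (0, y) = s0 y.
Proof.
have /choice[f Hf] : forall y, exists s, Q y -> exists W, part y 2 W s.
  move=> y; have [Qy|nQy] := pselect (Q y); last by exists (fun e => s0 e.2).
  by have [W [s Ws]] := part_all 2 Qy; exists s => _; exists W.
(* Time is frozen at 2, where [q] is already constant, so lifts up to time 2 become lifts for all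
   times. *)
pose m (e : R * Y) := (Num.min e.1 2, e.2).
have cm e : {for e, continuous m}.
  apply: for_continuous_pair; last exact: for_continuous_snd.
  apply: (@for_continuous_comp _ _ _ fst (fun t : R => Num.min t 2)).
    exact: for_continuous_fst.
  exact: (continuous_min (@for_continuous_id R e.1) (@for_continuous_cst R R 2 e.1)).
have qm e : q (m e) = q e.
  case: e => t y; rewrite /m /=; case: (leP t 2) => // /ltW t2.
  by rewrite q1 ?ler1n // [RHS]q1 // (le_trans _ t2) // ler1n.
have fm y W : part y 2 W (f y) -> flat [set e | W e.2] q (f y \o m).
  move=> [_ fl _]; have -> : q = q \o m by apply/funext => e; rewrite /= qm.
  apply: (flat_comp (Q' := [set e | W e.2]) (f := m) fl) => //.
  by move=> e We; split=> //=; rewrite ge_min lexx orbT.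
(* Lifts chosen for different [y] agree on a common track, as both start from [s0] at time -1. Hence
   reading at each point the lift chosen for that very [y] still gives a continuous lift. *)
have fE y W y' t : Q y -> Q y' -> part y 2 W (f y) -> W y' -> f y (m (t, y')) = f y' (m (t, y')).
  move=> Qy Qy' p2 Wy'; have [W' p2'] := Hf _ Qy'.
  have cy u : {for u, continuous (fun u : R => (u, y'))} by exact: continuous_pairr.
  have fl z V : part z 2 V (f z) -> V y' ->
      flat setT (fun u => q (u, y')) (fun u => f z (m (u, y'))).
    by move=> pz Vy'; apply: (flat_comp (f := fun u => (u, y')) (fm _ _ pz)).
  apply: (@flat_uniq (fun u => q (u, y')) (fun u => f y (m (u, y'))) (fun u => f y' (m (u, y'))) (-1) t); [| | exact: fl p2 _ | |].
  - by move=> u; apply: continuous_comp; [exact: cy | exact: cq].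
  - by move=> u; exact: lq.
  - by apply: (fl _ _ p2'); case: p2' => /nbhs_singleton.
  have m1 : m (-1, y') = (-1, y') by rewrite /m /= min_l //; lra.
  have a1 : (-1 : R) <= 2 by lra.
  have a2 : (-1 : R) <= 0 by lra.
  by rewrite m1; case: p2 => _ _ -> //; case: p2' => /nbhs_singleton ? _ ->.
exists (fun e => f e.2 (m e)); split; last first.
  move=> y Qy; have [W [/nbhs_singleton Wy _ E]] := Hf _ Qy.
  by rewrite /m /= min_l ?E.
move=> [t y] /= Qy; have [W p2] := Hf _ Qy.
have Wy : nbhs y W by case: p2.
have [sg sg1 sg2] := fm _ _ p2 (t, y) (nbhs_singleton Wy); exists sg => //.
have HW : \forall e \near (t, y), W e.2 /\ Q e.2.
  have H : \forall z \near y, W z /\ Q z by apply: filterI => //; exact: Qo.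
  exact: near_snd H.
apply: filterS (filterI HW sg2) => -[t' y'] /= [[Wy' Qy'] <-].
by rewrite (fE _ _ _ _ Qy Qy' p2 Wy').
Qed.
End HomotopyLifting.

Section Contractible.
Variables (Y : topologicalType) (Q : set Y) (q : Y -> X) (k : R * Y -> Y) (y0 : Y).
Hypotheses (Qo : forall y, Q y -> nbhs y Q)
  (cq : forall y, Q y -> {for y, continuous q}) (lq : forall y, Q y -> lc (q y))
  (ck : forall (t : R) (y : Y), Q y -> {for (t, y), continuous k})
  (kQ : forall (t : R) (y : Y), Q y -> Q (k (t, y)))
  (k0 : forall (t : R) (y : Y), t <= 0 -> k (t, y) = y0)
  (k1 : forall (t : R) (y : Y), 1 <= t -> k (t, y) = y)
  (kk : forall t : R, k (t, y0) = y0).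

(** The contraction is lifted from the constant lift at [y0] and read at time 1. As [y0] does not
    move, its track has a constant lift, which gives the value there. *)
Lemma contractible_section (v : S (q y0)) : Q y0 ->
  exists s, flat Q q s /\ s y0 = existT _ (q y0) v.
Proof.
move=> Qy0.
have [||t y t0|t y t1||s [fs s0]] := @homotopy_lifting Y Q (q \o k) (fun=> existT _ (q y0) v) Qo.
- by move=> t y Qy; apply: for_continuous_comp; [exact: ck | exact/cq/kQ].
- by move=> t y Qy; exact/lq/kQ.
- by rewrite /= !k0.
- by rewrite /= !k1.
- have -> : (fun y => (q \o k) (0, y)) = (fun=> q y0) by apply/funext => y; rewrite /= k0.
  by apply: flat_const; exact: lq.
exists (fun y => s (1, y)); split.
  have -> : q = (q \o k) \o pair (1 : R) by apply/funext => y; rewrite /= k1.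
  by apply: (flat_comp (f := pair (1 : R)) fs) => // y _; exact: continuous_pairl.
rewrite -[RHS](s0 y0) //.
apply: (@flat_uniq (fun=> q y0) (fun t => s (t, y0)) (fun=> s (0, y0)) 0 1) => //.
- by move=> t; exact: for_continuous_cst.
- by move=> t; exact: lq.
- have -> : (fun=> q y0) = (q \o k) \o (fun t : R => (t, y0)) by apply/funext => t; rewrite /= kk.
  by apply: (flat_comp (f := fun t : R => (t, y0)) fs) => // t _; exact: continuous_pairr.
by rewrite s0 //; apply: flat_const; exact: lq.
Qed.

Lemma contractible_uniq s s' y1 y : flat Q q s -> flat Q q s' -> Q y1 -> Q y ->
  s y1 = s' y1 -> s y = s' y.
Proof.
move=> fs fs' Qy1 Qy E.
have H z a b : Q z -> s (k (a, z)) = s' (k (a, z)) -> s (k (b, z)) = s' (k (b, z)).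
  move=> Qz.
  have ckz t : {for t, continuous (fun t : R => k (t, z))}.
    by apply: (@for_continuous_comp _ _ _ (fun t : R => (t, z)) k); [exact: continuous_pairr | exact: ck].
  have fl u : flat Q q u -> flat setT (fun t => q (k (t, z))) (fun t => u (k (t, z))).
    move=> fu; apply: (flat_comp (f := fun t : R => k (t, z)) fu) => // e _.
    exact: kQ.
  apply: (@flat_uniq (fun t => q (k (t, z))) (fun t => s (k (t, z))) (fun t => s' (k (t, z)))).
  - move=> t; apply: (@for_continuous_comp _ _ _ (fun t => k (t, z)) q); first exact: ckz.
    exact/cq/kQ.
  - by move=> t; exact/lq/kQ.
  - exact: fl.
  - exact: fl.
have := H y1 1 0 Qy1; rewrite (k1 y1 (lexx 1)) (k0 y1 (lexx 0)) => /(_ E) E0.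
by have := H y 0 1 Qy; rewrite (k1 y (lexx 1)) (k0 y (lexx 0)) => /(_ E0).
Qed.
End Contractible.

Lemma flat_path (q : R -> X) (v : S (q 0)) : continuous q -> (forall t, lc (q t)) ->
  (forall t, t <= 0 -> q t = q 0) -> (forall t, 1 <= t -> q t = q 1) ->
  exists s, flat setT q s /\ s 0 = existT _ (q 0) v.
Proof.
move=> cq lq q0 q1.
have [//||||//||s [fs s0]] := @homotopy_lifting R setT (q \o fst) (fun=> existT _ (q 0) v).
- by move=> y _; exact: filterT.
- by move=> t y _; apply: for_continuous_comp; [exact: for_continuous_fst | exact: cq].
- by move=> t y _; exact: lq.
- by move=> t y; exact: q0.
- by move=> t y; exact: q1.
- by rewrite /=; apply: flat_const.
exists (fun t => s (t, 0)); split; last exact: s0.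
by apply: (flat_comp (f := fun t : R => (t, 0 : R)) fs) => // t _; exact: continuous_pairr.
Qed.

(** Retraction of the line onto [0, 1]: precomposition turns a path of which only the values on
    [0, 1] matter into a map that is continuous on the whole line and constant outside. *)
Definition clamp (t : R) : R := Num.max 0 (Num.min t 1).

Lemma clampE t : clamp t = if t <= 0 then 0 else if t <= 1 then t else 1.
Proof.
rewrite /clamp; case: (leP t 1) => t1; first by rewrite maxEle; case: (leP t 0); case: (leP 0 t) => //; lra.
by rewrite maxEle ler01 ifN // -ltNge; lra.
Qed.

Lemma clamp_itv t : 0 <= clamp t <= 1.
Proof. by rewrite clampE; case: (leP t 0); case: (leP t 1); lra. Qed.

Lemma clamp_id t : 0 <= t <= 1 -> clamp t = t.
Proof. by rewrite clampE; case: (leP t 0); case: (leP t 1); lra. Qed.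

Lemma clamp_clamp t : clamp (clamp t) = clamp t.
Proof. exact/clamp_id/clamp_itv. Qed.

Lemma clamp_le0 t : t <= 0 -> clamp t = 0.
Proof. by rewrite clampE => ->. Qed.

Lemma clamp_ge1 t : 1 <= t -> clamp t = 1.
Proof. by rewrite clampE; case: (leP t 0); case: (leP t 1); lra. Qed.

Lemma clampB t : clamp (1 - t) = 1 - clamp t.
Proof.
by rewrite !clampE; case: (leP t 0); case: (leP t 1); case: (leP (1 - t) 0); case: (leP (1 - t) 1); lra.
Qed.

Lemma clamp2l t : t <= 2^-1 -> clamp (2 * t) = 2 * clamp t.
Proof.
by rewrite !clampE; case: (leP t 0); case: (leP t 1); case: (leP (2 * t) 0); case: (leP (2 * t) 1); lra.
Qed.

Lemma clamp2r t : 2^-1 <= t -> clamp (2 * t - 1) = 2 * clamp t - 1.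
Proof.
by rewrite !clampE; case: (leP t 0); case: (leP t 1); case: (leP (2 * t - 1) 0); case: (leP (2 * t - 1) 1); lra.
Qed.

Lemma clamp_continuous : continuous clamp.
Proof.
move=> t; apply: (continuous_max (@for_continuous_cst R R 0 t)).
exact: (continuous_min (@for_continuous_id R t) (@for_continuous_cst R R 1 t)).
Qed.

Lemma path_mul_clamp (T : topologicalType) (g h : R -> T) t : path_mul g h (clamp t) =
  if t <= 2^-1 then h (clamp (2 * t)) else g (clamp (2 * t - 1)).
Proof.
have [th|th] := leP t 2^-1; rewrite /path_mul.
  rewrite clamp2l // ifT // clampE.
  by case: (leP t 0); case: (leP t 1); lra.
have E : (clamp t <= 2^-1) = false.
  by apply/negbTE; rewrite -ltNge clampE; case: (leP t 0); case: (leP t 1); lra.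
by rewrite (clamp2r (ltW th)) E.
Qed.

Lemma continuous_glue (T : topologicalType) (c : R) (g h : R -> T) :
  continuous g -> continuous h -> g c = h c ->
  continuous (fun t => if t <= c then g t else h t).
Proof.
move=> cg ch gh t P /= Pt.
change (\forall u \near t, P (if u <= c then g u else h u)).
have [tc|ct|tc] := ltgtP t c.
- rewrite ifT ?ltW // in Pt; have H' := near_continuous (cg t) Pt.
  by apply: filterS (filterI (lt_le_nbhsl tc) H') => u [/= ->].
- rewrite ifN -?ltNge // in Pt; have H' := near_continuous (ch t) Pt.
  by apply: filterS (filterI (lt_nbhsr ct) H') => u [/=]; rewrite ltNge => /negbTE ->.
rewrite tc lexx in Pt; rewrite tc.
have H := near_continuous (cg c) Pt; rewrite gh in Pt; have H' := near_continuous (ch c) Pt.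
by apply: filterS (filterI H H') => u [/= ? ?]; case: ifP.
Qed.

Lemma affine_continuous (a b : R) : continuous (fun t : R => a * t + b).
Proof.
move=> t; apply: (@continuousD R R^o R (fun t => a * t) (cst b)); last exact: for_continuous_cst.
by apply: (@continuousM R R (cst a) id); [exact: for_continuous_cst | exact: for_continuous_id].
Qed.

Lemma mul2_continuous : continuous (fun t : R => 2 * t).
Proof.
have -> : (fun t : R => 2 * t) = (fun t => 2 * t + 0) by apply/funext => t; rewrite addr0.
exact: affine_continuous.
Qed.

Lemma opp_continuous1 : continuous (fun t : R => 1 - t).
Proof.
have -> : (fun t : R => 1 - t) = (fun t => - 1 * t + 1) by apply/funext => t; rewrite mulN1r addrC.
exact: affine_continuous.
Qed.

Lemma flat_glue (c : R) (g h : R -> X) sg sh :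
  continuous h -> lc (g c) -> flat setT g sg -> flat setT h sh -> sg c = sh c ->
  flat setT (fun t => if t <= c then g t else h t) (fun t => if t <= c then sg t else sh t).
Proof.
move=> ch [_ lg] fg fh sgh t _.
have gh : g c = h c by rewrite -(flat_base (e := c) fg) // sgh (flat_base (e := c) fh).
have [tc|ct|tc] := ltgtP t c.
- have [s s1 s2] := fg t I; exists s; first by [].
  by apply: filterS (filterI (lt_le_nbhsl tc) s2) => u [/= ->].
- have [s s1 s2] := fh t I; exists s; first by [].
  by apply: filterS (filterI (lt_nbhsr ct) s2) => u [/=]; rewrite ltNge => /negbTE ->.
rewrite tc; have [s s1 s2] := fg c I; exists s => //.
have [s' s1' s2'] := fh c I.
have E : s (g c) = s' (g c).
  apply: tot_inj; rewrite -(nbhs_singleton s2) sgh (nbhs_singleton s2').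
  by rewrite [in RHS]gh.
have H : \forall x \near h c, s x = s' x.
  rewrite -gh; rewrite -gh in s1'; have := lg _ _ s1 s1'.
  by apply: filterS => x [_ ->].
have H' := near_continuous (ch c) H.
apply: filterS (filterI (filterI s2 s2') H') => u [[/= E1 E2] E3].
by case: ifP => // _; rewrite E2 E3.
Qed.

Definition cpath (T : topologicalType) (g : R -> T) := continuous (g \o clamp).

Lemma cpath_mul (T : topologicalType) (g h : R -> T) : cpath g -> cpath h -> h 1 = g 0 ->
  cpath (path_mul g h).
Proof.
move=> cg ch E.
have -> : path_mul g h = (fun t => path_mul g h t) by [].
rewrite /cpath; have -> : path_mul g h \o clamp = (fun t => if t <= 2^-1 then
    (h \o clamp) (2 * t) else (g \o clamp) (2 * t - 1)).
  by apply/funext => t; rewrite /= path_mul_clamp.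
apply: continuous_glue.
- move=> t; apply: (@for_continuous_comp _ _ _ (fun t : R => 2 * t) (h \o clamp)); last exact: ch.
  exact: mul2_continuous.
- move=> t; apply: (@for_continuous_comp _ _ _ (fun t : R => 2 * t - 1) (g \o clamp)); last exact: cg.
  exact: affine_continuous.
by rewrite /= mulfV // subrr clamp_ge1 // clamp_le0.
Qed.

Lemma cpath_inv (T : topologicalType) (g : R -> T) : cpath g -> cpath (path_inv g).
Proof.
move=> cg; rewrite /cpath; have -> : path_inv g \o clamp = (g \o clamp) \o (fun t : R => 1 - t).
  by apply/funext => t; rewrite /= clampB.
move=> t; apply: (@for_continuous_comp _ _ _ (fun t : R => 1 - t) (g \o clamp)); last exact: cg.
exact: opp_continuous1.
Qed.

Lemma continuous_comp_within (E E' T : topologicalType) (A : set E) (g : E -> T) (c : E' -> E) :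
  {within A, continuous g} -> (forall e, A (c e)) -> continuous c -> continuous (g \o c).
Proof.
move=> /subspace_continuousP cg Ac cc e P Pe.
have /(near_continuous (cc e)) := cg _ (Ac e) _ Pe.
change ((\forall e' \near e, A (c e') -> P (g (c e'))) -> \forall e' \near e, P (g (c e'))).
by apply: filterS => e' /(_ (Ac e')).
Qed.

Lemma is_path_cpath (T : topologicalType) (g : R -> T) a b : is_path g a b -> cpath g.
Proof.
move=> [cg _ _]; apply: (continuous_comp_within cg); last exact: clamp_continuous.
by move=> t; rewrite /= in_itv /= clamp_itv.
Qed.

(** [a] is transported to [b] along [g], of which only the values on [[0, 1]]
    matter *)
Definition tr (g : R -> X) (a b : tot S) :=
  exists s, [/\ flat setT (g \o clamp) s, s 0 = a & s 1 = b].

Lemma tr_base g a b : tr g a b -> projT1 a = g 0 /\ projT1 b = g 1.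
Proof.
move=> [s [fs <- <-]]; rewrite !(flat_base fs) //=.
by rewrite clamp_le0 // clamp_ge1.
Qed.

Lemma tr_eq g h a b : (forall t, 0 <= t <= 1 -> g t = h t) -> tr g a b -> tr h a b.
Proof.
move=> E; rewrite /tr; have -> // : g \o clamp = h \o clamp.
by apply/funext => t; rewrite /= E // clamp_itv.
Qed.

Lemma tr_inv g a b : tr g a b -> tr (path_inv g) b a.
Proof.
move=> [s [fs s0 s1]]; exists (s \o (fun t : R => 1 - t)); split=> /=; rewrite ?subr0 ?subrr //.
have -> : path_inv g \o clamp = (g \o clamp) \o (fun t : R => 1 - t).
  by apply/funext => t; rewrite /= clampB.
by apply: (flat_comp (f := fun t : R => 1 - t) fs) => // t _; exact: opp_continuous1.
Qed.

Section LocallyConstant.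
Hypothesis lcS : forall x, lc x.

Lemma tr_exists g (v : S (g 0)) : cpath g -> exists w : S (g 1), tr g (existT _ (g 0) v) (existT _ (g 1) w).
Proof.
move=> cg; have gc0 : (g \o clamp) 0 = g 0 by rewrite /= clamp_le0.
have [s [fs s0]] := @flat_path (g \o clamp) (tot_at (existT _ (g 0) v) ((g \o clamp) 0)) cg
  (fun t => lcS _) (fun t t0 => congr1 g (etrans (clamp_le0 t0) (esym (clamp_le0 (lexx 0)))))
  (fun t t1 => congr1 g (etrans (clamp_ge1 t1) (esym (clamp_ge1 (lexx 1))))).
exists (tot_at (s 1) (g 1)), s; split=> //; first by rewrite s0; exact/esym/tot_tot_at.
by apply: tot_tot_at; rewrite (flat_base fs) //= clamp_ge1.
Qed.

Lemma tr_total g a : cpath g -> projT1 a = g 0 -> exists2 b, projT1 b = g 1 & tr g a b.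
Proof.
move=> cg a0; rewrite (tot_tot_at a0); have [w Tw] := tr_exists (tot_at a (g 0)) cg.
by exists (existT _ (g 1) w).
Qed.

Lemma tr_uniq g a b b' : cpath g -> tr g a b -> tr g a b' -> b = b'.
Proof.
move=> cg [s [fs s0 <-]] [s' [fs' s0' <-]].
by apply: (@flat_uniq (g \o clamp) s s' 0 1) => //; rewrite s0.
Qed.

Lemma tr_uniql g a a' b : cpath g -> tr g a b -> tr g a' b -> a = a'.
Proof.
move=> cg [s [fs <- s1]] [s' [fs' <- s1']].
by apply: (@flat_uniq (g \o clamp) s s' 1 0) => //; rewrite s1.
Qed.

Lemma tr_cst x (v : S x) : tr (cst x) (existT _ x v) (existT _ x v).
Proof. by exists (fun=> existT _ x v); split=> //; apply: flat_const. Qed.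

Lemma tr_mul g h a b c : cpath g -> tr h a b -> tr g b c -> tr (path_mul g h) a c.
Proof.
move=> cg [sh [fh h0 h1]] [sg [fg g0 g1]].
exists (fun t => if t <= 2^-1 then sh (2 * t) else sg (2 * t - 1)); split; last 2 first.
- by rewrite mulr0 ifT //; lra.
- have -> : 2 * 1 - 1 = 1 :> R by lra.
  by rewrite ifN // -ltNge; lra.
have -> : path_mul g h \o clamp = (fun t => if t <= 2^-1 then
    (h \o clamp) (2 * t) else (g \o clamp) (2 * t - 1)).
  by apply/funext => t; rewrite /= path_mul_clamp.
apply: flat_glue.
- move=> t; apply: (@for_continuous_comp _ _ _ (fun t : R => 2 * t - 1) (g \o clamp)); last exact: cg.
  exact: affine_continuous.
- exact: lcS.
- by apply: (flat_comp (f := fun t : R => 2 * t) fh) => // t _; exact: mul2_continuous.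
- by apply: (flat_comp (f := fun t : R => 2 * t - 1) fg) => // t _; exact: affine_continuous.
by rewrite mulfV // subrr h1 g0.
Qed.

(** The homotopy is lifted in the direction of the paths, from the constant value [a] on the edge at
    time 0. The edge at time 1 is constant too, so the lifts of all paths of the family share their
    end point. *)
Lemma tr_homotopic g h a b : homotopic g h -> tr g a b -> tr h a b.
Proof.
move=> [H [cH H01 Hs]] [s [fs s0 s1]].
have cc : continuous (fun e : R * R => (clamp e.1, clamp e.2)).
  move=> e; apply: (@for_continuous_pair _ _ _ (fun e : R * R => clamp e.1) (fun e : R * R => clamp e.2)).
    apply: (@for_continuous_comp _ _ _ fst clamp); last exact: clamp_continuous.
    exact: for_continuous_fst.
  apply: (@for_continuous_comp _ _ _ snd clamp); last exact: clamp_continuous.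
  exact: for_continuous_snd.
have cq : continuous (H \o (fun e : R * R => (clamp e.1, clamp e.2))).
  apply: (continuous_comp_within cH) => // e.
  by split; rewrite /= in_itv /= clamp_itv.
have cl0 : clamp 0 = 0 by rewrite clamp_le0.
have cl1 : clamp 1 = 1 by rewrite clamp_ge1.
have a0 : projT1 a = g 0 by rewrite -s0 (flat_base fs) //= cl0.
have b1 : projT1 b = g 1 by rewrite -s1 (flat_base fs) //= cl1.
have [||||||u [fu u0]] := @homotopy_lifting R setT
    (H \o (fun e : R * R => (clamp e.1, clamp e.2))) (fun=> a).
- by move=> y _; exact: filterT.
- by move=> t y _; exact: cq.
- by move=> t y _; exact: lcS.
- by move=> t y t0; rewrite /= clamp_le0 // cl0.
- by move=> t y t1; rewrite /= clamp_ge1 // cl1.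
- have -> : (fun y : R => (H \o (fun e : R * R => (clamp e.1, clamp e.2))) (0, y)) = fun=> g 0.
    by apply/funext => y; rewrite /= cl0; case: (Hs _ (clamp_itv y)).
  by rewrite (tot_tot_at a0); apply: flat_const.
have row c : flat setT (fun t : R => H (clamp t, clamp c)) (fun t => u (t, c)).
  apply: (flat_comp (f := fun t : R => (t, c)) fu) => // t _.
  exact: continuous_pairr.
have gE : (fun t => H (clamp t, clamp 0)) = g \o clamp.
  by apply/funext => t; rewrite cl0; case: (H01 _ (clamp_itv t)).
have hE : (fun t => H (clamp t, clamp 1)) = h \o clamp.
  by apply/funext => t; rewrite cl1; case: (H01 _ (clamp_itv t)).
exists (fun t => u (t, 1)); split; first by rewrite -hE; exact: row.
  exact: u0.
have Eu t : u (1, t) = u (1, 0).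
  apply: (@flat_uniq (fun=> g 1) (fun t => u (1, t)) (fun=> u (1, 0)) 0 t) => //.
  - by move=> y; exact: for_continuous_cst.
  - have -> : (fun=> g 1) = (H \o (fun e : R * R => (clamp e.1, clamp e.2))) \o pair (1 : R).
      by apply/funext => y /=; rewrite cl1; case: (Hs _ (clamp_itv y)).
    by apply: (flat_comp (f := pair (1 : R)) fu) => // y _; exact: continuous_pairl.
  have b0 : projT1 (u (1, 0)) = g 1.
    by rewrite (flat_base fu) //= cl0 cl1; case: (Hs 0 _); rewrite ?lexx ?ler01.
  by rewrite (tot_tot_at b0); apply: flat_const.
rewrite Eu -s1; apply: (@flat_uniq (g \o clamp) (fun t => u (t, 0)) s 0 1) => //.
- rewrite -gE => t; apply: (@for_continuous_comp _ _ _ (fun t : R => (t, 0 : R))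
    (H \o (fun e : R * R => (clamp e.1, clamp e.2)))); [exact: continuous_pairr | exact: cq].
- by rewrite -gE.
by rewrite u0 // s0.
Qed.
End LocallyConstant.
End Flat.

Arguments clamp {R} t.

(** * Pull-backs and linear combinations of lifts *)

Section Pullet.
Variables (K : fieldType) (X Y : topologicalType) (f : Y -> X) (S : et K X).

Definition pullet_sc (s : prodM (fun y => S (f y))) (y : Y) : Prop :=
  exists2 sg, sc S sg (f y) & \forall y' \near y, s y' = sg (f y').
Hypothesis cf : continuous f.
Fact pullet_near s y : pullet_sc s y -> \forall y' \near y, pullet_sc s y'.
Proof.
move=> [sg /sc_near/(near_continuous (@cf y)) H1 /near_join H2].
by apply: filterS (filterI H1 H2) => y' [/= ? ?]; exists sg.
Qed.
Fact pullet_loc s t y : (\forall y' \near y, s y' = t y') -> pullet_sc s y -> pullet_sc t y.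
Proof.
move=> H [sg sg1 sg2]; exists sg => //.
by apply: filterS (filterI H sg2) => y' [/= <-].
Qed.
Definition pullet : et K Y := Et pullet_near pullet_loc.

Lemma flat_pullet (E : topologicalType) (Q : set E) (q : E -> Y) s :
  flat (S := S) Q (f \o q) s ->
  flat (S := pullet) Q q (fun e => existT (fun y => pullet y : Type) (q e) (tot_at (s e) (f (q e)))).
Proof.
move=> fs e Qe; have [sg sg1 sg2] := fs e Qe.
exists (fun y => sg (f y)); first by exists sg => //; exact: nearW.
by apply: filterS sg2 => e' ->; rewrite tot_atE.
Qed.

Lemma pullet_flat (E : topologicalType) (Q : set E) (q : E -> Y) s :
  (forall e, Q e -> {for e, continuous q}) -> flat (S := pullet) Q q s ->
  flat (S := S) Q (f \o q)
    (fun e => existT (fun x => S x : Type) (f (projT1 (s e))) (projT2 (s e))).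
Proof.
move=> cq fs e Qe; have [sg [sg0 sg1 sg2] sg3] := fs e Qe; exists sg0 => //.
have := near_continuous (cq _ Qe) sg2.
by apply: filterS2 sg3 => e' -> /= ->.
Qed.
End Pullet.

Section PulletTransport.
Variables (K : fieldType) (X Y : topologicalType) (f : Y -> X) (S : et K X) (R : realType).
Hypothesis cf : continuous f.

Lemma tr_pullet (g : R -> Y) y y' (v : S (f y)) (w : S (f y')) :
  g 0 = y -> g 1 = y' ->
  tr (f \o g) (existT (fun x => S x : Type) (f y) v) (existT (fun x => S x : Type) (f y') w) ->
  tr (S := pullet S cf) g (existT (fun x => pullet S cf x : Type) y v)
    (existT (fun x => pullet S cf x : Type) y' w).
Proof.
move=> g0 g1 [s [fs s0 s1]].
exists (fun e => existT (fun x => pullet S cf x : Type) (g (clamp e)) (tot_at (s e) (f (g (clamp e))))).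
split; first exact: (flat_pullet (q := g \o clamp) cf fs).
  by rewrite clamp_le0 // g0 s0 tot_atE.
by rewrite clamp_ge1 // g1 s1 tot_atE.
Qed.

Lemma pullet_tr (g : R -> Y) y y' (v : S (f y)) (w : S (f y')) : cpath g ->
  tr (S := pullet S cf) g (existT (fun x => pullet S cf x : Type) y v)
    (existT (fun x => pullet S cf x : Type) y' w) ->
  tr (f \o g) (existT (fun x => S x : Type) (f y) v) (existT (fun x => S x : Type) (f y') w).
Proof.
move=> cg [s [fs s0 s1]].
exists (fun e => existT (fun x => S x : Type) (f (projT1 (s e))) (projT2 (s e))).
by split; [apply: pullet_flat fs => e _; exact: cg | rewrite s0 | rewrite s1].
Qed.
End PulletTransport.

Section TransportCombination.
Variables (K : fieldType) (X : topologicalType) (R : realType) (F : X -> lmodType K).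
Variables sc1 sc2 sc3 : prodM F -> X -> Prop.
Variables (near1 : forall s x, sc1 s x -> \forall y \near x, sc1 s y)
  (near2 : forall s x, sc2 s x -> \forall y \near x, sc2 s y)
  (near3 : forall s x, sc3 s x -> \forall y \near x, sc3 s y).
Variables (loc1 : forall s t x, (\forall y \near x, s y = t y) -> sc1 s x -> sc1 t x)
  (loc2 : forall s t x, (\forall y \near x, s y = t y) -> sc2 s x -> sc2 t x)
  (loc3 : forall s t x, (\forall y \near x, s y = t y) -> sc3 s x -> sc3 t x).
Variable a : K.
Hypothesis comb : forall s t x, sc1 s x -> sc2 t x -> sc3 (a *: s + t) x.
Notation pt z v := (existT (fun y => F y : Type) z v).

Lemma flat_comb (E : topologicalType) (Q : set E) (q : E -> X) (s t : E -> tot F) :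
  flat (S := Et near1 loc1) Q q s -> flat (S := Et near2 loc2) Q q t ->
  flat (S := Et near3 loc3) Q q
    (fun e => pt (q e) (a *: tot_at (s e) (q e) + tot_at (t e) (q e))).
Proof.
move=> fs ft e Qe; have [sg sg1 sg2] := fs e Qe; have [th th1 th2] := ft e Qe.
exists (a *: (sg : prodM F) + th); first exact: comb.
by apply: filterS2 sg2 th2 => e' -> ->; rewrite !tot_atE.
Qed.

(** The three predicates share the stalks but not the sections: a sheaf, a torsor under it,
    potentials of different sections. Linearity of transport, differences and translates of torsor
    points are all instances. *)
Lemma tr_comb (g : R -> X) x y (v v' : F x) (w w' : F y) :
  tr (S := Et near1 loc1) g (pt x v) (pt y w) -> tr (S := Et near2 loc2) g (pt x v') (pt y w') ->
  tr (S := Et near3 loc3) g (pt x (a *: v + v')) (pt y (a *: w + w')).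
Proof.
move=> tF; have [/= gx gy] := tr_base tF; case: tF => s [fs s0 s1] [t [ft t0 t1]].
eexists; split; first exact: flat_comb fs ft.
  by rewrite /= clamp_le0 // -gx s0 t0 !tot_atE.
by rewrite /= clamp_ge1 // -gy s1 t1 !tot_atE.
Qed.
End TransportCombination.

Section SheafEt.
Variables (K : fieldType) (X : topologicalType) (F : sheaf K X).

Definition sheaf_et : et K X := Et (@secat_near _ _ F) (@secat_local _ _ F).

Lemma secat_sum n (c : 'I_n -> K) (e : 'I_n -> sections F) x :
  (forall i, secat (e i) x) -> secat (\sum_i c i *: e i : sections F) x.
Proof.
move=> H; elim/big_rec: _ => [|i s _ IH]; first exact: secat0.
exact: secatP.
Qed.

Lemma sectionsE n (c : 'I_n -> K) (e : 'I_n -> sections F) x :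
  (\sum_i c i *: e i : sections F) x = \sum_i c i *: e i x.
Proof.
elim/big_rec2: _ => // i s t _ E.
by rewrite -E.
Qed.

Lemma secatB s t x : secat (s : sections F) x -> secat t x -> secat (s - t : sections F) x.
Proof.
by move=> Hs Ht; rewrite addrC -scaleN1r; apply: secatP.
Qed.

Lemma local_system_lc : local_system F -> forall x, lc sheaf_et x.
Proof.
move=> lF x; have [n [e He]] := lF x; split.
  exists [set y | (forall i, secat (e i) y) /\
      (forall v : F y, exists! c : 'I_n -> K, v = \sum_i c i *: e i y)] => //.
  move=> y v [_ /(_ v)[c [Ec _]]]; exists (\sum_i c i *: e i : sections F).
  split; first by rewrite sectionsE.
  by move=> z [ez _]; apply: secat_sum.
(* Near [x] the difference [s - t] is the combination of the basis [e] with the constant coordinates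
   [c] found at [x]. It vanishes at [y] iff [c] is zero, by uniqueness of coordinates at [y]. *)
move=> s t Hs Ht; have [ex /(_ (s x - t x))[c [Ec _]]] := nbhs_singleton He.
have H : secat (s - t - \sum_i c i *: e i : sections F) x.
  by apply: secatB; [exact: secatB | exact: secat_sum].
have /(secat_sep H) H' : (s - t - \sum_i c i *: e i : sections F) x = 0.
  rewrite -[LHS]/((s x - t x) - (\sum_i c i *: e i : sections F) x).
  by rewrite sectionsE -Ec subrr.
apply: filterS (filterI He H') => y [[ey uy]].
rewrite -[LHS]/((s y - t y) - (\sum_i c i *: e i : sections F) y) sectionsE.
move=> /subr0_eq E; have Z z : (forall i, c i = 0) -> \sum_i c i *: e i z = 0.
  by move=> c0; rewrite big1 // => i _; rewrite c0 scale0r.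
have c0 : s y = t y -> forall i, c i = 0.
  move=> st; have [d [_ ud]] := uy 0.
  have Ed : d = c by apply: ud; rewrite -E st subrr.
  by move=> i; rewrite -Ed (ud (fun=> 0)) // big1 // => j _; rewrite scale0r.
split=> [/c0/(Z x)|st]; first by rewrite -Ec => /subr0_eq.
apply/eqP; rewrite -subr_eq0 E; apply/eqP/Z.
have [_ /(_ 0)[d [_ ud]]] := nbhs_singleton He.
have Ed : d = c by apply: ud; rewrite -Ec st subrr.
by move=> i; rewrite -Ed (ud (fun=> 0)) // big1 // => j _; rewrite scale0r.
Qed.

Lemma tr_linear (R : realType) (g : R -> X) a x y (v v' : F x) (w w' : F y) :
  tr (S := sheaf_et) g (existT (fun x => F x : Type) x v) (existT (fun x => F x : Type) y w) ->
  tr (S := sheaf_et) g (existT (fun x => F x : Type) x v') (existT (fun x => F x : Type) y w') ->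
  tr (S := sheaf_et) g (existT (fun x => F x : Type) x (a *: v + v'))
    (existT (fun x => F x : Type) y (a *: w + w')).
Proof. by apply: tr_comb => s t z; exact: secatP. Qed.

Variable R : realType.

Lemma is_lift_flat (g : R -> X) (s : R -> tot F) : is_lift g s ->
  flat (S := sheaf_et) setT (g \o clamp) (s \o clamp).
Proof.
move=> ls t _; have [_ [sg sg1 sg2]] := ls _ (clamp_itv t); exists sg => //.
have := near_continuous (@clamp_continuous R t) sg2.
by apply: filterS => t' /= ->; rewrite // in_itv /= clamp_itv.
Qed.

Lemma flat_is_lift (g : R -> X) (s : R -> tot F) :
  flat (S := sheaf_et) setT (g \o clamp) s -> is_lift g s.
Proof.
move=> fs t t01; split; first by rewrite (flat_base fs) //= clamp_id.
have [sg] := fs t I; rewrite /= clamp_id // => sg1 sg2; exists sg => //.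
by apply: filterS sg2 => u -> /=; rewrite in_itv /= => ?; rewrite clamp_id.
Qed.

(** The exchange of [v] and [w] reflects the action from the right, which moves [v] backwards along
    the loop. *)
Lemma monodromyE (g : R -> X) a (v w : F a) : monodromy g v w <->
  tr (S := sheaf_et) g (existT (fun x => F x : Type) a w) (existT (fun x => F x : Type) a v).
Proof.
split=> [[s [/is_lift_flat fs s1 s0]]|[s [/flat_is_lift fs s0 s1]]].
  exists (s \o clamp); split=> //=; first by rewrite clamp_le0.
  by rewrite clamp_ge1.
by exists s.
Qed.
End SheafEt.

(** * Torsors and the first direct image *)

Section Torsor.
Variables (K : fieldType) (X : topologicalType) (F : sheaf K X).

(** A torsor lives on the stalks of [F] itself, with local sections of its own, so that differences
    and translates are taken in the stalks. The existence of local sections is kept apart, since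
    some torsors below have them only over a slab. *)
Record torsor := Torsor {
  tsc : sections F -> X -> Prop;
  tsc_near : forall s x, tsc s x -> \forall y \near x, tsc s y;
  tsc_loc : forall s t x, (\forall y \near x, s y = t y) -> tsc s x -> tsc t x;
  tsc_sub : forall s t x, tsc s x -> tsc t x -> secat (s - t) x;
  tsc_add : forall s t x, tsc s x -> secat t x -> tsc (s + t) x }.

Definition torsor_et (T : torsor) : et K X := Et (@tsc_near T) (@tsc_loc T).

Lemma torsor_lc (T : torsor) s x : lc (sheaf_et F) x -> tsc T s x -> lc (torsor_et T) x.
Proof.
move=> [[N Nx HN] HF] Ts; split.
  exists (N `&` [set y | tsc T s y]); first by apply: filterI => //; exact: tsc_near.
  move=> y v [Ny Ty]; have [t [tv tN]] := HN y (v - s y : F y) Ny.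
  exists (s + t : sections F); split.
    by rewrite -[LHS]/(s y + t y) tv addrC subrK.
  by move=> z [Nz Tz]; apply: tsc_add => //; exact: tN.
move=> t t' Ht Ht'; have := HF (t - t' : sections F) 0 (tsc_sub Ht Ht') (secat0 F x).
have E y : (t - t' : sections F) y = (0 : sections F) y <-> t y = t' y.
  by split=> [/subr0_eq//|tt]; rewrite -[LHS]/(t y - t' y) tt subrr.
by apply: filterS => y H; split=> [/E/H/E|/E/H/E].
Qed.

Lemma torsor_through (T : torsor) s x (v : F x) : tsc T s x ->
  exists2 t, tsc T t x & t x = v.
Proof.
move=> Ts; have [t Ht tv] := secat_germ (v - s x); exists (s + t); first exact: tsc_add.
by rewrite -[LHS]/(s x + t x) tv addrC subrK.
Qed.
End Torsor.

Section HigherDirectImage.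
Variables (K : fieldType) (X Z Y : topologicalType) (emb : X -> Z) (f : Z -> Y).
Hypotheses (cemb : continuous emb) (cf : continuous f)
  (emb_near : forall (u : X) (P : X -> Prop), (\forall v \near u, P v) ->
     \forall z \near emb u, forall v, emb v = z -> P v).

Section OneSheaf.
Variable F : sheaf K X.
Notation G := (push emb F).
Notation C1 := (gode1 G).
Notation germ1 z := (cls (all_sections G) (secat_submod G z)).
Notation pcls z := (cls (push_num emb F z) (push_den emb F z)).
Implicit Types (sg : sections C1) (g : sections G).

(** A germ of [push emb F] at [emb u] has a value at [u] that does not depend on the representative
    ([rep_pcls]). *)
Definition germ_values (g : sections G) : sections F := fun u => rep (g (emb u)) u.

Lemma rep_pcls (s : sections F) z u : push_num emb F z s -> emb u = z ->
  rep (pcls z s) u = s u.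
Proof.
move=> Ns uz; have := nbhs_singleton (rep_cls (push_den emb F z) Ns) u uz.
by move=> /subr0_eq.
Qed.

Lemma germ_valuesP a g g' u : germ_values (a *: g + g') u = a *: germ_values g u + germ_values g' u.
Proof.
have A1 := repA (g (emb u)); have A2 := repA (g' (emb u)).
have E : (a *: g + g') (emb u) = pcls (emb u) (a *: rep (g (emb u)) + rep (g' (emb u))).
  by rewrite clsP // !repK.
by rewrite /germ_values E rep_pcls //; apply: subP.
Qed.

Lemma germ_valuesB g g' u : germ_values (g - g') u = germ_values g u - germ_values g' u.
Proof. by rewrite addrC -scaleN1r germ_valuesP scaleN1r addrC. Qed.

Lemma germ_values_near g u s : push_num emb F (emb u) s ->
  (\forall z \near emb u, g z = pcls z s) -> \forall v \near u, germ_values g v = s v.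
Proof.
move=> /push_num_near Ns Eg.
apply: filterS2 (near_continuous (@cemb u) Ns) (near_continuous (@cemb u) Eg) => v N E.
by rewrite /germ_values E rep_pcls.
Qed.

Lemma germ_values_secat g u : secat g (emb u) -> secat (germ_values g) u.
Proof.
move=> [s Ns Eg]; apply: (@secat_local _ _ F s).
  by apply: filterS (germ_values_near Ns Eg) => v ->.
exact: (nbhs_singleton Ns).
Qed.

Definition slab_num (sg : sections C1) y := push_num f C1 y sg.
Definition psec (sg : sections C1) : sections (push f C1) :=
  fun y => cls (push_num f C1 y) (push_den f C1 y) sg.
Definition r1cls (s : sections (push f C1)) y : R1 f G y :=
  cls (secat_submod (push f C1) y) (coker_den (push_hom f (gode_proj G)) y) s.
(** The class, in the stalk of the first direct image, of a section of [C1] over a neighbourhood of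
    the fibre over [y]; all classes are of this form ([mk_surj]). *)
Definition mk sg y : R1 f G y := r1cls (psec sg) y.

Lemma psec_secat sg y : slab_num sg y -> secat (psec sg) y.
Proof. by move=> Ns; exists sg => //; exact: nearW. Qed.

Lemma slab_num_near sg y : slab_num sg y -> \forall y' \near y, slab_num sg y'.
Proof. exact: push_num_near. Qed.

Lemma r1cls_near s t y : secat s y -> secat t y -> (\forall y' \near y, s y' = t y') ->
  r1cls s y = r1cls t y.
Proof.
move=> Hs Ht st; apply/cls_eq => //; exists 0; first exact: secat0.
by apply: filterS st => y' E; rewrite linear0 -[LHS]/(s y' - t y') E subrr.
Qed.

Lemma mk_surj y (m : R1 f G y) : exists2 sg, slab_num sg y & m = mk sg y.
Proof.
have Am := repA m; have [sg Ns E] := Am; exists sg => //.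
by rewrite -[LHS]repK; apply: r1cls_near => //; exact: psec_secat.
Qed.

Lemma slab_numP a sg sg' y : slab_num sg y -> slab_num sg' y -> slab_num (a *: sg + sg') y.
Proof. exact: subP. Qed.

Lemma mkP a sg sg' y : slab_num sg y -> slab_num sg' y ->
  mk (a *: sg + sg') y = a *: mk sg y + mk sg' y.
Proof.
move=> Ns Ns'; rewrite /mk /r1cls -clsP; try exact: psec_secat.
apply: r1cls_near; first by apply: psec_secat; exact: slab_numP.
  by apply: secatP; exact: psec_secat.
apply: filterS2 (slab_num_near Ns) (slab_num_near Ns') => y' N N'.
by rewrite -[RHS]/(a *: psec sg y' + psec sg' y') /psec clsP.
Qed.

Lemma mk_secat sg y : slab_num sg y -> secat (fun y => mk sg y : R1 f G y) y.
Proof. by move=> /psec_secat Ns; exists (psec sg) => //; exact: nearW. Qed.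

Lemma secat_mk s y : secat (s : sections (R1 f G)) y -> exists2 sg, slab_num sg y &
  \forall y' \near y, s y' = mk sg y'.
Proof.
move=> [t Ht st]; have [sg Ns E] := Ht; exists sg => //.
apply: filterS2 (filterI st (secat_near Ht)) (filterI (near_join E) (slab_num_near Ns)).
move=> y' [-> Ht'] [E' N']; apply: r1cls_near => //; exact: psec_secat.
Qed.

(** Sections of the first Godement sheaf are arbitrary families, so nothing has to be glued: the
    class vanishes as soon as one family [tau] induces [sg] at all points over a neighbourhood of
    [y]. *)
Lemma mk_eq0P sg y : slab_num sg y -> (mk sg y = 0 <-> exists tau : sections G,
  \forall y' \near y, forall z, f z = y' -> sg z = germ1 z tau).
Proof.
move=> Ns; rewrite /mk /r1cls cls0; last exact: psec_secat.
split=> [[t [tau' Nt Et] E]|[tau E]].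
  (* A section of the sheaf of germs of families comes from a single family, formed by the values of
     its germs at their own base points. *)
  exists (fun z => rep (tau' z) z).
  apply: filterS2 (filterI E Et) (filterI (slab_num_near Ns) (push_num_near Nt)).
  move=> y' [E1 E2] [N1 N2] z fz.
  rewrite E2 /= subquot_map_cls // in E1.
  have /nbhs_singleton/(_ z fz)/subr0_eq -> :=
    (cls_eq (push_den f C1 y') N1 (push_hom_num (gode_proj G) N2)).1 E1.
  rewrite /prod_map /=.
  have [u _ Hu] := nbhs_singleton N2 z fz.
  apply/cls_eq => //; apply: (secat_local _ (secat0 G z)).
  have Bz : near_zero_sub G z (rep (tau' z) - u).
    by rewrite (nbhs_singleton Hu); exact: rep_cls.
  apply: filterS2 (near_join Hu) Bz => z' Hu' B.
  have := nbhs_singleton (@rep_cls _ _ (all_sections G) (near_zero_sub G z') u I).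
  rewrite -(nbhs_singleton Hu') => /subr0_eq E3.
  rewrite -[RHS]/(rep (tau' z) z' - rep (tau' z') z') E3.
  by rewrite -[RHS]/((rep (tau' z) - u) z') B.
pose t0 : sections (gode0 G) := fun z => cls (all_sections G) (near_zero_sub G z) tau.
have t0s z : secat t0 z by exists tau => //; exact: nearW.
have Nt y' : push_num f (gode0 G) y' t0 by apply: nearW => y'' z _.
exists (fun y => cls (push_num f (gode0 G) y) (push_den f (gode0 G) y) t0).
  by exists t0 => //; exact: nearW.
apply: filterS2 (near_join E) (slab_num_near Ns) => y' E' N'.
rewrite /= subquot_map_cls //.
have A2 := push_hom_num (gode_proj G) (Nt y').
apply/cls_eq => //.
apply: filterS E' => y'' H z fz.
have E2 : gode_proj G z (t0 z) = germ1 z tau.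
  exact: (@subquot_map_cls _ _ _ (all_sections G) _ _ _ _ _ _ tau I).
by change (sg z - gode_proj G z (t0 z) = 0); rewrite (H z fz) E2 subrr.
Qed.

(** Potentials are the lifts of [sg] from classes modulo sections to families, evaluated on [X]. Two
    of them differ by a section of [F], so they form the torsor that represents the class of
    [sg]. *)
Definition pot_sc (sg : sections C1) (s : sections F) (u : X) : Prop := exists g,
  (\forall z \near emb u, sg z = germ1 z g) /\ \forall v \near u, s v = germ_values g v.

Fact pot_near sg s u : pot_sc sg s u -> \forall v \near u, pot_sc sg s v.
Proof.
move=> [g [/near_join H1 /near_join H2]].
by apply: filterS2 (near_continuous (@cemb u) H1) H2 => v H1' H2'; exists g.
Qed.

Fact pot_loc sg s t u : (\forall v \near u, s v = t v) -> pot_sc sg s u -> pot_sc sg t u.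
Proof.
move=> st [g [H1 H2]]; exists g; split=> //.
by apply: filterS2 st H2 => v <-.
Qed.

Lemma germ1_eq g g' z : germ1 z g = germ1 z g' <-> secat (g - g') z.
Proof. exact: cls_eq. Qed.

Fact pot_sub sg s t u : pot_sc sg s u -> pot_sc sg t u -> secat (s - t) u.
Proof.
move=> [g [H1 H2]] [g' [H1' H2']].
have Hg : secat (g - g') (emb u).
  by apply/germ1_eq; rewrite -(nbhs_singleton H1) (nbhs_singleton H1').
apply: secat_local (germ_values_secat Hg).
by apply: filterS2 H2 H2' => v E E'; rewrite germ_valuesB -E -E'.
Qed.

Fact pot_add sg s t u : pot_sc sg s u -> secat t u -> pot_sc sg (s + t) u.
Proof.
move=> [g [H1 H2]] Ht; pose h : sections G := fun z => pcls z t.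
have Nt : push_num emb F (emb u) t by exact: emb_near (secat_near Ht).
have Hh : secat h (emb u) by exists t => //; exact: nearW.
exists (g + h); split.
  apply: filterS2 H1 (secat_near Hh) => z -> Hz; apply/germ1_eq.
  by rewrite opprD addrA subrr sub0r -scaleN1r -[_ *: _]addr0; apply: secatP => //; exact: secat0.
have E : \forall v \near u, germ_values h v = t v by apply: (germ_values_near Nt); exact: nearW.
apply: filterS2 H2 E => v E1 E2.
by rewrite -[g]scale1r germ_valuesP scale1r E2 -E1.
Qed.

Definition potentials sg : torsor F :=
  Torsor (@pot_near sg) (@pot_loc sg) (@pot_sub sg) (@pot_add sg).

Lemma pot_exists sg u : secat sg (emb u) -> exists s, tsc (potentials sg) s u.
Proof.
by move=> [g _ H]; exists (germ_values g), g; split=> //; exact: nearW.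
Qed.

Lemma potP a sg sg' s s' u : pot_sc sg s u -> pot_sc sg' s' u ->
  pot_sc (a *: sg + sg') (a *: s + s') u.
Proof.
move=> [g [H1 H2]] [g' [H1' H2']]; exists (a *: g + g'); split.
  apply: filterS2 H1 H1' => z E E'.
  by rewrite -[LHS]/(a *: sg z + sg' z) E E' -clsP.
apply: filterS2 H2 H2' => v E E'.
by rewrite germ_valuesP -E -E'.
Qed.

Lemma slab_num_secat sg y u : slab_num sg y -> f (emb u) = y -> secat sg (emb u).
Proof. by move=> /nbhs_singleton H; exact: H. Qed.

Lemma mk_eq0_pot sg y : slab_num sg y -> mk sg y = 0 -> exists s,
  \forall y' \near y, forall u, f (emb u) = y' -> pot_sc sg s u.
Proof.
move=> Ns /(mk_eq0P Ns)[tau E]; exists (germ_values tau).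
apply: filterS (near_join E) => y' E' u fu; exists tau; split; last exact: nearW.
rewrite -fu in E'; apply: filterS (near_continuous (@cf (emb u)) E') => z; exact.
Qed.

Lemma pot_mk_eq0 sg y s : slab_num sg y ->
  (\forall y' \near y, forall u, f (emb u) = y' -> pot_sc sg s u) -> mk sg y = 0.
Proof.
move=> Ns Hs; apply/mk_eq0P => //.
have /choice[g Hg] z : exists g, secat sg z -> \forall z' \near z, sg z' = germ1 z' g.
  have [[g _ H]|n] := pselect (secat sg z); first by exists g.
  by exists 0.
(* [h z] is a section of [F] on the preimage of a neighbourhood of [z], thus a germ of the direct
   image under [emb] even when [z] is not in the image. Correcting the local lift [g z] by it
   removes the dependence on the choice of [g z]. *)
pose h z := s - germ_values (g z); pose tau z := g z z + pcls z (h z).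
exists tau; apply: filterS2 (near_join Hs) (slab_num_near Ns) => y' Hs' Ns' z fz.
have sz : secat sg z by exact: (nbhs_singleton Ns').
rewrite (nbhs_singleton (Hg z sz)); apply/germ1_eq.
rewrite -opprB -scaleN1r -[_ *: _]addr0; apply: secatP; last exact: secat0.
have Hs1 : \forall z' \near z, forall u, emb u = z' -> pot_sc sg s u.
  rewrite -fz in Hs'; apply: filterS (near_continuous (@cf z) Hs') => z' H u E.
  by apply: H; rewrite E.
have Nh z1 : secat sg z1 -> (\forall z' \near z1, sg z' = germ1 z' (g z)) ->
    (\forall z' \near z1, forall u, emb u = z' -> pot_sc sg s u) -> push_num emb F z1 (h z).
  move=> s1 /near_join H1 H2; apply: filterS2 H1 H2 => z' H1' H2' u uz.
  apply: pot_sub; first exact: H2'.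
  by exists (g z); split; [rewrite uz | exact: nearW].
exists (h z); first exact: Nh (Hg z sz) Hs1.
have G1 := near_join (Hg z sz); have S1 := near_join Hs1.
apply: filterS2 (filterI G1 S1) (secat_near sz) => z' [G1' S1'] sz'.
have Nh' := Nh _ sz' G1' S1'.
have Nhz : push_num emb F z' (h z').
  have G2 := near_join (Hg z' sz'); apply: filterS2 G2 S1' => z2 G2' S2 u uz.
  apply: pot_sub; first exact: S2.
  by exists (g z'); split; [rewrite uz | exact: nearW].
have [k Nk Ek] : secat (g z' - g z) z'.
  by apply/germ1_eq; rewrite -(nbhs_singleton (Hg z' sz')) (nbhs_singleton G1').
rewrite -[LHS]/(g z' z' + pcls z' (h z') - g z z') addrAC.
rewrite -[g z' z' - g z z']/((g z' - g z) z') (nbhs_singleton Ek).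
rewrite -[pcls z' k]scale1r -clsP // scale1r; apply/cls_eq => //; first exact: subD.
apply: filterS2 (near_join Ek) (push_num_near Nk) => z2 E2 N2 u uz.
have : germ_values (g z' - g z) u = k u by rewrite /germ_values uz (nbhs_singleton E2) rep_pcls.
rewrite germ_valuesB => E3.
rewrite -[LHS]/(k u + (s u - germ_values (g z') u) - (s u - germ_values (g z) u)) -E3.
by rewrite [X in X - _]addrC subrKA subrr.
Qed.

(** Converse to taking potentials: [sg] records at each [z] how the local section of [T] chosen
    there differs from those chosen nearby. Modulo sections of [push emb F] this does not depend on
    the section taken at [z] ([key]). *)
Lemma torsor_slab (T : torsor F) (N : set Y) : injective emb -> open N ->
  (forall z, N (f z) -> exists s, \forall z' \near z, forall u, emb u = z' -> tsc T s u) ->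
  exists sg, (forall y, N y -> slab_num sg y) /\
    forall u s, N (f (emb u)) -> tsc T s u -> pot_sc sg s u.
Proof.
move=> emb_inj oN HT.
have /choice[s Hs] z : exists s, N (f z) ->
    (\forall z' \near z, forall u, emb u = z' -> tsc T s u) /\ (forall u, emb u = z -> s u = 0).
  have [Nz|nN] := pselect (N (f z)); last by exists 0.
  have [s0 Hs0] := HT z Nz.
  have [[u uz]|nu] := pselect (exists u, emb u = z); last first.
    by exists s0 => _; split=> // u uz; case: nu; exists u.
  (* The section chosen at [emb u] is made to vanish at [u], so that the values of the family [gs t]
     are those of [t]. *)
  have [t Tt t0] := torsor_through 0 (nbhs_singleton Hs0 u uz).
  exists t => _; split.
    by rewrite -uz; apply: emb_near; exact: tsc_near.
  by move=> u' u'z; have -> : u' = u by apply: emb_inj; rewrite u'z.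
pose gs (t : sections F) : sections G := fun z => pcls z (t - s z).
pose sg : sections C1 := fun z => germ1 z (gs (s z)).
have key t t' z : N (f z) ->
    (\forall z' \near z, forall u, emb u = z' -> tsc T t u) ->
    (\forall z' \near z, forall u, emb u = z' -> tsc T t' u) -> secat (gs t - gs t') z.
  move=> Nz Ht Ht'; exists (t - t').
    by apply: filterS2 Ht Ht' => z' H H' u uz; apply: tsc_sub; [exact: H | exact: H'].
  have oNz : \forall z' \near z, N (f z') by apply: (near_continuous (@cf z)); exact: open_nbhs_nbhs.
  apply: filterS2 oNz (filterI (near_join Ht) (near_join Ht')) => z' Nz' [H H'].
  have [H'' _] := Hs z' Nz'.
  have num t1 : (\forall z' \near z', forall u, emb u = z' -> tsc T t1 u) ->
      push_num emb F z' (t1 - s z').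
    move=> H1; apply: filterS2 H1 H'' => z2 H1 H2 u uz.
    by apply: tsc_sub; [exact: H1 | exact: H2].
  have N1 := num _ H; have N2 := num _ H'.
  rewrite -[LHS]/(gs t z' - gs t' z') /gs addrC -scaleN1r -clsP // scaleN1r.
  by congr cls; rewrite opprB addrC subrKA.
exists sg; split.
  move=> y Ny; have : \forall y' \near y, N y' by exact: open_nbhs_nbhs.
  apply: filterS => y' Ny' z fz; exists (gs (s z)) => //.
  rewrite -fz in Ny'.
  have oNz : \forall z' \near z, N (f z') by apply: (near_continuous (@cf z)); exact: open_nbhs_nbhs.
  have [H _] := Hs z Ny'.
  apply: filterS2 oNz (near_join H) => z' Nz' H'.
  by apply/germ1_eq; apply: key => //; case: (Hs z' Nz').
move=> u t Nu Tt; exists (gs t).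
have oN' : \forall z' \near emb u, N (f z').
  by apply: (near_continuous (@cf (emb u))); exact: open_nbhs_nbhs.
have Ht : \forall z \near emb u, forall v, emb v = z -> tsc T t v.
  by apply: emb_near; exact: tsc_near.
split.
  apply: filterS2 oN' (near_join Ht) => z' Nz' H'.
  by apply/germ1_eq; apply: key => //; case: (Hs z' Nz').
apply: filterS2 (near_continuous (@cemb u) oN') (near_continuous (@cemb u) (near_join Ht)).
move=> v Nv H; have [H1 H0] := Hs (emb v) Nv.
rewrite /germ_values /gs rep_pcls //; last first.
  by apply: filterS2 H H1 => z2 H2 H3 w wz; apply: tsc_sub; [exact: H2 | exact: H3].
by rewrite -[RHS]/(t v - s (emb v) v) H0 // subr0.
Qed.
End OneSheaf.

Section Naturality.
Variables (F F' : sheaf K X) (phi : shom F F').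
Notation hom1 := (gode1_hom (push_hom emb phi)).
Implicit Type sg : sections (gode1 (push emb F)).

Lemma slab_num_hom sg y : slab_num sg y -> slab_num (prod_map hom1 sg) y.
Proof. exact: push_hom_num. Qed.

Lemma R1_hom_mk sg y : slab_num sg y ->
  R1_hom f (push_hom emb phi) y (mk sg y) = mk (prod_map hom1 sg) y.
Proof.
move=> Ns; have As := psec_secat Ns.
transitivity (r1cls (prod_map (push_hom f hom1) (psec sg)) y).
  refine (@subquot_map_cls _ _ _ (secat_submod (push f (gode1 (push emb F))) y) _ _ _ _ _ _
    (psec sg) As).
apply: r1cls_near; [exact: shom_sec | exact/psec_secat/slab_num_hom |].
apply: filterS (slab_num_near Ns) => y' N'.
exact: subquot_map_cls N'.
Qed.

Lemma pot_hom sg s u : pot_sc (F := F) sg s u ->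
  pot_sc (F := F') (prod_map hom1 sg) (prod_map phi s) u.
Proof.
move=> [g [H1 H2]]; exists (prod_map (push_hom emb phi) g); split.
  by apply: filterS H1 => z E; rewrite /prod_map E /= subquot_map_cls.
apply: filterS H2 => v E; rewrite /prod_map E /germ_values /= /subquot_map rep_pcls //.
by apply: push_hom_num; exact: repA.
Qed.
End Naturality.
End HigherDirectImage.

(** * Tensor products of sheaves *)

Section FreegLinear.
Variables (K : fieldType) (T : choiceType) (M : lmodType K) (f : T -> M).

Lemma freeg_linear : exists g : {linear {freeg T / K} -> M}, forall x, g << x >> = f x.
Proof.
have addl : additive (fglift f) by exact: lift_is_additive.
pose g := HB.pack_for {additive {freeg T / K} -> M} (fglift f)
  (GRing.isAdditive.Build {freeg T / K} M (fglift f) addl).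
have gU k x : g << k *g x >> = k *: f x by exact: liftU.
have lin : linear (fglift f).
  move=> a u v; rewrite -[fglift f]/(g : _ -> _) raddfD; congr (_ + _).
  rewrite -[in RHS](freeg_sumE u) -[a *: u]/(fgscale a u) /fgscale !raddf_sum.
  by apply: eq_bigr => x _; rewrite gU -[RHS]/(a *: g _) gU scalerA.
pose h := HB.pack_for {linear {freeg T / K} -> M} (fglift f)
  (GRing.isLinear.Build K {freeg T / K} M *:%R (fglift f) lin).
by exists h => x; rewrite -[f x]scale1r -gU.
Qed.
End FreegLinear.

Section TensorProduct.
Variables (K : fieldType) (X : topologicalType) (F G : sheaf K X).
Notation gen x := (span_submod (@tensor_gen K X F G x)).
Notation rel x := (span_submod (@tensor_rel K X F G x)).

Definition tns_sec (s : sections F) (t : sections G) (x : X) : tensor F G x :=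
  cls (gen x) (rel x) << (s, t) >>.

Lemma tns_sec_gen s t x : secat (s : sections F) x -> secat (t : sections G) x ->
  gen x << (s, t) >>.
Proof. by move=> Hs Ht; apply: span_gen; exists s, t. Qed.

Lemma tns_sec_eq s s' t t' x : secat (s : sections F) x -> secat s' x ->
  secat (t : sections G) x -> secat t' x -> s x = s' x -> t x = t' x ->
  tns_sec s t x = tns_sec s' t' x.
Proof.
move=> Hs Hs' Ht Ht' Es Et; apply/cls_eq; try exact: tns_sec_gen.
apply/span_gen/tensor_rel_germ => //.
  have : (s - s') x = 0 by rewrite -[LHS]/(s x - s' x) Es subrr.
  by move=> /(secat_sep (secatB Hs Hs')); apply: filterS => y /subr0_eq.
have : (t - t') x = 0 by rewrite -[LHS]/(t x - t' x) Et subrr.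
by move=> /(secat_sep (secatB Ht Ht')); apply: filterS => y /subr0_eq.
Qed.

Definition germ_at (H : sheaf K X) x (v : H x) : sections H := projT1 (cid2 (secat_germ v)).

Lemma germ_at_secat (H : sheaf K X) x (v : H x) : secat (germ_at v) x.
Proof. by rewrite /germ_at; case: cid2. Qed.

Lemma germ_atE (H : sheaf K X) x (v : H x) : germ_at v x = v.
Proof. by rewrite /germ_at; case: cid2. Qed.

Definition tns x (v : F x) (l : G x) : tensor F G x := tns_sec (germ_at v) (germ_at l) x.

Lemma tnsE s t x : secat (s : sections F) x -> secat (t : sections G) x ->
  tns (s x) (t x) = tns_sec s t x.
Proof. by move=> Hs Ht; apply: tns_sec_eq; rewrite ?germ_atE //; exact: germ_at_secat. Qed.

Lemma tns_secat s t x : secat (s : sections F) x -> secat (t : sections G) x ->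
  secat (fun y => tns (s y) (t y) : tensor F G y) x.
Proof.
move=> Hs Ht; exists << (s, t) >>; first exact: tns_sec_gen.
by apply: filterS2 (secat_near Hs) (secat_near Ht) => y Hs' Ht'; rewrite tnsE.
Qed.

Lemma tnsPl x a (v v' : F x) (l : G x) : tns (a *: v + v') l = a *: tns v l + tns v' l.
Proof.
have [Hv Hv'] := (germ_at_secat v, germ_at_secat v'); have Hl := germ_at_secat l.
have -> : tns (a *: v + v') l = tns_sec (a *: germ_at v + germ_at v') (germ_at l) x.
  have E : (a *: germ_at v + germ_at v' : sections F) x = a *: v + v'.
    by rewrite -[in RHS](germ_atE v) -[in RHS](germ_atE v').
  by rewrite -tnsE ?E ?germ_atE //; exact: secatP.
rewrite /tns /tns_sec -clsP; try exact: tns_sec_gen.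
apply/cls_eq; first by apply: tns_sec_gen => //; exact: secatP.
  by apply: subP; exact: tns_sec_gen.
by apply/span_gen/tensor_rel_l.
Qed.

Lemma tnsPr x a (v : F x) (l l' : G x) : tns v (a *: l + l') = a *: tns v l + tns v l'.
Proof.
have [Hl Hl'] := (germ_at_secat l, germ_at_secat l'); have Hv := germ_at_secat v.
have -> : tns v (a *: l + l') = tns_sec (germ_at v) (a *: germ_at l + germ_at l') x.
  have E : (a *: germ_at l + germ_at l' : sections G) x = a *: l + l'.
    by rewrite -[in RHS](germ_atE l) -[in RHS](germ_atE l').
  by rewrite -tnsE ?E ?germ_atE //; exact: secatP.
rewrite /tns /tns_sec -clsP; try exact: tns_sec_gen.
apply/cls_eq; first by apply: tns_sec_gen => //; exact: secatP.
  by apply: subP; exact: tns_sec_gen.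
by apply/span_gen/tensor_rel_r.
Qed.

Lemma tns0l x (l : G x) : tns (0 : F x) l = 0.
Proof.
have := tnsPl (-1) (0 : F x) 0 l; rewrite scaler0 addr0 scaleN1r addNr => E.
exact: E.
Qed.

Lemma tnsZl x a (v : F x) (l : G x) : tns (a *: v) l = a *: tns v l.
Proof. by have := tnsPl a v 0 l; rewrite !addr0 tns0l addr0. Qed.

Lemma tnsBl x (v v' : F x) (l : G x) : tns (v - v') l = tns v l - tns v' l.
Proof. by rewrite addrC -scaleN1r tnsPl scaleN1r addrC. Qed.

Lemma tns0r x (v : F x) : tns v (0 : G x) = 0.
Proof.
have := tnsPr (-1) v (0 : G x) 0; rewrite scaler0 addr0 scaleN1r addNr => E.
exact: E.
Qed.

Lemma tnsZr x a (v : F x) (l : G x) : tns v (a *: l) = a *: tns v l.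
Proof. by have := tnsPr a v l 0; rewrite !addr0 tns0r addr0. Qed.

Definition stalk_line x (l : G x) := l != 0 /\ forall l', exists a, l' = a *: l.

Lemma tns_surj x (l : G x) (c : tensor F G x) : stalk_line l -> exists v, c = tns v l.
Proof.
move=> [_ Gl]; suff H u : gen x u -> exists v, cls (gen x) (rel x) u = tns v l.
  by have [v Ev] := H _ (repA c); exists v; rewrite -Ev repK.
elim=> [|a u' w [s [t [Hs Ht ->]]] Hw [v Ev]].
  by exists 0; rewrite tns0l; apply/cls0; [exact: sub0 | exact: sub0].
have [b tb] := Gl (t x); rewrite clsP //; last exact: tns_sec_gen.
rewrite Ev -[cls _ _ _]/(tns_sec s t x) -tnsE // tb tnsZr -tnsZl -tnsPl.
by exists (a *: (b *: s x) + v).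
Qed.

(** The linear map that sends a pair [(s, t)] to [c (t x) *: s x], with [c] the coordinate along
    [l], kills the relations. It sends [tns v l] to [c l *: v], and [c l] is nonzero because
    [l = c l *: l]. *)
Lemma tns_inj0 x (l : G x) (v : F x) : stalk_line l -> tns v l = 0 -> v = 0.
Proof.
move=> [l0 Gl]; have /choice[c Ec] := Gl.
have [g gE] := freeg_linear (fun st : sections F * sections G => c (st.2 x) *: st.1 x).
have cP a l1 l2 : c (a *: l1 + l2) = a * c l1 + c l2.
  apply/eqP; rewrite -subr_eq0; have /orP[//|/eqP E] : (c (a *: l1 + l2) - (a * c l1 + c l2) == 0) || (l == 0).
    by rewrite -scaler_eq0 scalerBl scalerDl -scalerA -!Ec subrr.
  by rewrite E eqxx in l0.
have g0 u : rel x u -> g u = 0.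
  elim=> [|a u' w Hu _ IH]; first by rewrite linear0.
  rewrite linearP IH addr0; case: Hu => [b s s' t _ _ _|b s t t' _ _ _|s s' t t' _ _ _ _ ss tt].
  - rewrite linearB linearP !gE /=.
    change (a *: (c (t x) *: (b *: s x + s' x) - (b *: (c (t x) *: s x) + c (t x) *: s' x)) = 0).
    by rewrite [X in _ *: X](_ : _ = 0) ?scaler0 // scalerDr !scalerA [b * _]mulrC subrr.
  - rewrite linearB linearP !gE /=.
    change (a *: (c (b *: t x + t' x) *: s x - (b *: (c (t x) *: s x) + c (t' x) *: s x)) = 0).
    by rewrite [X in _ *: X](_ : _ = 0) ?scaler0 // cP scalerDl scalerA subrr.
  by rewrite linearB !gE /= (nbhs_singleton ss) (nbhs_singleton tt) subrr scaler0.
move=> /cls0 H; have /g0 := H (tns_sec_gen (germ_at_secat v) (germ_at_secat l)).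
rewrite gE /= !germ_atE => /eqP; rewrite scaler_eq0 => /orP[/eqP cl|/eqP//].
by move/eqP: l0; rewrite (Ec l) cl scale0r.
Qed.

Lemma tns_inj x (l : G x) (v v' : F x) : stalk_line l -> tns v l = tns v' l -> v = v'.
Proof.
by move=> Gl E; apply/subr0_eq/(tns_inj0 Gl); rewrite tnsBl E subrr.
Qed.

Lemma rank_one_line x : trivial_near G 1 x -> exists e : sections G,
  \forall y \near x, secat e y /\ stalk_line (e y).
Proof.
move=> [e He]; exists (e ord0); apply: filterS He => y [ey uy]; split=> //; split.
  apply/eqP => e0; have [c [_ uc]] := uy 0.
  have E d : c = d by apply: uc; rewrite big_ord1 e0 scaler0.
  have := congr1 (fun d : 'I_1 -> K => d ord0) (etrans (esym (E (fun=> 0))) (E (fun=> 1))).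
  by move=> /eqP; rewrite eq_sym oner_eq0.
by move=> l; have [c [-> _]] := uy l; exists (c ord0); rewrite big_ord1.
Qed.

Lemma rank_one_stalk x : rank_one_local_system G -> exists l : G x, stalk_line l.
Proof. by move=> /(_ x)/rank_one_line[e /nbhs_singleton[_ ?]]; exists (e x). Qed.

Lemma tensor_local_system : local_system F -> rank_one_local_system G ->
  local_system (tensor F G).
Proof.
move=> lF lG x; have [n [e He]] := lF x; have [t Ht] := rank_one_line (lG x).
exists n, (fun i y => tns (e i y) (t y)).
apply: filterS2 He Ht => y [ey uy] [ty ly]; split; first by move=> i; exact: tns_secat.
move=> w; have [v ->] := tns_surj w ly; have [c [Ec uc]] := uy v.
have sumE (d : 'I_n -> K) : \sum_i d i *: tns (e i y) (t y) = tns (\sum_i d i *: e i y) (t y).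
  elim/big_rec2: _ => [|i u u' _ ->]; first by rewrite tns0l.
  by rewrite tnsPl.
exists c; split; first by rewrite sumE -Ec.
by move=> d; rewrite sumE => /(tns_inj ly) E; apply: uc.
Qed.

Lemma tns_flat (E : topologicalType) (Q : set E) (q : E -> X) s t :
  flat (S := sheaf_et F) Q q s -> flat (S := sheaf_et G) Q q t ->
  flat (S := sheaf_et (tensor F G)) Q q (fun e => existT (fun x => tensor F G x : Type) (q e)
    (tns (tot_at (s e) (q e) : F (q e)) (tot_at (t e) (q e) : G (q e)))).
Proof.
move=> fs ft e Qe; have [sg sg1 sg2] := fs e Qe; have [th th1 th2] := ft e Qe.
exists (fun x => tns (sg x) (th x)); first exact: tns_secat.
by apply: filterS2 sg2 th2 => e' -> ->; rewrite !tot_atE.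
Qed.

Lemma tr_tns (R : realType) (g : R -> X) x y (v : F x) (v' : F y) (l : G x) (l' : G y) :
  tr (S := sheaf_et F) g (existT (fun x => F x : Type) x v) (existT (fun x => F x : Type) y v') ->
  tr (S := sheaf_et G) g (existT (fun x => G x : Type) x l) (existT (fun x => G x : Type) y l') ->
  tr (S := sheaf_et (tensor F G)) g (existT (fun x => tensor F G x : Type) x (tns v l))
    (existT (fun x => tensor F G x : Type) y (tns v' l')).
Proof.
move=> trF; have [/= gx gy] := tr_base trF; case: trF => s [fs s0 s1] [t [ft t0 t1]].
eexists; split; first exact: tns_flat fs ft.
  by rewrite /= clamp_le0 // -gx s0 t0 !tot_atE.
by rewrite /= clamp_ge1 // -gy s1 t1 !tot_atE.
Qed.
End TensorProduct.

Section TensorFunctor.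
Variables (K : fieldType) (X : topologicalType) (F F' G G' : sheaf K X).
Variables (phi : shom F F') (psi : shom G G').

Lemma tensor_hom_tns x (v : F x) (l : G x) :
  tensor_hom phi psi x (tns v l) = tns (phi x v) (psi x l).
Proof.
have [Hv Hl] := (germ_at_secat v, germ_at_secat l).
have -> : tns (phi x v) (psi x l) = tns_sec (prod_map phi (germ_at v)) (prod_map psi (germ_at l)) x.
  rewrite -tnsE; try exact: shom_sec.
  by rewrite /prod_map !germ_atE.
rewrite /tns /tns_sec -tensor_liftE.
exact: (@subquot_map_cls _ _ _ (span_submod (@tensor_gen _ _ F G x)) _ _ _ _ _ _ _ (tns_sec_gen Hv Hl)).
Qed.
End TensorFunctor.

Section PullLocalSystem.
Variables (K : fieldType) (X Y : topologicalType) (f : Y -> X) (cf : continuous f).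
Variable F : sheaf K X.

Lemma pull_trivial_near n y : trivial_near F n (f y) -> trivial_near (pull cf F) n y.
Proof.
move=> [e He]; exists (fun i y => e i (f y)).
apply: filterS (near_continuous (@cf y) He) => z [ez uz]; split=> // i.
by exists (e i) => //; exact: nearW.
Qed.

Lemma pull_local_system : local_system F -> local_system (pull cf F).
Proof. by move=> lF y; have [n t] := lF (f y); exists n; exact: pull_trivial_near. Qed.

Lemma pull_rank_one : rank_one_local_system F -> rank_one_local_system (pull cf F).
Proof. by move=> lF y; exact/pull_trivial_near/lF. Qed.
End PullLocalSystem.

(** * The slices of the second projection *)

Section ComplexTopology.
Variable R : realType.
Local Notation C := ((R[i])^o).
Implicit Types z w : C.

(** The modulus as a real number; the norm itself has its values in [R[i]]. *)
Definition nC (z : C) : R := Normc.normc z.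

Lemma nCE z : `|z| = (nC z)%:C%C :> R[i].
Proof. by case: z. Qed.

Lemma nC_ge0 z : 0 <= nC z.
Proof. by case: z => a b; exact: sqrtr_ge0. Qed.

Lemma nC0 : nC 0 = 0.
Proof. exact: Normc.normc0. Qed.

Lemma nC_eq0 z : (nC z == 0) = (z == 0).
Proof. by apply/eqP/eqP => [/Normc.eq0_normc|->]; last exact: nC0. Qed.

Lemma nC_gt0 z : (0 < nC z) = (z != 0).
Proof. by rewrite lt_neqAle eq_sym nC_eq0 nC_ge0 andbT. Qed.

Lemma nCM z w : nC (z * w) = nC z * nC w.
Proof. exact: Normc.normcM. Qed.

Lemma nCV z : nC z^-1 = (nC z)^-1.
Proof. exact: Normc.normcV. Qed.

Lemma nCD z w : nC (z + w) <= nC z + nC w.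
Proof. exact: le_normcD. Qed.

Lemma nCN z : nC (- z) = nC z.
Proof. exact: normcN. Qed.

Lemma nCB z w : nC (z - w) = nC (w - z).
Proof. by rewrite -nCN opprB. Qed.

Lemma nC_dist z w : `|nC z - nC w| <= nC (z - w).
Proof.
rewrite ler_norml; have := nCD (z - w) w; have := nCD (w - z) z.
by rewrite !subrK (nCB w); lra.
Qed.

Lemma nC_real (t : R) : nC t%:C%C = `|t|.
Proof. by rewrite /nC /= expr0n addr0 sqrtr_sqr. Qed.

Lemma Re_le_nC z : `|complex.Re z| <= nC z.
Proof.
case: z => a b /=; rewrite -sqrtr_sqr ler_wsqrtr // lerDl; exact: sqr_ge0.
Qed.

Lemma Im_le_nC z : `|complex.Im z| <= nC z.
Proof.
case: z => a b /=; rewrite -sqrtr_sqr ler_wsqrtr // lerDr; exact: sqr_ge0.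
Qed.

Lemma nC_le z : nC z <= `|complex.Re z| + `|complex.Im z|.
Proof.
case: z => a b /=; rewrite -[leRHS]ger0_norm ?addr_ge0 // -sqrtr_sqr ler_wsqrtr //.
rewrite sqrrD !real_normK ?num_real // lerD2r lerDl.
by rewrite mulrn_wge0 // mulr_ge0.
Qed.

Lemma nbhs_nC z (P : C -> Prop) : nbhs z P <->
  exists2 e : R, 0 < e & forall w, nC (w - z) < e -> P w.
Proof.
split=> [/nbhs_ballP[e /= e0 H]|[e e0 H]].
  have eR : e = (complex.Re e)%:C%C by rewrite RRe_real // ger0_real // ltW.
  exists (complex.Re e); first by rewrite eR ltcR in e0.
  move=> w we; apply: H; rewrite /ball /= nCE nCB.
  by rewrite eR ltcR.
apply/nbhs_ballP; exists e%:C%C; first by rewrite /= ltcR.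
by move=> w; rewrite /ball /= nCE ltcR nCB; exact: H.
Qed.

Lemma near_nC z (e : R) : 0 < e -> \forall w \near z, nC (w - z) < e.
Proof. by move=> e0; apply/nbhs_nC; exists e. Qed.

Section Continuity.
Variables (E : topologicalType) (e : E).

Lemma for_continuous_complex (f g : E -> R) : {for e, continuous f} -> {for e, continuous g} ->
  {for e, continuous (fun e => Complex (f e) (g e) : C)}.
Proof.
move=> cf cg P /nbhs_nC[d d0 H].
change (\forall e' \near e, P (Complex (f e') (g e'))).
have d2 : 0 < d / 2 by lra.
have Hf := near_continuous cf (nbhsx_ballx (f e) _ d2).
have Hg := near_continuous cg (nbhsx_ballx (g e) _ d2).
apply: filterS2 Hf Hg => e' /= h1 h2; apply: H.
apply: le_lt_trans (nC_le _) _; rewrite /= distrC [X in _ + X]distrC.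
by rewrite /ball /= in h1 h2; lra.
Qed.

Lemma for_continuous_nC (f : E -> C) : {for e, continuous f} ->
  {for e, continuous (fun e => nC (f e))}.
Proof.
move=> cf P /nbhs_ballP[d /= d0 H].
change (\forall e' \near e, P (nC (f e'))).
apply: filterS (near_continuous cf (near_nC (f e) d0)) => e' h; apply: H.
by rewrite /ball /= distrC (le_lt_trans (nC_dist _ _)).
Qed.

Lemma for_continuous_CD (f g : E -> C) : {for e, continuous f} -> {for e, continuous g} ->
  {for e, continuous (fun e => f e + g e)}.
Proof. by move=> cf cg; exact: (@continuousD R[i] C E f g e cf cg). Qed.

Lemma for_continuous_CB (f g : E -> C) : {for e, continuous f} -> {for e, continuous g} ->
  {for e, continuous (fun e => f e - g e)}.
Proof. by move=> cf cg; exact: (@continuousB R[i] C E f g e cf cg). Qed.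

Lemma for_continuous_CM (f g : E -> C) : {for e, continuous f} -> {for e, continuous g} ->
  {for e, continuous (fun e => f e * g e)}.
Proof. by move=> cf cg; exact: (@continuousM R[i] E f g e cf cg). Qed.

Lemma for_continuous_CV (f : E -> C) : {for e, continuous f} -> f e != 0 ->
  {for e, continuous (fun e => (f e)^-1)}.
Proof. by move=> cf f0; exact: (@continuousV R[i] E f e f0 cf). Qed.

Lemma for_continuous_RD (f g : E -> R) : {for e, continuous f} -> {for e, continuous g} ->
  {for e, continuous (fun e => f e + g e)}.
Proof. by move=> cf cg; exact: (@continuousD R R^o E f g e cf cg). Qed.

Lemma for_continuous_RB (f g : E -> R) : {for e, continuous f} -> {for e, continuous g} ->
  {for e, continuous (fun e => f e - g e)}.
Proof. by move=> cf cg; exact: (@continuousB R R^o E f g e cf cg). Qed.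

Lemma for_continuous_RM (f g : E -> R) : {for e, continuous f} -> {for e, continuous g} ->
  {for e, continuous (fun e => f e * g e)}.
Proof. by move=> cf cg; exact: (@continuousM R E f g e cf cg). Qed.

Lemma for_continuous_RC (f : E -> R) : {for e, continuous f} ->
  {for e, continuous (fun e => (f e)%:C%C : C)}.
Proof. by move=> cf; apply: for_continuous_complex => //; exact: for_continuous_cst. Qed.

Lemma for_continuous_clamp (f : E -> R) : {for e, continuous f} ->
  {for e, continuous (fun e => clamp (f e))}.
Proof. by move=> cf; apply: (for_continuous_comp cf); exact: clamp_continuous. Qed.

Lemma for_continuous_expi (f : E -> R) : {for e, continuous f} ->
  {for e, continuous (fun e => expi (f e))}.
Proof.
move=> cf; apply: for_continuous_complex.
  apply: (@for_continuous_comp _ _ _ (fun e => 2 * pi * f e) (@cos R)); last exact: continuous_cos.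
  by apply: for_continuous_RM => //; exact: for_continuous_cst.
apply: (@for_continuous_comp _ _ _ (fun e => 2 * pi * f e) (@sin R)); last exact: continuous_sin.
by apply: for_continuous_RM => //; exact: for_continuous_cst.
Qed.
End Continuity.

Lemma disc_compact (r : R) : compact [set z : C | nC z <= r].
Proof.
pose sq : set (R * R) := `[- r, r] `*` `[- r, r].
have csq : compact sq by apply: compact_setX; exact: segment_compact.
pose f (u : R * R) : C := Complex u.1 u.2.
have cim : compact (f @` sq).
  apply: continuous_compact csq; apply: continuous_subspaceT => u.
  by apply: for_continuous_complex; [exact: for_continuous_fst | exact: for_continuous_snd].
apply: (subclosed_compact _ cim).
  have -> : [set z : C | nC z <= r] = nC @^-1` [set t | t <= r] by [].
  apply: preimage_closed; last exact: closed_le.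
  by move=> z _; apply: for_continuous_nC; exact: for_continuous_id.
move=> z /= zr; exists (complex.Re z, complex.Im z); last by case: z zr.
split; rewrite /= in_itv /= -ler_norml.
  exact: le_trans (Re_le_nC z) zr.
exact: le_trans (Im_le_nC z) zr.
Qed.

Lemma nC_bounded_compact (A : set C) : compact A -> exists r : R, forall z, A z -> nC z <= r.
Proof.
move=> cA; have cB : compact (nC @` A).
  apply: continuous_compact cA; apply: continuous_subspaceT => z.
  by apply: for_continuous_nC; exact: for_continuous_id.
have [r [_ H]] := compact_bounded cB; exists (r + 1) => z Az.
have r1 : r < r + 1 by rewrite ltrDl.
have := H (r + 1) r1 (nC z) (ex_intro2 _ _ z Az erefl).
by rewrite /= ger0_norm ?nC_ge0.
Qed.
End ComplexTopology.

Section Subspace.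
Variables (T : topologicalType) (A : set T).

Lemma nbhs_subP (a : A) (P : A -> Prop) :
  (\forall b \near a, P b) <-> \forall w \near \val a, forall b : A, \val b = w -> P b.
Proof.
split=> [|H].
  case=> V [[W oW WV] Va VP].
  have : nbhs (\val a) W by apply: open_nbhs_nbhs; split=> //; move: Va; rewrite -WV.
  apply: filterS => w Ww b bw; apply: VP; rewrite -WV.
  by change (W (\val b)); rewrite bw.
apply: filterS (near_continuous (@val_continuous T A a) H) => b /(_ b erefl); exact.
Qed.

Lemma for_continuous_val (E : topologicalType) (f : E -> A) e :
  {for e, continuous f} <-> {for e, continuous (fun e => \val (f e))}.
Proof.
split=> cf; first by apply: (for_continuous_comp cf); exact: val_continuous.
move=> P HP; change (\forall e' \near e, P (f e')).
have HP' : \forall w \near \val (f e), forall b : A, \val b = w -> P b by apply/nbhs_subP.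
apply: filterS (near_continuous cf HP') => e' /(_ _ erefl); exact.
Qed.
End Subspace.

Lemma nC_neq (R : realType) (z w : (R[i])^o) : (z != w) = (0 < nC (z - w)).
Proof. by rewrite nC_gt0 subr_eq0. Qed.

Section Geometry.
Variables (R : realType) (p : nat) (x : 'I_p -> (R[i])^o).
Local Notation C := ((R[i])^o).

Lemma sep_dist (z : C) : (forall i, z != x i) ->
  exists2 d : R, 0 < d & forall i, d <= nC (z - x i).
Proof.
move=> zx; suff H (s : seq 'I_p) : exists2 d : R, 0 < d & forall i, i \in s -> d <= nC (z - x i).
  by have [d d0 Hd] := H (enum 'I_p); exists d => // i; apply: Hd; rewrite mem_enum.
elim: s => [|i s [d d0 Hd]]; first by exists 1.
have i0 : 0 < nC (z - x i) by rewrite -nC_neq.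
exists (Num.min d (nC (z - x i))); first by rewrite lt_min d0.
by move=> j; rewrite inE => /orP[/eqP ->|/Hd h]; rewrite ge_min ?lexx ?orbT ?h.
Qed.

Lemma U_near (w : C * C) : U x w -> \forall w' \near w, U x w'.
Proof.
case: w => a b [/= h1 h2 h3]; have [d1 d10 D1] := sep_dist h1; have [d2 d20 D2] := sep_dist h2.
have d3 : 0 < nC (b - a) / 2 by rewrite divr_gt0 // -nC_neq.
have H1 := near_nC a d10; have H2 := near_nC b d20.
have H3 := near_nC a d3; have H4 := near_nC b d3.
have H13 : \forall a' \near a, nC (a' - a) < d1 /\ nC (a' - a) < nC (b - a) / 2 by exact: filterI.
have H24 : \forall b' \near b, nC (b' - b) < d2 /\ nC (b' - b) < nC (b - a) / 2 by exact: filterI.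
apply: filterS2 (near_fst b H13) (near_snd a H24) => -[a' b'] [n1 n3] [n2 n4]; split=> /=.
- move=> i; apply/eqP => E; have := D1 i; rewrite -E nCB leNgt => /negP; exact.
- move=> i; apply/eqP => E; have := D2 i; rewrite -E nCB leNgt => /negP; exact.
apply/eqP => E; have := nCD (b - b') (a' - a); rewrite /= in E; rewrite -E subrKA (nCB b b').
by apply/negP; rewrite -ltNge; rewrite /= -E in n3 n4 *; lra.
Qed.

Lemma pr2_continuous : continuous (@pr2 R p x).
Proof.
move=> u; apply/for_continuous_val.
apply: (@for_continuous_comp _ _ _ (fun u : U x => \val u) snd); first exact: val_continuous.
exact: for_continuous_snd.
Qed.

Lemma emb_continuous : continuous (@emb R p x).
Proof.
move=> u; apply: (@for_continuous_pair _ _ _ (fun u : U x => Some (\val u).1 : P1 R) (@pr2 R p x)).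
  apply: (@for_continuous_comp _ _ _ (fun u : U x => (\val u).1) (Some : C -> P1 R)).
    apply: (@for_continuous_comp _ _ _ (fun u : U x => \val u) fst); first exact: val_continuous.
    exact: for_continuous_fst.
  exact: one_point_compactification_some_continuous.
exact: pr2_continuous.
Qed.

Lemma pr2bar_continuous : continuous (@pr2bar R p x).
Proof. by move=> u; exact: for_continuous_snd. Qed.

Lemma emb_inj : injective (@emb R p x).
Proof.
move=> u v [E1 E2]; apply: val_inj.
have E3 : (\val u).2 = (\val v).2 by [].
by rewrite (surjective_pairing (\val u)) E1 E3 -surjective_pairing.
Qed.

Lemma emb_near (u : U x) (P : U x -> Prop) : (\forall v \near u, P v) ->
  \forall z \near emb u, forall v, emb v = z -> P v.
Proof.
move=> /nbhs_subP H.
have H' : \forall w \near ((\val u).1, (\val u).2), forall b : U x, \val b = w -> P b.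
  by rewrite -surjective_pairing.
have [A Aa [B Bb AB]] := near_prodP H'.
have HA : \forall o \near (Some (\val u).1 : P1 R), exists2 a, A a & o = Some a.
  by apply: filterS Aa => a Aa; exists a.
have HB : \forall y \near pr2 u, B (\val y).
  by apply/nbhs_subP; apply: filterS Bb => b Bb y ->.
apply: filterS2 (near_fst (pr2 u) HA) (near_snd (Some (\val u).1 : P1 R) HB).
move=> z /= [a Aa' za] Bz v vz; apply: (AB a (\val z.2)) => //; rewrite -vz.
have -> : a = (\val v).1 by case: (etrans (congr1 fst vz) za).
exact: surjective_pairing.
Qed.

Lemma P1_near_some (z : C) (P : P1 R -> Prop) :
  (\forall w \near z, P (Some w)) <-> \forall o \near (Some z : P1 R), P o.
Proof. by []. Qed.

(** Neighbourhoods of infinity are given by complements of closed compact sets; compact sets are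
    bounded and closed discs are compact. *)
Lemma P1_near_infty (P : P1 R -> Prop) : (\forall o \near (None : P1 R), P o) <->
  P None /\ exists r : R, forall z : C, r < nC z -> P (Some z).
Proof.
split=> [[B [cB _] BP]|[PN [r Hr]]].
  split; first by apply: BP; right.
  have [r Hr] := nC_bounded_compact cB; exists r => z zr; apply: BP; left; exists z => // Bz.
  by have := Hr z Bz; rewrite leNgt zr.
exists [set z : C | nC z <= r].
  by split; [exact: disc_compact | exact: compact_closed (@disc_compact R r)].
by move=> _ [[z /= nz <-]|->//]; apply: Hr; rewrite ltNge; apply/negP.
Qed.

Variable u0 : U x.

Definition mkU (w : C * C) : U x := insubd u0 w.

Lemma mkUE (w : C * C) : U x w -> \val (mkU w) = w.
Proof. by move=> Uw; rewrite val_insubd; case: ifP => // /negP[]; exact: mem_set. Qed.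

Lemma mkU_val (u : U x) : mkU (\val u) = u.
Proof. by apply: val_inj; rewrite mkUE //; exact: setP_val. Qed.

Lemma for_continuous_mkU (E : topologicalType) (f : E -> C * C) e :
  {for e, continuous f} -> U x (f e) -> {for e, continuous (fun e => mkU (f e))}.
Proof.
move=> cf Ue; apply/for_continuous_val => P HP.
change (\forall e' \near e, P (\val (mkU (f e')))).
rewrite mkUE // in HP.
apply: filterS2 (near_continuous cf HP) (near_continuous cf (U_near Ue)) => e' H U'.
by rewrite mkUE.
Qed.

(** * The retraction of a slab onto a slice *)

Variables (y1 : C) (r : R) (r0 : 0 < r) (yr : forall i, 4 * r <= nC (y1 - x i)).

(** The radius [r / 2] keeps two such points less than [r] apart. As the [x i] are at distance at
    least [4 * r] from [y1], a distance [3 * r] remains: one [r] for a point [z] close to [y], one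
    for its displacement, one to spare. *)
Definition nearby (y : C) := nC (y - y1) < r / 2.

Lemma nearby_dist y y' : nearby y -> nearby y' -> nC (y' - y) < r.
Proof.
by rewrite /nearby => h h'; have := nCD (y' - y1) (y1 - y); rewrite subrKA (nCB y1 y); lra.
Qed.

Lemma nearby_sep y i : nearby y -> 3 * r <= nC (y - x i).
Proof.
by rewrite /nearby => h; have := nCD (y1 - y) (y - x i); rewrite subrKA (nCB y1 y);
  have := yr i; have := r0; lra.
Qed.

Definition slab : set (U x) := [set u | nearby (\val u).2].

Lemma slab_nbhs u : slab u -> nbhs u slab.
Proof.
move=> Su; have : nearby (\val u).2 by [].
rewrite /nearby => h; have c : {for u, continuous (fun u : U x => nC ((\val u).2 - y1))}.
  apply: for_continuous_nC; apply: for_continuous_CB; last exact: for_continuous_cst.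
  apply: (@for_continuous_comp _ _ _ (fun u : U x => \val u) snd); first exact: val_continuous.
  exact: for_continuous_snd.
by have := near_continuous c (lt_nbhsl h).
Qed.

Variables (y' : U1 x) (Ny' : nearby (\val y')).

Definition bump (z y : C) : R := clamp (1 - nC (z - y) / r).

(** moves [(z, y)] towards the slice at [y'], the points at distance at least
    [r] from [y] keeping their first coordinate *)
Definition push_coord (t : R) (w : C * C) : C * C :=
  (w.1 + (t * bump w.1 w.2)%:C%C * (\val y' - w.2), w.2 + t%:C%C * (\val y' - w.2)).

(** Relative to [z], the point [y] moves by [t * (1 - bump z y)] times [y' - y]. Within distance [r]
    of the diagonal this is at most [|z - y| / r * |y' - y|], further away at most [|y' - y|]. As
    [|y' - y| < r], both are less than [|z - y|], so the points never collide. *)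
Lemma push_coord_U t w : 0 <= t <= 1 -> nearby w.2 -> U x w -> U x (push_coord t w).
Proof.
case: w => z y /= /andP[t0 t1] Ny [/= h1 h2 h3].
have Ne := nearby_dist Ny Ny'; set e := \val y' - y in Ne *.
have e0 := nC_ge0 e.
have /andP[b0 b1] := clamp_itv (1 - nC (z - y) / r); rewrite -/(bump z y) in b0 b1.
have tb : 0 <= t * bump z y <= 1 by rewrite mulr_ge0 //= mulr_ile1.
have ntb (s : R) : 0 <= s <= 1 -> nC (s%:C%C * e) <= nC e.
  move=> /andP[s0 s1]; rewrite nCM nC_real ger0_norm //.
  by rewrite -[leRHS]mul1r ler_wpM2r.
split=> /=.
- move=> i; have [far|cl] := leP r (nC (z - y)).
    have -> : bump z y = 0 by rewrite /bump clamp_le0 // subr_le0 ler_pdivlMr // mul1r.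
    by rewrite mulr0 mul0r addr0.
  rewrite nC_neq; have := nearby_sep i Ny; have := ntb _ tb.
  set q := _%:C%C * e; have := nCD (z + q - x i) (- q); rewrite nCN addrAC addrK.
  by have := nCD (y - z) (z - x i); rewrite subrKA (nCB y z); lra.
- move=> i; rewrite nC_neq; have := nearby_sep i Ny.
  have := ntb t; rewrite t0 t1 => /(_ isT); set q := _%:C%C * e.
  by have := nCD (y + q - x i) (- q); rewrite nCN addrAC addrK; lra.
rewrite nC_neq; set s := t * (1 - bump z y).
have -> : y + t%:C%C * e - (z + (t * bump z y)%:C%C * e) = (y - z) + s%:C%C * e.
  rewrite opprD addrACA -mulrBl -rmorphB /s; congr (_ + _ * _).
  by rewrite mulrBr mulr1.
have yz0 : 0 < nC (z - y) by rewrite -nC_neq eq_sym.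
suff H : nC (s%:C%C * e) < nC (z - y).
  by have := nCD (y - z + s%:C%C * e) (- (s%:C%C * e)); rewrite nCN addrK (nCB y z); lra.
have s0 : 0 <= s by rewrite mulr_ge0 // subr_ge0.
rewrite nCM nC_real ger0_norm //.
have [far|cl] := leP r (nC (z - y)).
  apply: le_lt_trans (lt_le_trans Ne far); rewrite -[leRHS]mul1r ler_wpM2r //.
  by rewrite mulr_ile1 // ?subr_ge0 // gerBl.
have bE : 1 - bump z y = nC (z - y) / r.
  rewrite /bump clamp_id; first by rewrite opprB addrC subrK.
  by rewrite subr_ge0 gerBl ler_pdivrMr // mul1r (ltW cl) divr_ge0 ?nC_ge0 ?ltW.
apply: le_lt_trans (_ : nC (z - y) / r * nC e < _).
  rewrite ler_wpM2r // /s bE -[leRHS]mul1r ler_wpM2r // divr_ge0 ?nC_ge0 //; exact: ltW.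
by rewrite mulrAC ltr_pdivrMr // ltr_pM2l.
Qed.

Lemma push_coord_continuous (e : R * (C * C)) :
  {for e, continuous (fun e : R * (C * C) => push_coord e.1 e.2)}.
Proof.
have c1 := @for_continuous_fst R (C * C)%type e.
have c2 := @for_continuous_snd R (C * C)%type e.
have c21 := for_continuous_comp c2 (@for_continuous_fst C C e.2).
have c22 := for_continuous_comp c2 (@for_continuous_snd C C e.2).
have cd := for_continuous_CB (@for_continuous_cst _ _ (\val y') e) c22.
have cn := for_continuous_nC (for_continuous_CB c21 c22).
have cb := for_continuous_clamp (for_continuous_RB (@for_continuous_cst _ _ (1 : R) e)
  (for_continuous_RM cn (@for_continuous_cst _ _ r^-1 e))).
apply: for_continuous_pair.
  exact: (for_continuous_CD c21 (for_continuous_CM (for_continuous_RC (for_continuous_RM c1 cb)) cd)).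
exact: (for_continuous_CD c22 (for_continuous_CM (for_continuous_RC c1) cd)).
Qed.

(** Time is reversed: at time 0 the point lies in the slice over [y'], at time 1 it is back at [u].
    Homotopy lifting starts at time 0, so it carries data from the slice to the slab. *)
Definition slide (e : R * U x) : U x := mkU (push_coord (1 - clamp e.1) (\val e.2)).

Lemma slide_val t u : slab u -> \val (slide (t, u)) = push_coord (1 - clamp t) (\val u).
Proof.
move=> Su; apply/mkUE/push_coord_U => //; last exact: setP_val.
by have := clamp_itv t; lra.
Qed.

Lemma slide_continuous t u : slab u -> {for (t, u), continuous slide}.
Proof.
move=> Su; apply: for_continuous_mkU; last first.
  by rewrite -slide_val //; exact: setP_val.
apply: (@for_continuous_comp _ _ _ (fun e : R * U x => (1 - clamp e.1, \val e.2))
  (fun e : R * (C * C) => push_coord e.1 e.2)); last exact: push_coord_continuous.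
apply: for_continuous_pair.
  apply: for_continuous_RB; first exact: for_continuous_cst.
  by apply: for_continuous_clamp; exact: for_continuous_fst.
apply: (@for_continuous_comp _ _ _ snd (fun u : U x => \val u)).
  exact: for_continuous_snd.
exact: val_continuous.
Qed.

Lemma slide1 t u : 1 <= t -> slab u -> slide (t, u) = u.
Proof.
move=> t1 Su; apply: val_inj; rewrite slide_val // clamp_ge1 // subrr /push_coord mul0r.
by rewrite !mul0r !addr0 -surjective_pairing.
Qed.

Lemma slide_slab t u : slab u -> slab (slide (t, u)).
Proof.
move=> Su; rewrite /slab /= slide_val //= /nearby.
have s01 : 0 <= 1 - clamp t <= 1 by have := clamp_itv t; lra.
move: (1 - clamp t) s01 => s s01.
have -> : (\val u).2 + s%:C%C * (\val y' - (\val u).2) - y1 =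
    (1 - s)%:C%C * ((\val u).2 - y1) + s%:C%C * (\val y' - y1) :> C.
  have H (a b c d : R[i]) : a + c * (b - a) - d = (1 - c) * (a - d) + c * (b - d) by ring.
  by rewrite rmorphB rmorph1; exact: (H (\val u).2 (\val y') s%:C%C y1).
have h1 : nearby (\val u).2 by []; have h2 := Ny'; rewrite /nearby in h1 h2.
apply: le_lt_trans (nCD _ _) _; rewrite !nCM !nC_real !ger0_norm; try lra.
have [->|s0] := eqVneq s 0; first by rewrite subr0 mul1r mul0r addr0.
have : s * nC (\val y' - y1) < s * (r / 2) by rewrite ltr_pM2l // lt_neqAle eq_sym s0; lra.
have : (1 - s) * nC ((\val u).2 - y1) <= (1 - s) * (r / 2) by apply: ler_wpM2l; [lra | exact: ltW].
lra.
Qed.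

Definition slice := U1minus x (\val y').

Fact fib_subproof (w : slice) : U x (\val w, \val y').
Proof.
have [h1 h2] := setP_val w; have h3 := setP_val y'.
by split=> //=; rewrite eq_sym.
Qed.
Definition fib : slice -> U x := corestr fib_subproof.

Lemma fib_continuous : continuous fib.
Proof.
move=> w; apply/for_continuous_val; apply: for_continuous_pair.
  exact: val_continuous.
exact: for_continuous_cst.
Qed.

Lemma fib_slab w : slab (fib w).
Proof. exact: Ny'. Qed.

Lemma slide0_snd u : slab u -> (\val (slide (0, u))).2 = \val y'.
Proof.
move=> Su; rewrite slide_val // clamp_le0 // subr0 /push_coord /= rmorph1.
by rewrite mul1r addrC subrK.
Qed.

Lemma ret_subproof u : slab u -> U1minus x (\val y') (\val (slide (0, u))).1.
Proof.
move=> Su; have [h1 _ h3] := setP_val (slide (0, u)).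
by split=> //; rewrite -(slide0_snd Su) eq_sym.
Qed.

Variable w0 : slice.
Definition ret (u : U x) : slice := insubd w0 (\val (slide (0, u))).1.

Lemma ret_val u : slab u -> \val (ret u) = (\val (slide (0, u))).1.
Proof.
move=> Su; rewrite val_insubd; case: ifP => // /negP[]; apply: mem_set.
exact: ret_subproof.
Qed.

Lemma fib_ret u : slab u -> fib (ret u) = slide (0, u).
Proof.
move=> Su; apply: val_inj; rewrite [LHS]/= ret_val //.
by rewrite -(slide0_snd Su) -surjective_pairing.
Qed.

Lemma slide_fib t w : slide (t, fib w) = fib w.
Proof.
by apply: val_inj; rewrite slide_val //= /push_coord /= subrr !mulr0 !addr0.
Qed.

Lemma ret_fib w : ret (fib w) = w.
Proof. by apply: val_inj; rewrite ret_val // slide_fib. Qed.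

Lemma ret_continuous u : slab u -> {for u, continuous ret}.
Proof.
move=> Su; apply/for_continuous_val => P HP.
change (\forall v \near u, P (\val (ret v))).
rewrite ret_val // in HP.
have c : {for u, continuous (fun u => (\val (slide (0, u))).1)}.
  apply: (@for_continuous_comp _ _ _ (fun u => \val (slide (0, u))) fst); last exact: for_continuous_fst.
  apply/for_continuous_val; apply: (@for_continuous_comp _ _ _ (fun u => (0, u)) slide).
    exact: continuous_pairl.
  exact: slide_continuous.
by apply: filterS2 (near_continuous c HP) (slab_nbhs Su) => v H Sv; rewrite ret_val.
Qed.

Lemma slide_cpath u : slab u -> cpath (fun t => slide (t, u)).
Proof.
move=> Su; rewrite /cpath; have -> : (fun t => slide (t, u)) \o clamp = fun t => slide (t, u).
  by apply/funext => t; rewrite /= /slide /= clamp_clamp.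
move=> t; apply: (@for_continuous_comp _ _ _ (fun t : R => (t, u)) slide).
  exact: continuous_pairr.
exact: slide_continuous.
Qed.

Variable K : fieldType.

(** Applied to a local system it spreads sections from the slice; applied to the torsor of
    potentials it spreads a trivialization. *)
Lemma slab_lift (S : et K (U x)) (W : set (U x)) (s0 : U x -> tot S) :
  (forall u, W u -> slab u /\ nbhs u W) ->
  (forall t u, W u -> lc S (slide (t, u))) ->
  flat W (fun u => slide (0, u)) s0 ->
  exists s : prodM S, forall u, W u -> sc S s u /\
    tr (fun t => slide (t, u)) (s0 u) (existT (fun u => S u : Type) u (s u)).
Proof.
move=> HW lS f0.
have [||||||sl [fl l0]] := @homotopy_lifting K (U x) S R (U x) W slide s0.
- by move=> u /HW[].
- by move=> t u /HW[Su _]; exact: slide_continuous.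
- exact: lS.
- by move=> t u t0; rewrite /slide /= clamp_le0 // clamp_le0.
- by move=> t u t1; rewrite /slide /= clamp_ge1 // clamp_ge1.
- exact: f0.
exists (fun u => tot_at (sl (1, u)) u) => u Wu; have [Su NW] := HW u Wu.
have E1 v : W v -> sl (1, v) = existT (fun u => S u : Type) v (tot_at (sl (1, v)) v).
  move=> Wv; apply: tot_tot_at; rewrite (flat_base fl) //.
  by apply: slide1 => //; case: (HW v Wv).
split.
  have [sg sg1 sg2] := fl (1, u) Wu; rewrite slide1 // in sg1.
  apply: sc_loc sg1.
  have H := near_continuous (@continuous_pairl R (U x) u 1) sg2.
  apply: filterS2 H NW => v /= -> Wv.
  by rewrite slide1 ?tot_atE //; case: (HW v Wv).
exists (fun t => sl (t, u)); split; [|exact: l0|exact: E1].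
have -> : (fun t => slide (t, u)) \o clamp = slide \o (fun t => (t, u)).
  by apply/funext => t; rewrite /= /slide /= clamp_clamp.
by apply: (flat_comp (f := fun t : R => (t, u)) fl) => // t _; exact: continuous_pairr.
Qed.

Variable F : sheaf K (U x).
Hypothesis lF : local_system F.
Notation lcF := (local_system_lc lF).
Notation FS := (pull fib_continuous F).

Lemma leaf_exists u (v : F (fib (ret u))) : exists w : F u, slab u ->
  tr (S := sheaf_et F) (fun t => slide (t, u)) (PT F (fib (ret u)) v) (PT F u w).
Proof.
have [Su|nS] := pselect (slab u); last by exists 0.
have [||b] := @tr_total _ _ (sheaf_et F) _ lcF (fun t => slide (t, u)) (PT F (fib (ret u)) v).
- exact: slide_cpath.
- by rewrite /= fib_ret.
rewrite slide1 // => bu Tb; exists (tot_at b u) => _.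
by rewrite -(tot_tot_at bu).
Qed.

Definition leaf (u : U x) (v : F (fib (ret u))) : F u := projT1 (cid (leaf_exists v)).

Lemma leaf_tr u (v : F (fib (ret u))) : slab u ->
  tr (S := sheaf_et F) (fun t => slide (t, u)) (PT F (fib (ret u)) v) (PT F u (leaf v)).
Proof. by rewrite /leaf; case: cid. Qed.

Lemma leaf_uniq u (v : F (fib (ret u))) w : slab u ->
  tr (S := sheaf_et F) (fun t => slide (t, u)) (PT F (fib (ret u)) v) (PT F u w) -> w = leaf v.
Proof.
move=> Su Tw; apply: tot_inj; apply: (@tr_uniq _ _ (sheaf_et F) _ lcF _ _ _ _ _ Tw (leaf_tr v Su)).
exact: slide_cpath.
Qed.

Lemma leafP u a (v v' : F (fib (ret u))) : slab u ->
  leaf (a *: v + v') = a *: leaf v + leaf v'.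
Proof.
by move=> Su; apply/esym/leaf_uniq => //; apply: tr_linear; exact: leaf_tr.
Qed.

Lemma leaf_surj u w : slab u -> exists v : F (fib (ret u)), leaf v = w.
Proof.
move=> Su; pose g t := slide (t, u).
have cg : cpath (path_inv g) by apply/cpath_inv/slide_cpath.
have [|b] := @tr_total _ _ (sheaf_et F) _ lcF (path_inv g) (PT F u w) cg.
  by rewrite /= /path_inv /g subr0 slide1.
rewrite /path_inv /g subrr -fib_ret // => bE Tb.
exists (tot_at b (fib (ret u))); apply/esym/leaf_uniq => //.
rewrite -(tot_tot_at bE); have := tr_inv Tb; apply: tr_eq => t _.
by rewrite /path_inv opprB addrC subrK.
Qed.

Lemma leaf_flat (tau : sections FS) u : slab u -> secat tau (ret u) ->
  secat (fun v => leaf (tau (ret v))) u.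
Proof.
move=> Su Ht; pose W := [set v | slab v /\ secat tau (ret v)]°.
have NW : nbhs u W.
  apply/nbhs_interior; apply: filterI; first exact: slab_nbhs.
  exact: near_continuous (ret_continuous Su) (secat_near Ht).
have [||v /interior_subset [Sv Hv]|s Hs] := @slab_lift (sheaf_et F) W (fun v => PT F (fib (ret v)) (tau (ret v))).
- move=> v Wv; split; first by case: (interior_subset Wv).
  by apply: open_nbhs_nbhs; split=> //; exact: open_interior.
- by move=> t v _; exact: lcF.
- have [th th1 th2] := Hv; exists th; first by rewrite -fib_ret.
  have H := near_continuous (ret_continuous Sv) th2.
  by apply: filterS2 H (slab_nbhs Sv) => w -> Sw; rewrite -fib_ret.
have [sc_s _] := Hs u (nbhs_singleton NW).
apply: (secat_local _ sc_s); apply: filterS NW => v Wv.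
have [Sv _] := interior_subset Wv.
by have [_] := Hs v Wv; exact: leaf_uniq.
Qed.

Lemma leaf_fib (tau : sections FS) w : leaf (tau (ret (fib w))) = tau w.
Proof.
apply/esym/leaf_uniq; first exact: fib_slab.
have -> : PT F (fib (ret (fib w))) (tau (ret (fib w))) = PT F (fib w) (tau w) by rewrite ret_fib.
have -> : (fun t => slide (t, fib w)) = cst (fib w) by apply/funext => t; rewrite slide_fib.
by apply: tr_cst; exact: lcF.
Qed.

Section SlabTorsor.
Variable T : torsor FS.

(** The pull-back of [T] along [ret], carried to the stalks of [F] by [leaf]. *)
Definition ext_sc (s : sections F) (u : U x) : Prop := slab u /\ exists2 tau : sections FS,
  tsc T tau (ret u) & \forall v \near u, s v = leaf (tau (ret v)).

Fact ext_near s u : ext_sc s u -> \forall v \near u, ext_sc s v.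
Proof.
move=> [Su [tau Ht /near_join Es]].
have H := near_continuous (ret_continuous Su) (tsc_near Ht).
by apply: filterS2 (filterI H Es) (slab_nbhs Su) => v [H' E'] Sv; split=> //; exists tau.
Qed.

Fact ext_loc s t u : (\forall v \near u, s v = t v) -> ext_sc s u -> ext_sc t u.
Proof.
move=> st [Su [tau Ht Es]]; split=> //; exists tau => //.
by apply: filterS2 st Es => v <-.
Qed.

Fact ext_sub s t u : ext_sc s u -> ext_sc t u -> secat (s - t) u.
Proof.
move=> [Su [tau Ht Es]] [_ [tau' Ht' Et]].
apply: secat_local (leaf_flat Su (tsc_sub Ht Ht')).
apply: filterS2 (filterI Es Et) (slab_nbhs Su) => v [E E'] Sv.
rewrite -[RHS]/(s v - t v) E E' -[X in leaf X]/(tau (ret v) - tau' (ret v)).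
by rewrite addrC -scaleN1r leafP // scaleN1r addrC.
Qed.

Fact ext_add s t u : ext_sc s u -> secat t u -> ext_sc (s + t) u.
Proof.
move=> [Su [tau Ht Es]] Htt; split=> //.
have [v Ev] := leaf_surj (t u) Su; have [th Hth thv] := @secat_germ _ _ FS (ret u) v.
exists (tau + th); first exact: tsc_add.
have E0 : ((fun v => leaf (th (ret v))) : sections F) u - t u = 0 by rewrite thv Ev subrr.
have := secat_sep (secatB (leaf_flat Su Hth) Htt) E0.
apply: filterS2 (filterI Es (slab_nbhs Su)) => w [E Sw] /subr0_eq E'.
rewrite -[LHS]/(s w + t w) E -E'.
by have := @leafP w 1 (tau (ret w)) (th (ret w)) Sw; rewrite !scale1r => <-.
Qed.

Definition ext_torsor : torsor F := Torsor ext_near ext_loc ext_sub ext_add.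

(** The extended torsor must have sections near all points of the projective line, so the punctures
    have to be mapped as well. Infinity can be kept fixed because [bump] vanishes far from [y]. *)
Definition retbar (z : P1 R * U1 x) : P1 R :=
  if z.1 is Some a then Some (a + (bump a (\val z.2))%:C%C * (\val y' - \val z.2)) else None.

Lemma retbar_emb u : slab u -> retbar (emb u) = Some (\val (ret u)).
Proof.
by move=> Su; rewrite /retbar /= ret_val // slide_val // clamp_le0 // subr0 /push_coord mul1r.
Qed.

Lemma retbar_near z (P : P1 R -> Prop) : (\forall o \near retbar z, P o) ->
  \forall z' \near z, P (retbar z').
Proof.
case: z => -[a|] y.
  rewrite /retbar /= => H.
  pose f (w : C * C) : C := w.1 + (bump w.1 w.2)%:C%C * (\val y' - w.2).
  have cf : {for (a, \val y), continuous f}.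
    have c1 := @for_continuous_fst C C (a, \val y).
    have c2 := @for_continuous_snd C C (a, \val y).
    have cb := for_continuous_clamp (for_continuous_RB (@for_continuous_cst _ _ (1 : R) _)
      (for_continuous_RM (for_continuous_nC (for_continuous_CB c1 c2)) (@for_continuous_cst _ _ r^-1 _))).
    exact: (for_continuous_CD c1 (for_continuous_CM (for_continuous_RC cb)
      (for_continuous_CB (@for_continuous_cst _ _ (\val y') _) c2))).
  have H' : \forall w \near f (a, \val y), P (Some w) by [].
  have [A Aa [B By AB]] := near_prodP (near_continuous cf H').
  have HA : \forall c \near (Some a : P1 R), exists2 a, A a & c = Some a.
    by apply: filterS Aa => a' Aa; exists a'.
  have HB : \forall y \near y, B (\val y) by exact: near_continuous (@val_continuous _ _ y) By.
  apply: filterS2 (near_fst y HA) (near_snd (Some a : P1 R) HB) => -[c w] /= [a' Aa' ->] Bw.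
  exact: AB.
move=> /P1_near_infty [PN [M HM]].
(* The margin [2 * r] puts [a] at distance more than [r] from every [w] within [r] of [y], so that
   [bump a w] is 0. *)
have HA : \forall c \near (None : P1 R), if c is Some a then M < nC a /\ nC (\val y) + 2 * r < nC a else True.
  apply/P1_near_infty; split=> //; exists (Num.max M (nC (\val y) + 2 * r)) => z.
  by rewrite gt_max => /andP.
have HB : \forall w \near y, nC (\val w - \val y) < r.
  exact: near_continuous (@val_continuous _ _ y) (near_nC (\val y) r0).
apply: filterS2 (near_fst y HA) (near_snd (None : P1 R) HB) => -[[a|] w] //= [h1 h2] h3.
rewrite /retbar /=; have -> : bump a (\val w) = 0.
  rewrite /bump clamp_le0 // subr_le0 ler_pdivlMr // mul1r.
  have := nCD (a - \val w) (\val w); rewrite subrK.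
  have := nCD (\val w - \val y) (\val y); rewrite subrK; lra.
by rewrite mul0r addr0; exact: HM.
Qed.

Lemma slab_extension :
  (forall z : P1 R, exists tau : sections FS, \forall z' \near z, forall w : slice,
     Some (\val w) = z' -> tsc T tau w) ->
  exists sg : sections (gode1 (push (@emb R p x) F)),
    (forall y : U1 x, nearby (\val y) -> slab_num (@pr2bar R p x) sg y) /\
    forall tau w, tsc T tau w -> exists2 s, pot_sc sg s (fib w) &
      \forall w' \near w, s (fib w') = tau w'.
Proof.
move=> par.
have [|z Nz|sg [H1 H2]] := @torsor_slab _ _ _ _ (@emb R p x) (@pr2bar R p x) emb_continuous
  pr2bar_continuous emb_near F ext_torsor [set y : U1 x | nearby (\val y)] emb_inj.
- rewrite openE => y Ny; have h : nC (\val y - y1) < r / 2 by [].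
  have c : {for y, continuous (fun y : U1 x => nC (\val y - y1))}.
    apply: for_continuous_nC; apply: for_continuous_CB; last exact: for_continuous_cst.
    exact: val_continuous.
  exact: near_continuous c (lt_nbhsl h).
- have [tau Ht] := par (retbar z); exists (fun u => leaf (tau (ret u))).
  have HN : \forall y \near z.2, nearby (\val y).
    have h : nC (\val z.2 - y1) < r / 2 by [].
    have c : {for z.2, continuous (fun y : U1 x => nC (\val y - y1))}.
      apply: for_continuous_nC; apply: for_continuous_CB; last exact: for_continuous_cst.
      exact: val_continuous.
    exact: near_continuous c (lt_nbhsl h).
  have HN' : \forall z' \near z, nearby (\val z'.2).
    by case: z {Nz Ht} HN => c y HN; exact: (near_snd c HN).
  apply: filterS2 HN' (retbar_near Ht) => z' Nz' H u uz.
  have Su : slab u by rewrite /slab /= -[(\val u).2]/(\val (emb u).2) uz.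
  split=> //; exists tau; first by apply: H; rewrite -uz retbar_emb.
  exact: near_all.
exists sg; split=> // tau w Ht; exists (fun u => leaf (tau (ret u))).
  apply: H2; first exact: Ny'.
  split; first exact: fib_slab.
  by exists tau; [rewrite ret_fib | exact: near_all].
by apply: near_all => w'; rewrite leaf_fib.
Qed.
End SlabTorsor.

(** The slides carry a global potential on one slice to one on the whole slab, so the vanishing of a
    class spreads from one fibre to all nearby ones. *)
Lemma slab_vanishing (sg : sections (gode1 (push (@emb R p x) F))) (tau : sections FS) :
  (forall y : U1 x, nearby (\val y) -> slab_num (@pr2bar R p x) sg y) ->
  (forall w, exists2 s, pot_sc sg s (fib w) & \forall w' \near w, tau w' = s (fib w')) ->
  forall y : U1 x, nearby (\val y) -> mk (@pr2bar R p x) sg y = 0.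
Proof.
move=> Nsg Htau; pose P := potentials emb_continuous emb_near sg.
have [||u Su|s Hs] := @slab_lift (torsor_et P) slab (fun v => PT F (fib (ret v)) (tau (ret v))).
- by move=> u Su; split=> //; exact: slab_nbhs.
- move=> t u Su; have Su' : slab (slide (t, u)) by exact: slide_slab.
  have [s Hs] : exists s, tsc P s (slide (t, u)).
    apply: pot_exists; apply: (slab_num_secat (f := @pr2bar R p x) (y := pr2 (slide (t, u)))) => //.
    exact: Nsg.
  exact: torsor_lc (lcF _) Hs.
- have [s s1 s2] := Htau (ret u); exists s; first by rewrite -fib_ret.
  have H := near_continuous (ret_continuous Su) s2.
  by apply: filterS2 H (slab_nbhs Su) => w -> Sw; rewrite -fib_ret.
move=> y Ny; apply: (pot_mk_eq0 emb_continuous pr2bar_continuous (s := s)).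
  exact: Nsg.
have h : nC (\val y - y1) < r / 2 by [].
have c : {for y, continuous (fun y : U1 x => nC (\val y - y1))}.
  apply: for_continuous_nC; apply: for_continuous_CB; last exact: for_continuous_cst.
  exact: val_continuous.
apply: filterS (near_continuous c (lt_nbhsl h)) => w Nw u uw.
have Su : slab u by rewrite /slab /= -[(\val u).2]/(\val (pr2bar (emb u))) uw.
by have [] := Hs u Su.
Qed.
End Geometry.

(** * Parallel transport of direct image classes *)

Section Avoidance.
Variable R : realType.
Local Notation C := ((R[i])^o).

Lemma nat_avoid (D : numDomainType) (L : seq D) : exists n : nat, n%:R \notin L.
Proof.
apply: contrapT => H; have sub : {subset [seq (n%:R : D) | n <- iota 0 (size L).+1] <= L}.
  move=> _ /mapP[n _ ->]; apply: contrapT => /negP nL; apply: H; exists n => //.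
have U : uniq [seq (n%:R : D) | n <- iota 0 (size L).+1].
  rewrite map_inj_uniq ?iota_uniq // => m n /eqP.
  by rewrite eqr_nat => /eqP.
by have := uniq_leq_size U sub; rewrite size_map size_iota ltnn.
Qed.

Definition segment_path (a b : C) (t : R) : C := a + t%:C%C * (b - a).

Lemma segment_path_continuous a b : continuous (segment_path a b).
Proof.
move=> t; exact: (for_continuous_CD (@for_continuous_cst R C a t)
  (for_continuous_CM (for_continuous_RC (@for_continuous_id R t)) (@for_continuous_cst R C (b - a) t))).
Qed.

Lemma segment_path_cpath a b : cpath (segment_path a b).
Proof.
move=> t; apply: (@for_continuous_comp _ _ _ clamp (segment_path a b)); first exact: clamp_continuous.
exact: segment_path_continuous.
Qed.

Lemma segment_path0 a b : segment_path a b 0 = a.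
Proof. by rewrite /segment_path mul0r addr0. Qed.

Lemma segment_path1 a b : segment_path a b 1 = b.
Proof. by rewrite /segment_path mul1r addrC subrK. Qed.

(** In the coordinate with [a] at 0 and [b] at 1, the segment lies on the line of slope [y] through
    0; a point [l] on it therefore determines [y]. *)
Lemma segment_path_bend (a b l : C) (y t : R) : a != b -> l != a ->
  segment_path a (a + (b - a) * Complex 1 y) t = l ->
  y = complex.Im ((l - a) / (b - a)) / complex.Re ((l - a) / (b - a)).
Proof.
move=> ab la; have ba0 : (b - a : R[i]) != 0 by rewrite subr_eq0 eq_sym.
rewrite /segment_path addrAC subrr add0r => E.
have Eq : (l - a) / (b - a) = t%:C%C * Complex 1 y :> R[i].
  by rewrite -E addrAC subrr add0r mulrCA mulrAC mulfV // mul1r.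
rewrite Eq; simpc; rewrite /=; have t0 : t != 0.
  by apply: contraNneq la => t0; rewrite -E t0 mul0r addr0.
by rewrite mulrAC mulfV // mul1r.
Qed.

(** Two straight legs meet at a point [m] of the perpendicular bisector. A point of [L] forbids at
    most one height of [m] for each leg, so some natural number is an admissible height. Seen from
    [b], the slope changes sign. *)
Lemma path_avoid (L : seq C) (a b : C) : a \notin L -> b \notin L ->
  exists g : R -> C, [/\ cpath g, g 0 = a, g 1 = b & forall t, 0 <= t <= 1 -> g t \notin L].
Proof.
move=> aL bL; have [->|ab] := eqVneq a b.
  by exists (cst b); split=> // t; exact: for_continuous_cst.
pose s (u v l : C) := complex.Im ((l - u) / (v - u)) / complex.Re ((l - u) / (v - u)).
pose c := a + (b - a) / 2.
have [n] := nat_avoid ([seq s a c l | l <- L] ++ [seq - s b c l | l <- L]).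
rewrite mem_cat negb_or => /andP[n1 n2].
pose m : C := a + (c - a) * Complex 1 n%:R.
have ca : c - a = (b - a) / 2 by rewrite /c addrAC subrr add0r.
have cb : c - b = - ((b - a) / 2).
  rewrite /c; have H (u v : R[i]) : u + (v - u) / 2 - v = - ((v - u) / 2) by field.
  exact: H.
have mE : m = b + (c - b) * Complex 1 (- n%:R).
  rewrite /m ca cb; have -> : Complex 1 (- n%:R) = 2 - Complex 1 n%:R :> R[i].
    by apply/eqP; rewrite eq_complex /=; apply/andP; split; apply/eqP; rewrite ?add0r ?sub0r //; lra.
  have H (u v w : R[i]) : u + (v - u) / 2 * w = v + - ((v - u) / 2) * (2 - w) by field.
  exact: H.
have d0 : (b - a : R[i]) / 2 != 0 by rewrite mulf_neq0 ?invr_eq0 ?pnatr_eq0 // subr_eq0 eq_sym.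
have ac : a != c by rewrite eq_sym -subr_eq0 ca.
have bc : b != c by rewrite eq_sym -subr_eq0 cb oppr_eq0.
have H1 t : segment_path a m t \notin L.
  apply/negP => tL; case/negP: n1; apply/mapP; exists (segment_path a m t) => //.
  apply: (segment_path_bend ac _ erefl); apply: contraNneq aL => <-; exact: tL.
have H2 t : segment_path b m t \notin L.
  apply/negP => tL; case/negP: n2; apply/mapP; exists (segment_path b m t) => //.
  apply: oppr_inj; rewrite opprK; rewrite mE in tL *.
  apply: (segment_path_bend bc _ erefl); apply: contraNneq bL => <-; exact: tL.
exists (path_mul (path_inv (segment_path b m)) (segment_path a m)); split.
- apply: cpath_mul; [exact/cpath_inv/segment_path_cpath | exact: segment_path_cpath |].
  by rewrite segment_path1 /path_inv subr0 segment_path1.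
- by rewrite /path_mul mulr0 ifT ?segment_path0 // invr_ge0.
- rewrite /path_mul ifF; last by apply/negbTE; rewrite -ltNge; lra.
  by rewrite /path_inv (_ : 1 - (2 * 1 - 1) = 0) ?segment_path0 //; lra.
by move=> t _; rewrite /path_mul; case: ifP => _; rewrite ?H1 ?H2.
Qed.

Variables (A : set C) (L : seq C).
Hypothesis AL : forall z, A z <-> z \notin L.

Lemma cofinite_path (a b : A) : exists g : R -> A, [/\ cpath g, g 0 = a & g 1 = b].
Proof.
have aL : \val a \notin L by apply/AL; exact: setP_val.
have bL : \val b \notin L by apply/AL; exact: setP_val.
have [g [cg g0 g1 gL]] := path_avoid aL bL.
pose h t : A := insubd a (g t).
have hE t : 0 <= t <= 1 -> \val (h t) = g t.
  by move=> /gL/AL Ag; rewrite val_insubd; case: ifP => // /negP[]; exact: mem_set.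
exists h; split.
- move=> t; apply/for_continuous_val.
  have -> : (fun t => \val ((h \o clamp) t)) = g \o clamp.
    by apply/funext => u; rewrite /= hE // clamp_itv.
  exact: cg.
- by apply: val_inj; rewrite hE // ?g0 // lexx ler01.
- by apply: val_inj; rewrite hE // ?g1 // lexx ler01.
Qed.

Lemma cofinite_nonempty : exists a : C, A a.
Proof. by have [n nL] := nat_avoid (L : seq R[i]); exists n%:R; apply/AL. Qed.
End Avoidance.

(** * Local constancy of the direct image *)

Section DirectImageLocalSystem.
Variables (R : realType) (p : nat) (x : 'I_p -> (R[i])^o) (u0 : U x).
Local Notation C := ((R[i])^o).

Lemma U1_mem (z : C) : U1 x z <-> z \notin codom x.
Proof.
split=> [H|/negP H i]; last by apply/eqP => E; apply: H; rewrite E codom_f.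
by apply/negP => /codomP[i E]; have := H i; rewrite E eqxx.
Qed.

Lemma U1minus_mem (b z : C) : U1minus x b z <-> z \notin b :: codom x.
Proof.
rewrite inE negb_or; split=> [[/U1_mem H1 H2]|/andP[H2 /U1_mem H1]]; last by split.
by rewrite H2.
Qed.

Lemma slice_point (y : U1 x) : slice y.
Proof.
have [a Aa] := cid (cofinite_nonempty (U1minus_mem (\val y))).
by exists a; exact: mem_set.
Qed.

Lemma slice_path (y : U1 x) (a b : slice y) :
  exists g : R -> slice y, [/\ cpath g, g 0 = a & g 1 = b].
Proof. exact: cofinite_path (U1minus_mem (\val y)) a b. Qed.

Lemma U1_path (a b : U1 x) : exists g : R -> U1 x, [/\ cpath g, g 0 = a & g 1 = b].
Proof. exact: cofinite_path U1_mem a b. Qed.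

Lemma small_ball (y : U1 x) (P : U1 x -> Prop) : (\forall w \near y, P w) ->
  exists r : R, [/\ 0 < r, forall i, 4 * r <= nC (\val y - x i)
    & forall w : U1 x, nearby (\val y) r (\val w) -> P w].
Proof.
have [d d0 Hd] := sep_dist (setP_val y : forall i, \val y != x i).
move=> /nbhs_subP/nbhs_nC[e e0 He].
have m0 : 0 < Num.min d e by rewrite lt_min d0.
have md : Num.min d e <= d by rewrite ge_min lexx.
have me : Num.min d e <= e by rewrite ge_min lexx orbT.
exists (Num.min d e / 4); split; first lra.
  by move=> i; apply: le_trans (Hd i); rewrite mulrC divfK.
by move=> w Nw; apply: (He (\val w)) => //; apply: lt_le_trans Nw _; lra.
Qed.

Lemma nearby_center (c : C) (r : R) : 0 < r -> nearby c r c.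
Proof. by move=> r0; rewrite /nearby subrr nC0 divr_gt0. Qed.

Lemma nearby_near (y : U1 x) (r : R) : 0 < r -> \forall w \near y, nearby (\val y) r (\val w).
Proof.
move=> r0; have H : \forall z \near \val y, nearby (\val y) r z.
  by apply/nbhs_nC; exists (r / 2) => //; rewrite divr_gt0.
exact: near_continuous (@val_continuous _ _ y) H.
Qed.

Variables (K : fieldType) (F : sheaf K (U x)).
Hypothesis lF : local_system F.
Notation RF := (R1 (@pr2bar R p x) (push (@emb R p x) F)).
Notation num := (slab_num (@pr2bar R p x)).
Notation mk := (mk (@pr2bar R p x)).
Notation lcF := (local_system_lc lF).

Section SlicePotentials.
Variables (y : U1 x) (sg : sections (gode1 (push (@emb R p x) F))).
Notation fib := (@fib R p x y).
Notation FS := (pull (@fib_continuous R p x y) F).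

Definition slice_sc (tau : sections FS) (w : slice y) : Prop :=
  exists2 s, pot_sc sg s (fib w) & \forall w' \near w, tau w' = s (fib w').

Fact slice_near s w : slice_sc s w -> \forall w' \near w, slice_sc s w'.
Proof.
move=> [t Ht /near_join st].
have H := near_continuous (@fib_continuous R p x y w) (pot_near (@emb_continuous R p x) Ht).
by apply: filterS2 H st => w' H1 H2; exists t.
Qed.

Fact slice_loc s t w : (\forall w' \near w, s w' = t w') -> slice_sc s w -> slice_sc t w.
Proof. by move=> st [s' H1 H2]; exists s' => //; apply: filterS2 st H2 => w' <-. Qed.

Fact slice_sub s t w : slice_sc s w -> slice_sc t w -> secat (s - t) w.
Proof.
move=> [s' H1 H2] [t' H1' H2']; exists (s' - t'); first exact: pot_sub (@emb_continuous R p x) _ _ _ _ _ H1 H1'.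
by apply: filterS2 H2 H2' => w' E E'; rewrite -[LHS]/(s w' - t w') E E'.
Qed.

Fact slice_add s t w : slice_sc s w -> secat t w -> slice_sc (s + t) w.
Proof.
move=> [s' H1 H2] [t' H1' H2']; exists (s' + t').
  exact: (pot_add (@emb_continuous R p x) (@emb_near R p x) H1 H1').
by apply: filterS2 H2 H2' => w' E E'; rewrite -[LHS]/(s w' + t w') E E'.
Qed.

Definition slice_pot : torsor FS := Torsor slice_near slice_loc slice_sub slice_add.

Hypothesis Nsg : num sg y.

Lemma slice_parabolic (z : P1 R) : exists tau : sections FS,
  \forall z' \near z, forall w : slice y, Some (\val w) = z' -> tsc slice_pot tau w.
Proof.
have /nbhs_singleton/(_ (z, y) erefl)[g _ Hg] := Nsg.
exists (fun w => germ_values g (fib w)).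
have [A Az [B By AB]] := near_prodP (near_join Hg).
apply: filterS Az => z' Az' w wz; exists (germ_values g); last exact: near_all.
exists g; split; last exact: near_all.
have -> : emb (fib w) = (z', y).
  by rewrite -wz; congr pair; apply: val_inj.
exact: AB (nbhs_singleton By).
Qed.

Lemma slice_pot_exists w : exists tau, tsc slice_pot tau w.
Proof.
have E : pr2bar (emb (fib w)) = y by apply: val_inj.
have [s Hs] := pot_exists (@emb_continuous R p x) (@emb_near R p x) (slab_num_secat Nsg E).
by exists (fun w => s (fib w)); exists s => //; exact: near_all.
Qed.
End SlicePotentials.

(** Base change to the fibre: a global potential on the single slice suffices, because
    [slab_vanishing] spreads it to a neighbourhood. *)
Lemma mk_eq0_slice (sg : sections (gode1 (push (@emb R p x) F))) (y : U1 x) : num sg y ->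
  (mk sg y = 0 <-> exists tau, forall w, tsc (slice_pot y sg) tau w).
Proof.
move=> Nsg; split=> [m0|[tau Ht]].
  have [s Hs] := mk_eq0_pot (@pr2bar_continuous R p x) Nsg m0.
  exists (fun w => s (fib w)) => w; exists s; last exact: near_all.
  by apply: (nbhs_singleton Hs); apply: val_inj.
have [r [r0 yr Hr]] := small_ball (slab_num_near Nsg).
have Ny := nearby_center (\val y) r0.
by apply: (slab_vanishing u0 r0 yr Ny (slice_point y) lF Hr Ht).
Qed.

Lemma mk_eq0_nearby (sg : sections (gode1 (push (@emb R p x) F))) (y1 y y' : U1 x) (r : R) :
  0 < r -> (forall i, 4 * r <= nC (\val y1 - x i)) ->
  (forall w : U1 x, nearby (\val y1) r (\val w) -> num sg w) ->
  nearby (\val y1) r (\val y) -> nearby (\val y1) r (\val y') ->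
  mk sg y = 0 -> mk sg y' = 0.
Proof.
move=> r0 yr Hr Ny Ny' /(mk_eq0_slice (Hr _ Ny))[tau Ht].
exact: (slab_vanishing u0 r0 yr Ny (slice_point y) lF Hr Ht).
Qed.

Lemma slice_extension (y1 y : U1 x) (r : R) (T : torsor (pull (@fib_continuous R p x y) F)) :
  0 < r -> (forall i, 4 * r <= nC (\val y1 - x i)) -> nearby (\val y1) r (\val y) ->
  (forall z : P1 R, exists tau, \forall z' \near z, forall w : slice y,
     Some (\val w) = z' -> tsc T tau w) ->
  exists sg : sections (gode1 (push (@emb R p x) F)),
    (forall w : U1 x, nearby (\val y1) r (\val w) -> num sg w) /\
    forall tau w, tsc T tau w -> tsc (slice_pot y sg) tau w.
Proof.
move=> r0 yr Ny par.
have [sg [H1 H2]] := slab_extension u0 r0 yr Ny (slice_point y) lF par.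
exists sg; split=> // tau w /H2[s Hs E]; exists s => //.
by apply: filterS E => w' ->.
Qed.

(** The disc around [y1] does not depend on [m], as [lc] demands. The torsor of [m] on its slice is
    extended to the slab; this gives a section [sg'] with the same potentials on the slice, hence
    with the same class. *)
Lemma class_extension (y1 y : U1 x) (r : R) (m : RF y) :
  0 < r -> (forall i, 4 * r <= nC (\val y1 - x i)) -> nearby (\val y1) r (\val y) ->
  exists sg : sections (gode1 (push (@emb R p x) F)),
    (forall w : U1 x, nearby (\val y1) r (\val w) -> num sg w) /\ mk sg y = m.
Proof.
move=> r0 yr Ny; have [sg Nsg ->] := mk_surj m.
have [sg' [N' H']] := slice_extension r0 yr Ny (slice_parabolic Nsg).
exists sg'; split; first exact: N'.
have Nsg' := N' _ Ny.
suff E0 : mk (-1 *: sg' + sg) y = 0.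
  have := mkP (-1) Nsg' Nsg; rewrite E0 scaleN1r => /esym/addr0_eq <-.
  by rewrite opprK.
apply/mk_eq0_slice; first exact: slab_numP.
(* 0 is a potential of the difference, because [sg] and [sg'] have a potential in common near each
   point of the slice. *)
exists 0 => w; have [tau Ht] := slice_pot_exists Nsg w.
have [s Hs Es] := Ht; have [s' Hs' Es'] := H' _ _ Ht.
exists (- 1 *: s' + s); first exact: potP.
apply: filterS2 Es Es' => w' E E'.
by rewrite -[RHS]/(- 1 *: s' (fib w') + s (fib w')) -E -E' scaleN1r addNr.
Qed.

Lemma direct_image_lc (y1 : U1 x) : lc (sheaf_et RF) y1.
Proof.
have [r [r0 yr _]] := small_ball (near_all y1 (fun _ => I)).
split.
  exists [set y | nearby (\val y1) r (\val y)].
    exact: nearby_near.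
  move=> y m Ny; have [sg [Nsg <-]] := class_extension m r0 yr Ny.
  by exists (fun w => mk sg w); split=> // w Nw; exact/mk_secat/Nsg.
move=> s t Hs Ht; have [sg Nsg E] := secat_mk (secatB Hs Ht).
have [r' [r'0 yr' Hr']] := small_ball (filterI (slab_num_near Nsg) E).
have NP := nearby_near y1 r'0.
have Hn (w : U1 x) : nearby (\val y1) r' (\val w) -> num sg w by move=> /Hr'[].
have Es (y : U1 x) : nearby (\val y1) r' (\val y) -> (s y = t y <-> mk sg y = 0).
  move=> /Hr'[_ <-]; rewrite -[(s - t : sections RF) y]/(s y - t y).
  by split=> [->|/subr0_eq//]; rewrite subrr.
have N1 := nearby_center (\val y1) r'0.
have E1 := Es _ N1.
apply: filterS NP => y Ny; have Ey := Es _ Ny.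
have H1 := mk_eq0_nearby r'0 yr' Hn Ny N1; have H2 := mk_eq0_nearby r'0 yr' Hn N1 Ny.
split=> [/(proj1 Ey) H|/(proj1 E1) H]; first exact: (proj2 E1 (H1 H)).
exact: (proj2 Ey (H2 H)).
Qed.
End DirectImageLocalSystem.

(** * Circles around punctures *)

Section Circle.
Variable R : realType.
Local Notation C := ((R[i])^o).

Lemma expi0 : expi (0 : R) = 1.
Proof. by rewrite /expi mulr0 cos0 sin0. Qed.

Lemma expi1 : expi (1 : R) = 1.
Proof. by rewrite /expi mulr1 mulr_natl -[pi *+ 2]add0r cosD2pi sinD2pi cos0 sin0. Qed.

Lemma nC_expi (t : R) : nC (expi t) = 1.
Proof. by rewrite /nC /expi /= cos2Dsin2 sqrtr1. Qed.

Lemma cos_turn_gt0 (t : R) : - 8^-1 <= t <= 8^-1 -> 0 < cos (2 * pi * t).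
Proof. by have := pi_gt0 R => pi0 t8; apply: cos_gt0_pihalf; apply/andP; split; nra. Qed.

Lemma sin_turn_gt0 (t : R) : 8^-1 <= t <= 3 / 8 -> 0 < sin (2 * pi * t).
Proof. by have := pi_gt0 R => pi0 t8; apply: sin_gt0_pi; apply/andP; split; nra. Qed.

Lemma cos_turn_lt0 (t : R) : 3 / 8 <= t <= 5 / 8 -> cos (2 * pi * t) < 0.
Proof.
move=> t8; have -> : 2 * pi * t = 2 * pi * (t - 2^-1) + pi :> R by field.
by rewrite (cosDpi _) oppr_lt0; apply: cos_turn_gt0; lra.
Qed.

Lemma sin_turn_lt0 (t : R) : 5 / 8 <= t <= 7 / 8 -> sin (2 * pi * t) < 0.
Proof.
move=> t8; have -> : 2 * pi * t = 2 * pi * (t - 2^-1) + pi :> R by field.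
by rewrite (sinDpi _) oppr_lt0; apply: sin_turn_gt0; lra.
Qed.

Lemma cos_turn_gt0_last (t : R) : 7 / 8 <= t <= 1 -> 0 < cos (2 * pi * t).
Proof.
move=> t8; have -> : 2 * pi * t = 2 * pi * (t - 1) + pi *+ 2 :> R by rewrite -mulr_natl; ring.
by rewrite (cosD2pi _); apply: cos_turn_gt0; lra.
Qed.

Definition convex_in (Q : set C) := forall z w (t : R), Q z -> Q w -> 0 <= t <= 1 ->
  Q (z + t%:C%C * (w - z)).

Lemma disc_open (c : C) (r : R) : open [set z : C | nC (z - c) < r].
Proof.
rewrite openE => z /= zr; apply/nbhs_nC; exists (r - nC (z - c)); first by rewrite subr_gt0.
move=> w wz; have := nCD (w - z) (z - c); rewrite addrA subrK => h /=; lra.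
Qed.

Lemma disc_convex (c : C) (r : R) : convex_in [set z : C | nC (z - c) < r].
Proof.
move=> z w t /= zr wr /andP[t0 t1].
have -> : z + t%:C%C * (w - z) - c = (1 - t)%:C%C * (z - c) + t%:C%C * (w - c).
  have H (a b e f : R[i]) : a + f * (b - a) - e = (1 - f) * (a - e) + f * (b - e) by ring.
  by rewrite rmorphB rmorph1; exact: H.
apply: (le_lt_trans (nCD _ _)); rewrite !nCM !nC_real !ger0_norm ?subr_ge0 //.
have [->|t0'] := eqVneq t 0; first by rewrite subr0 mul1r mul0r addr0.
have {}t0 : 0 < t by rewrite lt_neqAle eq_sym t0'.
nra.
Qed.

(** Taking [d] to be 1, -i, -1 and i gives the right, upper, left and lower half disc: four convex
    sets that cover the punctured disc. *)
Definition half_disc (d : C) (r : R) : set C := [set z | 0 < complex.Re (d * z) /\ nC z < r].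

Lemma half_disc_open d r : open (half_disc d r).
Proof.
rewrite openE => z [/= z0 zr]; apply/nbhs_nC.
have d0 := nC_ge0 d.
pose e := Num.min (r - nC z) (complex.Re (d * z) / (nC d + 1)).
have e1 : e <= r - nC z by rewrite ge_min lexx.
have e2 : e * (nC d + 1) <= complex.Re (d * z).
  by rewrite -ler_pdivlMr ?ge_min ?lexx ?orbT //; lra.
exists e; first by rewrite lt_min subr_gt0 zr divr_gt0 //; lra.
move=> w wz; split; last first.
  have := nCD (w - z) z; rewrite subrK => h; lra.
have -> : d * w = d * z + d * (w - z).
  have H (a b c : R[i]) : a * c = a * b + a * (c - b) by ring.
  exact: H.
rewrite raddfD /=; have := Re_le_nC (d * (w - z)); rewrite nCM ler_norml => /andP[h _].
have w0 := nC_ge0 (w - z); nra.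
Qed.

Lemma half_disc_convex d r : convex_in (half_disc d r).
Proof.
move=> z w t [/= z0 zr] [/= w0 wr] t01; split; last first.
  have := @disc_convex 0 r z w t; rewrite /= !subr0; exact.
have H (a b e f : R[i]) : a * (b + f * (e - b)) = a * b + f * (a * e - a * b) by ring.
rewrite [d * _]H; move: (d * z) (d * w) z0 w0 => [a b] [e f] /= z0 w0.
by case/andP: t01 => t0 t1; rewrite mul0r subr0; nra.
Qed.

Lemma half_discI d d' r : convex_in (half_disc d r `&` half_disc d' r).
Proof. by move=> z w t [z1 z2] [w1 w2] t01; split; exact: half_disc_convex. Qed.

Lemma half_disc_neq0 d r z : half_disc d r z -> 0 < nC z.
Proof. by move=> [z0 _]; rewrite nC_gt0; apply: contraTneq z0 => ->; rewrite mulr0 ltxx. Qed.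
End Circle.

Section Convex.
Variables (R : realType) (K : fieldType) (X : topologicalType) (S : et K X).
Local Notation C := ((R[i])^o).
Variables (Q : set C) (q : C -> X).
Hypotheses (oQ : open Q) (vQ : convex_in Q).
Hypotheses (cq : forall z, Q z -> {for z, continuous q}) (lq : forall z, Q z -> lc S (q z)).

Let contract (c : C) (e : R * C) : C := c + (clamp e.1)%:C%C * (e.2 - c).

Let contract_continuous c t z : {for (t, z), continuous (contract c)}.
Proof.
have c1 := for_continuous_clamp (@for_continuous_fst R C (t, z)).
have c2 := for_continuous_CB (@for_continuous_snd R C (t, z)) (@for_continuous_cst _ _ c _).
exact: (for_continuous_CD (@for_continuous_cst _ _ c _) (for_continuous_CM (for_continuous_RC c1) c2)).
Qed.

Let contract0 c t z : t <= 0 -> contract c (t, z) = c.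
Proof. by move=> t0; rewrite /contract clamp_le0 // mul0r addr0. Qed.

Let contract1 c t z : 1 <= t -> contract c (t, z) = z.
Proof. by move=> t1; rewrite /contract clamp_ge1 // mul1r addrC subrK. Qed.

Let contractQ c t z : Q c -> Q z -> Q (contract c (t, z)).
Proof. by move=> Qc Qz; apply: vQ => //; exact: clamp_itv. Qed.

Let contract_id c t : contract c (t, c) = c.
Proof. by rewrite /contract subrr mulr0 addr0. Qed.

Lemma convex_section (a : tot S) c : Q c -> projT1 a = q c ->
  exists s, flat (S := S) Q q s /\ s c = a.
Proof.
move=> Qc ac; rewrite (tot_tot_at ac).
have Qo z : Q z -> nbhs z Q by move=> Qz; exact: open_nbhs_nbhs.
exact: (contractible_section Qo cq lq (fun t y _ => @contract_continuous c t y)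
  (fun t y => @contractQ c t y Qc) (@contract0 c) (@contract1 c) (@contract_id c)).
Qed.

Lemma convex_uniq s s' z w : flat (S := S) Q q s -> flat Q q s' -> Q z -> Q w ->
  s z = s' z -> s w = s' w.
Proof.
move=> fs fs' Qz.
exact: (contractible_uniq cq lq (fun t y _ => @contract_continuous z t y)
  (fun t y => @contractQ z t y Qz) (@contract0 z) (@contract1 z) fs fs').
Qed.
End Convex.

Section PathInSection.
Variables (R : realType) (K : fieldType) (X Y : topologicalType) (S : et K X).
Variables (Q : set Y) (q : Y -> X) (s : Y -> tot S).

Lemma flat_tr (g : R -> Y) : flat (S := S) Q q s -> cpath g ->
  (forall t, 0 <= t <= 1 -> Q (g t)) -> tr (S := S) (q \o g) (s (g 0)) (s (g 1)).
Proof.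
move=> fs cg gQ; exists (s \o (g \o clamp)); split.
- apply: (flat_comp fs) => t _; last exact: cg.
  by apply: gQ; exact: clamp_itv.
- by rewrite /= clamp_le0.
- by rewrite /= clamp_ge1.
Qed.
End PathInSection.

Section Puncture.
Variables (R : realType) (K : fieldType) (X : topologicalType) (S : et K X).
Local Notation C := ((R[i])^o).
Variables (r : R) (q : C -> X).
Hypothesis r1 : 1 < r.
Notation Q := [set z : C | 0 < nC z < r].
Hypotheses (cq : forall z, Q z -> {for z, continuous q}) (lq : forall z, Q z -> lc S (q z)).

Let expiQ t : Q (expi t).
Proof. by change (0 < nC (expi t) < r); rewrite nC_expi ltr01 r1. Qed.

Let halfQ d z : half_disc d r z -> Q z.
Proof. by move=> h; have z0 := half_disc_neq0 h; case: h => _ zr; apply/andP. Qed.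

Let between (lo hi a b t : R) : lo <= a <= hi -> lo <= b <= hi -> 0 <= t <= 1 ->
  lo <= a + t * (b - a) <= hi.
Proof. by move=> /andP[? ?] /andP[? ?] /andP[? ?]; apply/andP; split; nra. Qed.

(** Eighths of a turn: the even ones are in the middle of a half disc, the odd ones in the overlap
    of two neighbouring ones. *)
Let pt (k : nat) : R := k%:R / 8.

Let pt_le k j : (pt k <= pt j) = (k <= j)%N.
Proof. by rewrite /pt ler_pM2r ?ler_nat. Qed.

Let pt0 : pt 0 = 0. Proof. by rewrite /pt mul0r. Qed.
Let pt8 : pt 8 = 1. Proof. by rewrite /pt divff ?pnatr_eq0. Qed.

Let match_arc (lo a b hi : nat) d s l : flat (S := S) (half_disc d r) q s ->
  flat (S := S) setT ((q \o @expi R) \o clamp) l ->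
  (forall t, pt lo <= t <= pt hi -> half_disc d r (expi t)) ->
  (lo <= a <= hi)%N -> (lo <= b <= hi)%N -> (hi <= 8)%N ->
  s (expi (pt a)) = l (pt a) -> s (expi (pt b)) = l (pt b).
Proof.
move=> fs fl hd' /andP[la ah] /andP[lb bh] h8.
have : 0 <= pt a <= 1 by rewrite -pt0 -pt8 !pt_le (leq_trans ah).
have : 0 <= pt b <= 1 by rewrite -pt0 -pt8 !pt_le (leq_trans bh).
have hd t : 0 <= t <= 1 -> half_disc d r (expi (pt a + t * (pt b - pt a))).
  by move=> t01; apply: hd'; apply: between; rewrite // !pt_le ?la ?lb.
move: (pt a) (pt b) hd => {la ah lb bh}{}a {}b hd b01 a01 sa.
pose h (t : R) := a + clamp t * (b - a).
have ch : continuous h.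
  move=> t; exact: (for_continuous_RD (@for_continuous_cst _ _ a t) (for_continuous_RM (for_continuous_clamp (@for_continuous_id _ t)) (@for_continuous_cst _ _ (b - a) t))).
have h01 t : 0 <= h t <= 1.
  have := clamp_itv t; rewrite /h; move: (clamp t) => c.
  by case/andP: a01 => ? ?; case/andP: b01 => ? ? /andP[? ?]; apply/andP; split; nra.
have hE t : clamp (h t) = h t by apply: clamp_id.
have Eq : ((q \o @expi R) \o clamp) \o h = q \o (@expi R \o h).
  by apply: functional_extensionality_dep => t /=; rewrite hE.
have f1 : flat (S := S) setT (q \o (@expi R \o h)) (s \o (@expi R \o h)).
  apply: (flat_comp fs) => t _; first exact/hd/clamp_itv.
  exact: (for_continuous_expi (@ch t)).
have f2 : flat (S := S) setT (q \o (@expi R \o h)) (l \o h).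
  by rewrite -Eq; apply: (flat_comp fl) => // t _; exact: ch.
have cqh : continuous (q \o (@expi R \o h)).
  move=> t; apply: (@for_continuous_comp _ _ _ (@expi R \o h) q).
    exact: (for_continuous_expi (@ch t)).
  exact/cq/expiQ.
have := @flat_uniq K X S R _ _ _ 0 1 cqh (fun t => lq (expiQ (h t))) f1 f2.
by rewrite /h /= clamp_le0 // clamp_ge1 // mul0r mul1r addr0 subrKC; apply.
Qed.

(** The lift along the unit circle determines sections on four half discs. Neighbouring ones agree
    at an odd eighth of a turn, hence on their convex intersection; for the last overlap it matters
    that the lift ends where it started. *)
Lemma puncture (a : tot S) : tr (S := S) (q \o @expi R) a a ->
  exists s, flat (S := S) Q q s /\ s 1 = a.
Proof.
move=> [l [fl l0 l1]].
have lb t : 0 <= t <= 1 -> projT1 (l t) = q (expi t).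
  by move=> t01; rewrite (flat_base fl) //= clamp_id.
have half d t : 0 <= t <= 1 -> half_disc d r (expi t) ->
    exists s, flat (S := S) (half_disc d r) q s /\ s (expi t) = l t.
  move=> t01 dt; apply: (convex_section (half_disc_open (d := d) (r := r))) => //.
  - exact: half_disc_convex.
  - by move=> z /halfQ; exact: cq.
  - by move=> z /halfQ; exact: lq.
  - exact: lb.
have hd (d : C) t : 0 < complex.Re (d * expi t) -> half_disc d r (expi t).
  by split=> //; rewrite nC_expi.
have re t : complex.Re (1 * expi t) = cos (2 * pi * t) :> R by rewrite mul1r.
have re' t : complex.Re ((- 1 : C) * expi t) = - cos (2 * pi * t) :> R by rewrite mulN1r.
have im t : complex.Re (Complex 0 (- 1) * expi t) = sin (2 * pi * t) :> R.
  by rewrite /= mul0r sub0r mulN1r opprK.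
have im' t : complex.Re (Complex 0 1 * expi t) = - sin (2 * pi * t) :> R.
  by rewrite /= mul0r sub0r mul1r.
have h0 t : pt 0 <= t <= pt 1 -> half_disc 1 r (expi t).
  by rewrite /pt => ht; apply: hd; rewrite re; apply: cos_turn_gt0; lra.
have h0' t : pt 7 <= t <= pt 8 -> half_disc 1 r (expi t).
  by rewrite /pt => ht; apply: hd; rewrite re; apply: cos_turn_gt0_last; lra.
have h1 t : pt 1 <= t <= pt 3 -> half_disc (Complex 0 (- 1)) r (expi t).
  by rewrite /pt => ht; apply: hd; rewrite im; apply: sin_turn_gt0; lra.
have h2 t : pt 3 <= t <= pt 5 -> half_disc (- 1) r (expi t).
  by rewrite /pt => ht; apply: hd; rewrite re' oppr_gt0; apply: cos_turn_lt0; lra.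
have h3 t : pt 5 <= t <= pt 7 -> half_disc (Complex 0 1) r (expi t).
  by rewrite /pt => ht; apply: hd; rewrite im' oppr_gt0; apply: sin_turn_lt0; lra.
have half' k d : (k <= 8)%N -> half_disc d r (expi (pt k)) ->
    exists s, flat (S := S) (half_disc d r) q s /\ s (expi (pt k)) = l (pt k).
  by move=> k8; apply: half; rewrite -pt0 -pt8 !pt_le.
have ptin lo k hi : (lo <= k <= hi)%N -> pt lo <= pt k <= pt hi by rewrite !pt_le.
have [s0 [f0 e0]] := half' 0 _ isT (h0 _ (ptin 0 0 1 isT)).
have [s1 [f1 e1]] := half' 2 _ isT (h1 _ (ptin 1 2 3 isT)).
have [s2 [f2 e2]] := half' 4 _ isT (h2 _ (ptin 3 4 5 isT)).
have [s3 [f3 e3]] := half' 6 _ isT (h3 _ (ptin 5 6 7 isT)).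
have e0' : s0 (expi (pt 8)) = l (pt 8) by rewrite pt8 expi1 -expi0 -pt0 e0 pt0 l0 l1.
have m01 := @match_arc 0 0 1 1 _ _ _ f0 fl h0 isT isT isT e0.
have m11 := @match_arc 1 2 1 3 _ _ _ f1 fl h1 isT isT isT e1.
have m12 := @match_arc 1 2 3 3 _ _ _ f1 fl h1 isT isT isT e1.
have m22 := @match_arc 3 4 3 5 _ _ _ f2 fl h2 isT isT isT e2.
have m23 := @match_arc 3 4 5 5 _ _ _ f2 fl h2 isT isT isT e2.
have m33 := @match_arc 5 6 5 7 _ _ _ f3 fl h3 isT isT isT e3.
have m30 := @match_arc 5 6 7 7 _ _ _ f3 fl h3 isT isT isT e3.
have m00 := @match_arc 7 8 7 8 _ _ _ f0 fl h0' isT isT isT e0'.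
have agree d d' s s' t : flat (S := S) (half_disc d r) q s -> flat (S := S) (half_disc d' r) q s' ->
    half_disc d r (expi t) -> half_disc d' r (expi t) -> s (expi t) = l t -> s' (expi t) = l t ->
    forall z, half_disc d r z -> half_disc d' r z -> s z = s' z.
  move=> fs fs' dt dt' es es' z dz dz'.
  apply: (convex_uniq (Q := half_disc d r `&` half_disc d' r) (q := q) _ _ _ _ _
    (conj dt dt') (conj dz dz')); last by rewrite es es'.
  - exact: half_discI.
  - by move=> w [/halfQ + _]; exact: cq.
  - by move=> w [/halfQ + _]; exact: lq.
  - by apply: flat_sub fs => w [].
  - by apply: flat_sub fs' => w [].
have a01 := agree _ _ _ _ _ f0 f1 (h0 _ (ptin 0 1 1 isT)) (h1 _ (ptin 1 1 3 isT)) m01 m11.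
have a12 := agree _ _ _ _ _ f1 f2 (h1 _ (ptin 1 3 3 isT)) (h2 _ (ptin 3 3 5 isT)) m12 m22.
have a23 := agree _ _ _ _ _ f2 f3 (h2 _ (ptin 3 5 5 isT)) (h3 _ (ptin 5 5 7 isT)) m23 m33.
have a03 := agree _ _ _ _ _ f0 f3 (h0' _ (ptin 7 7 8 isT)) (h3 _ (ptin 5 7 7 isT)) m00 m30.
pose s (z : C) := if 0 < complex.Re z then s0 z else if 0 < complex.Im z then s1 z
  else if complex.Re z < 0 then s2 z else s3 z.
have H0 (z : C) : half_disc 1 r z <-> 0 < complex.Re z /\ nC z < r by rewrite /half_disc /= mul1r.
have H2 (z : C) : half_disc (- 1) r z <-> complex.Re z < 0 /\ nC z < r.
  by rewrite /half_disc /= mulN1r; case: z => z1 z2; rewrite /= oppr_gt0.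
have H1 (z : C) : half_disc (Complex 0 (- 1)) r z <-> 0 < complex.Im z /\ nC z < r.
  by rewrite /half_disc; case: z => z1 z2; rewrite /= mul0r sub0r mulN1r opprK.
have H3 (z : C) : half_disc (Complex 0 1) r z <-> complex.Im z < 0 /\ nC z < r.
  by rewrite /half_disc; case: z => z1 z2; rewrite /= mul0r sub0r mul1r oppr_gt0.
have glue d sd : flat (S := S) (half_disc d r) q sd ->
    (forall z, half_disc d r z -> s z = sd z) -> flat (S := S) (half_disc d r) q s.
  move=> fd ed; apply: (flat_ext _ fd) => z dz.
  have dn : nbhs z (half_disc d r) by apply: open_nbhs_nbhs; split=> //; exact: half_disc_open.
  by apply: filterS dn => w dw; rewrite ed.
have F0 : flat (S := S) (half_disc 1 r) q s.
  by apply: (glue _ _ f0) => z /H0[z0 _]; rewrite /s z0.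
have F1 : flat (S := S) (half_disc (Complex 0 (- 1)) r) q s.
  apply: (glue _ _ f1) => z dz; have [z1 zr] := (H1 z).1 dz; rewrite /s z1.
  by case: ifP => // z0; apply: a01 => //; apply/H0.
have F2 : flat (S := S) (half_disc (- 1) r) q s.
  apply: (glue _ _ f2) => z dz; have [z2 zr] := (H2 z).1 dz; rewrite /s z2 ltNge ltW //=.
  by case: ifP => // z1; apply: a12 => //; apply/H1.
have F3 : flat (S := S) (half_disc (Complex 0 1) r) q s.
  apply: (glue _ _ f3) => z dz; have [z3 zr] := (H3 z).1 dz.
  rewrite /s (ltNge 0 (complex.Im z)) ltW //=.
  case: ifP => [z0|_]; first by apply: a03 => //; apply/H0.
  by case: ifP => // z2; apply: a23 => //; apply/H2.
exists s; split; last by rewrite /s /= ltr01 -expi0 -pt0 e0 pt0 l0.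
move=> z /= /andP[z0 zr].
have [z1|z1] := ltP 0 (complex.Re z); first by apply: F0; apply/H0.
have [z2|z2] := ltP 0 (complex.Im z); first by apply: F1; apply/H1.
have [z3|z3] := ltP (complex.Re z) 0; first by apply: F2; apply/H2.
apply: F3; apply/H3; split=> //; rewrite lt_neqAle z2 andbT.
apply: contraTneq z0 => i0; rewrite nC_gt0 negbK; apply/eqP.
case: z z1 z2 z3 i0 {zr} => a1 b1 /= ? ? ? ->; congr Complex.
by apply/eqP; rewrite eq_le; apply/andP.
Qed.

(** The family of circles from radius [e'] to radius 1 is lifted, starting with [sg] on the small
    circle. The lift over the unit circle closes up because the radial tracks at the parameters 0
    and 1 coincide. *)
Lemma circle_fix (e : R) (sg : prodM S) : 0 < e ->
  (forall z, 0 < nC z < e -> sc S sg (q z)) ->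
  exists a, projT1 a = q 1 /\ tr (S := S) (q \o @expi R) a a.
Proof.
move=> e0 Hsg.
have [e' [e'0 e'e e'1]] : exists e' : R, [/\ 0 < e', e' < e & e' <= 1].
  exists (Num.min (e / 2) 1); split.
  - by rewrite lt_min ltr01 andbT; lra.
  - by rewrite gt_min; apply/orP; left; lra.
  - by rewrite ge_min lexx orbT.
pose m (u : R * R) : C := (e' + clamp u.1 * (1 - e'))%:C%C * expi u.2.
have rad (t : R) : e' <= e' + clamp t * (1 - e') <= 1.
  have /andP[c0 c1] := clamp_itv t; have e'' : 0 <= 1 - e' by rewrite subr_ge0.
  have h1 := mulr_ge0 c0 e''; have h2 := ler_wpM2r e'' c1; rewrite mul1r in h2.
  by rewrite lerDl h1 -lerBrDl.
have mN u : nC (m u) = e' + clamp u.1 * (1 - e').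
  rewrite nCM nC_real nC_expi mulr1 ger0_norm //=.
  by have /andP[h _] := rad u.1; apply: le_trans h; exact: ltW.
have mQ u : Q (m u).
  change (0 < nC (m u) < r); rewrite mN; have /andP[h1 h2] := rad u.1.
  by rewrite (lt_le_trans e'0 h1) (le_lt_trans h2 r1).
have cm u : {for u, continuous m}.
  have c1 := for_continuous_RM (for_continuous_clamp (@for_continuous_fst _ _ u)) (@for_continuous_cst _ _ (1 - e') u).
  have c2 := for_continuous_RC (for_continuous_RD (@for_continuous_cst _ _ e' u) c1).
  exact: (for_continuous_CM c2 (for_continuous_expi (@for_continuous_snd _ _ u))).
have m0 y : m (0, y) = e'%:C%C * expi y by rewrite /m /= clamp_le0 // mul0r addr0.
have mT t : m (t, 0) = m (t, 1) by rewrite /m /= expi0 expi1.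
have m1 y : m (1, y) = expi y by rewrite /m /= clamp_ge1 // mul1r subrKC mul1r.
have cq' u : {for u, continuous (q \o m)}.
  by apply: for_continuous_comp; [exact: cm | exact/cq/mQ].
pose s0 (y : R) := PT S (q (m (0, y))) (sg (q (m (0, y)))).
have fs0 : flat (S := S) setT (fun y => (q \o m) (0, y)) s0.
  move=> y _; exists sg; last exact: near_all.
  by apply: Hsg; rewrite mN /= clamp_le0 // mul0r addr0 e'0.
have q0 (t y : R) : t <= 0 -> (q \o m) (t, y) = (q \o m) (0, y).
  by move=> t0; rewrite /= /m /= !clamp_le0.
have q1 (t y : R) : 1 <= t -> (q \o m) (t, y) = (q \o m) (1, y).
  by move=> t0; rewrite /= /m /= !clamp_ge1.
have [s [fs es]] := homotopy_lifting (Q := setT) (fun _ _ => filterT)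
  (fun t y _ => cq' (t, y)) (fun t y _ => lq (mQ (t, y))) q0 q1 fs0.
have f1 y : flat (S := S) setT (fun t : R => q (m (t, y))) (fun t => s (t, y)).
  exact: (flat_comp fs) (fun _ _ => I) (fun t _ => @continuous_pairr R R y t).
have f2 : flat (S := S) setT (fun y : R => q (m (1, y))) (fun y => s (1, y)).
  exact: (flat_comp fs) (fun _ _ => I) (fun y _ => @continuous_pairl R R y 1).
have E1 : s (1, 0) = s (1, 1).
  have f1' : flat (S := S) setT (fun t : R => q (m (t, 0))) (fun t => s (t, 1)).
    by rewrite (_ : (fun t => _) = fun t => q (m (t, 1))) //; apply: functional_extensionality_dep => t; rewrite mT.
  have cqm : continuous (fun t : R => q (m (t, 0))).
    move=> t; exact: (@for_continuous_comp _ _ _ (fun t : R => (t, 0)) (q \o m) t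
      (@continuous_pairr R R 0 t) (cq' (t, 0))).
  have := @flat_uniq K X S R _ _ _ 0 1 cqm (fun t => lq (mQ (t, 0))) (f1 0) f1'; apply.
  by rewrite !es // /s0 mT.
exists (s (1, 0)); split; first by rewrite (flat_base f2) //= m1 expi0.
have E2 : (fun y : R => q (m (1, y))) = q \o @expi R.
  by apply: functional_extensionality_dep => y; rewrite m1.
rewrite E2 in f2; rewrite {2}E1.
apply: (flat_tr f2 (g := id)) => // t; exact: clamp_continuous.
Qed.
End Puncture.

(** * Homotopies and words in the generators *)

Section HomotopyClamp.
Variables (R : realType) (X : topologicalType).
Implicit Types g h k : R -> X.

Lemma homotopic_clamp g h : homotopic g h <-> exists H : R * R -> X,
  [/\ continuous (fun e : R * R => H (clamp e.1, clamp e.2)),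
      (forall t, 0 <= t <= 1 -> H (t, 0) = g t /\ H (t, 1) = h t)
    & (forall s, 0 <= s <= 1 -> H (0, s) = g 0 /\ H (1, s) = g 1)].
Proof.
split=> -[H [cH e1 e2]].
  exists H; split=> //.
  have cc : continuous (fun e : R * R => (clamp e.1, clamp e.2)).
    move=> e; exact: (for_continuous_pair (for_continuous_clamp (@for_continuous_fst R R e)) (for_continuous_clamp (@for_continuous_snd R R e))).
  have cq : continuous (H \o (fun e : R * R => (clamp e.1, clamp e.2))).
    by apply: (continuous_comp_within cH) => // e; split; rewrite /= in_itv /= clamp_itv.
  exact: cq.
exists (fun e => H (clamp e.1, clamp e.2)); split.
- exact: continuous_subspaceT.
- move=> t t01; have [h0 h1] := e1 t t01.
  by rewrite /= (clamp_id t01) clamp_le0 // clamp_ge1.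
- move=> s s01; have [h0 h1] := e2 s s01.
  by rewrite /= (clamp_id s01) clamp_le0 // clamp_ge1.
Qed.

End HomotopyClamp.

Section HomotopyAlgebra.
Variables (R : realType) (X : topologicalType).
Implicit Types g h k : R -> X.

Let itv01B (t : R) : 0 <= t <= 1 -> 0 <= 1 - t <= 1. Proof. by move=> t01; lra. Qed.
Let clamp0 : clamp (0 : R) = 0. Proof. by rewrite clamp_le0. Qed.
Let clamp1 : clamp (1 : R) = 1. Proof. by rewrite clamp_ge1. Qed.

Lemma homotopic_ends g h : homotopic g h -> h 0 = g 0 /\ h 1 = g 1.
Proof.
move=> [H [_ e1 e2]]; have [_ <-] := e1 0 ltac:(lra); have [_ <-] := e1 1 ltac:(lra).
have [_ <-] := e2 0 ltac:(lra); have [<- _] := e2 1 ltac:(lra).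
by split=> //; have [_ ->] := e2 1 ltac:(lra); have [_ <-] := e2 0 ltac:(lra).
Qed.

Lemma homotopic_comp (Y : topologicalType) (f : X -> Y) g h : continuous f ->
  homotopic g h -> homotopic (f \o g) (f \o h).
Proof.
move=> cf /homotopic_clamp[H [cH e1 e2]]; apply/homotopic_clamp; exists (f \o H); split.
- move=> e; apply: (@for_continuous_comp _ _ _ (fun e : R * R => H (clamp e.1, clamp e.2)) f).
    exact: cH.
  exact: cf.
- by move=> t /e1[/= -> ->].
- by move=> t /e2[/= -> ->].
Qed.

(** straight-line homotopies between reparametrizations *)
Lemma homotopic_reparam g (f1 f2 : R -> R) : cpath g ->
  continuous (f1 \o clamp) -> continuous (f2 \o clamp) ->
  (forall t, 0 <= t <= 1 -> 0 <= f1 t <= 1) -> (forall t, 0 <= t <= 1 -> 0 <= f2 t <= 1) ->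
  f1 0 = f2 0 -> f1 1 = f2 1 -> homotopic (g \o f1) (g \o f2).
Proof.
move=> cg c1 c2 h1 h2 e0 e1; apply/homotopic_clamp.
exists (fun e => g (f1 e.1 + e.2 * (f2 e.1 - f1 e.1))); split.
- have cf : continuous (fun e : R * R => (f1 \o clamp) e.1 + clamp e.2 * ((f2 \o clamp) e.1 - (f1 \o clamp) e.1)).
    move=> e; have d1 := for_continuous_comp (@for_continuous_fst R R e) (@c1 e.1).
    have d2 := for_continuous_comp (@for_continuous_fst R R e) (@c2 e.1).
    exact: (for_continuous_RD d1 (for_continuous_RM (for_continuous_clamp (@for_continuous_snd R R e)) (for_continuous_RB d2 d1))).
  rewrite (_ : (fun e => _) = fun e : R * R => (g \o clamp) ((f1 \o clamp) e.1 + clamp e.2 * ((f2 \o clamp) e.1 - (f1 \o clamp) e.1))).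
    by move=> e; apply: (for_continuous_comp (@cf e)); exact: cg.
  apply: functional_extensionality_dep => e /=; rewrite [X in _ = g X]clamp_id //.
  have /andP[? ?] := h1 _ (clamp_itv e.1); have /andP[? ?] := h2 _ (clamp_itv e.1).
  have /andP[? ?] := clamp_itv e.2; apply/andP; split; nra.
- by move=> t t01 /=; rewrite mul0r addr0 mul1r subrKC.
- by move=> s s01 /=; rewrite -e0 -e1 !subrr !mulr0 !addr0.
Qed.

Lemma homotopic_eq g h : cpath g -> (forall t, 0 <= t <= 1 -> g t = h t) -> homotopic g h.
Proof.
move=> cg gh; apply/homotopic_clamp; exists (fun e => g e.1); split => //.
- move=> e; apply: (@for_continuous_comp _ _ _ (fun e : R * R => e.1) (g \o clamp)).
    exact: for_continuous_fst.
  exact: cg.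
- by move=> t /gh ->.
Qed.

Lemma homotopic_refl g : cpath g -> homotopic g g.
Proof. by move=> cg; apply: homotopic_eq. Qed.

Lemma homotopic_sym g h : homotopic g h -> homotopic h g.
Proof.
move=> gh; have [h0 h1] := homotopic_ends gh; move: gh => /homotopic_clamp[H [cH e1 e2]].
apply/homotopic_clamp; exists (fun e => H (e.1, 1 - e.2)); split.
- move=> e; have c : {for e, continuous (fun e : R * R => (e.1, 1 - e.2))}.
    apply: for_continuous_pair; first exact: for_continuous_fst.
    exact: (for_continuous_RB (@for_continuous_cst (R * R)%type R 1 e) (@for_continuous_snd R R e)).
  rewrite (_ : (fun e => _) = fun e : R * R => H (clamp e.1, clamp (1 - e.2))).
    exact: (@for_continuous_comp _ _ _ _ (fun e => H (clamp e.1, clamp e.2)) _ c (@cH (e.1, 1 - e.2))).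
  by apply: functional_extensionality_dep => u; rewrite clampB.
- by move=> t /e1; rewrite subr0 subrr => -[].
- by move=> s s01; rewrite h0 h1; exact/e2/itv01B.
Qed.

Lemma glue_continuous (E : topologicalType) (f : E -> R) (c : R) (g h : E -> X) :
  continuous f -> continuous g -> continuous h -> (forall e, f e = c -> g e = h e) ->
  continuous (fun e => if f e <= c then g e else h e).
Proof.
move=> cf cg ch gh e P; rewrite nbhs_simpl /=.
have gn Q : nbhs (g e) Q -> \forall e' \near e, Q (g e') by move=> ?; exact: near_continuous (@cg e) _.
have hn Q : nbhs (h e) Q -> \forall e' \near e, Q (h e') by move=> ?; exact: near_continuous (@ch e) _.
have [ec|ec|ec] := ltgtP (f e) c => HP; change (\forall e' \near e, P (if f e' <= c then g e' else h e')).
- by apply: filterS2 (near_continuous (@cf e) (lt_nbhsl ec)) (gn _ HP) => e' /ltW ->.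
- by apply: filterS2 (near_continuous (@cf e) (lt_nbhsr ec)) (hn _ HP) => e'; rewrite ltNge => /negbTE ->.
- have HP' : nbhs (h e) P by rewrite -gh.
  by apply: filterS2 (gn _ HP) (hn _ HP') => e' ? ?; case: ifP.
Qed.

Lemma homotopic_trans g h k : homotopic g h -> homotopic h k -> homotopic g k.
Proof.
move=> gh; have [h0 h1] := homotopic_ends gh; move: gh.
move=> /homotopic_clamp[H [cH e1 e2]] /homotopic_clamp[H' [cH' e1' e2']].
apply/homotopic_clamp; exists (fun e => if e.2 <= 2^-1 then H (e.1, clamp (2 * e.2)) else H' (e.1, clamp (2 * e.2 - 1))).
split.
- have c1 : continuous (fun e : R * R => H (clamp e.1, clamp (2 * clamp e.2))).
    move=> e; apply: (@for_continuous_comp _ _ _ (fun e : R * R => (e.1, 2 * clamp e.2)) (fun e => H (clamp e.1, clamp e.2))); last exact: cH.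
    exact: (for_continuous_pair (@for_continuous_fst R R e) (for_continuous_RM (@for_continuous_cst (R * R)%type R 2 e) (for_continuous_clamp (@for_continuous_snd R R e)))).
  have c2 : continuous (fun e : R * R => H' (clamp e.1, clamp (2 * clamp e.2 - 1))).
    move=> e; apply: (@for_continuous_comp _ _ _ (fun e : R * R => (e.1, 2 * clamp e.2 - 1)) (fun e => H' (clamp e.1, clamp e.2))); last exact: cH'.
    exact: (for_continuous_pair (@for_continuous_fst R R e) (for_continuous_RB (for_continuous_RM (@for_continuous_cst (R * R)%type R 2 e) (for_continuous_clamp (@for_continuous_snd R R e))) (@for_continuous_cst (R * R)%type R 1 e))).
  apply: (glue_continuous (f := fun e : R * R => clamp e.2) _ c1 c2) => [e|e ->].
    exact: (for_continuous_clamp (@for_continuous_snd R R e)).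
  rewrite mulfV ?pnatr_eq0 // subrr clamp1 clamp0.
  have [_ ->] := e1 _ (clamp_itv e.1); by have [-> _] := e1' _ (clamp_itv e.1).
- move=> t t01 /=; rewrite mulr0 clamp_le0 // ltW ?invr_gt0 //.
  have [-> _] := e1 t t01; split=> //; rewrite (_ : (1 <= 2^-1 :> R) = false); last by apply/negbTE; rewrite -ltNge; lra.
  by rewrite clamp_ge1; [have [_ ->] := e1' t t01 | lra].
- move=> s s01 /=; case: ifP => _; first exact/e2/clamp_itv.
  by rewrite -h0 -h1; exact/e2'/clamp_itv.
Qed.

Lemma homotopic_mul g g' h h' : homotopic g g' -> homotopic h h' -> h 1 = g 0 ->
  homotopic (path_mul g h) (path_mul g' h').
Proof.
move=> /homotopic_clamp[H [cH e1 e2]] /homotopic_clamp[H' [cH' e1' e2']] hg.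
apply/homotopic_clamp; exists (fun e => if e.1 <= 2^-1 then H' (clamp (2 * e.1), e.2) else H (clamp (2 * e.1 - 1), e.2)).
split.
- have c1 : continuous (fun e : R * R => H' (clamp (2 * clamp e.1), clamp e.2)).
    move=> e; apply: (@for_continuous_comp _ _ _ (fun e : R * R => (2 * clamp e.1, e.2)) (fun e => H' (clamp e.1, clamp e.2))); last exact: cH'.
    exact: (for_continuous_pair (for_continuous_RM (@for_continuous_cst (R * R)%type R 2 e) (for_continuous_clamp (@for_continuous_fst R R e))) (@for_continuous_snd R R e)).
  have c2 : continuous (fun e : R * R => H (clamp (2 * clamp e.1 - 1), clamp e.2)).
    move=> e; apply: (@for_continuous_comp _ _ _ (fun e : R * R => (2 * clamp e.1 - 1, e.2)) (fun e => H (clamp e.1, clamp e.2))); last exact: cH.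
    exact: (for_continuous_pair (for_continuous_RB (for_continuous_RM (@for_continuous_cst (R * R)%type R 2 e) (for_continuous_clamp (@for_continuous_fst R R e))) (@for_continuous_cst (R * R)%type R 1 e)) (@for_continuous_snd R R e)).
  apply: (glue_continuous (f := fun e : R * R => clamp e.1) _ c1 c2) => [e|e ->].
    exact: (for_continuous_clamp (@for_continuous_fst R R e)).
  rewrite mulfV ?pnatr_eq0 // subrr clamp1 clamp0.
  have [_ ->] := e2' _ (clamp_itv e.2); by have [-> _] := e2 _ (clamp_itv e.2).
- move=> t t01 /=; rewrite /path_mul; case: ifP => t2.
    by rewrite clamp_id; [apply: e1'; lra | lra].
  have {}t2 : 2^-1 < t by rewrite ltNge t2.
  by rewrite clamp_id; [apply: e1; lra | lra].
- move=> s s01 /=; rewrite /path_mul mulr0 clamp_le0 // ltW ?invr_gt0 //.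
  rewrite (_ : (1 <= 2^-1 :> R) = false); last by apply/negbTE; rewrite -ltNge; lra.
  have [-> _] := e2' s s01; rewrite clamp_ge1; last by lra.
  by have [_ ->] := e2 s s01; rewrite (_ : 2 * 1 - 1 = 1 :> R); last by ring.
Qed.

Let half_le : (1 <= 2^-1 :> R) = false.
Proof. by apply/negbTE; rewrite -ltNge; lra. Qed.

Lemma path_mul0 g h : path_mul g h 0 = h 0.
Proof. by rewrite /path_mul invr_ge0 ler0n mulr0. Qed.

Lemma path_mul1 g h : path_mul g h 1 = g 1.
Proof. by rewrite /path_mul half_le mulr1 (_ : 2 - 1 = 1 :> R) //; lra. Qed.

Lemma cpath_is_path g : cpath g -> is_path g (g 0) (g 1).
Proof.
move=> cg; split=> //; apply/subspace_continuousP => t t01 P HP.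
have t01' : 0 <= t <= 1 by move: t01; rewrite /= in_itv.
have HP' : nbhs ((g \o clamp) t) P by rewrite /= clamp_id.
rewrite /within /=; change (\forall u \near t, `[0, 1]%classic u -> P (g u)).
have := near_continuous (@cg t) HP'; apply: filterS => u /= Pu.
by rewrite in_itv /= => u01; rewrite clamp_id in Pu.
Qed.

Lemma homotopic_reparam_continuous g (f1 f2 : R -> R) : cpath g -> continuous f1 -> continuous f2 ->
  (forall t, 0 <= t <= 1 -> 0 <= f1 t <= 1) -> (forall t, 0 <= t <= 1 -> 0 <= f2 t <= 1) ->
  f1 0 = f2 0 -> f1 1 = f2 1 -> homotopic (g \o f1) (g \o f2).
Proof.
move=> cg c1 c2; apply: homotopic_reparam => // t.
  exact: (for_continuous_comp (@clamp_continuous R t) (@c1 _)).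
exact: (for_continuous_comp (@clamp_continuous R t) (@c2 _)).
Qed.

Let bent_continuous (c a1 b1 a2 b2 : R) : a1 * c + b1 = a2 * c + b2 ->
  continuous (fun t : R => if t <= c then a1 * t + b1 else a2 * t + b2).
Proof. by move=> e; apply: continuous_glue => //; exact: affine_continuous. Qed.

Let id_continuous : continuous (fun t : R => t).
Proof. by move=> t; exact: for_continuous_id. Qed.

Let cst0_continuous (c : R) : continuous (fun _ : R => c).
Proof. by move=> t; exact: for_continuous_cst. Qed.

Lemma homotopic_inv_mul g : cpath g -> homotopic (path_mul (path_inv g) g) (cst (g 0)).
Proof.
move=> cg.
have -> : path_mul (path_inv g) g = g \o (fun t => if t <= 2^-1 then 2 * t + 0 else - 2 * t + 2).
  apply: functional_extensionality_dep => t; rewrite /path_mul /path_inv /=.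
  by case: ifP => _; congr g; ring.
apply: (homotopic_reparam_continuous cg (f2 := fun=> 0)).
- by apply: bent_continuous; field.
- exact: cst0_continuous.
- by move=> t t01; case: ifP => h; [lra | have {}h := negbT h; rewrite -ltNge in h; lra].
- by move=> t _; lra.
- by rewrite ifT ?mulr0 ?addr0 // invr_ge0.
- by rewrite half_le; ring.
Qed.

Lemma path_invK g : path_inv (path_inv g) = g.
Proof. by apply: functional_extensionality_dep => t; rewrite /path_inv subKr. Qed.

Lemma homotopic_mul_inv g : cpath g -> homotopic (path_mul g (path_inv g)) (cst (g 1)).
Proof.
by move=> cg; have := homotopic_inv_mul (cpath_inv cg); rewrite path_invK /path_inv subr0.
Qed.

Lemma homotopic_mul1 g : cpath g -> homotopic (path_mul g (cst (g 0))) g.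
Proof.
move=> cg.
have -> : path_mul g (cst (g 0)) = g \o (fun t => if t <= 2^-1 then 0 * t + 0 else 2 * t + (- 1)).
  by apply: functional_extensionality_dep => t; rewrite /path_mul /=; case: ifP => _ //=; rewrite mul0r addr0.
apply: (homotopic_reparam_continuous cg (f2 := fun t => t)) => //.
- by apply: bent_continuous; field.
- by move=> t t01; case: ifP => h; [lra | have {}h := negbT h; rewrite -ltNge in h; lra].
- by rewrite ifT ?mulr0 ?addr0 // invr_ge0.
- by rewrite half_le; ring.
Qed.

Lemma homotopic_1mul g : cpath g -> homotopic (path_mul (cst (g 1)) g) g.
Proof.
move=> cg.
have -> : path_mul (cst (g 1)) g = g \o (fun t => if t <= 2^-1 then 2 * t + 0 else 0 * t + 1).
  apply: functional_extensionality_dep => t; rewrite /path_mul /=; case: ifP => _ //=; congr g; ring.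
apply: (homotopic_reparam_continuous cg (f2 := fun t => t)) => //.
- by apply: bent_continuous; field.
- by move=> t t01; case: ifP => h; [lra | have {}h := negbT h; rewrite -ltNge in h; lra].
- by rewrite ifT ?mulr0 ?addr0 // invr_ge0.
- by rewrite half_le; ring.
Qed.

Lemma homotopic_mulA g h k : cpath g -> cpath h -> cpath k -> k 1 = h 0 -> h 1 = g 0 ->
  homotopic (path_mul (path_mul g h) k) (path_mul g (path_mul h k)).
Proof.
move=> cg ch ck kh hg.
have cp : cpath (path_mul (path_mul g h) k).
  by apply: cpath_mul => //; [exact: cpath_mul | rewrite path_mul0].
(* The two bracketings differ by the piecewise linear change of parameter that sends 1/4 to 1/2 and
   1/2 to 3/4. *)
have -> : path_mul g (path_mul h k) = path_mul (path_mul g h) k \o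
    (fun t => if t <= 2^-1 then if t <= 4^-1 then 2 * t + 0 else 1 * t + 4^-1 else 2^-1 * t + 2^-1).
  apply: functional_extensionality_dep => t; rewrite /path_mul /=.
  have [t2|t2] := lerP t 2^-1; have [t4|t4] := lerP t 4^-1.
  - by rewrite !ifT; [congr k; ring | lra | lra].
  - rewrite ifF; last by apply/negbTE; rewrite -ltNge; lra.
    rewrite ifF; last by apply/negbTE; rewrite -ltNge; lra.
    by rewrite ifT; [congr h; field | lra].
  - have t2' : t < 2^-1 by lra.
    by move: t2; rewrite ltNge ltW.
  - rewrite ifF; last by apply/negbTE; rewrite -ltNge; lra.
    rewrite ifF; last by apply/negbTE; rewrite -ltNge; lra.
    by congr g; field.
have := homotopic_reparam_continuous cp (f1 := fun t => t); apply => //.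
- apply: (continuous_glue (g := fun t => if t <= 4^-1 then 2 * t + 0 else 1 * t + 4^-1)).
  + by apply: bent_continuous; field.
  + exact: affine_continuous.
  + by rewrite ifF; [field | apply/negbTE; rewrite -ltNge; lra].
- move=> t t01; case: ifP => h2; first by case: ifP => h4; lra.
  lra.
- by rewrite !ifT ?invr_ge0 // mulr0 addr0.
- by rewrite half_le; field.
Qed.

(** The case [b < a] is allowed and gives the piece run backwards. *)
Definition subpath g (a b t : R) := g (a + t * (b - a)).

Lemma subpath_cpath g a b : cpath g -> 0 <= a <= 1 -> 0 <= b <= 1 -> cpath (subpath g a b).
Proof.
move=> cg a01 b01.
rewrite /cpath (_ : _ \o _ = (g \o clamp) \o (fun t => a + clamp t * (b - a))).
  move=> t; apply: (@for_continuous_comp _ _ _ (fun t => a + clamp t * (b - a)) (g \o clamp)); last exact: cg.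
  exact: (for_continuous_RD (@for_continuous_cst _ _ a t) (for_continuous_RM (for_continuous_clamp (@for_continuous_id _ t)) (@for_continuous_cst _ _ (b - a) t))).
apply: functional_extensionality_dep => t; rewrite /subpath /= [in RHS]clamp_id //.
have /andP[? ?] := clamp_itv t; case/andP: a01 => ? ?; case/andP: b01 => ? ?.
apply/andP; split; nra.
Qed.

Lemma homotopic_subpath g a b c : cpath g -> 0 <= a <= 1 -> 0 <= b <= 1 -> 0 <= c <= 1 ->
  homotopic (path_mul (subpath g b c) (subpath g a b)) (subpath g a c).
Proof.
move=> cg /andP[a0 a1] /andP[b0 b1] /andP[c0 c1].
have -> : path_mul (subpath g b c) (subpath g a b) =
    g \o (fun t => if t <= 2^-1 then (2 * (b - a)) * t + a else (2 * (c - b)) * t + (2 * b - c)).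
  by apply: functional_extensionality_dep => t; rewrite /path_mul /subpath /=; case: ifP => _; congr g; ring.
have -> : subpath g a c = g \o (fun t => (c - a) * t + a).
  by apply: functional_extensionality_dep => t; rewrite /subpath /=; congr g; ring.
apply: (homotopic_reparam_continuous cg).
- by apply: bent_continuous; field.
- exact: affine_continuous.
- move=> t /andP[t0 t1]; case: ifP => h; first by apply/andP; split; nra.
  by have {}h := negbT h; rewrite -ltNge in h; apply/andP; split; nra.
- by move=> t /andP[t0 t1]; apply/andP; split; nra.
- by rewrite ifT ?invr_ge0 // !mulr0.
- by rewrite half_le; ring.
Qed.
End HomotopyAlgebra.

Section Words.
Variables (R : realType) (X : topologicalType) (n : nat) (g : 'I_n -> R -> X) (a : X).
Hypothesis gl : forall i, is_path (g i) a a.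
Implicit Types (l : 'I_n * bool) (w : seq ('I_n * bool)).
Notation wp := (word_path g a).

Definition letter_path l : R -> X := if l.2 then path_inv (g l.1) else g l.1.
Definition letter_inv l := (l.1, ~~ l.2).
Definition word_inv w := rev [seq letter_inv l | l <- w].

Lemma word_path_cons l w : wp (l :: w) = path_mul (letter_path l) (wp w).
Proof. by []. Qed.

Lemma letter_path_loop l : [/\ cpath (letter_path l), letter_path l 0 = a & letter_path l 1 = a].
Proof.
have [_ g0 g1] := gl l.1; have cg := is_path_cpath (gl l.1).
rewrite /letter_path; case: l.2; split=> //; first exact: cpath_inv.
  by rewrite /path_inv subr0.
by rewrite /path_inv subrr.
Qed.

Lemma word_path_loop w : [/\ cpath (wp w), wp w 0 = a & wp w 1 = a].
Proof.
elim: w => [|l w [IH1 IH2 IH3]]; first by split=> // t; exact: cst_continuous.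
have [l1 l2 l3] := letter_path_loop l.
by rewrite word_path_cons; split; rewrite ?path_mul0 ?path_mul1 //; apply: cpath_mul; rewrite // IH3.
Qed.

Lemma word_path_cat w w' : homotopic (wp (w ++ w')) (path_mul (wp w) (wp w')).
Proof.
have [c' a' b'] := word_path_loop w'.
elim: w => [|l w IH].
  by apply: homotopic_sym; have := homotopic_1mul c'; rewrite b'.
have [c0 a0 b0] := word_path_loop w; have [c1 a1 b1] := letter_path_loop l.
rewrite cat_cons !word_path_cons.
apply: (@homotopic_trans _ _ _ (path_mul (letter_path l) (path_mul (wp w) (wp w')))).
  by apply: homotopic_mul IH _; [exact: homotopic_refl | have [_ _ ->] := word_path_loop (w ++ w')].
by apply/homotopic_sym/homotopic_mulA => //; rewrite ?b' ?b0.
Qed.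

Lemma letter_pathV l : letter_path (letter_inv l) = path_inv (letter_path l).
Proof. by rewrite /letter_path /=; case: l.2 => //=; rewrite path_invK. Qed.

Lemma letter_path_cancel l : homotopic (path_mul (letter_path l) (letter_path (letter_inv l))) (cst a).
Proof.
have [c1 a1 b1] := letter_path_loop l.
by rewrite letter_pathV; have := homotopic_mul_inv c1; rewrite b1.
Qed.

Lemma word_path_cancel w l w' : homotopic (wp (w ++ l :: letter_inv l :: w')) (wp (w ++ w')).
Proof.
have [c0 a0 b0] := word_path_loop w; have [c' a' b'] := word_path_loop w'.
have [cl al bl] := letter_path_loop l; have [cl' al' bl'] := letter_path_loop (letter_inv l).
apply: (homotopic_trans (word_path_cat _ _)); apply: homotopic_sym.
apply: (homotopic_trans (word_path_cat _ _)); apply: homotopic_sym.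
apply: homotopic_mul; [exact: homotopic_refl | | by have [_ _ ->] := word_path_loop (l :: letter_inv l :: w')].
rewrite !word_path_cons.
apply: (@homotopic_trans _ _ _ (path_mul (path_mul (letter_path l) (letter_path (letter_inv l))) (wp w'))).
  by apply/homotopic_sym/homotopic_mulA => //; rewrite ?b' ?bl'.
apply: (@homotopic_trans _ _ _ (path_mul (cst a) (wp w'))).
  apply: homotopic_mul; [exact: letter_path_cancel | exact: homotopic_refl |].
  by rewrite path_mul0 b'.
by have := homotopic_1mul c'; rewrite b'.
Qed.

Lemma word_path_inv w : homotopic (wp (word_inv w)) (path_inv (wp w)).
Proof.
elim: w => [|l w IH].
  by apply: homotopic_eq => // t; exact: cst_continuous.
have [c0 a0 b0] := word_path_loop w; have [c1 a1 b1] := letter_path_loop l.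
have [cv av bv] := word_path_loop (word_inv w).
have [cl al bl] := letter_path_loop (letter_inv l).
rewrite /word_inv map_cons rev_cons -cats1 -/(word_inv w).
apply: (homotopic_trans (word_path_cat _ _)).
apply: (@homotopic_trans _ _ _ (path_mul (path_inv (wp w)) (path_inv (letter_path l)))).
  apply: homotopic_mul => //; last by have [_ _ ->] := word_path_loop [:: letter_inv l].
  by rewrite -letter_pathV word_path_cons; have := homotopic_mul1 cl; rewrite al.
apply: homotopic_eq.
  apply: cpath_mul; [exact: cpath_inv | exact: cpath_inv|].
  by rewrite /path_inv subr0 subrr b0 a1.
move=> t _; rewrite word_path_cons /path_mul /path_inv.
have [t2|t2|->] := ltgtP t 2^-1.
- by rewrite ifF; [congr (letter_path l); ring | apply/negbTE; rewrite -ltNge; lra].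
- by rewrite ifT; [congr (wp w); ring | lra].
rewrite ifT; last by lra.
have -> : 1 - 2 * 2^-1 = 0 :> R by field.
have -> : 2 * (1 - 2^-1) = 1 :> R by field.
by rewrite b0 a1.
Qed.

Section Action.
Variables (M : Type) (act1 : 'I_n * bool -> M -> M).
Hypothesis act1K : forall l m, act1 (letter_inv l) (act1 l m) = m.

(** The first letter acts first although its path is run last; this is the action from the right for
    the given product of paths. *)
Definition act w m := foldl (fun m l => act1 l m) m w.

Lemma act_cat w w' m : act (w ++ w') m = act w' (act w m).
Proof. exact: foldl_cat. Qed.

Lemma act_inv w m : act (word_inv w) (act w m) = m.
Proof.
elim: w m => //= l w IH m; rewrite /word_inv map_cons rev_cons -cats1 act_cat.
by rewrite -/(word_inv w) IH /= act1K.
Qed.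

Lemma unreduced w : ~~ reduced_word w -> exists w1 l w2, w = w1 ++ l :: letter_inv l :: w2.
Proof.
rewrite /reduced_word; case: w => //= l w; elim: w l => //= l' w IH l.
rewrite negb_and negbK => /orP[/andP[/eqP e1 /eqP e2]|/IH[w1 [k [w2 E]]]].
  exists [::], l, w => /=; congr (_ :: _ :: _); rewrite /letter_inv.
  by case: l l' e1 e2 => [i b] [j c] /= -> h; congr pair; case: b c h => [] [].
by exists (l :: w1), k, w2; rewrite /= E.
Qed.

Hypothesis free : forall w, reduced_word w -> homotopic (wp w) (cst a) -> w = [::].

(** Removing a letter next to its inverse shortens the word and changes neither its action nor its
    homotopy class; a reduced null-homotopic word is empty by freeness. *)
Lemma act_null w m : homotopic (wp w) (cst a) -> act w m = m.
Proof.
have [k] := ubnP (size w); elim: k w m => // k IH w m sw Hw.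
have [rw|/unreduced[w1 [l [w2 E]]]] := boolP (reduced_word w).
  by rewrite (free rw Hw).
rewrite E act_cat /= act1K -act_cat; apply: IH.
  by move: sw; rewrite E !size_cat /= !addnS ltnS => /ltnW.
by apply: homotopic_trans Hw; apply/homotopic_sym; rewrite E; exact: word_path_cancel.
Qed.

Lemma act_homotopic w w' m : homotopic (wp w) (wp w') -> act w m = act w' m.
Proof.
move=> ww'; have [c a1 b] := word_path_loop w; have [c' a1' b'] := word_path_loop w'.
rewrite -[RHS](act_null (w := word_inv w' ++ w)).
  by rewrite act_cat act_inv.
apply: (homotopic_trans (word_path_cat _ _)).
apply: (@homotopic_trans _ _ _ (path_mul (path_inv (wp w')) (wp w'))).
  by apply: homotopic_mul => //; [exact: word_path_inv | have [_ -> _] := word_path_loop (word_inv w')].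
by have := homotopic_inv_mul c'; rewrite a1'.
Qed.
End Action.
End Words.

(** * Sections on punctured discs *)

Section CofinitePlane.
Variables (R : realType) (A : set (R[i])^o) (Ls : seq (R[i])^o).
Local Notation C := ((R[i])^o).
Hypothesis AL : forall z, A z <-> z \notin Ls.

Let dist_above (L : seq C) (c : C) (r : R) : (forall z, z \in L -> z = c \/ r < nC (z - c)) ->
  exists2 r', r < r' & forall z, z \in L -> z = c \/ r' <= nC (z - c).
Proof.
elim: L => [|a L IH] H; first by exists (r + 1); [lra|].
have [r' rr' H'] := IH (fun z zL => H z (mem_behead (s := a :: L) zL)).
have [ac|ra] := H a (mem_head _ _).
  by exists r' => // z; rewrite inE => /orP[/eqP ->|/H'//]; left.
exists (Num.min r' (nC (a - c))); first by rewrite lt_min rr' ra.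
move=> z; rewrite inE => /orP[/eqP ->|/H'[->|h]]; first by right; rewrite ge_min lexx orbT.
  by left.
by right; rewrite ge_min h.
Qed.

Let dist_below (L : seq C) (r : R) : 0 < r -> (forall z, z \in L -> nC z < r) ->
  exists r', [/\ 0 < r', r' < r & forall z, z \in L -> nC z <= r'].
Proof.
move=> r0; elim: L => [|a L IH] H; first by exists (r / 2); split=> //; lra.
have [r' [r'0 rr' H']] := IH (fun z zL => H z (mem_behead (s := a :: L) zL)).
have ar := H a (mem_head _ _).
exists (Num.max r' (nC a)); split; first by rewrite lt_max r'0.
  by rewrite gt_max rr' ar.
by move=> z; rewrite inE => /orP[/eqP ->|/H' h]; rewrite le_max ?lexx ?orbT // h.
Qed.

(** Only finitely many points are removed, so what holds on a closed disc holds on a slightly larger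
    one. After rescaling this gives the radius greater than 1 that [puncture] and [circle_fix] need
    around the unit circle. *)
Lemma punctured_disc_extend (c : C) (r : R) : (forall z : C, 0 < nC (z - c) <= r -> A z) ->
  exists2 r', r < r' & forall z : C, 0 < nC (z - c) < r' -> A z.
Proof.
move=> H; have [|r' rr' H'] := @dist_above Ls c r.
  move=> z zL; have [->|zc] := eqVneq z c; first by left.
  right; rewrite ltNge; apply/negP => h.
  have /AL : A z by apply: H; rewrite h andbT -nC_neq.
  by rewrite zL.
exists r' => // z /andP[z0 zr]; apply/AL/negP => /H'[zc|]; last by rewrite leNgt zr.
by rewrite zc subrr nC0 ltxx in z0.
Qed.

Lemma disc_extend (c : C) (r : R) : (forall z : C, nC (z - c) <= r -> A z) ->
  exists2 r', r < r' & forall z : C, nC (z - c) < r' -> A z.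
Proof.
move=> H; have [|r' rr' H'] := @punctured_disc_extend c r; first by move=> z /andP[_]; exact: H.
have [r0|r0] := lerP 0 r.
  exists r' => // z zr; have [->|zc] := eqVneq z c; first by apply: H; rewrite subrr nC0.
  by apply: H'; rewrite -nC_neq zc.
exists (r / 2); first lra.
by move=> z zr; have := nC_ge0 (z - c) => ?; exfalso; lra.
Qed.

Lemma outside_extend (r : R) : 0 < r -> (forall z : C, r <= nC z -> A z) ->
  exists r', [/\ 0 < r', r' < r & forall z : C, r' < nC z -> A z].
Proof.
move=> r0 H; have [z zL|r' [r'0 rr' H']] := @dist_below Ls r r0.
  by rewrite ltNge; apply/negP => /H/AL; rewrite zL.
exists r'; split=> // z zr; apply/AL/negP => /H'; by rewrite leNgt zr.
Qed.

Lemma point_ball (z : A) (P : A -> Prop) : (\forall w \near z, P w) ->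
  exists r : R, [/\ 0 < r, forall w : C, nC (w - \val z) < r -> A w
    & forall w : A, nC (\val w - \val z) < r -> P w].
Proof.
move=> /nbhs_subP/nbhs_nC[r1 r10 H1].
have [r [r0 Hr]] : exists2 r : R, 0 < r & forall w : C, nC (w - \val z) < r -> A w.
  have [|r r0 Hr] := @disc_extend (\val z) 0; last by exists r.
  move=> w w0; have /eqP : nC (w - \val z) = 0 by apply: le_anti; rewrite w0 nC_ge0.
  by rewrite nC_eq0 subr_eq0 => /eqP ->; exact: setP_val.
exists (Num.min r r1); split; first by rewrite lt_min r0 r10.
  by move=> w; rewrite lt_min => /andP[/Hr].
by move=> w; rewrite lt_min => /andP[_ /H1]; apply.
Qed.

Section ConvexPaths.
Variables (Q : set C) (w0 : A).
Hypotheses (vQ : convex_in Q) (QA : Q `<=` A).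

Definition segment (a b : A) (t : R) : A := insubd w0 (segment_path (\val a) (\val b) t).

Lemma segment_val a b t : Q (\val a) -> Q (\val b) -> 0 <= t <= 1 ->
  \val (segment a b t) = segment_path (\val a) (\val b) t.
Proof. by move=> Qa Qb t01; rewrite /segment insubdK //; apply/mem_set/QA/vQ. Qed.

Lemma segment_in a b t : Q (\val a) -> Q (\val b) -> 0 <= t <= 1 -> Q (\val (segment a b t)).
Proof. by move=> Qa Qb t01; rewrite segment_val //; exact: vQ. Qed.

Lemma segment0 a b : segment a b 0 = a.
Proof. by rewrite /segment segment_path0 valKd. Qed.

Lemma segment1 a b : segment a b 1 = b.
Proof. by rewrite /segment segment_path1 valKd. Qed.

Lemma segment_cpath a b : Q (\val a) -> Q (\val b) -> cpath (segment a b).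
Proof.
move=> Qa Qb t; apply/for_continuous_val.
rewrite (_ : (fun e => _) = segment_path (\val a) (\val b) \o clamp); first exact: segment_path_cpath.
by apply: functional_extensionality_dep => u /=; rewrite segment_val // clamp_itv.
Qed.

Lemma homotopic_convex (g h : R -> A) : cpath g -> cpath h ->
  (forall t, 0 <= t <= 1 -> Q (\val (g t))) -> (forall t, 0 <= t <= 1 -> Q (\val (h t))) ->
  g 0 = h 0 -> g 1 = h 1 -> homotopic g h.
Proof.
move=> cg ch gQ hQ e0 e1; apply/homotopic_clamp.
exists (fun e => segment (g e.1) (h e.1) e.2); split.
- move=> e; apply/for_continuous_val.
  rewrite (_ : (fun e => _) = fun e : R * R => (\val ((g \o clamp) e.1) : C) +
      (clamp e.2)%:C%C * (\val ((h \o clamp) e.1) - \val ((g \o clamp) e.1))).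
    have c1 := for_continuous_comp (@for_continuous_fst R R e) ((for_continuous_val _ _).1 (@cg e.1)).
    have c2 := for_continuous_comp (@for_continuous_fst R R e) ((for_continuous_val _ _).1 (@ch e.1)).
    have c3 := for_continuous_RC (for_continuous_clamp (@for_continuous_snd R R e)).
    exact: (for_continuous_CD c1 (for_continuous_CM c3 (for_continuous_CB c2 c1))).
  apply: functional_extensionality_dep => u /=; rewrite segment_val ?clamp_itv //.
    exact/gQ/clamp_itv.
  exact/hQ/clamp_itv.
- by move=> t t01; rewrite /= segment0 segment1.
- by move=> s s01 /=; rewrite -e0 -e1 /segment /segment_path !subrr !mulr0 !addr0 !valKd.
Qed.
End ConvexPaths.
End CofinitePlane.

Section ChartSection.
Variables (K : fieldType) (X E : topologicalType) (S : et K X) (Q : set E) (q : E -> X) (s : E -> tot S).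

(** Turns a lift along [q] into a section of [S], by means of a continuous [h] with
    [q (h z) = z]. *)
Lemma chart_section (B : set X) (h : X -> E) : flat (S := S) Q q s ->
  (forall z, B z -> [/\ Q (h z), q (h z) = z, nbhs z B & {for z, continuous h}]) ->
  exists tau, forall z, B z -> sc S tau z.
Proof.
move=> fs HB; exists (fun z => tot_at (s (h z)) z) => z Bz.
have [Qz qz Bn ch] := HB z Bz; have [sg Hsg Es] := fs _ Qz.
rewrite qz in Hsg; apply: sc_loc Hsg.
apply: filterS2 (near_continuous ch Es) Bn => z' E' /HB[_ qz' _ _].
by rewrite E' qz' tot_atE.
Qed.
End ChartSection.

Section TorsorTransport.
Variables (K : fieldType) (X : topologicalType) (F : sheaf K X) (R : realType).
Variable T : torsor F.
Implicit Types g : R -> X.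
Notation trF g := (tr (S := sheaf_et F) (R := R) g).
Notation trT g := (tr (S := torsor_et T) (R := R) g).
Notation pt z v := (PT F z v).

Let addE (s t : sections F) z : tsc T s z -> secat t z -> tsc T (1 *: t + s) z.
Proof. by move=> Hs Ht; rewrite scale1r addrC; exact: tsc_add. Qed.

Let subE (t s : sections F) z : tsc T t z -> tsc T s z -> secat (-1 *: t + s) z.
Proof. by move=> Ht Hs; rewrite scaleN1r addrC; exact: tsc_sub Hs Ht. Qed.

Lemma tr_add g a b (f : F a) (f' : F b) (u : F a) (u' : F b) :
  trT g (pt a f) (pt b f') -> trF g (pt a u) (pt b u') -> trT g (pt a (f + u)) (pt b (f' + u')).
Proof.
move=> tf tu.
have := tr_comb (@tsc_near _ _ _ T) (@tsc_loc _ _ _ T) (fun s t z hs ht => addE ht hs) tu tf.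
by rewrite !scale1r ![u + _]addrC ![u' + _]addrC.
Qed.

Lemma tr_sub g a b (f f1 : F a) (f' f1' : F b) :
  trT g (pt a f) (pt b f') -> trT g (pt a f1) (pt b f1') -> trF g (pt a (f - f1)) (pt b (f' - f1')).
Proof.
move=> tf tu.
have := tr_comb (@secat_near _ _ F) (@secat_local _ _ F) subE tu tf.
by rewrite !scaleN1r ![- _ + _]addrC.
Qed.
End TorsorTransport.

Section LoopConjugation.
Variables (K : fieldType) (X : topologicalType) (S : et K X) (R : realType).
Hypothesis lS : forall z, lc S z.
Variables (b : X) (g k c : R -> X).
Hypotheses (cb : is_path c b (k 0)) (ck : cpath k) (k1 : k 1 = k 0)
  (gk : homotopic g (path_mul (path_inv c) (path_mul k c))).

Let cc : cpath c := is_path_cpath cb.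
Let c0 : c 0 = b. Proof. by case: cb. Qed.
Let c1 : c 1 = k 0. Proof. by case: cb. Qed.
Let ckc : cpath (path_mul k c). Proof. exact: cpath_mul. Qed.
Let cV : cpath (path_inv c). Proof. exact: cpath_inv. Qed.
Let ckcV : cpath (path_mul (path_inv c) (path_mul k c)).
Proof. by apply: cpath_mul => //; rewrite path_mul1 k1 /path_inv subr0. Qed.

Lemma conj_fixed_circle (d : tot S) : projT1 d = b -> tr (S := S) g d d ->
  exists a, projT1 a = k 0 /\ tr (S := S) k a a.
Proof.
move=> db /(tr_homotopic lS gk) td.
have [a ak ca] := tr_total (g := c) lS cc (etrans db (esym c0)).
have [a' ak' ka] := tr_total lS ck (etrans ak c1).
have [e eb Ve] := tr_total lS cV (etrans ak' (etrans k1 (esym (etrans (congr1 c (subr0 1)) c1)))).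
have te := tr_mul lS cV (tr_mul lS ck ca ka) Ve.
have de := tr_uniq lS ckcV td te; rewrite -de in Ve.
have := tr_inv Ve; rewrite path_invK => ca'.
exists a; split; first by rewrite ak.
by rewrite {2}(tr_uniq lS cc ca ca').
Qed.

Lemma circle_fixed_conj (a : tot S) : projT1 a = k 0 -> tr (S := S) k a a ->
  exists d, projT1 d = b /\ tr (S := S) g d d.
Proof.
move=> ak ka.
have [d db Vd] := tr_total lS cV (etrans ak (esym (etrans (congr1 c (subr0 1)) c1))).
exists d; split; first by rewrite db /path_inv subrr.
apply: (tr_homotopic lS (homotopic_sym gk)).
have := tr_inv Vd; rewrite path_invK => cd.
exact: (tr_mul lS cV (tr_mul lS ck cd ka) Vd).
Qed.

Lemma tr_conj (a d d' : tot S) (a' : tot S) : tr (S := S) c d a -> tr (S := S) k a a' ->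
  tr (S := S) c d' a' -> tr (S := S) g d d'.
Proof.
move=> cd ka cd'; apply: (tr_homotopic lS (homotopic_sym gk)).
exact: (tr_mul lS cV (tr_mul lS ck cd ka) (tr_inv cd')).
Qed.
End LoopConjugation.

Section ParabolicLoops.
Variables (R : realType) (K : fieldType) (A : set (R[i])^o) (Ls : seq (R[i])^o).
Local Notation C := ((R[i])^o).
Hypothesis AL : forall z, A z <-> z \notin Ls.
Variables (S : et K A) (b : A) (g : R -> A).
Hypothesis lS : forall z, lc S z.
Notation expi := (@expi R).

Let chart (f : C -> C) (w0 : A) (w : C) : A := insubd w0 (f w).

Let chartE f w0 w : A (f w) -> \val (chart f w0 w) = f w.
Proof. by move=> Aw; rewrite /chart insubdK //; exact: mem_set. Qed.

Let chart_continuous f w0 w : {for w, continuous f} -> nbhs w (fun w => A (f w)) ->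
  {for w, continuous (chart f w0)}.
Proof.
move=> cf Aw; apply/for_continuous_val => P; rewrite chartE; last exact: nbhs_singleton Aw.
move=> HP; change (\forall w' \near w, P (\val (chart f w0 w'))).
by apply: filterS2 Aw (near_continuous cf HP) => w' Aw' Pw'; rewrite chartE.
Qed.

Let annulus_open (r : R) (w : C) : 0 < nC w < r -> nbhs w [set w : C | 0 < nC w < r].
Proof.
move=> /andP[w0 wr]; apply/nbhs_nC; exists (Num.min (nC w) (r - nC w)).
  by rewrite lt_min w0 subr_gt0.
move=> w'; rewrite lt_min => /andP[h1 h2]; have := nCD (w - w') w'; rewrite subrK nCB => h3.
have := nCD (w' - w) w; rewrite subrK => h4; apply/andP; split; lra.
Qed.

Section Affine.
Variables (c : C) (k : R -> A) (r : R).
Hypotheses (r0 : 0 < r) (rA : forall z : C, 0 < nC (z - c) <= r -> A z)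
  (kr : nC (\val (k 0) - c) = r)
  (kE : forall t, 0 <= t <= 1 -> \val (k t) = c + (\val (k 0) - c) * expi t).

Let e : C := \val (k 0) - c.
Let f (w : C) : C := c + e * w.
Let fc w : f w - c = e * w. Proof. by rewrite /f addrC addKr. Qed.
Let nfc w : nC (f w - c) = r * nC w. Proof. by rewrite fc nCM kr. Qed.
Let cf (w : C) : {for w, continuous f}.
Proof. exact: (for_continuous_CD (@for_continuous_cst _ _ c w) (for_continuous_CM (@for_continuous_cst _ _ e w) (@for_continuous_id _ w))). Qed.
Let e0 : e != 0. Proof. by rewrite -nC_gt0 kr. Qed.

Let wide : exists2 r', 1 < r' & forall w : C, 0 < nC w < r' -> A (f w).
Proof.
have [r' rr' H] := punctured_disc_extend AL rA.
exists (r' / r); first by rewrite ltr_pdivlMr // mul1r.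
move=> w /andP[w0 wr]; apply: H; rewrite nfc mulr_gt0 //=.
by rewrite ltr_pdivlMr // in wr; rewrite mulrC.
Qed.

Let kf t : 0 <= t <= 1 -> k t = (chart f (k 0) \o expi) t.
Proof.
move=> t01; apply: val_inj; rewrite /= chartE; first exact: kE.
by apply: rA; rewrite nfc nC_expi mulr1 r0 lexx.
Qed.

Let inv (z : A) : C := (\val z - c) / e.

Let inv_continuous z : {for z, continuous inv}.
Proof.
have c1 : {for z, continuous (fun z : A => \val z : C)} by exact: val_continuous.
exact: (for_continuous_CM (for_continuous_CB c1 (@for_continuous_cst _ _ c z)) (@for_continuous_cst _ _ e^-1 z)).
Qed.

Let inv_chart (z : A) : chart f (k 0) (inv z) = z.
Proof.
have E : f (inv z) = \val z by rewrite /f /inv mulrC divfK // addrC subrK.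
by apply: val_inj; rewrite chartE E //; exact: setP_val.
Qed.

Lemma affine_circle_section (a : tot S) : tr (S := S) k a a ->
  exists tau : prodM S, \forall z' \near c, forall w : A, \val w != c -> \val w = z' -> sc S tau w.
Proof.
move=> ka; have [r' r1 H] := wide.
have cq (w : C) : 0 < nC w < r' -> {for w, continuous (chart f (k 0))}.
  by move=> wr; apply: chart_continuous (@cf w) _; apply: filterS (annulus_open wr) => w'; exact: H.
have [s [fs _]] := puncture r1 cq (fun w _ => lS _) (tr_eq kf ka).
have [z|tau Ht] := @chart_section _ _ _ S _ _ s [set z : A | 0 < nC (inv z) < r'] inv fs.
  move=> zr; split; [exact: zr | exact: inv_chart | | exact: inv_continuous].
  exact: near_continuous (@inv_continuous z) (annulus_open zr).
exists tau; have r'0 : 0 < r' * r by rewrite mulr_gt0 //; lra.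
apply: filterS (near_nC c r'0) => z' zr w wc wz; apply: Ht; rewrite /= /inv nCM nCV kr.
rewrite divr_gt0 ?ltr_pdivrMr //; first by rewrite wz zr.
by rewrite -nC_neq.
Qed.

Lemma affine_circle_fixed (tau : prodM S) :
  (\forall z' \near c, forall w : A, \val w != c -> \val w = z' -> sc S tau w) ->
  exists a, projT1 a = k 0 /\ tr (S := S) k a a.
Proof.
move=> /nbhs_nC[d d0 Hd]; have [r' r1 H] := wide.
have cq (w : C) : 0 < nC w < r' -> {for w, continuous (chart f (k 0))}.
  by move=> wr; apply: chart_continuous (@cf w) _; apply: filterS (annulus_open wr) => w'; exact: H.
have dr : 0 < Num.min (d / r) r' by rewrite lt_min divr_gt0 //; lra.
have [w /andP[w0]|a [a1 ta]] := circle_fix r1 cq (fun w _ => lS _) (sg := tau) dr.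
  rewrite lt_min => /andP[wd wr]; have wA := H w (introT andP (conj w0 wr)).
  apply: (Hd (f w)); last by rewrite chartE.
    by rewrite nfc mulrC -ltr_pdivlMr.
  by rewrite chartE // -subr_eq0 fc mulf_neq0 // -nC_gt0.
exists a; split; last by apply: tr_eq ta => t t01; rewrite -kf.
by have := @kf 0; rewrite lexx ler01 /= expi0 a1 => /(_ isT) <-.
Qed.
End Affine.

Section Infinity.
Variables (k : R -> A) (r : R).
Hypotheses (r0 : 0 < r) (rA : forall z : C, r <= nC z -> A z) (kr : nC (\val (k 0)) = r)
  (kE : forall t, 0 <= t <= 1 -> \val (k t) = \val (k 0) * expi (- t)).

Let e : C := \val (k 0).
(** This inversion takes 0 to infinity and the unit circle run counterclockwise to the large circle
    run clockwise, so the results on a punctured disc apply at infinity. *)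
Let f (w : C) : C := e / w.
Let nf w : nC (f w) = r / nC w. Proof. by rewrite nCM nCV kr. Qed.
Let cf (w : C) : w != 0 -> {for w, continuous f}.
Proof. by move=> w0; exact: (for_continuous_CM (@for_continuous_cst _ _ e w) (for_continuous_CV (@for_continuous_id _ w) w0)). Qed.
Let e0 : e != 0. Proof. by rewrite -nC_gt0 kr. Qed.

Let wide : exists2 r', 1 < r' & forall w : C, 0 < nC w < r' -> A (f w).
Proof.
have [r' [r'0 rr' H]] := outside_extend AL r0 rA.
exists (r / r'); first by rewrite ltr_pdivlMr // mul1r.
move=> w /andP[w0 wr]; apply: H; rewrite nf.
by rewrite ltr_pdivlMr // in wr; rewrite ltr_pdivlMr // mulrC.
Qed.

Let kf t : 0 <= t <= 1 -> k t = (chart f (k 0) \o expi) t.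
Proof.
have E : expi (- t) = (expi t)^-1.
  have n0 : expi t != 0 by rewrite -nC_gt0 nC_expi.
  apply: (mulfI n0); rewrite mulfV // /expi mulrN cosN sinN.
  apply/eqP; rewrite eq_complex /= mulrN opprK -!expr2 cos2Dsin2 eqxx /=.
  by apply/eqP; ring.
move=> t01; apply: val_inj; rewrite /= chartE; first by rewrite kE // E.
by apply: rA; rewrite nf nC_expi divr1.
Qed.

Let inv (z : A) : C := e / \val z.

Let inv_continuous (z : A) : \val z != 0 -> {for z, continuous inv}.
Proof.
move=> z0; have c1 : {for z, continuous (fun z : A => \val z : C)} by exact: val_continuous.
exact: (for_continuous_CM (@for_continuous_cst _ _ e z) (for_continuous_CV c1 z0)).
Qed.

Let inv_chart (z : A) : \val z != 0 -> chart f (k 0) (inv z) = z.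
Proof.
move=> z0; have E : f (inv z) = \val z by rewrite /f /inv invf_div mulrC divfK.
by apply: val_inj; rewrite chartE E //; exact: setP_val.
Qed.

Let cq (r' : R) (w : C) : (forall w : C, 0 < nC w < r' -> A (f w)) -> 0 < nC w < r' ->
  {for w, continuous (chart f (k 0))}.
Proof.
move=> H wr; apply: chart_continuous.
  by apply: cf; rewrite -nC_gt0; case/andP: wr.
by apply: filterS (annulus_open wr) => w'; exact: H.
Qed.

Lemma infinity_circle_section (a : tot S) : tr (S := S) k a a ->
  exists tau : prodM S, exists d : R, forall w : A, d < nC (\val w) -> sc S tau w.
Proof.
move=> ka; have [r' r1 H] := wide.
have [s [fs _]] := puncture r1 (fun w => cq H) (fun w _ => lS _) (tr_eq kf ka).
have [z|tau Ht] := @chart_section _ _ _ S _ _ s [set z : A | 0 < nC (inv z) < r'] inv fs.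
  move=> zr; have z0 : \val z != 0.
    by apply/eqP => z0; move: zr; rewrite /= /inv z0 invr0 mulr0 nC0 ltxx.
  split; [exact: zr | exact: inv_chart | | exact: inv_continuous].
  exact: near_continuous (inv_continuous z0) (annulus_open zr).
exists tau, (r / r') => w wr; apply: Ht; rewrite /= /inv nCM nCV kr.
have w0 : 0 < nC (\val w) by apply: le_lt_trans wr; rewrite divr_ge0 // ltW //; lra.
rewrite divr_gt0 // ltr_pdivrMr //; rewrite ltr_pdivrMr in wr; last by lra.
by rewrite mulrC.
Qed.

Lemma infinity_circle_fixed (tau : prodM S) (d : R) :
  (forall w : A, d < nC (\val w) -> sc S tau w) ->
  exists a, projT1 a = k 0 /\ tr (S := S) k a a.
Proof.
move=> Hd; have [r' r1 H] := wide.
pose d' := Num.max d 1; have d'0 : 0 < d' by rewrite lt_max ltr01 orbT.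
have dr : 0 < Num.min (r / d') r' by rewrite lt_min divr_gt0 //; lra.
have [w /andP[w0]|a [a1 ta]] := circle_fix r1 (fun w => cq H) (fun w _ => lS _) (sg := tau) dr.
  rewrite lt_min => /andP[wd wr]; have wA := H w (introT andP (conj w0 wr)).
  apply: Hd; rewrite chartE // nf; apply: (@le_lt_trans _ _ d'); first by rewrite le_max lexx.
  by rewrite ltr_pdivlMr // mulrC -ltr_pdivlMr.
exists a; split; last by apply: tr_eq ta => t t01; rewrite -kf.
by have := @kf 0; rewrite lexx ler01 /= expi0 a1 => /(_ isT) <-.
Qed.
End Infinity.
End ParabolicLoops.

(** * Parabolic torsors and their cocycles *)

Section SimpleLoops.
Variables (R : realType) (K : fieldType) (A : set (R[i])^o) (Ls : seq (R[i])^o).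
Local Notation C := ((R[i])^o).
Hypothesis AL : forall z, A z <-> z \notin Ls.
Variables (S : et K A) (b : A).
Hypothesis lS : forall z, lc S z.
Implicit Types g : R -> A.

Lemma circle_cpath (k : R -> A) (c e : C) (s : R) :
  (forall t, 0 <= t <= 1 -> \val (k t) = c + e * expi (s * t)) -> cpath k.
Proof.
move=> kE t; apply/for_continuous_val.
rewrite (_ : (fun t => _) = fun t => c + e * expi (s * clamp t)).
  have c1 := for_continuous_RM (@for_continuous_cst _ _ s t) (for_continuous_clamp (@for_continuous_id _ t)).
  exact: (for_continuous_CD (@for_continuous_cst _ _ c t) (for_continuous_CM (@for_continuous_cst _ _ e t) (for_continuous_expi c1))).
by apply: functional_extensionality_dep => u /=; rewrite kE // clamp_itv.
Qed.

Lemma simple_loopE (D : set C) (a : D) (c : C) (g : R -> D) : simple_loop a c g <->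
  exists (r : R) (k h : R -> D),
    [/\ 0 < r /\ (forall z : C, 0 < nC (z - c) <= r -> D z),
        nC (\val (k 0) - c) = r,
        forall t, 0 <= t <= 1 -> \val (k t) = c + (\val (k 0) - c) * expi t,
        is_path h a (k 0)
      & homotopic g (path_mul (path_inv h) (path_mul k h))].
Proof.
split=> -[r [k [h [[r0 rD] kr kE hp gh]]]]; exists r, k, h; split=> //.
- by split=> // z; have := rD z; rewrite nCE ltcR lecR.
- by move: kr; rewrite nCE => -[].
- by split=> // z; rewrite nCE ltcR lecR; exact: rD.
- by rewrite nCE kr.
Qed.

Lemma simple_loop_inftyE (D : set C) (a : D) (g : R -> D) : simple_loop_infty a g <->
  exists (r : R) (k h : R -> D),
    [/\ 0 < r /\ (forall z : C, r <= nC z -> D z), nC (\val (k 0)) = r,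
        forall t, 0 <= t <= 1 -> \val (k t) = \val (k 0) * expi (- t),
        is_path h a (k 0)
      & homotopic g (path_mul (path_inv h) (path_mul k h))].
Proof.
split=> -[r [k [h [[r0 rD] kr kE hp gh]]]]; exists r, k, h; split=> //.
- by split=> // z; have := rD z; rewrite nCE lecR.
- by move: kr; rewrite nCE => -[].
- by split=> // z; rewrite nCE lecR; exact: rD.
- by rewrite nCE kr.
Qed.

Let k_loop (k : R -> A) (c : C) :
  (forall t, 0 <= t <= 1 -> \val (k t) = c + (\val (k 0) - c) * expi t) -> cpath k /\ k 1 = k 0.
Proof.
move=> kE; split.
  by apply: (@circle_cpath k c (\val (k 0) - c) 1) => t /kE; rewrite mul1r.
by apply: val_inj; rewrite kE ?ler01 ?lexx // expi1 mulr1 addrC subrK.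
Qed.

Let k_loop_infty (k : R -> A) :
  (forall t, 0 <= t <= 1 -> \val (k t) = \val (k 0) * expi (- t)) -> cpath k /\ k 1 = k 0.
Proof.
move=> kE; split.
  by apply: (@circle_cpath k 0 (\val (k 0)) (- 1)) => t /kE; rewrite mulN1r add0r.
apply: val_inj; rewrite kE ?ler01 ?lexx //.
by rewrite -[RHS]mulr1 -(expi1 R) /expi mulrN cosN sinN !mulr1 mulr_natl -[pi *+ 2]add0r sinD2pi sin0 oppr0.
Qed.

Lemma simple_loop_section g c (a : tot S) : simple_loop b c g -> projT1 a = b ->
  tr (S := S) g a a ->
  exists tau : prodM S, \forall z' \near c, forall w : A, \val w != c -> \val w = z' -> sc S tau w.
Proof.
move=> /simple_loopE[r [k [h [[r0 rA] kr kE hp gh]]]] ab ga.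
have [ck k1] := k_loop kE.
have [a' [_ ka]] := conj_fixed_circle lS hp ck k1 gh ab ga.
exact: (affine_circle_section AL lS r0 rA kr kE ka).
Qed.

Lemma simple_loop_fixed g c (tau : prodM S) : simple_loop b c g ->
  (\forall z' \near c, forall w : A, \val w != c -> \val w = z' -> sc S tau w) ->
  exists a, projT1 a = b /\ tr (S := S) g a a.
Proof.
move=> /simple_loopE[r [k [h [[r0 rA] kr kE hp gh]]]] Ht.
have [ck k1] := k_loop kE.
have [a [ak ka]] := affine_circle_fixed AL lS r0 rA kr kE Ht.
exact: (circle_fixed_conj lS hp ck gh ak ka).
Qed.

Lemma simple_loop_infty_section g (a : tot S) : simple_loop_infty b g -> projT1 a = b ->
  tr (S := S) g a a ->
  exists tau : prodM S, exists d : R, forall w : A, d < nC (\val w) -> sc S tau w.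
Proof.
move=> /simple_loop_inftyE[r [k [h [[r0 rA] kr kE hp gh]]]] ab ga.
have [ck k1] := k_loop_infty kE.
have [a' [_ ka]] := conj_fixed_circle lS hp ck k1 gh ab ga.
exact: (infinity_circle_section AL lS r0 rA kr kE ka).
Qed.

Lemma simple_loop_infty_fixed g (tau : prodM S) (d : R) : simple_loop_infty b g ->
  (forall w : A, d < nC (\val w) -> sc S tau w) ->
  exists a, projT1 a = b /\ tr (S := S) g a a.
Proof.
move=> /simple_loop_inftyE[r [k [h [[r0 rA] kr kE hp gh]]]] Ht.
have [ck k1] := k_loop_infty kE.
have [a [ak ka]] := infinity_circle_fixed AL lS r0 rA kr kE Ht.
exact: (circle_fixed_conj lS hp ck gh ak ka).
Qed.
End SimpleLoops.

Lemma enum_ord_lift p : enum 'I_p.+1 = rcons [seq fintype.lift ord_max i | i <- enum 'I_p] ord_max.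
Proof.
apply: (inj_map (@ord_inj p.+1)); rewrite map_rcons -map_comp.
rewrite (eq_map (g := @nat_of_ord p)); last by move=> i /=; exact: lift_max.
by rewrite ![[seq nat_of_ord i | i <- _]]val_enum_ord -cats1 -[in LHS]addn1 iotaD.
Qed.

Section AffineMonodromy.
Variables (R : realType) (K : fieldType) (p : nat) (x : 'I_p -> (R[i])^o) (y0 : (R[i])^o).
Local Notation C := ((R[i])^o).
Notation A := (U1minus x y0).
Variables (F : sheaf K A) (b : A) (alpha : 'I_p.+1 -> R -> A).
Variables (V : lmodType K) (B : 'I_p.+1 -> GL V) (J : {linear V -> F b}) (lambda : K).
Hypotheses (lF : local_system F) (Jbij : bijective J) (lambda0 : lambda != 0) (lambda1 : lambda != 1).
Notation aq := (alpha ord_max).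
Notation ai i := (alpha (fintype.lift ord_max i)).
Notation pt v := (PT F b v).
Notation trF g := (tr (S := sheaf_et F) (R := R) g).
Notation lcF := (local_system_lc lF).
Hypotheses (gens : free_generators alpha b)
  (loops : forall i, simple_loop b (x i) (ai i)) (loopq : simple_loop b y0 aq)
  (loop_infty : simple_loop_infty b (path_inv (path_prod b [seq alpha j | j <- enum 'I_p.+1])))
  (Bi : forall i v, trF (ai i) (pt (J (B (fintype.lift ord_max i) v))) (pt (J v)))
  (Bq : forall u : F b, trF aq (pt (lambda *: u)) (pt u)).

Let AL z : A z <-> z \notin y0 :: codom x.
Proof. exact: U1minus_mem. Qed.

Let al j : is_path (alpha j) b b. Proof. by have [[H _] _] := gens; exact: H. Qed.
Let ac j : cpath (alpha j). Proof. exact: is_path_cpath (al j). Qed.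
Let a0 j : alpha j 0 = b. Proof. by case: (al j). Qed.
Let a1 j : alpha j 1 = b. Proof. by case: (al j). Qed.

Section OneTorsor.
Variable T : torsor F.
Hypothesis Tne : forall z, exists s, tsc T s z.
Notation trT g := (tr (S := torsor_et T) (R := R) g).

Let lT z : lc (torsor_et T) z.
Proof. by have [s] := Tne z; apply: torsor_lc; exact: lcF. Qed.

(** in terms of the right action of loops on the stalk at [b], [f] is fixed
    by the last generator and [f alpha_j = f + J w_j] for the others *)
Definition normal (f : F b) (w : prodM (fun _ : 'I_p => V)) :=
  trT aq (pt f) (pt f) /\ forall i, trT (ai i) (pt (f + J (w i))) (pt f).

Lemma tr_back j (f : F b) : exists f', trT (alpha j) (pt f') (pt f).
Proof.
have [a ab ta] := tr_total (g := path_inv (alpha j)) (a := pt f) lT (cpath_inv (@ac j)) ltac:(by rewrite /= /path_inv subr0 a1).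
have ab' : projT1 a = b by rewrite ab /path_inv subrr a0.
exists (tot_at a b); rewrite -tot_tot_at //.
by have := tr_inv ta; rewrite path_invK.
Qed.

(** The difference of two fixed points is a vector fixed by multiplication with [lambda]. *)
Lemma aq_fixed_uniq f f' : trT aq (pt f) (pt f) -> trT aq (pt f') (pt f') -> f = f'.
Proof.
move=> tf tf'; have td := tr_sub tf tf'.
have E0 := tr_uniql lcF (@ac _) td (Bq _).
have E : f - f' = lambda *: (f - f') := tot_inj E0.
have : (1 - lambda) *: (f - f') == 0 by rewrite scalerBl scale1r -E subrr.
by rewrite scaler_eq0 !subr_eq0 eq_sym (negPf lambda1) => /eqP.
Qed.

Lemma normal_exists : exists f w, normal f w.
Proof.
have [c tc] := tr_back ord_max 0.
(* The last generator acts by [u -> c + lambda u], whose fixed point is [c / (1 - lambda)]. *)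
pose f := (1 - lambda)^-1 *: c.
have ff : trT aq (pt f) (pt f).
  have := tr_add tc (Bq f); rewrite add0r.
  suff -> : c + lambda *: f = f by [].
  have n0 : 1 - lambda != 0 by rewrite subr_eq0 eq_sym.
  rewrite -[c in c + _]scale1r -(mulfV n0) -scalerA -/f -scalerDl subrK scale1r //.
have [J' JK KJ] := Jbij.
have /choice[w Hw] : forall i, exists w, trT (ai i) (pt (f + J w)) (pt f).
  move=> i; have [f' tf] := tr_back (fintype.lift ord_max i) f.
  by exists (J' (f' - f)); rewrite KJ addrC subrK.
by exists f, w.
Qed.

(** In the coordinate [v] of the point [f + J v], generator [i] acts by the affine map
    [v -> v B_i + w_i]. *)
Let act (w : prodM (fun _ : 'I_p => V)) (s : seq 'I_p) (v : V) : V :=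
  foldl (fun v i => B (fintype.lift ord_max i) v + w i) v s.

(** Linear part and translation part of a product of affine maps; the translation part is the sum
    that occurs in [MC_L]. *)
Lemma act_tail w v : act w (enum 'I_p) v = tail_prod B 0 v + \sum_(j < p) tail_prod B j.+1 (w j).
Proof.
suff H m v' : (m <= p)%N -> act w (drop m (enum 'I_p)) v' =
    tail_prod B m v' + \sum_(j < p | (m <= j)%N) tail_prod B j.+1 (w j).
  by have := H 0 v (leq0n _); rewrite drop0.
move=> mp; rewrite -(subKn mp); elim: (p - m)%N (leq_subr m p) v' => {m mp} [|k IH] kp v'.
  rewrite subn0 big_pred0 ?addr0 // ?drop_oversize ?size_enum_ord //.
    by rewrite /tail_prod drop_oversize // size_enum_ord.
  by move=> j; rewrite leqNgt ltn_ord.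
have mp : (p - k.+1 < p)%N by rewrite ltn_subrL; case: (p) kp.
pose i := Ordinal mp; have Em : (p - k = i.+1)%N by rewrite /= -subSn.
rewrite (drop_nth i) ?size_enum_ord // (nth_ord_enum _ i) /= -Em IH; last exact: ltnW.
have -> : tail_prod B (p - k.+1) v' = tail_prod B (p - k) (B (fintype.lift ord_max i) v').
  by rewrite Em -tail_prodS.
rewrite linearD -addrA; congr (_ + _); rewrite [RHS](bigD1 i) //= Em; congr (_ + _).
apply: eq_bigl => j; rewrite -[(p - k.+1)%N]/(i : nat) ltn_neqAle andbC; congr (_ && _).
by rewrite eq_sym.
Qed.

Let prod_cpath (s : seq 'I_p.+1) : cpath (path_prod b [seq alpha i | i <- s]) /\
  path_prod b [seq alpha i | i <- s] 1 = b.
Proof.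
elim: s => [|i s [IH1 IH2]] /=; first by split=> // t; exact: cst_continuous.
by split; [apply: cpath_mul => //; rewrite IH2 a0 | rewrite path_mul1 a1].
Qed.

Lemma normal_infty f w v : normal f w ->
  trT (path_prod b [seq alpha j | j <- enum 'I_p.+1])
    (pt (f + J (lambda *: act w (enum 'I_p) v))) (pt (f + J v)).
Proof.
move=> nf; rewrite enum_ord_lift map_rcons -map_comp.
elim: (enum 'I_p) v => [|i s IH] v /=.
  apply: (tr_mul lT (@ac _)); first exact: tr_cst.
  by have := tr_add nf.1 (Bq (J v)); rewrite linearZ.
apply: (tr_mul lT (@ac _) (IH _)).
rewrite (_ : f + J _ = f + J (w i) + J (B (fintype.lift ord_max i) v)); last by rewrite linearD addrA addrAC.
exact: tr_add (nf.2 i) (Bi i v).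
Qed.

Let Jsurj (u : F b) : exists v, J v = u.
Proof. by have [J' _ KJ] := Jbij; exists (J' u). Qed.

Let Jinj : injective J. Proof. exact: bij_inj Jbij. Qed.

(** Membership in [MC_L] means that the product of all generators, the last of which multiplies by
    [lambda], has a fixed point. The vector [u] of [MC_L] and the fixed point [v] are related by
    [v = - lambda u]. *)
Let MC_LE w : MC_L lambda B w <-> exists v, lambda *: act w (enum 'I_p) v = v.
Proof.
split=> [[u Hu]|[v Hv]].
  exists (- (lambda *: u)).
  by rewrite act_tail Hu linearN linearZ /= addKr scalerN.
exists (- (lambda^-1 *: v)); rewrite linearN linearZ /= scalerN scalerA mulfV // scale1r opprK.
by rewrite -{2}Hv scalerA mulVf // scale1r act_tail addKr.
Qed.

Definition parabolic := forall z : P1 R, exists tau,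
  \forall z' \near z, forall w : A, Some (\val w) = z' -> tsc T tau w.

Lemma fixed_at (j : R -> A) (a : tot F) : projT1 a = b -> trT j a a -> trT j (pt (tot_at a b)) (pt (tot_at a b)).
Proof. by move=> ab; rewrite -tot_tot_at. Qed.

(** A section near a puncture is the same as a fixed point of the loop around it
    ([simple_loop_section], [simple_loop_fixed] and their analogues at infinity), which turns the
    condition into equations for the affine action. *)
Lemma normal_parabolic f w : normal f w -> parabolic <-> MC_W lambda B w.
Proof.
move=> nf; split=> [par|[Kw /MC_LE[v Lw]]].
  have Kw : MC_K B w.
    move=> i; have [tau Ht0] := par (Some (x i)).
    have Ht := (P1_near_some _ _).2 Ht0.
    have [|a [ab /(fixed_at ab) ta]] := simple_loop_fixed AL lT (tau := tau) (loops i).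
      by apply: filterS Ht => z' Hz' z _ zz'; apply: Hz'; rewrite zz'.
    move: (tot_at a b) ta => d td.
    have [v Jv] := Jsurj (f - d); exists v; apply: Jinj.
    have := tr_sub (nf.2 i) td; rewrite -Jv => tv.
    have E0 := tr_uniql lcF (@ac _) tv (Bi i v); have E := tot_inj E0.
    by rewrite linearB -E Jv opprB addrA subrK addrC addKr.
  split; first exact: Kw.
  apply/MC_LE; have [tau /P1_near_infty[_ [r Hr]]] := par None.
  have [|a [ab /(fixed_at ab) ta]] := simple_loop_infty_fixed AL lT (tau := tau) (d := r) loop_infty.
    by move=> z /Hr; apply.
  move: (tot_at a b) ta => d /tr_inv; rewrite path_invK => td.
  have [v Jv] := Jsurj (d - f); exists v; apply: Jinj.
  have := normal_infty v nf; rewrite Jv [f + (d - f)]addrC subrK => tv.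
  have [cp _] := prod_cpath (enum 'I_p.+1).
  have E0 := tr_uniql lT cp tv td; have E := tot_inj E0.
  by rewrite -E addrC addKr.
have near_pt (z : A) : exists tau, \forall z' \near \val z, forall w : A, \val w = z' -> tsc T tau w.
  have [s Hs] := Tne z; exists s; exact/nbhs_subP/tsc_near.
have at_point (c : C) g (d : F b) : ~ A c -> simple_loop b c g -> trT g (pt d) (pt d) ->
    exists tau, \forall z' \near c, forall w : A, \val w = z' -> tsc T tau w.
  move=> nAc sg td; have [tau Ht] := simple_loop_section (a := pt d) AL lT sg erefl td.
  exists tau; apply: filterS Ht => z' Hz' z zz'; apply: Hz' => //.
  by apply/eqP => zc; apply: nAc; rewrite -zc; exact: setP_val.
case=> [c|]; last first.
  have [tau [d Hd]] : exists tau : prodM (torsor_et T), exists d : R, forall w : A, d < nC (\val w) -> sc (torsor_et T) tau w.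
    apply: (simple_loop_infty_section AL lT loop_infty (a := pt (f + J v))) => //.
    by apply: tr_inv; have := normal_infty v nf; rewrite Lw.
  by exists tau; apply/P1_near_infty; split=> //; exists d => z dz z' [zz']; apply: Hd; rewrite -[\val z']/(sval z') zz'.
suff [tau Ht] : exists tau, \forall z' \near c, forall w : A, \val w = z' -> tsc T tau w.
  by exists tau; apply/P1_near_some; apply: filterS Ht => z' H z [/H].
have [Ac|nAc] := pselect (A c); first exact: (near_pt (exist _ c (mem_set Ac))).
have : c \in y0 :: codom x by apply/negPn/negP => /AL.
rewrite inE => /orP[/eqP c0|/codomP[i ci]].
  apply: (at_point c aq f nAc); last exact: nf.1.
  by rewrite c0.
(* As [w i] is [u B_i - u], the point [f - J u] is fixed by generator [i]. *)
have [u Eu] := Kw i; apply: (at_point c (ai i) (f - J u) nAc); first by rewrite ci.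
have td := tr_add (nf.2 i) (Bi i (- u)).
rewrite !linearN in td; rewrite Eu linearB in td.
suff E : f + (J (B (fintype.lift ord_max i) u) - J u) - J (B (fintype.lift ord_max i) u) = f - J u by rewrite -{1}E.
by rewrite -addrA [J _ - J u]addrC addrK.
Qed.

Let base_path z : exists g : R -> A, [/\ cpath g, g 0 = b & g 1 = z].
Proof. exact: cofinite_path AL b z. Qed.

Let fixed_word (f : F b) s : (forall j, trT (alpha j) (pt f) (pt f)) ->
  trT (word_path alpha b s) (pt f) (pt f).
Proof.
move=> fj; elim: s => [|l s IH]; first exact: tr_cst.
rewrite word_path_cons; have [cl _ _] := letter_path_loop al l.
apply: (tr_mul lT cl IH); rewrite /letter_path; case: l.2 => //.
exact/tr_inv/fj.
Qed.

Let fixed_indep (f : F b) g g' z (v : F z) : (forall j, trT (alpha j) (pt f) (pt f)) ->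
  [/\ cpath g, g 0 = b & g 1 = z] -> [/\ cpath g', g' 0 = b & g' 1 = z] ->
  trT g (pt f) (PT F z v) -> trT g' (pt f) (PT F z v).
Proof.
move=> fj [cg g0 g1] [cg' g'0 g'1] tg.
have [e eb te] := tr_total (g := path_inv g') (a := PT F z v) lT (cpath_inv cg') ltac:(by rewrite /path_inv subr0 g'1).
have cV := cpath_inv cg'.
have cl : cpath (path_mul (path_inv g') g) by apply: cpath_mul => //; rewrite g1 /path_inv subr0.
have [[_ gen] _] := gens.
have [s /homotopic_sym hs] : exists s, homotopic (path_mul (path_inv g') g) (word_path alpha b s).
  apply: gen; have := cpath_is_path cl.
  by rewrite path_mul0 path_mul1 g0 /path_inv subrr g'0.
have t1 := tr_homotopic lT hs (fixed_word s fj).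
have t2 := tr_mul lT cV tg te.
rewrite (tr_uniq lT cl t1 t2) -[g']path_invK; exact: tr_inv te.
Qed.

(** Every word fixes [f], so its transport to [z] does not depend on the path. Near [z] the
    transports are compared with a local section along straight segments. *)
Lemma normal0_global f : normal f 0 -> exists tau, forall z, tsc T tau z.
Proof.
move=> [fq fi]; have fj j : trT (alpha j) (pt f) (pt f).
  case: (unliftP ord_max j) => [i ->|->] //.
  by have := fi i; rewrite -[(0 : prodM _) i]/(0 : V) linear0 addr0.
have W : forall z, exists v : F z, exists2 g, [/\ cpath g, g 0 = b & g 1 = z] & trT g (pt f) (PT F z v).
  move=> z; have [g [cg g0 g1]] := base_path z.
  have [e ez te] := tr_total (a := pt f) lT cg (esym g0).
  by exists (tot_at e z), g => //; rewrite -tot_tot_at // ez.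
pose tau z := projT1 (cid (W z)).
have Htau z : exists2 g, [/\ cpath g, g 0 = b & g 1 = z] & trT g (pt f) (PT F z (tau z)) := projT2 (cid (W z)).
exists tau => z; have [s Hs sz] : exists2 s, tsc T s z & s z = tau z.
  by have [s Hs] := Tne z; exact: torsor_through Hs.
have [r [r0 rA Hr]] := point_ball AL (tsc_near Hs).
apply: (tsc_loc _ Hs); apply/nbhs_subP/nbhs_nC; exists r => // w wr z' zw; rewrite -zw in wr.
have Qz : nC (\val z - \val z) < r by rewrite subrr nC0.
have vQ := @disc_convex R (\val z) r.
have [g [cg g0 g1] tg] := Htau z.
have cs := segment_cpath (w0 := b) vQ rA Qz wr.
have fs : flat (S := torsor_et T) [set w : A | nC (\val w - \val z) < r] id (fun w => PT F w (s w)).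
  by move=> e er; exists s; [exact: Hr | exact: near_all].
have ts := flat_tr fs cs (fun t t01 => segment_in b vQ rA Qz wr t01).
rewrite segment0 segment1 sz in ts.
have tm := tr_mul lT cs tg ts.
have [g' Hg' tg'] := Htau z'.
have Hm : [/\ cpath (path_mul (segment b z z') g), path_mul (segment b z z') g 0 = b & path_mul (segment b z z') g 1 = z'].
  by split; [apply: cpath_mul; rewrite // segment0 | rewrite path_mul0 | rewrite path_mul1 segment1].
have tm' := fixed_indep fj Hm Hg' tm.
by have [cg' _ _] := Hg'; exact: tot_inj (tr_uniq lT cg' tm' tg').
Qed.
End OneTorsor.
End AffineMonodromy.

(** * The torsor of a cocycle *)

Lemma tr_subF (K : fieldType) (X : topologicalType) (F : sheaf K X) (R : realType) (g : R -> X)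
  x y (v v' : F x) (w w' : F y) :
  tr (S := sheaf_et F) g (PT F x v) (PT F y w) -> tr (S := sheaf_et F) g (PT F x v') (PT F y w') ->
  tr (S := sheaf_et F) g (PT F x (v - v')) (PT F y (w - w')).
Proof.
by move=> t1 t2; have := tr_linear (-1) t2 t1; rewrite !scaleN1r ![- _ + _]addrC.
Qed.

Section AffineTorsor.
Variables (R : realType) (K : fieldType) (A : set (R[i])^o) (Ls : seq (R[i])^o).
Local Notation C := ((R[i])^o).
Hypothesis AL : forall z, A z <-> z \notin Ls.
Variables (F : sheaf K A) (b : A) (n : nat) (alpha : 'I_n -> R -> A).
Hypotheses (lF : local_system F) (free : free_generators alpha b).
Notation lcF := (local_system_lc lF).
Notation pt z v := (PT F z v).
Notation trF g := (tr (S := sheaf_et F) (R := R) g).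
Notation wp := (word_path alpha b).
Variable act1 : 'I_n * bool -> F b -> F b.
Hypotheses (act1K : forall l f, act1 (letter_inv l) (act1 l f) = f)
  (act1F : forall l f f', trF (letter_path alpha l) (pt b (act1 l f - act1 l f')) (pt b (f - f'))).

Let al j : is_path (alpha j) b b. Proof. by have [[H _] _] := free; exact: H. Qed.

Let loop (h : R -> A) := [/\ cpath h, h 0 = b & h 1 = b].

Let word_of (h : R -> A) : loop h -> exists w, homotopic h (wp w).
Proof.
move=> [ch h0 h1]; have [[_ gen] _] := free; apply: gen.
by have := cpath_is_path ch; rewrite h0 h1.
Qed.

(** the affine right action of loops on the stalk at [b], extending [act1];
    freeness makes it well defined *)
Let lact (h : R -> A) (f : F b) : F b :=
  if pselect (loop h) is left H then act act1 (projT1 (cid (word_of H))) f else f.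

Let lactE h w f : loop h -> homotopic h (wp w) -> lact h f = act act1 w f.
Proof.
move=> Hh hw; rewrite /lact; case: pselect => // H; case: cid => w' /= hw'.
have [_ fr] := free; apply: (act_homotopic al act1K fr).
exact: homotopic_trans (homotopic_sym hw') hw.
Qed.

Let lact_homotopic h h' f : loop h -> homotopic h h' -> loop h' -> lact h f = lact h' f.
Proof.
move=> Hh hh' Hh'; have [w hw] := word_of Hh'.
by rewrite (lactE _ Hh' hw) (lactE _ Hh (homotopic_trans hh' hw)).
Qed.

Let loop_mul g h : loop g -> loop h -> loop (path_mul g h).
Proof.
move=> [cg g0 g1] [ch h0 h1]; split; rewrite ?path_mul0 ?path_mul1 //.
by apply: cpath_mul; rewrite // h1.
Qed.

Let lact_mul g h f : loop g -> loop h -> lact (path_mul g h) f = lact h (lact g f).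
Proof.
move=> Lg Lh; have [w gw] := word_of Lg; have [w' hw'] := word_of Lh.
rewrite (lactE _ Lg gw) (lactE _ Lh hw') -act_cat; apply: lactE; first exact: loop_mul.
apply: (@homotopic_trans _ _ _ (path_mul (wp w) (wp w'))); last exact/homotopic_sym/(word_path_cat al).
by apply: homotopic_mul => //; case: Lg => _ -> _; case: Lh.
Qed.

Let act_tr w f f' : trF (wp w) (pt b (act act1 w f - act act1 w f')) (pt b (f - f')).
Proof.
elim: w f f' => [|l w IH] f f'; first by apply: tr_cst; exact: lcF.
have [cl _ _] := letter_path_loop al l.
exact: (tr_mul lcF cl (IH _ _) (act1F l f f')).
Qed.

Let lact_tr h f f' : loop h -> trF h (pt b (lact h f - lact h f')) (pt b (f - f')).
Proof.
move=> Hh; have [w hw] := word_of Hh; rewrite !(lactE _ Hh hw).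
exact: (tr_homotopic lcF (homotopic_sym hw) (act_tr _ _ _)).
Qed.

Let base_path z : exists g : R -> A, [/\ cpath g, g 0 = b & g 1 = z].
Proof. exact: cofinite_path AL b z. Qed.

Let bp z := projT1 (cid (base_path z)).
Let bpP z : [/\ cpath (bp z), bp z 0 = b & bp z 1 = z].
Proof. exact: projT2 (cid (base_path z)). Qed.

Let to_b z (h : R -> A) := [/\ cpath h, h 0 = z & h 1 = b].

Let loop_bp z h : to_b z h -> loop (path_mul h (bp z)).
Proof.
move=> [ch h0 h1]; have [c c0 c1] := bpP z.
by split; rewrite ?path_mul0 ?path_mul1 //; apply: cpath_mul; rewrite // c1.
Qed.

Let val_exists z (h : R -> A) (f : F b) : exists v : F z, trF (bp z) (pt b (lact (path_mul h (bp z)) f)) (pt z v).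
Proof.
have [c c0 c1] := bpP z.
have [e ez te] := tr_total (a := pt b (lact (path_mul h (bp z)) f)) lcF c (esym c0).
by exists (tot_at e z); rewrite -tot_tot_at // ez.
Qed.

(** the point over [z] of the torsor obtained from [f] over [b] by moving
    backwards along [h] *)
Let bval z (h : R -> A) (f : F b) : F z := projT1 (cid (val_exists z h f)).

Let bvalP z h f : trF (bp z) (pt b (lact (path_mul h (bp z)) f)) (pt z (bval z h f)).
Proof. exact: projT2 (cid (val_exists z h f)). Qed.

Let bval_homotopic z h h' f : to_b z h -> to_b z h' -> homotopic h h' -> bval z h f = bval z h' f.
Proof.
move=> Hh Hh' hh'; have [c c0 c1] := bpP z.
have E : lact (path_mul h (bp z)) f = lact (path_mul h' (bp z)) f.
  apply: lact_homotopic; [exact: loop_bp | | exact: loop_bp].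
  by apply: homotopic_mul => //; [exact: homotopic_refl | case: Hh => _ -> _].
by have T' := bvalP z h' f; rewrite -E in T'; exact: tot_inj (tr_uniq lcF c (bvalP z h f) T').
Qed.

(** A point over [z] is presented by a path [h] from [z] to [b] and a point [f] over [b];
    presentations that differ by a loop at [b] are identified. *)
Let bval_mul z k h f : loop k -> to_b z h -> bval z (path_mul k h) f = bval z h (lact k f).
Proof.
move=> Lk Hh; have [c c0 c1] := bpP z; have [ck k0 k1] := Lk; have [ch h0 h1] := Hh.
have Hkh : to_b z (path_mul k h) by split; rewrite ?path_mul0 ?path_mul1 //; apply: cpath_mul; rewrite // h1.
have E : lact (path_mul (path_mul k h) (bp z)) f = lact (path_mul h (bp z)) (lact k f).
  rewrite -lact_mul //; last exact: loop_bp.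
  apply: lact_homotopic; [exact: loop_bp | | by apply: loop_mul => //; exact: loop_bp].
  by apply: homotopic_mulA => //; rewrite ?c1 ?h1.
by have T' := bvalP z (path_mul k h) f; rewrite E in T'; exact: tot_inj (tr_uniq lcF c T' (bvalP z h _)).
Qed.

(** The affine action has the monodromy of [F] as its linear part, so differences of torsor points
    are transported as in [F], whatever the chosen base paths are. *)
Let bval_tr z h f f' : to_b z h -> trF h (pt z (bval z h f - bval z h f')) (pt b (f - f')).
Proof.
move=> Hh; have [c c0 c1] := bpP z; have [ch h0 h1] := Hh.
have t1 := tr_subF (bvalP z h f) (bvalP z h f').
have [e eb te] := tr_total (a := pt z (bval z h f - bval z h f')) lcF ch (esym h0).
have [cl _ _] := loop_bp Hh.
by rewrite -(tr_uniq lcF cl (tr_mul lcF ch t1 te) (lact_tr f f' (loop_bp Hh))).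
Qed.

Let seg := segment b.

Let ball_convex (z : A) (r : R) : convex_in [set w : C | nC (w - \val z) < r] := @disc_convex R (\val z) r.

Let center (z : A) (r : R) : 0 < r -> [set w : C | nC (w - \val z) < r] (\val z).
Proof. by move=> r0; rewrite /= subrr nC0. Qed.

Definition affine_sc (s : sections F) (z : A) : Prop := exists h f r,
  [/\ to_b z h, 0 < r, (forall w : C, nC (w - \val z) < r -> A w)
    & forall z' : A, nC (\val z' - \val z) < r -> s z' = bval z' (path_mul h (seg z' z)) f].

Let to_b_seg z h z' r : to_b z h -> 0 < r -> (forall w : C, nC (w - \val z) < r -> A w) ->
  nC (\val z' - \val z) < r -> to_b z' (path_mul h (seg z' z)).
Proof.
move=> [ch h0 h1] r0 rA zr; split; rewrite ?path_mul0 ?path_mul1 ?/seg ?segment0 ?segment1 //.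
apply: cpath_mul; rewrite ?segment1 //.
exact: (segment_cpath (w0 := b) (@ball_convex z r) rA zr (center z r0)).
Qed.

Fact affine_near s z : affine_sc s z -> \forall z' \near z, affine_sc s z'.
Proof.
move=> [h [f [r [Hh r0 rA Hs]]]]; apply/nbhs_subP; apply: filterS (near_nC (\val z) r0) => w wr z1 zw.
rewrite -{w}zw in wr; have vQ := @ball_convex z r; have Qz := center z r0.
exists (path_mul h (seg z1 z)), f, (r - nC (\val z1 - \val z)).
have sub (w : C) : nC (w - \val z1) < r - nC (\val z1 - \val z) -> nC (w - \val z) < r.
  move=> h1; have := nCD (w - \val z1) (\val z1 - \val z); rewrite addrA subrK => h2; lra.
split; [exact: to_b_seg Hh r0 rA wr | by rewrite subr_gt0 | by move=> w /sub/rA |].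
move=> z2 /sub z2r; rewrite (Hs _ z2r); have [ch h0 h1] := Hh.
have Hz1 := to_b_seg Hh r0 rA wr; have [c1 c10 c11] := Hz1.
have s12 : cpath (seg z2 z1) := segment_cpath (w0 := b) vQ rA z2r wr.
have s1z : cpath (seg z1 z) := segment_cpath (w0 := b) vQ rA wr Qz.
have s2z : cpath (seg z2 z) := segment_cpath (w0 := b) vQ rA z2r Qz.
apply: bval_homotopic; first exact: to_b_seg Hh r0 rA z2r.
  by split; rewrite ?path_mul0 ?path_mul1 ?/seg ?segment0 //; apply: cpath_mul; rewrite // c10 /seg segment1.
apply: (@homotopic_trans _ _ _ (path_mul h (path_mul (seg z1 z) (seg z2 z1)))); last first.
  by apply/homotopic_sym/homotopic_mulA => //; rewrite /seg ?segment0 ?segment1.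
apply: homotopic_mul; [exact: homotopic_refl | | by rewrite /seg segment1].
have cm : cpath (path_mul (seg z1 z) (seg z2 z1)) by apply: cpath_mul; rewrite // /seg segment0 segment1.
apply: (homotopic_convex b vQ rA s2z cm) => [t t01|t t01||].
- exact: (segment_in b vQ rA z2r Qz t01).
- rewrite /path_mul; case: ifP => t2.
    by apply: (segment_in b vQ rA z2r wr); apply/andP; split; lra.
  by have {}t2 := negbT t2; rewrite -ltNge in t2; apply: (segment_in b vQ rA wr Qz); apply/andP; split; lra.
- by rewrite path_mul0 /seg !segment0.
- by rewrite path_mul1 /seg !segment1.
Qed.

Fact affine_loc s t z : (\forall z' \near z, s z' = t z') -> affine_sc s z -> affine_sc t z.
Proof.
move=> st [h [f [r [Hh r0 rA Hs]]]]; have [r' [r'0 rA' Hr']] := point_ball AL st.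
exists h, f, (Num.min r r'); split=> //; first by rewrite lt_min r0 r'0.
  by move=> w; rewrite lt_min => /andP[/rA].
by move=> z'; rewrite lt_min => /andP[/Hs <- /Hr'].
Qed.

Let seg_tr (s : sections F) z r : 0 < r -> (forall w : C, nC (w - \val z) < r -> A w) ->
  (forall w : A, nC (\val w - \val z) < r -> secat s w) ->
  forall z' : A, nC (\val z' - \val z) < r -> trF (seg z' z) (pt z' (s z')) (pt z (s z)).
Proof.
move=> r0 rA Hs z' zr; have vQ := @ball_convex z r; have Qz := center z r0.
have fs : flat (S := sheaf_et F) [set w : A | nC (\val w - \val z) < r] id (fun w => pt w (s w)).
  by move=> e er; exists s; [exact: Hs | exact: near_all].
have := flat_tr fs (segment_cpath (w0 := b) vQ rA zr Qz) (fun t t01 => segment_in b vQ rA zr Qz t01).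
by rewrite segment0 segment1.
Qed.

Fact affine_sub s t z : affine_sc s z -> affine_sc t z -> secat (s - t) z.
Proof.
move=> [h [f [r [Hh r0 rA Hs]]]] [h' [f' [r' [Hh' r'0 rA' Ht]]]].
have [ch h0 h1] := Hh; have [ch' h'0 h'1] := Hh'.
(* This loop rewrites the second section with the path [h] of the first one. The difference of the
   two is then obtained from the single vector [f - f2]. *)
pose k := path_mul h' (path_inv h).
have Lk : loop k.
  rewrite /k; split; rewrite ?path_mul0 ?path_mul1 // /path_inv ?subr0 //.
  by apply: cpath_mul; [exact: ch' | exact: cpath_inv | rewrite subrr h0 h'0].
pose f2 := lact k f'.
have [e ez te] := tr_total (g := path_inv h) (a := pt b (f - f2)) lcF (cpath_inv ch) ltac:(by rewrite /path_inv subr0 h1).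
have ez' : projT1 e = z by rewrite ez /path_inv subrr.
have {}te := tr_inv te; rewrite path_invK (tot_tot_at ez') in te.
have [sg Hsg sgz] := secat_germ (tot_at e z).
have [r2 [r20 _ Hr2]] := point_ball AL (secat_near Hsg).
pose r3 := Num.min (Num.min r r') r2.
have r30 : 0 < r3 by rewrite !lt_min r0 r'0 r20.
apply: (@secat_local K A F sg (s - t : sections F) z _ Hsg); apply/nbhs_subP; apply: filterS (near_nC (\val z) r30) => w wr z' zw.
rewrite -{w}zw !lt_min in wr; have /andP[/andP[wr1 wr2] wr3] := wr.
rewrite -[RHS]/(s z' - t z') (Hs _ wr1) (Ht _ wr2).
have Qz := center z r0; have vQ := @ball_convex z r.
have cs : cpath (seg z' z) := segment_cpath (w0 := b) vQ rA wr1 Qz.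
have Hm := to_b_seg Hh r0 rA wr1; have [cm m0 m1] := Hm.
have -> : bval z' (path_mul h' (seg z' z)) f' = bval z' (path_mul h (seg z' z)) f2.
  rewrite -bval_mul //; apply: bval_homotopic; first exact: to_b_seg Hh' r'0 rA' wr2.
    have [ck k0 k1] := Lk; split; rewrite ?path_mul0 ?path_mul1 // /seg ?segment0 //.
    by apply: cpath_mul; rewrite // m1.
  have z1 : seg z' z 1 = z by rewrite /seg segment1.
  apply: (@homotopic_trans _ _ _ (path_mul (path_mul k h) (seg z' z))); last first.
    by have [ck k0 k1] := Lk; apply: homotopic_mulA; rewrite ?z1 ?h0 ?h1 ?k0.
  apply: homotopic_mul; [|exact: homotopic_refl | by rewrite z1].
  apply: homotopic_sym.
  apply: (@homotopic_trans _ _ _ (path_mul h' (path_mul (path_inv h) h))).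
    by apply: homotopic_mulA; rewrite // /path_inv ?subr0 ?subrr ?h0 //; exact: cpath_inv.
  apply: (@homotopic_trans _ _ _ (path_mul h' (cst z))).
    apply: homotopic_mul; [exact: homotopic_refl | |].
      by have := homotopic_inv_mul ch; rewrite h0.
    by rewrite path_mul1 /path_inv subrr h0 h'0.
  by have := homotopic_mul1 ch'; rewrite h'0.
have t1 := bval_tr f f2 Hm.
have r01 : 0 < Num.min r r2 by rewrite lt_min r0 r20.
have t2 := @seg_tr sg z (Num.min r r2) r01 _ _ z'.
have {}t2 : trF (seg z' z) (pt z' (sg z')) (pt z (sg z)).
  apply: t2; last by rewrite lt_min wr1 wr3.
    by move=> w; rewrite lt_min => /andP[/rA].
  by move=> w; rewrite lt_min => /andP[_ /Hr2].
rewrite sgz in t2.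
exact: tot_inj (tr_uniql lcF cm (tr_mul lcF ch t2 te) t1).
Qed.

Fact affine_add s t z : affine_sc s z -> secat t z -> affine_sc (s + t) z.
Proof.
move=> [h [f [r [Hh r0 rA Hs]]]] Ht; have [ch h0 h1] := Hh.
have [r2 [r20 _ Hr2]] := point_ball AL (secat_near Ht).
have [e eb te] := tr_total (a := pt z (t z)) lcF ch (esym h0).
have eb' : projT1 e = b by rewrite eb h1.
rewrite (tot_tot_at eb') in te; set u := tot_at e b in te.
exists h, (f + u), (Num.min r r2); split=> //; first by rewrite lt_min r0 r20.
  by move=> w; rewrite lt_min => /andP[/rA].
move=> z' zr; have := zr; rewrite lt_min => /andP[zr1 zr2].
rewrite -[LHS]/(s z' + t z') (Hs _ zr1).
have Hm := to_b_seg Hh r0 rA zr1; have [cm m0 m1] := Hm.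
have t1 := bval_tr (f + u) f Hm; rewrite [f + u]addrC addrK [u + f]addrC in t1.
have r01 : 0 < Num.min r r2 by rewrite lt_min r0 r20.
have t2 : trF (seg z' z) (pt z' (t z')) (pt z (t z)).
  apply: (seg_tr r01) zr => w; rewrite lt_min => /andP[] //.
    by move=> /rA.
  by move=> _ /Hr2.
have E := tot_inj (tr_uniql lcF cm (tr_mul lcF ch t2 te) t1).
by rewrite E [LHS]addrC subrK.
Qed.

Definition affine_torsor : torsor F := Torsor affine_near affine_loc affine_sub affine_add.
Notation trT g := (tr (S := torsor_et affine_torsor) (R := R) g).

Let bval_sc z h f : to_b z h -> tsc affine_torsor (fun z' => bval z' (path_mul h (seg z' z)) f) z.
Proof.
move=> Hh; have [r [r0 rA _]] := point_ball AL (near_all z (fun _ => I)).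
by exists h, f, r.
Qed.

Lemma affine_torsor_exists z : exists s, tsc affine_torsor s z.
Proof.
have [c c0 c1] := bpP z; exists (fun z' => bval z' (path_mul (path_inv (bp z)) (seg z' z)) 0).
by apply: bval_sc; split; [exact: cpath_inv | rewrite /path_inv subr0 | rewrite /path_inv subrr].
Qed.

(** At time [t] the lift is the point presented by [f] and the remaining part of [g], from [t] to
    1. *)
Let bval_lift (g : R -> A) f : cpath g -> g 1 = b ->
  trT g (pt (g 0) (bval (g 0) g f)) (pt b (bval b (cst b) f)).
Proof.
move=> cg g1; pose v (t : R) := pt (g (clamp t)) (bval (g (clamp t)) (subpath g (clamp t) 1) f).
have e1 : (1 : R) = clamp 1 by rewrite clamp_ge1.
have i1 : 0 <= (1 : R) <= 1 by rewrite ler01 lexx.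
have Hsub (t : R) : 0 <= t <= 1 -> to_b (g t) (subpath g t 1).
  move=> t01; split; first exact: subpath_cpath.
    by rewrite /subpath mul0r addr0.
  by rewrite /subpath mul1r subrKC.
exists v; split; last 2 first.
- rewrite /v clamp_le0 //; congr (pt _ (bval _ _ _)); apply: functional_extensionality_dep => t.
  by rewrite /subpath subr0 mulr1 add0r.
- rewrite /v -e1 g1; congr (pt _ (bval _ _ _)); apply: functional_extensionality_dep => t.
  by rewrite /subpath subrr mulr0 addr0.
move=> t _ /=; set z := g (clamp t).
have t01 := clamp_itv t; have Hz := Hsub _ t01.
exists (fun z' => bval z' (path_mul (subpath g (clamp t) 1) (seg z' z)) f); first exact: bval_sc.
have [r [r0 rA _]] := point_ball AL (near_all z (fun _ => I)).
have vQ := @ball_convex z r; have Qz := center z r0.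
have near_z : \forall c \near clamp t, nC (\val (g (clamp c)) - \val z) < r.
  have cv := (for_continuous_val _ _).1 (@cg (clamp t)).
  apply: (near_continuous cv (P := fun w => nC (w - \val z) < r)).
  by rewrite /= clamp_clamp; exact: near_nC.
have [d d0 Hd] : exists2 d : R, 0 < d & forall c, `|c - clamp t| < d -> nC (\val (g (clamp c)) - \val z) < r.
  by move/nbhs_ballP: near_z => [d d0 Hd]; exists d => // c cd; apply: Hd; rewrite /ball /= distrC.
have nd : \forall t' \near t, `|clamp t' - clamp t| < d.
  apply: (near_continuous (@clamp_continuous R t) (P := fun u => `|u - clamp t| < d)).
  by apply/nbhs_ballP; exists d => // u; rewrite /ball /= distrC.
apply: filterS nd => t' td; rewrite /v; congr (existT _ _ _).
have t'01 := clamp_itv t'.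
have Q' (u : R) : 0 <= u <= 1 -> nC (\val (subpath g (clamp t') (clamp t) u) - \val z) < r.
  move=> /andP[u0 u1]; rewrite /subpath; set c := clamp t' + _.
  have cc : clamp c = c.
    apply: clamp_id; rewrite /c; move: (clamp t') (clamp t) t'01 t01 => a a' /andP[? ?] /andP[? ?].
    by apply/andP; split; nra.
  rewrite -cc; apply: Hd.
  have -> : c - clamp t = (1 - u) * (clamp t' - clamp t) by rewrite /c; ring.
  rewrite normrM ger0_norm ?subr_ge0 //; apply: le_lt_trans td.
  by rewrite ler_piMl // lerBlDr lerDl.
have zr : nC (\val (g (clamp t')) - \val z) < r.
  have : nC (\val (subpath g (clamp t') (clamp t) 0) - \val z) < r by apply: Q'; rewrite lexx ler01.
  by rewrite /subpath mul0r addr0.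
apply: bval_homotopic; first exact: Hsub.
  exact: to_b_seg Hz r0 rA zr.
apply: (homotopic_trans (homotopic_sym (homotopic_subpath cg t'01 t01 i1))).
apply: homotopic_mul; [by apply: homotopic_refl; case: Hz | | by rewrite /subpath mul1r mul0r addr0 subrKC].
apply: (homotopic_convex b vQ rA).
- exact: subpath_cpath.
- exact: (segment_cpath (w0 := b) vQ rA zr Qz).
- exact: Q'.
- by move=> u u01; exact: (segment_in b vQ rA zr Qz u01).
- by rewrite /subpath mul0r addr0 /seg segment0.
- by rewrite /subpath mul1r subrKC /seg segment1.
Qed.

(** [f0] is the point presented by 0 and the constant path. It need not be 0, because the base path
    chosen for [b] may be any loop. *)
Lemma affine_torsor_monodromy : exists f0, forall j,
  trT (alpha j) (pt b (f0 + act1 (j, false) 0)) (pt b f0).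
Proof.
have c0 : to_b b (cst b) by split=> // t; exact: cst_continuous.
have L0 : loop (cst b) by [].
exists (bval b (cst b) 0) => j; have [_ a0 a1] := al j; have aj := is_path_cpath (al j).
have Lj : loop (alpha j) by [].
have := bval_lift 0 aj a1; rewrite a0; suff -> : bval b (alpha j) 0 = bval b (cst b) 0 + act1 (j, false) 0 by [].
have hj : homotopic (path_mul (alpha j) (cst b)) (alpha j) by have := homotopic_mul1 aj; rewrite a0.
rewrite -(bval_homotopic 0 _ _ hj) //; last by have [? ? ?] := loop_mul Lj L0.
rewrite bval_mul //; have -> : lact (alpha j) 0 = act1 (j, false) 0.
  by rewrite (@lactE _ [:: (j, false)]) //; exact: homotopic_sym.
have := bval_tr (act1 (j, false) 0) 0 c0; rewrite subr0 => t1.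
have E := tot_inj (tr_uniq lcF (g := cst b) (@cst_continuous _ _ _) t1 (tr_cst R lcF _)).
by apply/eqP; rewrite [X in _ == X]addrC -subr_eq -E.
Qed.
End AffineTorsor.

(** * The convolution sheaf *)

Section LinearGadgets.
Variable K : fieldType.

Lemma linear_of_rel (U W : lmodType K) (P : U -> W -> Prop) :
  (forall u, exists w, P u w) ->
  (forall a u u' w w', P u w -> P u' w' -> P (a *: u + u') (a *: w + w')) ->
  (forall w, P 0 w -> w = 0) -> exists f : {linear U -> W}, forall u, P u (f u).
Proof.
move=> P1 PD P0; have /choice[f Hf] := P1.
have uniq u w w' : P u w -> P u w' -> w = w'.
  move=> h h'; have := PD (-1) _ _ _ _ h' h; rewrite !scaleN1r !addNr => /P0 /eqP.
  by rewrite addrC subr_eq0 => /eqP.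
have lin : linear f by move=> a u v; exact: uniq (Hf _) (PD a _ _ _ _ (Hf u) (Hf v)).
pose h := HB.pack_for {linear U -> W} f (GRing.isLinear.Build K U W *:%R f lin).
by exists h.
Qed.

Lemma tot_cast (X : Type) (F : X -> lmodType K) x z : x = z ->
  exists J : {linear F x -> F z}, bijective J /\ forall v, existT (fun y => F y : Type) z (J v) = existT _ x v.
Proof. by case: z /; exists idfun; split=> //; exists id. Qed.
End LinearGadgets.

Section CircleTransport.
Variables (R : realType) (K : fieldType) (Y : topologicalType) (S : et K Y).
Local Notation C := ((R[i])^o).
Variables (D : set C) (Ls : seq C) (q : D -> Y).
Hypotheses (DL : forall z, D z <-> z \notin Ls) (cq : continuous q) (lS : forall y, lc S y).

(** The circle lies in a full disc inside [D], over which a section through [a] exists by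
    convexity. *)
Lemma circle_trivial (k : R -> D) (c : C) (r : R) (a : tot S) :
  (forall z : C, nC (z - c) <= r -> D z) -> nC (\val (k 0) - c) <= r ->
  (forall t, 0 <= t <= 1 -> \val (k t) = c + (\val (k 0) - c) * expi t) ->
  projT1 a = q (k 0) -> tr (S := S) (q \o k) a a.
Proof.
move=> rD kr kE ak; have [r' rr' H] := disc_extend DL rD.
pose Q := [set z : C | nC (z - c) < r']; pose q' (z : C) : Y := q (insubd (k 0) z).
have insE (z : C) : Q z -> \val (insubd (k 0) z) = z.
  by move=> Qz; rewrite insubdK //; apply: mem_set; exact: H.
have cq' (z : C) : Q z -> {for z, continuous q'}.
  move=> Qz; have c1 : {for z, continuous (fun z : C => insubd (k 0) z : D)}.
    apply/for_continuous_val => P; rewrite insE // => HP.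
    change (\forall z' \near z, P (\val (insubd (k 0) z'))).
    have Qn : nbhs z Q by apply: open_nbhs_nbhs; split=> //; exact: disc_open.
    by apply: filterS2 Qn HP => z' Qz' Pz'; rewrite insE.
  exact: (@for_continuous_comp _ _ _ (fun z : C => insubd (k 0) z : D) q z c1 (@cq _)).
have kQ t : 0 <= t <= 1 -> Q (\val (k t)).
  move=> t01; rewrite /Q /= kE // addrC addKr nCM nC_expi mulr1.
  exact: le_lt_trans rr'.
have q'k t : q' (\val (k t)) = q (k t) by rewrite /q' valKd.
have i0 : 0 <= (0 : R) <= 1 by rewrite lexx ler01.
have i1 : 0 <= (1 : R) <= 1 by rewrite lexx ler01.
have [s [fs sa]] := convex_section (@disc_open R c r') (@disc_convex R c r') cq'
  (fun z _ => lS _) (kQ 0 i0) (etrans ak (esym (q'k 0))).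
have kE' t : 0 <= t <= 1 -> \val (k t) = c + (\val (k 0) - c) * expi (1 * t) by rewrite mul1r; exact: kE.
have ck0 := circle_cpath kE'.
have ck : cpath (fun t => \val (k t) : C) by move=> t; exact: (for_continuous_val _ _).1 (@ck0 t).
have := flat_tr fs ck kQ; have -> : \val (k 1) = \val (k 0).
  by rewrite kE // expi1 mulr1 addrC subrK.
rewrite sa; apply: tr_eq => t _ /=; exact: q'k.
Qed.
End CircleTransport.

Lemma comp_path_mul (R : realType) (X Y : topologicalType) (f : X -> Y) (g h : R -> X) :
  f \o path_mul g h = path_mul (f \o g) (f \o h).
Proof. by apply: functional_extensionality_dep => t; rewrite /path_mul /=; case: ifP. Qed.

Section SimpleLoopTransport.
Variables (R : realType) (K : fieldType) (A : set (R[i])^o) (Y : topologicalType) (S : et K Y) (q : A -> Y).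
Local Notation C := ((R[i])^o).
Hypotheses (cq : continuous q) (lS : forall y, lc S y).
Variables (b : A) (k h g : R -> A).
Hypotheses (hp : is_path h b (k 0)) (ck : cpath k) (k1 : k 1 = k 0)
  (gh : homotopic g (path_mul (path_inv h) (path_mul k h))).

Let cpath_comp (f : R -> A) : cpath f -> cpath (q \o f).
Proof. by move=> cf t; exact: (for_continuous_comp (@cf t) (@cq _)). Qed.

Lemma tr_conj_comp (d a a' d' : tot S) : tr (S := S) (q \o h) d a -> tr (S := S) (q \o k) a a' ->
  tr (S := S) (q \o h) d' a' -> tr (S := S) (q \o g) d d'.
Proof.
have gh' := homotopic_comp cq gh; rewrite !comp_path_mul in gh'.
have [_ h0 h1] := hp; have ch := cpath_comp (is_path_cpath hp).
have hp' : is_path (q \o h) (q b) ((q \o k) 0) by have := cpath_is_path ch; rewrite /= h0 h1.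
exact: (tr_conj lS hp' (cpath_comp ck) gh').
Qed.

Lemma tr_conj_fixed (d : tot S) : projT1 d = q b ->
  (forall a, projT1 a = q (k 0) -> tr (S := S) (q \o k) a a) -> tr (S := S) (q \o g) d d.
Proof.
move=> db ka; have [_ h0 h1] := hp; have ch := cpath_comp (is_path_cpath hp).
have [a ab ha] := tr_total (g := q \o h) (a := d) lS ch (etrans db (congr1 q (esym h0))).
apply: (tr_conj_comp ha _ ha); apply: ka; by rewrite ab /= h1.
Qed.
End SimpleLoopTransport.

Section Setup.
Variables (R : realType) (K : fieldType) (p : nat) (x : 'I_p -> (R[i])^o) (lambda : K) (L : sheaf K (Gm R)).
Local Notation C := ((R[i])^o).
Hypotheses (lambda0 : lambda != 0) (lambda1 : lambda != 1) (kL : kummer lambda L).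
Variable V : sheaf K (U1 x).
Hypothesis lV : local_system V.

Definition conv_sheaf : sheaf K (U x) := tensor (pull (@pr1_continuous R p x) V) (pull (@dif_continuous R p x) L).

Let rL : rank_one_local_system L. Proof. by case: kL. Qed.
Let lL : local_system L. Proof. by move=> z; exists 1%N; exact: rL. Qed.
Let rLd : rank_one_local_system (pull (@dif_continuous R p x) L).
Proof. exact: pull_rank_one. Qed.

Lemma coeff_local_system : local_system conv_sheaf.
Proof. by apply: tensor_local_system => //; exact: pull_local_system. Qed.
Notation lcF := (local_system_lc coeff_local_system).

Lemma coeff_line (u : U x) : exists l : pull (@dif_continuous R p x) L u, stalk_line l.
Proof. exact: rank_one_stalk. Qed.

Lemma tr_coeff (g : R -> U x) u u' (v : V (pr1 u)) (v' : V (pr1 u')) (l : L (dif u)) (l' : L (dif u')) :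
  g 0 = u -> g 1 = u' ->
  tr (S := sheaf_et V) (@pr1 R p x \o g) (PT V (pr1 u) v) (PT V (pr1 u') v') ->
  tr (S := sheaf_et L) (@dif R p x \o g) (PT L (dif u) l) (PT L (dif u') l') ->
  tr (S := sheaf_et conv_sheaf) g
    (PT conv_sheaf u (tns (v : pull (@pr1_continuous R p x) V u) (l : pull (@dif_continuous R p x) L u)))
    (PT conv_sheaf u' (tns (v' : pull (@pr1_continuous R p x) V u') (l' : pull (@dif_continuous R p x) L u'))).
Proof.
move=> g0 g1 tv tl.
have t1 : tr (S := sheaf_et (pull (@pr1_continuous R p x) V)) g
  (PT (pull (@pr1_continuous R p x) V) u v) (PT (pull (@pr1_continuous R p x) V) u' v').
  exact: (tr_pullet (@pr1_continuous R p x) g0 g1 tv).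
have t2 : tr (S := sheaf_et (pull (@dif_continuous R p x) L)) g
  (PT (pull (@dif_continuous R p x) L) u l) (PT (pull (@dif_continuous R p x) L) u' l').
  exact: (tr_pullet (@dif_continuous R p x) g0 g1 tl).
exact: (tr_tns t1 t2).
Qed.

Section OnSlice.
Variable y : U1 x.
Notation fib := (@fib R p x y).
Let cf : continuous fib := @fib_continuous R p x y.

(** On a slice [dif] extends to the plane without [y], where the [x i] are no punctures; this makes
    the monodromy of [L] around them trivial. *)
Let off_y : set C := [set z | z != \val y].
Let off_yE z : off_y z <-> z \notin [:: \val y].
Proof. by rewrite inE. Qed.
Fact off_dif_subproof (z : off_y) : Gm R (\val y - \val z).
Proof. by rewrite /Gm /= subr_eq0 eq_sym; exact: setP_val z. Qed.
Let off_dif : off_y -> Gm R := corestr off_dif_subproof.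
Let off_dif_continuous : continuous off_dif.
Proof.
apply: corestr_continuous => z.
exact: (for_continuous_CB (@for_continuous_cst _ _ (\val y : C) z) (@val_continuous _ off_y z)).
Qed.

Let to_off : slice y -> off_y := @to_C R p x (\val y).

Let dif_fib (z : slice y) : dif (fib z) = off_dif (to_off z).
Proof. exact: val_inj. Qed.

Let pr1_fib (z : slice y) : pr1 (fib z) = to_U1 z.
Proof. exact: val_inj. Qed.

Let cdif : continuous (@dif R p x \o fib).
Proof. by move=> z; exact: (for_continuous_comp (@cf z) (@dif_continuous R p x _)). Qed.

Let cpr1 : continuous (@pr1 R p x \o fib).
Proof. by move=> z; exact: (for_continuous_comp (@cf z) (@pr1_continuous R p x _)). Qed.

Let yU1 : U1 x (\val y) := setP_val y.

Let circle_end (k : R -> slice y) (c : C) :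
  (forall t, 0 <= t <= 1 -> \val (k t) = c + (\val (k 0) - c) * expi t) -> cpath k /\ k 1 = k 0.
Proof.
move=> kE; split.
  by apply: (@circle_cpath _ _ k c (\val (k 0) - c) 1) => t /kE; rewrite mul1r.
by apply: val_inj; rewrite kE ?ler01 ?lexx // expi1 mulr1 addrC subrK.
Qed.

(** [pr1] forgets the puncture [y]: in [U1] the circle around it bounds a full disc. *)
Let circle_V (k : R -> slice y) (r : R) (a : tot (sheaf_et V)) :
  (forall z : C, 0 < nC (z - \val y) <= r -> U1minus x (\val y) z) -> nC (\val (k 0) - \val y) = r ->
  (forall t, 0 <= t <= 1 -> \val (k t) = \val y + (\val (k 0) - \val y) * expi t) ->
  projT1 a = pr1 (fib (k 0)) -> tr (S := sheaf_et V) (@pr1 R p x \o fib \o k) a a.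
Proof.
move=> rA kr kE ak.
have := @circle_trivial R K _ (sheaf_et V) (U1 x) _ id (@U1_mem R p x) (fun z => @for_continuous_id _ z)
  (local_system_lc lV) (@to_U1 R p x (\val y) \o k) (\val y) r a.
rewrite (_ : id \o _ = @pr1 R p x \o fib \o k); last first.
  by apply: functional_extensionality_dep => t; rewrite /= pr1_fib.
apply => //.
- move=> z zr; have [z0|z0] := ltP 0 (nC (z - \val y)).
    by have [] := rA z (introT andP (conj z0 zr)).
  suff -> : z = \val y by [].
  by apply/eqP; rewrite -subr_eq0 -nC_eq0 eq_le z0 nC_ge0.
- by rewrite -kr.
- by rewrite ak pr1_fib.
Qed.

Let circle_L (k : R -> slice y) (l : L (dif (fib (k 0)))) :
  (forall t, 0 <= t <= 1 -> \val (k t) = \val y + (\val (k 0) - \val y) * expi t) ->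
  tr (S := sheaf_et L) (@dif R p x \o fib \o k) (PT L _ (lambda *: l)) (PT L _ l).
Proof.
move=> kE; apply/(@monodromyE _ _ L); have [_ kum] := kL; apply: kum => t t01 /=.
rewrite kE //.
(* Along the circle [dif] is [(y - k 0) * expi t], one counterclockwise turn around 0 in spite of
   the sign in [y - z]. *)
have H (a c e : R[i]) : a - (a + (c - a) * e) = (a - c) * e by ring.
exact: H.
Qed.

Lemma coeff_circle (k : R -> slice y) (r : R) (u : conv_sheaf (fib (k 0))) :
  (forall z : C, 0 < nC (z - \val y) <= r -> U1minus x (\val y) z) -> nC (\val (k 0) - \val y) = r ->
  (forall t, 0 <= t <= 1 -> \val (k t) = \val y + (\val (k 0) - \val y) * expi t) ->
  tr (S := sheaf_et conv_sheaf) (fib \o k) (PT conv_sheaf _ (lambda *: u)) (PT conv_sheaf _ u).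
Proof.
move=> rA kr kE; have [l sl] := coeff_line (fib (k 0)); have [v ->] := tns_surj u sl.
rewrite -tnsZr; have [ck k1] := circle_end kE.
have t1 := circle_V (a := PT V (pr1 (fib (k 0))) v) rA kr kE erefl; have t2 := circle_L l kE.
exact: (tr_coeff (g := fib \o k) (u := fib (k 0)) (u' := fib (k 0)) erefl (congr1 fib k1) t1 t2).
Qed.

Section BasePoint.
Variable b : slice y.

Lemma loop_V (g : R -> slice y) (a : tot (sheaf_et V)) : simple_loop b (\val y) g ->
  projT1 a = pr1 (fib b) -> tr (S := sheaf_et V) (@pr1 R p x \o fib \o g) a a.
Proof.
move=> /simple_loopE[r [k [h [[r0 rA] kr kE hp gh]]]] ab.
have [ck k1] := circle_end kE.
apply: (tr_conj_fixed cpr1 (local_system_lc lV) hp ck gh ab) => a' a'k.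
exact: circle_V rA kr kE a'k.
Qed.

Lemma loop_L (g : R -> slice y) (l : L (dif (fib b))) : simple_loop b (\val y) g ->
  tr (S := sheaf_et L) (@dif R p x \o fib \o g) (PT L (dif (fib b)) (lambda *: l)) (PT L (dif (fib b)) l).
Proof.
move=> /simple_loopE[r [k [h [[r0 rA] kr kE hp gh]]]].
have [ck k1] := circle_end kE; have [_ h0 h1] := hp.
have ch : cpath (@dif R p x \o fib \o h) by move=> t; exact: (for_continuous_comp (@is_path_cpath _ _ _ _ _ hp t) (@cdif _)).
have [a ab ha] := tr_total (g := @dif R p x \o fib \o h) (a := PT L (dif (fib b)) l) (local_system_lc lL) ch ltac:(by rewrite /= h0).
have ak : projT1 a = dif (fib (k 0)) by rewrite ab /= h1.
rewrite (tot_tot_at ak) in ha; have kl := circle_L (tot_at a (dif (fib (k 0)))) kE.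
(* Linearity of transport, with [lambda *: v] written as [(lambda - 1) *: v + v]. *)
have := tr_linear (lambda - 1) ha ha; rewrite !scalerBl !scale1r !subrK => ha'.
exact: (tr_conj_comp cdif (local_system_lc lL) hp ck gh ha' kl ha).
Qed.

Lemma loop_L_trivial i (g : R -> slice y) (a : tot (sheaf_et L)) : simple_loop b (x i) g ->
  projT1 a = dif (fib b) -> tr (S := sheaf_et L) (@dif R p x \o fib \o g) a a.
Proof.
move=> /simple_loopE[r [k [h [[r0 rA] kr kE hp gh]]]] ab.
have [ck k1] := circle_end kE.
apply: (tr_conj_fixed cdif (local_system_lc lL) hp ck gh ab) => a' a'k.
have := @circle_trivial R K _ (sheaf_et L) off_y _ off_dif off_yE off_dif_continuous
  (local_system_lc lL) (to_off \o k) (x i) r a'.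
rewrite (_ : off_dif \o _ = @dif R p x \o fib \o k); last first.
  by apply: functional_extensionality_dep => t; rewrite /= dif_fib.
apply => //.
- move=> z zr; have [z0|z0] := ltP 0 (nC (z - x i)).
    by have [] := rA z (introT andP (conj z0 zr)).
  suff -> : z = x i by rewrite /off_y /= eq_sym; exact: yU1.
  by apply/eqP; rewrite -subr_eq0 -nC_eq0 eq_le z0 nC_ge0.
- by rewrite -kr.
- by rewrite a'k /= dif_fib.
Qed.
End BasePoint.

(** A section is invariant along a small circle around [y], while the monodromy multiplies by
    [lambda], which is not 1. So it vanishes there and, by uniqueness of lifts, on the whole
    slice. *)
Lemma coeff_global0 (s : sections (pull cf conv_sheaf)) : (forall z, secat s z) -> forall z, s z = 0.
Proof.
move=> Hs; have [r [r0 yr _]] := small_ball (near_all y (fun _ => I)).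
have cA (t : R) : U1minus x (\val y) (\val y + r%:C%C * expi t).
  have E : \val y + r%:C%C * expi t - \val y = r%:C%C * expi t :> C by rewrite addrC addKr.
  have N : nC (\val y + r%:C%C * expi t - \val y) = r by rewrite E nCM nC_expi mulr1 nC_real gtr0_norm.
  split=> [i|]; last by rewrite nC_neq N.
  rewrite nC_neq; have := yr i; have := nCD (\val y - (\val y + r%:C%C * expi t)) (\val y + r%:C%C * expi t - x i).
  by rewrite addrA subrK nCB N => h1 h2; lra.
pose k (t : R) : slice y := exist (fun z => z \in U1minus x (\val y)) _ (mem_set (cA t)).
have kE t : 0 <= t <= 1 -> \val (k t) = \val y + (\val (k 0) - \val y) * expi t.
  by move=> _; rewrite /= expi0 mulr1 [X in _ + (X - _) * _]addrC addrK.
have kr : nC (\val (k 0) - \val y) = r by rewrite /= [X in X - _]addrC addrK nCM nC_expi mulr1 nC_real gtr0_norm.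
have rA (z : C) : 0 < nC (z - \val y) <= r -> U1minus x (\val y) z.
  move=> /andP[z0 zr]; split=> [i|]; last by rewrite nC_neq.
  by rewrite nC_neq; have := yr i; have := nCD (\val y - z) (z - x i); rewrite addrA subrK nCB => h1 h2; lra.
have [ck k1] := circle_end kE.
have lS := local_system_lc (pull_local_system cf coeff_local_system).
have fs : flat (S := sheaf_et (pull cf conv_sheaf)) setT id (fun z => PT (pull cf conv_sheaf) z (s z)).
  by move=> z _; exists s; [exact: Hs | exact: near_all].
have k0 : s (k 0) = 0.
  have t1 := flat_tr fs ck (fun _ _ => I); rewrite k1 in t1.
  have t2 : tr (S := sheaf_et (pull cf conv_sheaf)) k (PT (pull cf conv_sheaf) (k 0) (lambda *: s (k 0))) (PT (pull cf conv_sheaf) (k 0) (s (k 0))).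
    exact: (tr_pullet cf erefl k1 (coeff_circle (s (k 0)) rA kr kE)).
  have E : s (k 0) = lambda *: s (k 0) := tot_inj (tr_uniql lS ck t1 t2).
  have : (1 - lambda) *: s (k 0) == 0 by rewrite scalerBl scale1r -E subrr.
  by rewrite scaler_eq0 subr_eq0 eq_sym (negPf lambda1) => /eqP.
move=> z; have [g [cg g0 g1]] := slice_path (k 0) z.
have t1 := flat_tr fs cg (fun _ _ => I); rewrite g0 g1 k0 in t1.
have f0 : flat (S := sheaf_et (pull cf conv_sheaf)) setT id (fun z => PT (pull cf conv_sheaf) z 0).
  by move=> w _; exists 0; [exact: secat0 | exact: near_all].
have t2 := flat_tr f0 cg (fun _ _ => I); rewrite g0 g1 in t2.
exact: tot_inj (tr_uniq lS cg t1 t2).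
Qed.
End OnSlice.
End Setup.

(** * The stalk of the middle convolution *)

Section StalkMap.
Variables (R : realType) (K : fieldType) (p : nat) (x : 'I_p -> (R[i])^o) (u0 : U x)
  (alpha : 'I_p.+1 -> R -> U0 u0) (lambda : K) (L : sheaf K (Gm R)).
Local Notation C := ((R[i])^o).
Hypotheses (lambda0 : lambda != 0) (lambda1 : lambda != 1) (kL : kummer lambda L).
Hypothesis ab : alpha_base alpha.
Notation y := (pr2 u0).
Notation fib := (@fib R p x y).
Notation cf := (@fib_continuous R p x y).
Notation base := (baseU0 u0 : slice y).
Notation num := (slab_num (@pr2bar R p x)).
Notation mk := (mk (@pr2bar R p x)).
Notation ai i := (alpha (fintype.lift ord_max i)).

Lemma fib_base : fib base = u0.
Proof. by apply: val_inj; rewrite /=; case: (\val u0). Qed.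

(** Depends on [L] but not on the sheaf [V], so that [stalk_iso] is natural in [V]. *)
Definition base_line : pull (@dif_continuous R p x) L u0 := projT1 (cid (coeff_line kL u0)).
Lemma base_lineP : stalk_line base_line. Proof. exact: projT2 (cid (coeff_line kL u0)). Qed.

Section OneSheaf.
Variable V : sheaf K (U1 x).
Notation F := (conv_sheaf L V).
Notation FS := (pull cf F).

Lemma stalk_iso_exists : exists J : {linear V (pr1 u0) -> FS base},
  bijective J /\ forall v, PT F (fib base) (J v) =
    PT F u0 (tns (v : pull (@pr1_continuous R p x) V u0) base_line).
Proof.
have [J [Jb JE]] := tot_cast F (esym fib_base).
pose t (v : V (pr1 u0)) : F u0 := tns (v : pull (@pr1_continuous R p x) V u0) base_line.
have lin : linear t by move=> a v w; exact: tnsPl.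
pose T := HB.pack_for {linear V (pr1 u0) -> F u0} t (GRing.isLinear.Build K (V (pr1 u0)) (F u0) *:%R t lin).
exists (J \o T); split=> [|v]; last exact: JE.
apply: bij_comp Jb _.
have /choice[t' Ht'] : forall c : F u0, exists v, t v = c.
  by move=> c; have [v ->] := tns_surj c base_lineP; exists v.
exists t' => [v|c]; last exact: Ht'.
exact: (tns_inj base_lineP (Ht' (t v))).
Qed.

Definition stalk_iso : {linear V (pr1 u0) -> FS base} := projT1 (cid stalk_iso_exists).
Lemma stalk_iso_bij : bijective stalk_iso. Proof. by have [] := projT2 (cid stalk_iso_exists). Qed.
Lemma stalk_isoE v : PT F (fib base) (stalk_iso v) =
  PT F u0 (tns (v : pull (@pr1_continuous R p x) V u0) base_line).
Proof. by have [_] := projT2 (cid stalk_iso_exists). Qed.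
Notation J := stalk_iso.

(** A relation and not a function: the representative [sg] and its fixed point [f] are arbitrary, so
    linearity and naturality can be shown with the representatives at hand. *)
Definition stalk_rel (m : MC L V y) (w : prodM (fun _ : 'I_p => V (pr1 u0))) := exists sg f,
  [/\ num sg y, m = mk sg y & normal (alpha : 'I_p.+1 -> R -> slice y) J (slice_pot y sg) f w].

Hypothesis lV : local_system V.
Variable A : 'I_p.+1 -> GL (V (pr1 u0)).
Hypothesis mA : monodromy_tuple (alphaU1 alpha) A.

Let lF : local_system F. Proof. exact (coeff_local_system kL lV). Qed.
Let lFS : local_system FS. Proof. exact (pull_local_system cf lF). Qed.

Let gens : free_generators (alpha : 'I_p.+1 -> R -> slice y) base. Proof. by case: ab. Qed.
Let loops i : simple_loop (base : slice y) (x i) (ai i). Proof. by case: ab => _ H _ _; exact: H. Qed.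
Let loopq : simple_loop (base : slice y) (\val y) (alpha ord_max). Proof. by case: ab. Qed.
Let loop_infty : simple_loop_infty (base : slice y) (path_inv (path_prod base [seq alpha j | j <- enum 'I_p.+1])).
Proof. by case: ab. Qed.

Let al j : is_path (alpha j) base base. Proof. by have [[H _] _] := gens; exact: H. Qed.
Let al0 j : fib (alpha j 0) = u0. Proof. by have [_ -> _] := al j; exact: fib_base. Qed.
Let al1 j : fib (alpha j 1) = u0. Proof. by have [_ _ ->] := al j; exact: fib_base. Qed.

Lemma stalk_iso_monodromy i v :
  tr (S := sheaf_et FS) (ai i) (PT FS base (J (A (fintype.lift ord_max i) v))) (PT FS base (J v)).
Proof.
have [_ a0 a1] := al (fintype.lift ord_max i).
suff t : tr (S := sheaf_et F) (fib \o ai i) (PT F (fib base) (J (A (fintype.lift ord_max i) v))) (PT F (fib base) (J v)).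
  exact: (tr_pullet (S := sheaf_et F) cf a0 a1 t).
rewrite !stalk_isoE; apply: (tr_coeff (g := fib \o ai i) (al0 _) (al1 _)).
  have [/(_ i v)/monodromyE t _] := mA; apply: tr_eq t => t _ /=; exact: val_inj.
apply: (loop_L_trivial kL (b := base) (a := PT L (dif u0) base_line) (loops i)).
by rewrite fib_base.
Qed.

Lemma stalk_iso_monodromy_y (u : FS base) :
  tr (S := sheaf_et FS) (alpha ord_max) (PT FS base (lambda *: u)) (PT FS base u).
Proof.
have [_ a0 a1] := al ord_max; suff t : tr (S := sheaf_et F) (fib \o alpha ord_max) (PT F (fib base) (lambda *: u)) (PT F (fib base) u).
  exact: (tr_pullet (S := sheaf_et F) cf a0 a1 t).
have [l sl] := coeff_line kL (fib base); have [v ->] := tns_surj u sl; rewrite -tnsZr.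
apply: (tr_coeff (g := fib \o alpha ord_max)); [by rewrite /= a0|by rewrite /= a1| |].
  exact: (loop_V lV (a := PT V (pr1 (fib base)) v) loopq erefl).
exact: (loop_L kL l loopq).
Qed.

Lemma stalk_rel_total m : exists w, stalk_rel m w.
Proof.
have [sg Nsg ->] := mk_surj m.
have [f [w Hw]] := normal_exists lFS stalk_iso_bij lambda1 gens stalk_iso_monodromy_y (slice_pot_exists Nsg).
by exists w, sg, f.
Qed.

Lemma stalk_rel_W m w : stalk_rel m w -> MC_W lambda A w.
Proof.
move=> [sg [f [Nsg _ nf]]].
apply/(normal_parabolic lFS stalk_iso_bij lambda0 gens loops loopq loop_infty
  stalk_iso_monodromy stalk_iso_monodromy_y (slice_pot_exists Nsg) nf).
exact: slice_parabolic.
Qed.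

Lemma stalk_rel_lin a m m' w w' : stalk_rel m w -> stalk_rel m' w' ->
  stalk_rel (a *: m + m') (a *: w + w').
Proof.
move=> [sg [f [Nsg -> [nq ni]]]] [sg' [f' [Nsg' -> [nq' ni']]]].
exists (a *: sg + sg'), (a *: f + f'); split; [exact: slab_numP | by rewrite mkP |].
have comb (s t : sections FS) (z : slice y) : slice_sc sg s z -> slice_sc sg' t z -> slice_sc (a *: sg + sg') (a *: s + t) z.
  move=> [s1 H1 E1] [s2 H2 E2]; exists (a *: s1 + s2); first exact: potP.
  by apply: filterS2 E1 E2 => z' e1 e2; rewrite -[LHS]/(a *: s z' + t z') e1 e2.
have comb_tr g (v1 v1' v2 v2' : FS base) :
    tr (S := torsor_et (slice_pot y sg)) (R := R) g (PT FS base v1) (PT FS base v2) ->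
    tr (S := torsor_et (slice_pot y sg')) (R := R) g (PT FS base v1') (PT FS base v2') ->
    tr (S := torsor_et (slice_pot y (a *: sg + sg'))) (R := R) g (PT FS base (a *: v1 + v1')) (PT FS base (a *: v2 + v2')).
  move=> t1 t2; exact: (tr_comb (@slice_near _ _ _ _ _ _ _) (@slice_loc _ _ _ _ _ _ _) comb t1 t2).
split=> [|i]; first exact: comb_tr.
have := comb_tr _ _ _ _ _ (ni i) (ni' i).
rewrite -[(a *: w + w' : prodM _) i]/(a *: w i + w' i) linearP.
suff -> : a *: (f + J (w i)) + (f' + J (w' i)) = a *: f + f' + (a *: J (w i) + J (w' i)) by [].
by rewrite scalerDr addrACA.
Qed.

Lemma stalk_rel0 w : stalk_rel 0 w -> w = 0.
Proof.
move=> [sg [f [Nsg m0 [nq ni]]]].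
have [tau Ht] := (mk_eq0_slice u0 lF Nsg).1 (esym m0).
have fs : flat (S := torsor_et (slice_pot y sg)) setT id (fun z => PT FS z (tau z)).
  by move=> z _; exists tau; [exact: Ht | exact: near_all].
have lT z : lc (torsor_et (slice_pot y sg)) z.
  by have [s] := slice_pot_exists Nsg z; apply: torsor_lc; exact: (local_system_lc lFS).
have tj j : tr (S := torsor_et (slice_pot y sg)) (alpha j) (PT FS base (tau base)) (PT FS base (tau base)).
  have [_ a0 a1] := al j; have := flat_tr fs (is_path_cpath (al j)) (fun _ _ => I).
  by rewrite a0 a1.
(* The value of a global section at the base point is fixed by all generators, so it is the unique
   fixed point [f] of the last one. *)
have fE := aq_fixed_uniq lFS lambda1 gens stalk_iso_monodromy_y nq (tj _); subst f.
apply: functional_extensionality_dep => i; apply: (bij_inj stalk_iso_bij).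
have E := tot_inj (tr_uniql lT (is_path_cpath (al _)) (ni i) (tj _)).
by rewrite -[(0 : prodM _) i]/(0 : V (pr1 u0)) linear0; apply: (addrI (tau base)); rewrite E addr0.
Qed.

Lemma stalk_rel_inj m : stalk_rel m 0 -> m = 0.
Proof.
move=> [sg [f [Nsg -> nf]]]; apply/(mk_eq0_slice u0 lF Nsg).
exact: (normal0_global lFS gens (slice_pot_exists Nsg) nf).
Qed.

Lemma tr_subtorsor (T T' : torsor FS) (g : R -> slice y) a b :
  (forall s z, tsc T s z -> tsc T' s z) ->
  tr (S := torsor_et T) g a b -> tr (S := torsor_et T') g a b.
Proof.
move=> TT' [s [fs s0 s1]]; exists s; split=> // t _.
by have [sg Hsg E] := fs t I; exists sg => //; exact: TT'.
Qed.

Lemma stalk_rel_surj w : MC_W lambda A w -> exists m, stalk_rel m w.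
Proof.
move=> Ww; have [J' JK KJ] := stalk_iso_bij.
(* The action of the generators on a torsor with cocycle [w], in coordinates with the fixed point of
   the last generator as origin; [true] marks inverse letters. *)
pose act1 (l : 'I_p.+1 * bool) (f : FS base) : FS base := match unlift ord_max l.1 with
  | Some i => if l.2 then J (gl_inv (A (fintype.lift ord_max i)) (J' f - w i))
              else J (w i + A (fintype.lift ord_max i) (J' f))
  | None => if l.2 then lambda^-1 *: f else lambda *: f end.
have act1K l f : act1 (letter_inv l) (act1 l f) = f.
  rewrite /act1 /letter_inv /=; case: unlift => [i|]; case: l.2 => /=.
  - by rewrite JK gl_invK addrC subrK KJ.
  - by rewrite JK [w i + _]addrC addrK gl_funK KJ.
  - by rewrite scalerA mulfV // scale1r.
  - by rewrite scalerA mulVf // scale1r.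
have act1F l f f' : tr (S := sheaf_et FS) (letter_path (alpha : 'I_p.+1 -> R -> slice y) l)
    (PT FS base (act1 l f - act1 l f')) (PT FS base (f - f')).
  rewrite /act1 /letter_path; case: l => j b /=.
  case: (unliftP ord_max j) => [i ->|->]; case: b.
  - apply: tr_inv; have Ee g : A (fintype.lift ord_max i) (gl_inv (A (fintype.lift ord_max i)) g) = g by exact: gl_invK.
    move: (gl_inv _ (J' f - _)) (gl_inv _ (J' f' - _)) (Ee (J' f - w i)) (Ee (J' f' - w i)) => e e' E1 E2.
    have := stalk_iso_monodromy i (e - e').
    have -> : A (fintype.lift ord_max i) (e - e') = J' f - J' f'.
      by rewrite linearB E1 E2 opprB addrA subrK.
    by rewrite !linearB !KJ.
  - have E : J (w i + A (fintype.lift ord_max i) (J' f)) - J (w i + A (fintype.lift ord_max i) (J' f')) =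
        J (A (fintype.lift ord_max i) (J' f - J' f')).
      by rewrite -(linearB J); congr (J _); rewrite opprD addrACA subrr add0r -linearB.
    by rewrite E -{2}(KJ f) -{2}(KJ f') -(linearB J); exact: stalk_iso_monodromy.
  - apply: tr_inv; have := stalk_iso_monodromy_y (lambda^-1 *: f - lambda^-1 *: f').
    by rewrite -scalerBr scalerA mulfV // scale1r.
  - by rewrite -scalerBr; exact: stalk_iso_monodromy_y.
have AL := @U1minus_mem R p x (\val y).
pose T := affine_torsor AL lFS gens act1K act1F.
have Tne : forall z, exists s, tsc T s z := affine_torsor_exists AL lFS gens act1K act1F.
have [f0 Hf0] := affine_torsor_monodromy AL lFS gens act1K act1F.
have J'0 : J' 0 = 0 by rewrite -(linear0 J) JK.
have nf : normal (alpha : 'I_p.+1 -> R -> slice y) J T f0 w.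
  split=> [|i]; first by have := Hf0 ord_max; rewrite /act1 /= unlift_none scaler0 addr0.
  by have := Hf0 (fintype.lift ord_max i); rewrite /act1 /= liftK J'0 linear0 addr0.
have par := (normal_parabolic lFS stalk_iso_bij lambda0 gens loops loopq loop_infty
  stalk_iso_monodromy stalk_iso_monodromy_y Tne nf).2 Ww.
have [r [r0 yr _]] := small_ball (near_all y (fun _ => I)).
have [sg [Nsg Hsg]] := slice_extension u0 lF r0 yr (nearby_center _ r0) par.
exists (mk sg y), sg, f0; split=> //; first exact/Nsg/nearby_center.
by case: nf => nq ni; split=> [|i]; apply: tr_subtorsor Hsg _.
Qed.

Lemma stalk_map_exists : exists phi : {linear MC L V y -> submodT (MC_W lambda A)},
  bijective phi /\ forall m, stalk_rel m (val (phi m)).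
Proof.
have [|a m m' w w' h h'|w h|f Hf] := @linear_of_rel K (MC L V y) (submodT (MC_W lambda A)) (fun m w => stalk_rel m (val w)).
- move=> m; have [w Hw] := stalk_rel_total m.
  have Ww : sub_pred (MC_W lambda A) w by apply/asboolP; exact: stalk_rel_W Hw.
  by exists (exist _ w Ww).
- exact: stalk_rel_lin.
- by apply: val_inj; exact: stalk_rel0.
exists f; split=> //.
have finj : injective f.
  move=> m m' e; apply/eqP; rewrite -subr_eq0; apply/eqP/stalk_rel_inj.
  have h := stalk_rel_lin (-1) (Hf m') (Hf m).
  by move: h; rewrite e !scaleN1r addNr [- m' + m]addrC.
have /choice[g Hg] : forall w, exists m, f m = w.
  move=> w; have /asboolP Ww := valP w; have [m Hm] := stalk_rel_surj Ww.
  exists m; apply: val_inj; apply/eqP; rewrite -subr_eq0; apply/eqP/stalk_rel0.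
  by have := stalk_rel_lin (-1) Hm (Hf m); rewrite !scaleN1r addNr addrC.
by exists g => [m|w]; [apply: finj; rewrite Hg | rewrite Hg].
Qed.
End OneSheaf.
End StalkMap.

Section TransportMaps.
Variables (K : fieldType) (X : topologicalType) (R : realType).

Lemma tr_map (S S' : et K X) (phi : forall z, S z -> S' z) (g : R -> X) x y (v : S x) (w : S y) :
  (forall s z, sc S s z -> sc S' (fun z => phi z (s z)) z) ->
  tr (S := S) g (PT S x v) (PT S y w) -> tr (S := S') g (PT S' x (phi x v)) (PT S' y (phi y w)).
Proof.
move=> Hphi [s [fs s0 s1]].
have map_pt (a : tot S) z (u : S z) : a = PT S z u ->
    PT S' (projT1 a) (phi _ (projT2 a)) = PT S' z (phi z u) by move=> ->.
exists (fun t => PT S' (projT1 (s t)) (phi _ (projT2 (s t)))); split; rewrite ?(map_pt _ _ _ s0) ?(map_pt _ _ _ s1) //.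
move=> t _; have [sg Hsg E] := fs t I; exists (fun z => phi z (sg z)); first exact: Hphi.
by apply: filterS E => t' ->.
Qed.

Lemma tr_map2 (S1 S2 S3 : et K X) (op : forall z, S1 z -> S2 z -> S3 z) (g : R -> X) x y
  (v : S1 x) (w : S1 y) (v' : S2 x) (w' : S2 y) :
  (forall s t z, sc S1 s z -> sc S2 t z -> sc S3 (fun z => op z (s z) (t z)) z) ->
  tr (S := S1) g (PT S1 x v) (PT S1 y w) -> tr (S := S2) g (PT S2 x v') (PT S2 y w') ->
  tr (S := S3) g (PT S3 x (op x v v')) (PT S3 y (op y w w')).
Proof.
move=> Hop [s [fs s0 s1]] [t [ft t0 t1]].
have map_pt (a : tot S1) (b : tot S2) z (u : S1 z) (u' : S2 z) : a = PT S1 z u -> b = PT S2 z u' ->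
    PT S3 (projT1 a) (op _ (projT2 a) (tot_at b (projT1 a))) = PT S3 z (op z u u').
  by move=> -> -> /=; rewrite tot_atE.
exists (fun e => PT S3 (projT1 (s e)) (op _ (projT2 (s e)) (tot_at (t e) (projT1 (s e))))); split.
- move=> e _; have [sg Hsg E] := fs e I; have [th Hth E'] := ft e I.
  exists (fun z => op z (sg z) (th z)); first exact: Hop.
  by apply: filterS2 E E' => e' a b; rewrite (map_pt _ _ _ _ _ a b).
- exact: map_pt.
- exact: map_pt.
Qed.
End TransportMaps.

Section Naturality.
Variables (R : realType) (K : fieldType) (p : nat) (x : 'I_p -> (R[i])^o) (u0 : U x)
  (alpha : 'I_p.+1 -> R -> U0 u0) (lambda : K) (L : sheaf K (Gm R)).
Hypothesis kL : kummer lambda L.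
Variables (V V' : sheaf K (U1 x)) (f : shom V V').
Notation y := (pr2 u0).
Notation fib := (@fib R p x y).
Notation cf := (@fib_continuous R p x y).
Notation base := (baseU0 u0 : slice y).
Notation phi := (tensor_hom (pull_hom (@pr1_continuous R p x) f) (shom1 (pull (@dif_continuous R p x) L))).

Lemma stalk_iso_hom v : phi (fib base) (stalk_iso u0 kL V v) = stalk_iso u0 kL V' (f (pr1 u0) v).
Proof.
apply: tot_inj; rewrite stalk_isoE.
pose F := conv_sheaf L V; pose F' := conv_sheaf L V'.
have map_pt (a b : tot F) : a = b -> PT F' (projT1 a) (phi _ (projT2 a)) = PT F' (projT1 b) (phi _ (projT2 b)) by move=> ->.
have := map_pt _ _ (stalk_isoE kL v); rewrite /= => ->.
by rewrite tensor_hom_tns.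
Qed.

Lemma stalk_rel_hom m w : stalk_rel alpha kL (V := V) m w ->
  stalk_rel alpha kL (V := V') (MC_hom L f y m) (fun i => f (pr1 u0) (w i)).
Proof.
move=> [sg [v [Nsg -> [nq ni]]]].
exists (prod_map (gode1_hom (push_hom (@emb R p x) phi)) sg), (phi (fib base) v); split.
- exact: slab_num_hom.
- exact: R1_hom_mk.
have step (s : sections (pull cf (conv_sheaf L V))) (z : slice y) : slice_sc sg s z ->
    slice_sc (prod_map (gode1_hom (push_hom (@emb R p x) phi)) sg) (fun z => phi (fib z) (s z)) z.
  move=> [s1 H1 E1]; exists (prod_map phi s1); first exact: pot_hom.
  by apply: filterS E1 => z' ->.
have move_tr g (a b : pull cf (conv_sheaf L V) base) :
    tr (S := torsor_et (slice_pot y sg)) (R := R) g (PT (pull cf (conv_sheaf L V)) base a) (PT (pull cf (conv_sheaf L V)) base b) ->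
    tr (S := torsor_et (slice_pot y (prod_map (gode1_hom (push_hom (@emb R p x) phi)) sg))) g
      (PT (pull cf (conv_sheaf L V')) base (phi (fib base) a)) (PT (pull cf (conv_sheaf L V')) base (phi (fib base) b)).
  exact: (@tr_map K _ R (torsor_et (slice_pot y sg)) (torsor_et (slice_pot y _)) (fun z => phi (fib z)) g base base a b step).
split=> [|i]; first exact: move_tr.
have E : phi (fib base) (v + stalk_iso u0 kL V (w i)) =
    phi (fib base) v + stalk_iso u0 kL V' (f (pr1 u0) (w i)) :> conv_sheaf L V' (fib base).
  rewrite -stalk_iso_hom; exact: (linearD (phi (fib base))).
exact: (eq_ind _ (fun a : pull cf (conv_sheaf L V') base => tr (S := torsor_et (slice_pot y _)) _
  (PT (pull cf (conv_sheaf L V')) base a) (PT (pull cf (conv_sheaf L V')) base (phi (fib base) v)))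
  (move_tr _ _ _ (ni i)) _ E).
Qed.
End Naturality.

(** * Classes with a potential *)

Section SubTranslates.
Variables (K : fieldType) (V : lmodType K).

Lemma sub_translates (a a' b c : V) : a = a' -> -1 *: (-1 *: a' + b) + (-1 *: a + c) = -1 *: b + c.
Proof. by move=> ->; rewrite !scaleN1r opprD opprK addrACA addrN add0r. Qed.
End SubTranslates.

Lemma mk_sub0 (K : fieldType) (X Z Y : topologicalType) (emb : X -> Z) (f : Z -> Y) (F : sheaf K X)
    (sg sg' : sections (gode1 (push emb F))) y : slab_num f sg y -> slab_num f sg' y ->
  mk f sg y = mk f sg' y -> mk f (-1 *: sg + sg') y = 0.
Proof.
move=> N N' E; have := mkP (-1) N N'; rewrite E.
move: (mk f sg' y) (mk f _ y); move: (R1 f (push emb F) y : lmodType K) => V m m' ->.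
by rewrite scaleN1r addNr.
Qed.

Section Box.
Variables (R : realType) (p : nat) (x : 'I_p -> (R[i])^o).
Local Notation C := ((R[i])^o).

Definition box (u : U x) (e : R) : set (U x) :=
  [set v | nC ((\val v).1 - (\val u).1) < e /\ nC ((\val v).2 - (\val u).2) < e].

Lemma small_box (u : U x) (r : R) : 0 < r -> exists e : R, [/\ 0 < e, e <= r &
  forall w : C * C, nC (w.1 - (\val u).1) < e -> nC (w.2 - (\val u).2) < e -> U x w].
Proof.
move=> r0; have := U_near (setP_val u : U x (\val u)).
rewrite [\val u]surjective_pairing => /near_prodP[A /nbhs_nC[a a0 HA] [B /nbhs_nC[b b0 HB] H]].
have m0 : 0 < Num.min r (Num.min a b) by rewrite !lt_min r0 a0.
exists (Num.min r (Num.min a b)); split=> //; first by rewrite ge_min lexx.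
move=> [w1 w2] /= h1 h2; apply: H; [apply: HA | apply: HB].
  by apply: lt_le_trans h1 _; rewrite !ge_min lexx orbT.
by apply: lt_le_trans h2 _; rewrite !ge_min lexx !orbT.
Qed.

Lemma box_center u e : 0 < e -> box u e u.
Proof. by move=> e0; rewrite /box /= !subrr nC0. Qed.

Lemma box_nbhs u e v : box u e v -> nbhs v (box u e).
Proof.
move=> [v1 v2]; have H1 := open_nbhs_nbhs (conj (@disc_open R (\val u).1 e) v1).
have H2 := open_nbhs_nbhs (conj (@disc_open R (\val u).2 e) v2).
have H : \forall w \near \val v, nC (w.1 - (\val u).1) < e /\ nC (w.2 - (\val u).2) < e.
  rewrite [\val v]surjective_pairing.
  exact: filterS2 (@near_fst C C _ _ (\val v).2 H1) (@near_snd C C _ (\val v).1 _ H2).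
exact: near_continuous (@val_continuous _ (U x) v) H.
Qed.

Variables (K : fieldType) (S : et K (U x)) (u : U x) (e : R).
Hypothesis boxU : forall w : C * C, nC (w.1 - (\val u).1) < e -> nC (w.2 - (\val u).2) < e -> U x w.
Hypothesis lS : forall v, box u e v -> lc S v.

(** A product of two discs is contracted to [u1] along segments in each coordinate. *)
Lemma box_section (u1 : U x) (a : S u1) : box u e u1 ->
  exists s : prodM S, (forall v, box u e v -> sc S s v) /\ s u1 = a.
Proof.
move=> [b1 b2].
pose c (z : C) (t : R) (w : C) : C := z + (clamp t)%:C%C * (w - z).
pose k (d : R * U x) : U x := mkU u (c (\val u1).1 d.1 (\val d.2).1, c (\val u1).2 d.1 (\val d.2).2).
have cbox t v : box u e v -> nC (c (\val u1).1 t (\val v).1 - (\val u).1) < e /\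
    nC (c (\val u1).2 t (\val v).2 - (\val u).2) < e.
  by move=> [v1 v2]; split; apply: disc_convex => //; exact: clamp_itv.
have cU t v : box u e v -> U x (c (\val u1).1 t (\val v).1, c (\val u1).2 t (\val v).2).
  by move=> Bv; have [h1 h2] := cbox t v Bv; exact: boxU.
have kE t v : box u e v -> \val (k (t, v)) = (c (\val u1).1 t (\val v).1, c (\val u1).2 t (\val v).2).
  by move=> /cU h; rewrite mkUE.
have cc (z : C) t (v : U x) (pr : C * C -> C) : continuous pr ->
    {for (t, v), continuous (fun d : R * U x => c z d.1 (pr (\val d.2)))}.
  move=> cpr; have c1 := for_continuous_clamp (@for_continuous_fst R (U x) (t, v)).
  have c0 : {for (t, v), continuous (fun d : R * U x => pr (\val d.2))}.
    apply: (for_continuous_comp (f := fun d : R * U x => \val d.2)); last exact: cpr.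
    by apply: (for_continuous_comp (@for_continuous_snd R (U x) (t, v))); exact: val_continuous.
  have c2 := for_continuous_CB c0 (@for_continuous_cst _ _ z _).
  exact: (for_continuous_CD (@for_continuous_cst _ _ z _) (for_continuous_CM (for_continuous_RC c1) c2)).
have ck t v : box u e v -> {for (t, v), continuous k}.
  move=> Bv; apply: for_continuous_mkU; last exact: cU.
  by apply: for_continuous_pair; apply: cc; [move=> d; exact: cvg_fst | move=> d; exact: cvg_snd].
have c0 z t w : t <= 0 -> c z t w = z by move=> t0; rewrite /c clamp_le0 // mul0r addr0.
have c1 z t w : 1 <= t -> c z t w = w by move=> t1; rewrite /c clamp_ge1 // mul1r addrC subrK.
have cz z t : c z t z = z by rewrite /c subrr mulr0 addr0.
have k0 t v : t <= 0 -> k (t, v) = u1.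
  by move=> t0; rewrite /k !c0 // -surjective_pairing mkU_val.
have k1 t v : 1 <= t -> k (t, v) = v.
  by move=> t1; rewrite /k !c1 // -surjective_pairing mkU_val.
have kk t : k (t, u1) = u1 by rewrite /k !cz -surjective_pairing mkU_val.
have kQ t v : box u e v -> box u e (k (t, v)).
  by move=> Bv; rewrite /box /= kE //; exact: cbox.
have [s [fs s1]] := contractible_section (S := S) (q := id) (@box_nbhs u e)
  (fun v _ => @for_continuous_id _ v) lS ck kQ k0 k1 kk a (conj b1 b2).
exists (fun v => tot_at (s v) v); split; last by rewrite s1 tot_atE.
move=> v /fs[t Ht E]; apply: sc_loc Ht.
by apply: filterS E => v' ->; rewrite tot_atE.
Qed.
End Box.

Lemma pot_sub_eq (K : fieldType) (X Z : topologicalType) (emb : X -> Z) (F : sheaf K X)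
    (sg sg' : sections (gode1 (push emb F))) (d : sections F) u : pot_sc sg d u -> sg' = sg ->
  pot_sc (-1 *: sg' + sg) 0 u.
Proof.
move=> H ->; have := potP (-1) H H.
by have -> : -1 *: d + d = 0 by rewrite scaleN1r addNr.
Qed.

Section ClassEtale.
Variables (R : realType) (p : nat) (x : 'I_p -> (R[i])^o) (u0 : U x) (K : fieldType) (F : sheaf K (U x)).
Local Notation C := ((R[i])^o).
Hypothesis lF : local_system F.
Hypothesis F0 : forall (y : U1 x) (s : sections F), (forall u, pr2 u = y -> secat s u) ->
  forall u, pr2 u = y -> s u = 0.
Notation RF := (R1 (@pr2bar R p x) (push (@emb R p x) F)).
Notation num := (slab_num (@pr2bar R p x)).
Notation mk := (mk (@pr2bar R p x)).
Notation lcF := (local_system_lc lF).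
Notation C1 := (sections (gode1 (push (@emb R p x) F))).
Implicit Type sg : C1.

Let rep_exists (a : tot (sheaf_et RF)) : exists sg, num sg (projT1 a) /\ projT2 a = mk sg (projT1 a).
Proof. by case: a => y m; have [sg Nsg E] := mk_surj m; exists sg. Qed.

Definition class_rep (a : tot (sheaf_et RF)) : C1 := projT1 (cid (rep_exists a)).
Notation vs y m := (class_rep (PT (sheaf_et RF) y m)).

Lemma class_rep_num y (m : RF y) : num (vs y m) y.
Proof. by have [] := projT2 (cid (rep_exists (PT (sheaf_et RF) y m))). Qed.

Lemma class_rep_mk y (m : RF y) : mk (vs y m) y = m.
Proof. by have [_ E] := projT2 (cid (rep_exists (PT (sheaf_et RF) y m))). Qed.

(** The chosen representative may jump from one slice to the next; along the slice over [y], [d]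
    compares it with [sg], which represents the classes at all nearby points at once. *)
Definition slice_difference sg y (d : sections F) :=
  forall u, pr2 u = y -> pot_sc (-1 *: vs y (mk sg y) + sg) d u.

Lemma slice_difference_exists sg y : num sg y -> exists d, slice_difference sg y d.
Proof.
move=> Nsg; have Nd : num (-1 *: vs y (mk sg y) + sg) y by apply: slab_numP => //; exact: class_rep_num.
have [|d /nbhs_singleton Hd] := mk_eq0_pot (@pr2bar_continuous R p x) Nd.
  exact: mk_sub0 (class_rep_num _) Nsg (class_rep_mk _).
by exists d.
Qed.

Lemma slice_potential_uniq sg y d d' : (forall u, pr2 u = y -> pot_sc sg d u) ->
  (forall u, pr2 u = y -> pot_sc sg d' u) -> forall u, pr2 u = y -> d u = d' u.
Proof.
move=> Hd Hd' u uy; apply: subr0_eq; apply: (@F0 y (d - d')) => // v vy.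
exact: (pot_sub (@emb_continuous R p x) (Hd _ vy) (Hd' _ vy)).
Qed.

(** The sheaf of pairs (class [m] in the direct image, value of a potential of
    [m]); a potential of an arbitrary representative of [m] is turned into one
    of the chosen representative, in a unique way because [F] has no global
    sections along the slices. *)
Definition ee_st (u : U x) : lmodType K := (RF (pr2 u) * F u)%type.

(** A potential [q] of [sg] varies continuously across the slices; subtracting [d] on each slice
    turns it into a potential of the representative chosen there. *)
Definition ee_sc (s : prodM ee_st) (u : U x) : Prop := exists sg q,
  [/\ num sg (pr2 u), pot_sc sg q u & \forall v \near u, (s v).1 = mk sg (pr2 v) /\
    exists2 d, slice_difference sg (pr2 v) d & (s v).2 = q v - d v].

Let pr2_near (u : U x) (P : U1 x -> Prop) : (\forall y \near pr2 u, P y) -> \forall v \near u, P (pr2 v).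
Proof. exact: near_continuous (@pr2_continuous R p x u). Qed.

Fact ee_near s u : ee_sc s u -> \forall v \near u, ee_sc s v.
Proof.
move=> [sg [q [Nsg Hq /near_join Hs]]]; have N1 := pr2_near (slab_num_near Nsg).
near=> v; exists sg, q; split; first exact: (near N1 v).
  exact: (near (pot_near (@emb_continuous R p x) Hq) v).
exact: (near Hs v).
Unshelve. all: by end_near. Qed.

Fact ee_loc s t u : (\forall v \near u, s v = t v) -> ee_sc s u -> ee_sc t u.
Proof.
move=> st [sg [q [Nsg Hq Hs]]]; exists sg, q; split=> //.
by apply: filterS2 st Hs => v ->.
Qed.

Definition class_et : et K (U x) := Et ee_near ee_loc.

Definition ee_section sg (q : sections F) : prodM ee_st := fun u => (mk sg (pr2 u), q u -
  (if pselect (num sg (pr2 u)) is left N then projT1 (cid (slice_difference_exists N)) u else 0)).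

Lemma ee_section_snd sg q u d : num sg (pr2 u) -> slice_difference sg (pr2 u) d ->
  (ee_section sg q u).2 = q u - d u.
Proof.
move=> N Hd; rewrite /ee_section /=; case: pselect => // N'; congr (_ - _).
exact: slice_potential_uniq (projT2 (cid (slice_difference_exists N'))) Hd _ erefl.
Qed.

Lemma ee_section_sc sg q u : num sg (pr2 u) -> pot_sc sg q u -> ee_sc (ee_section sg q) u.
Proof.
move=> N Hq; exists sg, q; split=> //.
apply: filterS (pr2_near (slab_num_near N)) => v Nv; split=> //.
by have [d Hd] := slice_difference_exists Nv; exists d => //; exact: ee_section_snd.
Qed.

Lemma ee_add s t u : ee_sc s u -> secat (t : sections F) u ->
  ee_sc (fun v => ((s v).1, (s v).2 + t v)) u.
Proof.
move=> [sg [q [Nsg Hq Hs]]] Ht; exists sg, (q + t); split=> //; first exact: (pot_add (@emb_continuous R p x) (@emb_near R p x) Hq Ht).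
apply: filterS Hs => v [-> [d Hd ->]]; split=> //; exists d => //.
by rewrite -[(q + t : sections F) v]/(q v + t v) addrAC.
Qed.

Lemma ee_fst s u : ee_sc s u -> exists2 t, secat (t : sections RF) (pr2 u) &
  \forall v \near u, (s v).1 = t (pr2 v).
Proof.
move=> [sg [q [Nsg Hq Hs]]]; exists (fun y => mk sg y); first exact: mk_secat.
by apply: filterS Hs => v [].
Qed.

(** If the classes agree, [sg - sg'] has a potential [d0] on the fibres near that of [u]. Equality
    of the two sections then means that the section [q - q' - d0] of [F] vanishes, a locally
    constant condition. *)
Lemma ee_separated s t u : ee_sc s u -> ee_sc t u -> \forall v \near u, (s v = t v <-> s u = t u).
Proof.
move=> [sg [q [Nsg Hq Hs]]] [sg' [q' [Nsg' Hq' Ht]]].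
have [_ disc] := direct_image_lc u0 lF (pr2 u).
have H1 := pr2_near (disc _ _ (mk_secat Nsg) (mk_secat Nsg')).
have [su1 _] := nbhs_singleton Hs; have [tu1 _] := nbhs_singleton Ht.
have [E|NE] := pselect (mk sg (pr2 u) = mk sg' (pr2 u)); last first.
  apply: filterS2 H1 (filterI Hs Ht) => v H [[sv _] [tv _]]; split=> /(congr1 fst).
    by rewrite sv tv => /H.
  by rewrite su1 tu1.
have ND : num (-1 *: sg' + sg) (pr2 u) by exact: slab_numP.
have D0 : mk (-1 *: sg' + sg) (pr2 u) = 0 by exact: mk_sub0 Nsg' Nsg (esym E).
have [d0 Hd0] := mk_eq0_pot (@pr2bar_continuous R p x) ND D0.
have Sq : secat (-1 *: q' + q - d0 : sections F) u.
  exact: (pot_sub (@emb_continuous R p x) (potP (-1) Hq' Hq) (nbhs_singleton Hd0 u erefl)).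
have [_ discF] := lcF u; have HF := discF _ _ Sq (secat0 F u).
have key v : mk sg (pr2 v) = mk sg' (pr2 v) -> (forall w, pr2 w = pr2 v -> pot_sc (-1 *: sg' + sg) d0 w) ->
    (s v).1 = mk sg (pr2 v) /\ (exists2 d, slice_difference sg (pr2 v) d & (s v).2 = q v - d v) ->
    (t v).1 = mk sg' (pr2 v) /\ (exists2 d, slice_difference sg' (pr2 v) d & (t v).2 = q' v - d v) ->
    (s v = t v <-> (-1 *: q' + q - d0 : sections F) v = 0).
  move=> Ev Hd0v [s1 [d Hd s2]] [t1 [d' Hd' t2]].
  have dd : -1 *: d' v + d v = d0 v.
    have := @slice_potential_uniq (-1 *: sg' + sg) (pr2 v) (-1 *: d' + d) d0 _ Hd0v v erefl; apply.
    move=> w wv.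
    have E1 := congr1 (fun m => vs (pr2 v) m) Ev.
    exact: (eq_ind _ (fun z : C1 => pot_sc z (-1 *: d' + d) w) (potP (-1) (Hd' w wv) (Hd w wv)) _ (sub_translates _ _ E1)).
  rewrite -[(_ - d0 : sections F) v]/(-1 *: q' v + q v - d0 v) -dd.
  have -> : -1 *: q' v + q v - (-1 *: d' v + d v) = (s v).2 - (t v).2.
    rewrite s2 t2 !scaleN1r opprD opprK opprB [in RHS](addrC (d' v)) [RHS]addrACA [in RHS](addrC (q v)).
    by congr (_ + _); rewrite addrC.
  split=> [->|/subr0_eq e2]; first by rewrite subrr.
  by rewrite [s v]surjective_pairing [t v]surjective_pairing s1 t1 Ev e2.
have kU := key u E (nbhs_singleton Hd0) (nbhs_singleton Hs) (nbhs_singleton Ht).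
apply: filterS2 (filterI H1 (pr2_near Hd0)) (filterI HF (filterI Hs Ht)) => v [h1 h2] [h3 [h4 h5]].
have kv := key v (h1.2 E) h2 h4 h5.
by split=> [/kv.1/h3.1/kU.2|/kU.1/h3.2/kv.2].
Qed.
Lemma ee_lc u : lc class_et u.
Proof.
have [r [r0 yr _]] := small_ball (near_all (pr2 u) (fun _ => I)).
have r20 : 0 < r / 2 by rewrite divr_gt0.
have [e [e0 er eU]] := small_box u r20.
split; last by move=> s t; exact: ee_separated.
exists (box u e); first by apply: box_nbhs; exact: box_center.
move=> u1 [m f] B1.
have near_y v : box u e v -> nearby (\val (pr2 u)) r (\val (pr2 v)).
  by move=> [_ h]; exact: lt_le_trans h er.
have [sg [Nsg Em]] := class_extension u0 lF m r0 yr (near_y _ B1).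
have [d1 Hd1] := slice_difference_exists (Nsg _ (near_y _ B1)).
have lcP v : box u e v -> lc (torsor_et (potentials (@emb_continuous R p x) (@emb_near R p x) sg)) v.
  move=> Bv; have [s Hs] := pot_exists (@emb_continuous R p x) (@emb_near R p x) (slab_num_secat (Nsg _ (near_y _ Bv)) erefl).
  exact: torsor_lc (lcF v) Hs.
have [q [Hq q1]] := box_section eU lcP (f + d1 u1) B1.
exists (ee_section sg q); split=> [|v Bv]; last first.
  by apply: ee_section_sc; [exact: Nsg _ (near_y _ Bv) | exact: Hq].
have E2 := ee_section_snd q (Nsg _ (near_y _ B1)) Hd1.
by rewrite [LHS]surjective_pairing E2 q1 addrK -Em.
Qed.
Lemma tr_class_fst (g : R -> U x) u u' (v : class_et u) (v' : class_et u') : cpath g ->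
  tr (S := class_et) g (PT class_et u v) (PT class_et u' v') ->
  tr (S := sheaf_et RF) (@pr2 R p x \o g) (PT RF (pr2 u) v.1) (PT RF (pr2 u') v'.1).
Proof.
move=> cg t; apply: (pullet_tr (S := sheaf_et RF) (cf := @pr2_continuous R p x) cg).
exact: (tr_map (S' := pullet (sheaf_et RF) (@pr2_continuous R p x)) (phi := fun z (a : class_et z) => a.1) (@ee_fst) t).
Qed.

Lemma tr_class_add (g : R -> U x) u u' (v : class_et u) (v' : class_et u') (d : F u) (d' : F u') :
  tr (S := class_et) g (PT class_et u v) (PT class_et u' v') ->
  tr (S := sheaf_et F) g (PT F u d) (PT F u' d') ->
  tr (S := class_et) g (PT class_et u (v.1, v.2 + d)) (PT class_et u' (v'.1, v'.2 + d')).
Proof.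
move=> t t'.
have Hop (s : prodM class_et) (s' : prodM F) z : sc class_et s z -> sc (sheaf_et F) s' z ->
    sc class_et (fun z => ((s z).1, (s z).2 + s' z)) z by exact: ee_add.
exact: (tr_map2 (S1 := class_et) (S2 := sheaf_et F) (S3 := class_et) (op := fun z (a : class_et z) (b : F z) => (a.1, a.2 + b)) Hop t t').
Qed.

Section Slice.
Variables (y : U1 x) (m : RF y).
Notation fib := (@fib R p x y).
Notation FS := (pull (@fib_continuous R p x y) F).
Notation slice_et := (torsor_et (slice_pot y (vs y m))).

Lemma pr2_fib (w : slice y) : pr2 (fib w) = y.
Proof. exact: val_inj. Qed.

(** [pr2 (fib w)] is equal to [y] only propositionally, hence the [tot_at]. *)
Definition class_point (w : slice y) (f : F (fib w)) : class_et (fib w) :=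
  (tot_at (PT RF y m) (pr2 (fib w)), f).

Lemma class_rep_mk_at (z : U1 x) : z = y -> mk (vs y m) z = tot_at (PT RF y m) z.
Proof. by move=> ->; rewrite tot_atE class_rep_mk. Qed.

Lemma tr_class_point (g : R -> slice y) w w' (f : F (fib w)) (f' : F (fib w')) : cpath g ->
  tr (S := slice_et) g (PT FS w f) (PT FS w' f') ->
  tr (S := class_et) (fib \o g) (PT class_et (fib w) (class_point f)) (PT class_et (fib w') (class_point f')).
Proof.
move=> cg [s [fs s0 s1]].
exists (fun t => PT class_et (fib (projT1 (s t))) (class_point (projT2 (s t)))).
split; rewrite ?s0 ?s1 // => t _; have [tau [q Hq E] Es] := fs t I.
have N : num (vs y m) (pr2 (fib (g (clamp t)))) by rewrite pr2_fib; exact: class_rep_num.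
exists (ee_section (vs y m) q); first exact: ee_section_sc.
have Eg := near_continuous (@cg t) E.
apply: filterS2 Es Eg => t' -> /= Et; congr existT.
have N' : num (vs y m) (pr2 (fib (g (clamp t')))) by rewrite pr2_fib; exact: class_rep_num.
(* On this slice the section at hand is the chosen representative itself, so 0 is a potential of the
   difference. *)
have D0 : slice_difference (vs y m) (pr2 (fib (g (clamp t')))) 0.
  rewrite pr2_fib => u uy; rewrite /slice_difference.
  have Nd : num (vs y m) (pr2 u) by rewrite uy; exact: class_rep_num.
  have [d Hd] := pot_exists (@emb_continuous R p x) (@emb_near R p x) (slab_num_secat Nd erefl).
  exact: pot_sub_eq Hd (congr1 (fun c => vs y c) (class_rep_mk m)).
by rewrite [RHS]surjective_pairing (ee_section_snd _ N' D0) subr0 -Et /= (class_rep_mk_at (pr2_fib _)).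
Qed.

Lemma class_point_tr (g : R -> slice y) w w' (v : class_et (fib w)) (f' : F (fib w')) :
  is_path g w w' ->
  tr (S := class_et) (fib \o g) (PT class_et (fib w) v) (PT class_et (fib w') (class_point f')) ->
  v.1 = tot_at (PT RF y m) (pr2 (fib w)) /\ tr (S := slice_et) g (PT FS w v.2) (PT FS w' f').
Proof.
move=> gp t; have [_ g0 g1] := gp; have cg := is_path_cpath gp.
have lT z : lc slice_et z.
  have [s Hs] := slice_pot_exists (class_rep_num m) z.
  exact: torsor_lc (local_system_lc (pull_local_system (@fib_continuous R p x y) lF) z) Hs.
have [a aw ta] := tr_total (g := path_inv g) (a := PT FS w' f') lT (cpath_inv cg) ltac:(by rewrite /= /path_inv subr0 g1).
have aw' : projT1 a = w by rewrite aw /path_inv subrr g0.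
have ta' := tr_inv ta; rewrite path_invK (tot_tot_at aw') in ta'.
have cfg : cpath (fib \o g).
  by move=> s; exact: (for_continuous_comp (@cg s) (@fib_continuous R p x y _)).
have E := tot_inj (tr_uniql (ee_lc) cfg t (tr_class_point cg ta')).
by rewrite E.
Qed.
End Slice.
End ClassEtale.

(** * The action of the loops around the punctures *)

Section BackwardTransport.
Variables (K : fieldType) (X : topologicalType) (S : et K X) (R : realType) (b : X).
Hypothesis lS : forall z, lc S z.
Implicit Types (g h : R -> X) (v w : S b).

(** [v g = w]: as [path_mul g h] runs through [h] first, transport backwards is
    an action from the right. *)
Definition bt g v w := tr (S := S) g (PT S b w) (PT S b v).

Lemma bt_mul g h v w z : cpath g -> bt g v w -> bt h w z -> bt (path_mul g h) v z.
Proof. by move=> cg t t'; exact: (tr_mul lS cg t' t). Qed.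

Lemma bt_inv g v w : bt g v w -> bt (path_inv g) w v.
Proof. exact: tr_inv. Qed.

Lemma bt_uniq g v w w' : cpath g -> bt g v w -> bt g v w' -> w = w'.
Proof. by move=> cg t t'; exact: tot_inj (tr_uniql lS cg t t'). Qed.

Lemma bt_homotopic g h v w : homotopic g h -> bt g v w -> bt h v w.
Proof. exact: tr_homotopic. Qed.

Lemma bt_total g v : is_path g b b -> exists w, bt g v w.
Proof.
move=> gp; have [_ g0 g1] := gp; have cg := is_path_cpath gp.
have [a aw ta] := tr_total (g := path_inv g) (a := PT S b v) lS (cpath_inv cg) ltac:(by rewrite /= /path_inv subr0 g1).
have aw' : projT1 a = b by rewrite aw /path_inv subrr g0.
by exists (tot_at a b); have := tr_inv ta; rewrite path_invK (tot_tot_at aw') tot_atE.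
Qed.
End BackwardTransport.

Lemma conv_slice_global0 (R : realType) (K : fieldType) (p : nat) (x : 'I_p -> (R[i])^o) (lambda : K)
    (L : sheaf K (Gm R)) (V : sheaf K (U1 x)) (z : U1 x) (s : sections (conv_sheaf L V)) :
  lambda != 1 -> kummer lambda L -> local_system V -> (forall u, pr2 u = z -> secat s u) ->
  forall u, pr2 u = z -> s u = 0.
Proof.
move=> lambda1 kL lV Hs u uz.
pose s' : sections (pull (@fib_continuous R p x z) (conv_sheaf L V)) := fun w => s (fib w).
have H w : secat s' w.
  by exists s; [apply: Hs; exact: val_inj | exact: near_all].
have z2 : \val z = (\val u).2 by rewrite -uz.
have Hw : slice z (\val u).1.
  have [h1 _ h3] := (setP_val u : U x (\val u)); split=> //.
  by rewrite z2 eq_sym.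
have E := coeff_global0 lambda1 kL lV H (exist _ (\val u).1 (mem_set Hw)).
have <- : fib (exist _ (\val u).1 (mem_set Hw) : slice z) = u; last exact: E.
by apply: val_inj; change (((\val u).1, \val z) = \val u :> (R[i])^o * (R[i])^o); rewrite z2 -surjective_pairing.
Qed.

Section LoopAction.
Variables (R : realType) (K : fieldType) (p : nat) (x : 'I_p -> (R[i])^o) (u0 : U x)
  (alpha : 'I_p.+1 -> R -> U0 u0) (delta : 'I_p -> R -> S0 u0) (lambda : K) (L : sheaf K (Gm R)).
Local Notation C := ((R[i])^o).
Hypotheses (lambda0 : lambda != 0) (lambda1 : lambda != 1) (kL : kummer lambda L).
Hypotheses (ab : alpha_base alpha) (db : delta_base alpha delta).
Variable V : sheaf K (U1 x).
Hypothesis lV : local_system V.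
Variable A : 'I_p.+1 -> GL (V (pr1 u0)).
Hypothesis mA : monodromy_tuple (alphaU1 alpha) A.
Notation y := (pr2 u0).
Notation fib := (@fib R p x y).
Notation cf := (@fib_continuous R p x y).
Notation base := (baseU0 u0 : slice y).
Notation F := (conv_sheaf L V).
Notation FS := (pull cf F).
Notation RF := (R1 (@pr2bar R p x) (push (@emb R p x) F)).
Notation ee := (class_et F).
Notation J := (stalk_iso u0 kL V).
Notation b0 := (fib base).
Notation ai i := (alpha (fintype.lift ord_max i)).
Notation ga j := (fib \o (alpha j : R -> slice y)).
Notation gd i := (@fib_y R p x u0 \o delta i).

Let lF : local_system F := coeff_local_system kL lV.

Let F0 (z : U1 x) (s : sections F) : (forall u, pr2 u = z -> secat s u) ->
  forall u, pr2 u = z -> s u = 0.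
Proof. exact: (conv_slice_global0 lambda1 kL lV). Qed.

Let lee : forall u, lc ee u := ee_lc u0 lF F0.
Notation lcF := (local_system_lc lF).

Let al j : is_path (alpha j : R -> slice y) base base.
Proof. by have [[[H _] _] _ _ _] := ab; exact: H. Qed.

Let cga j : cpath (ga j).
Proof. by move=> t; exact: (for_continuous_comp (@is_path_cpath _ _ _ _ _ (al j) t) (@cf _)). Qed.

Let fib_x_fib : @fib_x R p x u0 = fib :> (slice y -> U x).
Proof. by apply: functional_extensionality_dep => w; exact: val_inj. Qed.

Let fib_y_base : fib_y (baseS0 u0) = b0.
Proof. exact: val_inj. Qed.

Let fib_y_continuous : continuous (@fib_y R p x u0).
Proof.
apply: corestr_continuous => z.
exact: (for_continuous_pair (@for_continuous_cst _ _ (\val u0).1 z) (@val_continuous _ _ z)).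
Qed.

Let dl i : is_path (delta i) (baseS0 u0) (baseS0 u0).
Proof. by have [_ H _ _ _] := db. Qed.

Let cgd i : cpath (gd i).
Proof. by move=> t; exact: (for_continuous_comp (@is_path_cpath _ _ _ _ _ (dl i) t) (@fib_y_continuous _)). Qed.

Let gdp i : is_path (gd i) b0 b0.
Proof.
have [_ d0 d1] := dl i; have := cpath_is_path (@cgd i).
by rewrite /= d0 d1 fib_y_base.
Qed.

Let btA i v : bt (S := sheaf_et F) (ga (fintype.lift ord_max i)) (J v) (J (A (fintype.lift ord_max i) v)).
Proof. exact: (pullet_tr (S := sheaf_et F) (cf := cf) (is_path_cpath (al _)) (stalk_iso_monodromy kL ab mA i v)). Qed.

Let btq u : bt (S := sheaf_et F) (ga ord_max) (u : F b0) (lambda *: u).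
Proof. exact: (pullet_tr (S := sheaf_et F) (cf := cf) (is_path_cpath (al _)) (stalk_iso_monodromy_y kL ab lV u)). Qed.

Let dif_shift_subproof (w : [set w : C | w != (\val u0).1]) : Gm R (\val w - (\val u0).1).
Proof. by rewrite /Gm /= subr_eq0; exact: setP_val w. Qed.

(* along [delta i] the first coordinate is constant, and the loop is
   contractible in the complement of [x0] *)
Let btd i v : bt (S := sheaf_et F) (gd i) (J v : F b0) (J v).
Proof.
rewrite /bt !stalk_isoE; have [_ d0 d1] := dl i.
have e0 : fib_y (baseS0 u0) = u0 by rewrite fib_y_base fib_base.
apply: (tr_coeff (g := gd i)); rewrite /= ?d0 ?d1 //.
  apply: (tr_eq (g := cst (pr1 u0))); first by move=> t _; exact: val_inj.
  by apply: tr_cst; exact: local_system_lc.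
pose c : [set w : C | w != (\val u0).1] -> Gm R := corestr dif_shift_subproof.
have cc : continuous c.
  apply: corestr_continuous => z.
  exact: (for_continuous_CB (@val_continuous _ _ z) (@for_continuous_cst _ _ (\val u0).1 z)).
have [_ _ _ /(_ i) H _] := db; have H' := homotopic_sym (homotopic_comp cc H).
have lL : local_system L by move=> z; exists 1%N; case: kL.
have E : c (to_C (baseS0 u0)) = dif u0 by exact: val_inj.
apply: (tr_eq (g := c \o (@to_C R p x (\val u0).1 \o delta i))); first by move=> t _; exact: val_inj.
apply: (tr_homotopic (local_system_lc lL) H').
by apply: (tr_eq (g := cst (dif u0))); [move=> t _; rewrite -E | exact: (tr_cst R (local_system_lc lL) _)].
Qed.


Let loop_mul (g h : R -> U x) : is_path g b0 b0 -> is_path h b0 b0 -> is_path (path_mul g h) b0 b0.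
Proof.
move=> gp hp; have [_ g0 g1] := gp; have [_ h0 h1] := hp.
have := cpath_is_path (cpath_mul (is_path_cpath gp) (is_path_cpath hp) (etrans h1 (esym g0))).
by rewrite path_mul0 path_mul1 g1 h0.
Qed.

Let loop_inv (g : R -> U x) : is_path g b0 b0 -> is_path (path_inv g) b0 b0.
Proof.
move=> gp; have [_ g0 g1] := gp; have := cpath_is_path (cpath_inv (is_path_cpath gp)).
by rewrite /path_inv subr0 subrr g0 g1.
Qed.

Let gap j : is_path (ga j) b0 b0.
Proof. by have [_ a0 a1] := al j; have := cpath_is_path (@cga j); rewrite /= a0 a1. Qed.

Let btadd (g : R -> U x) (e e' : ee b0) (v v' : F b0) : bt (S := ee) g e e' -> bt (S := sheaf_et F) g v v' ->
  bt (S := ee) g (e.1, e.2 + v) (e'.1, e'.2 + v').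
Proof. exact: tr_class_add. Qed.

Section Representative.
Variables (f : F b0) (w : prodM (fun _ : 'I_p => V (pr1 u0))) (c : RF (pr2 b0)).
(** The points of the torsor in the coordinate centred at the fixed point [f]. *)
Let P (v : V (pr1 u0)) : ee b0 := (c, f + J v).
Hypothesis Pq : bt (S := ee) (ga ord_max) (P 0) (P 0).
Hypothesis Pi : forall k, bt (S := ee) (ga (fintype.lift ord_max k)) (P 0) (P (w k)).

Let Pqv v : bt (S := ee) (ga ord_max) (P v) (P (lambda *: v)).
Proof.
have E u : P u = ((P 0).1, (P 0).2 + J u) by rewrite /P /= linear0 addr0.
by rewrite (E v) (E (_ *: _)) linearZ; exact: btadd Pq (btq _).
Qed.

Let Piv k v : bt (S := ee) (ga (fintype.lift ord_max k)) (P v) (P (w k + A (fintype.lift ord_max k) v)).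
Proof.
have := btadd (Pi k) (btA k v).
by rewrite /P /= linear0 addr0 linearD addrA.
Qed.

(** An affine map is determined by its value at one point and its linear part. *)
Let PD (g : R -> U x) a b v v' : bt (S := ee) g (P a) (P b) -> bt (S := sheaf_et F) g (J v) (J v') ->
  bt (S := ee) g (P (a + v)) (P (b + v')).
Proof. by move=> t t'; have := btadd t t'; rewrite /P /= !linearD !addrA. Qed.

Let bt_conj (g h : R -> U x) (v v' z z' : ee b0) : is_path g b0 b0 -> is_path h b0 b0 ->
  bt (S := ee) h v' v -> bt (S := ee) g v' z -> bt (S := ee) h z z' -> bt (S := ee) (path_conj g h) v z'.
Proof.
move=> gp hp t1 t2 t3; apply: (bt_mul lee (is_path_cpath (loop_inv hp)) (bt_inv t1)).
exact: (bt_mul lee (is_path_cpath gp) t2 t3).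
Qed.

Let fib_conj (g h : R -> slice y) : fib \o path_conj g h = path_conj (fib \o g) (fib \o h).
Proof. by rewrite /path_conj !comp_path_mul. Qed.

Let fib_comm (g h : R -> slice y) : fib \o path_comm g h = path_comm (fib \o g) (fib \o h).
Proof. by rewrite /path_comm !comp_path_mul. Qed.

(** As [lambda] is a scalar, the commutator has trivial linear part; it is the translation that
    takes [w i] to [lambda *: w i]. *)
Let bt_comm i v : bt (S := ee) (path_comm (ga (fintype.lift ord_max i)) (ga ord_max))
  (P (w i + v)) (P (lambda *: w i + v)).
Proof.
have ci := is_path_cpath (loop_inv (gap (fintype.lift ord_max i))).
have cq := is_path_cpath (loop_inv (gap ord_max)).
apply: PD.
  apply: (bt_mul lee ci (bt_inv (Pi i))); apply: (bt_mul lee cq (bt_inv Pq)).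
  exact: (bt_mul lee (@cga _) (Pi i) (Pqv _)).
have Ai := btA i (gl_inv (A (fintype.lift ord_max i)) v); rewrite gl_invK in Ai.
have Aq := btq (lambda^-1 *: J (gl_inv (A (fintype.lift ord_max i)) v)).
rewrite scalerA mulfV // scale1r -linearZ in Aq.
apply: (bt_mul lcF ci (bt_inv Ai)); apply: (bt_mul lcF cq (bt_inv Aq)).
have Ai' := btA i (lambda^-1 *: gl_inv (A (fintype.lift ord_max i)) v).
rewrite [A _ (_ *: _)]linearZ /= gl_invK in Ai'.
apply: (bt_mul lcF (@cga _) Ai'); have := btq (J (lambda^-1 *: v)).
by rewrite -linearZ scalerA mulfV // scale1r.
Qed.

(** The cases of [braided] produce the coefficients of [mcD]. Below [i] the generator acts at [W]
    itself. Above [i] the commutator shifts the computation to [w i], which removes the factor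
    [lambda]. At [i], conjugation by the last generator multiplies the result found at [w i] by
    [lambda]. *)
Lemma braided_action i k : let W := lambda *: w i in
  bt (S := ee) (@fib_x R p x u0 \o braided alpha i (fintype.lift ord_max k)) (P W) (P (W + mcD lambda0 A i w k)).
Proof.
move=> W; rewrite fib_x_fib /braided lift_max [_ == ord_max]eq_sym (negPf (neq_lift _ _)).
rewrite -[mcD _ _ _ _ _]/(mcD_fun _ _ _ _ _) /mcD_fun /mc_coef -[k == i]/(val k == val i).
case: ltngtP => [ki|ik|kiE].
- have -> : W + (w k + lambda *: (A (fintype.lift ord_max k) (w i) - w i)) = w k + A (fintype.lift ord_max k) W.
    by rewrite linearZ scalerBr addrC -addrA subrK.
  exact: Piv.
- rewrite scale1r fib_conj fib_comm.
  have h0 := bt_comm i 0; rewrite !addr0 in h0.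
  have gi := gap (fintype.lift ord_max i); have gq := gap ord_max.
  apply: (bt_conj (gap _) _ h0 (Piv k (w i))).
    exact: (loop_mul (loop_inv gi) (loop_mul (loop_inv gq) (loop_mul gi gq))).
  have := bt_comm i (w k + (A (fintype.lift ord_max k) (w i) - w i)).
  by rewrite [w i + (_ + _)]addrCA [w i + (_ - _)]addrC subrK.
have E : k = i by exact: val_inj.
rewrite {}E fib_conj; apply: (bt_conj (gap _) (gap _) (Pqv (w i)) (Piv i (w i))).
by rewrite -scalerDr; exact: Pqv.
Qed.

(** A conjugate fixes the image of a fixed point under the conjugating element, here
    [alpha_i alpha_(p+1)]; this is why [lambda *: w i] is the point to move along [delta i]. *)
Lemma braided_action_y i : let W := lambda *: w i in
  bt (S := ee) (@fib_x R p x u0 \o braided alpha i ord_max) (P W) (P W).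
Proof.
move=> W; rewrite fib_x_fib /braided /= ltnNge ltnW //= gtn_eqF // eqxx fib_conj comp_path_mul.
have e0 : bt (S := ee) (path_mul (ga (fintype.lift ord_max i)) (ga ord_max)) (P 0) (P W).
  exact: (bt_mul lee (@cga _) (Pi i) (Pqv _)).
exact: (bt_conj (gap _) (loop_mul (gap _) (gap _)) e0 Pq e0).
Qed.

(** In terms of the right action, [delta i] followed by [alpha j] equals the braided loop followed
    by [delta i], by the conjugation formula; and [delta i] leaves the translation vector [J X]
    unchanged ([btd]). *)
Lemma delta_step i j (e : ee b0) X : bt (S := ee) (gd i) (P (lambda *: w i)) e ->
  bt (S := ee) (@fib_x R p x u0 \o braided alpha i j) (P (lambda *: w i)) (P (lambda *: w i + X)) ->
  bt (S := ee) (ga j) e (e.1, e.2 + J X).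
Proof.
move=> te tb; have [z1 t1] := bt_total lee e (gap j).
have [z2 t2] := bt_total lee z1 (loop_inv (gdp i)).
have [_ _ _ _ H] := db; have {H} := H i j; rewrite fib_x_fib => H; rewrite fib_x_fib in tb.
have t3 := bt_mul lee (@cgd i) te (bt_mul lee (@cga j) t1 t2).
have E := bt_uniq lee (is_path_cpath (loop_mul (gdp i) (loop_mul (gap j) (loop_inv (gdp i))))) t3
  (bt_homotopic lee (homotopic_sym H) tb).
have t4 := bt_inv t2; rewrite path_invK E in t4.
have t5 := btadd te (btd i X).
suff -> : (e.1, e.2 + J X) = z1 by [].
apply: (bt_uniq lee (@cgd i) _ t4).
by move: t5; rewrite /P /= linearD addrA.
Qed.
End Representative.

Lemma stalk_rel_uniq m w w' : stalk_rel alpha kL (V := V) m w -> stalk_rel alpha kL (V := V) m w' -> w = w'.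
Proof.
move=> h h'; have := stalk_rel_lin (-1) h' h; rewrite scaleN1r addNr scaleN1r => h0.
by have /eqP := stalk_rel0 lambda1 ab lV h0; rewrite addrC subr_eq0 => /eqP.
Qed.

Lemma delta_action i m m' w : monodromy (deltaU1 delta i) m m' ->
  stalk_rel alpha kL (V := V) m w -> stalk_rel alpha kL (V := V) m' (mcD lambda0 A i w).
Proof.
move=> /monodromyE tm rw.
have Nm := class_rep_num m.
have gens : free_generators (alpha : 'I_p.+1 -> R -> slice y) base by case: ab.
have [f [w' [Nq Ni]]] := normal_exists (pull_local_system cf lF) (stalk_iso_bij u0 kL V) lambda1
  gens (stalk_iso_monodromy_y kL ab lV) (slice_pot_exists Nm).
have Ew : w' = w.
  have h : stalk_rel alpha kL (V := V) m w' by exists (class_rep (PT (sheaf_et RF) y m)), f; split=> //; rewrite class_rep_mk.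
  exact: stalk_rel_uniq h rw.
subst w'.
pose c := tot_at (PT RF y m) (pr2 b0).
have P0 : (c, f + J 0) = class_point m f by rewrite linear0 addr0.
have Pq : bt (S := ee) (ga ord_max) (c, f + J 0) (c, f + J 0).
  by rewrite P0; exact: (tr_class_point F0 (is_path_cpath (al _)) Nq).
have Pi k : bt (S := ee) (ga (fintype.lift ord_max k)) (c, f + J 0) (c, f + J (w k)).
  by rewrite P0; exact: (tr_class_point F0 (is_path_cpath (al _)) (Ni k)).
have [e te] := bt_total lee (c, f + J (lambda *: w i)) (gdp i).
have tk k := delta_step te (braided_action Pq Pi i k).
have tq : bt (S := ee) (ga ord_max) e (e.1, e.2 + J 0).
  apply: (delta_step te); rewrite addr0; exact: braided_action_y.
rewrite linear0 addr0 -surjective_pairing in tq.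
(* The first component of the moved point is the transport of [m] in the direct image, hence it is
   [m']. *)
have cp : PT RF (pr2 b0) e.1 = PT RF y m'.
  have t1 := tr_class_fst (@cgd i) te.
  have Em : PT RF (pr2 b0) c = PT RF y m by exact: esym (@tot_tot_at _ _ _ (PT RF y m) (pr2 b0) (esym (pr2_fib base))).
  have t2 : tr (S := sheaf_et RF) (@pr2 R p x \o gd i) (PT RF y m') (PT RF y m).
    by apply: tr_eq tm => t _; exact: val_inj.
  rewrite [(c, _).1]/= Em in t1.
  have cgd2 : cpath (@pr2 R p x \o gd i) by move=> t; exact: (for_continuous_comp (@cgd i t) (@pr2_continuous R p x _)).
  exact: (tr_uniql (direct_image_lc u0 lF) cgd2 t1 t2).
have Ee : e = class_point m' e.2.
  by rewrite [LHS]surjective_pairing /class_point -cp tot_atE.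
have tp j v : bt (S := ee) (ga j) e v ->
    tr (S := ee) (ga j) (PT ee b0 v) (PT ee b0 (class_point m' (e.2 : F b0))) by rewrite -Ee.
have [_ nq] := class_point_tr u0 lF F0 (al ord_max) (tp _ _ tq).
have nk k := (class_point_tr u0 lF F0 (al _) (tp _ _ (tk k))).2.
by exists (class_rep (PT (sheaf_et RF) y m')), e.2; split=> //; [exact: class_rep_num | rewrite class_rep_mk].
Qed.
End LoopAction.

(** * Finite-dimensionality and the main theorem *)

Section FiniteBasis.
Variable K : fieldType.

Definition has_basis (M : lmodType K) := exists n (e : 'I_n -> M),
  forall v, exists! c : 'I_n -> K, v = \sum_i c i *: e i.

Lemma has_basis_coords (M : lmodType K) : has_basis M ->
  exists n (f : {linear M -> 'rV[K]_n}), injective f.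
Proof.
move=> [n [e He]]; exists n.
pose comb (r : 'rV[K]_n) := \sum_i r 0 i *: e i.
have [||w|f Hf] := @linear_of_rel K M 'rV[K]_n (fun v r => v = comb r).
- move=> v; have [c [Ec _]] := He v; exists (\row_i c i).
  by rewrite {1}Ec; apply: eq_bigr => i _; rewrite mxE.
- move=> a v v' r r' -> ->; rewrite /comb scaler_sumr -big_split /=.
  by apply: eq_bigr => i _; rewrite !mxE scalerDl scalerA.
- move=> E; have [c [_ uc]] := He 0.
  have c0 : c = fun=> 0 by apply: uc; rewrite big1 // => i _; rewrite scale0r.
  have c1 : c = fun i => w 0 i by exact: uc.
  by apply/rowP => i; rewrite mxE -[LHS]/((fun i => w 0 i) i) -c1 c0.
by exists f => v v' E; rewrite (Hf v) E -Hf.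
Qed.

(* a maximal family of elements with independent coordinates is a basis *)
Lemma coords_has_basis (M : lmodType K) n (f : {linear M -> 'rV[K]_n}) : injective f -> has_basis M.
Proof.
move=> fi; pose P r := `[< exists e : 'I_r -> M, row_free (\matrix_(i < r) f (e i)) >].
have P0 : exists r, P r.
  by exists 0%N; apply/asboolP; exists (fun=> 0); rewrite -row_leq_rank leq0n.
have Pn r : P r -> (r <= n)%N by move=> /asboolP[e /eqP <-]; exact: rank_leq_col.
case: (ex_maxnP P0 Pn) => r /asboolP[e fe] maxr; exists r, e => v.
set A := \matrix_(i < r) f (e i) in fe.
have fsum (c : 'I_r -> K) : f (\sum_i c i *: e i) = (\row_i c i) *m A.
  rewrite linear_sum; apply/rowP => j; rewrite summxE !mxE; apply: eq_bigr => i _.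
  by rewrite linearZ !mxE.
have /submxP[c Ec] : (f v <= A)%MS.
  apply: contraT => nv; have : P r.+1.
    apply/asboolP; exists (fun i => if unlift ord0 i is Some j then e j else v).
    set B := \matrix_i _; apply: inj_row_free => d dB.
    pose d' := \row_j d 0 (fintype.lift ord0 j).
    have dE : d *m B = d 0 ord0 *: f v + d' *m A.
      rewrite mulmx_sum_row big_ord_recl rowK unlift_none mulmx_sum_row; congr (_ + _).
      by apply: eq_bigr => j _; rewrite !rowK liftK mxE.
    rewrite {}dE in dB; case: (eqVneq (d 0 ord0) 0) => d0.
      move: dB; rewrite d0 scale0r add0r -[RHS](mul0mx _ A) => /(row_free_inj fe)/rowP E.
      by apply/rowP => i; case: (unliftP ord0 i) => [j ->|->]; [have := E j; rewrite !mxE | rewrite d0 mxE].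
    case/negP: nv; apply/submxP; exists (- (d 0 ord0)^-1 *: d').
    move/eqP: dB; rewrite addrC addr_eq0 -scalemxAl => /eqP ->.
    by rewrite scalerN scaleNr opprK scalerA mulVf // scale1r.
  by move=> /maxr; rewrite ltnn.
exists (fun i => c 0 i); split.
  by apply: fi; rewrite fsum Ec; congr (_ *m _); apply/rowP => i; rewrite mxE.
move=> d Ed; have := congr1 f Ed; rewrite fsum Ec => /(row_free_inj fe)/rowP E.
by apply: functional_extensionality_dep => i; rewrite E mxE.
Qed.

Lemma has_basis_inj (M M' : lmodType K) (f : {linear M -> M'}) : injective f -> has_basis M' -> has_basis M.
Proof.
move=> fi /has_basis_coords[n [g gi]].
exact: (@coords_has_basis _ _ (g \o f : {linear M -> 'rV[K]_n})) (inj_comp gi fi).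
Qed.

Lemma has_basis_power (M : lmodType K) p : has_basis M -> has_basis (prodM (fun _ : 'I_p => M)).
Proof.
move=> /has_basis_coords[n [g gi]].
pose h (w : prodM (fun _ : 'I_p => M)) : 'rV[K]_(p * n) := mxvec (\matrix_(i < p) g (w i)).
have hl : linear h.
  move=> a v w; rewrite /h -linearP; congr mxvec; apply/row_matrixP => i.
  by rewrite linearP /= !rowK -linearP.
pose H := HB.pack_for {linear prodM (fun _ : 'I_p => M) -> 'rV[K]_(p * n)} h
  (GRing.isLinear.Build K (prodM (fun _ : 'I_p => M)) 'rV[K]_(p * n) *:%R h hl).
apply: (@coords_has_basis _ _ H) => v w /(can_inj mxvecK)/row_matrixP E.
apply: functional_extensionality_dep => i; apply: gi.
by have := E i; rewrite !rowK.
Qed.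

Lemma trivial_near_basis (X : topologicalType) (F : sheaf K X) n z : trivial_near F n z -> has_basis (F z).
Proof. by move=> [e /nbhs_singleton[_ He]]; exists n, (e^~ z). Qed.
End FiniteBasis.

Section Conjugate.
Variables (K : fieldType) (M W : lmodType K) (phi : {linear M -> W}).

Lemma gl_conj : bijective phi -> exists c : GL W -> GL M, forall g m, phi (c g m) = g (phi m).
Proof.
move=> [psi phiK psiK]; have psil : linear psi := can2_linear phiK psiK.
pose Psi := HB.pack_for {linear W -> M} psi (GRing.isLinear.Build K W M *:%R psi psil).
have K1 (g h : {linear W -> W}) : cancel g h -> cancel (Psi \o (g \o phi)) (Psi \o (h \o phi)).
  by move=> gh m; rewrite /= psiK gh phiK.
exists (fun g => MkGL (K1 _ _ (@gl_funK _ _ g)) (K1 _ _ (@gl_invK _ _ g))) => g m.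
exact: psiK.
Qed.

Lemma gl_conj_prod (c : GL W -> GL M) s : (forall g m, phi (c g m) = g (phi m)) ->
  forall m, phi (gl_prod [seq c g | g <- s] m) = gl_prod s (phi m).
Proof. by move=> Hc; elim: s => //= g s IH m; rewrite IH Hc. Qed.

Lemma gl_conj_inv (f : GL M) (g : GL W) : (forall m, phi (f m) = g (phi m)) ->
  forall m, phi (glV f m) = glV g (phi m).
Proof. by move=> H m; apply: (can_inj (@gl_funK _ _ g)); rewrite -H /= !gl_invK. Qed.
End Conjugate.

Lemma MC_tuple_infty (K : fieldType) (V : lmodType K) (p : nat) (lambda : K) (lambda0 : lambda != 0)
    (A : 'I_p.+1 -> GL V) :
  MC_tuple lambda0 A ord_max = glV (gl_prod [seq MC_tuple lambda0 A (fintype.lift ord_max i) | i <- enum 'I_p]).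
Proof.
rewrite /MC_tuple unlift_none; congr (glV (gl_prod _)).
by apply: eq_map => i; rewrite liftK.
Qed.

Lemma MC_tupleE (K : fieldType) (V : lmodType K) (p : nat) (lambda : K) (lambda0 : lambda != 0)
    (A : 'I_p.+1 -> GL V) i w :
  val (MC_tuple lambda0 A (fintype.lift ord_max i) w) = mcD lambda0 A i (val w).
Proof. by rewrite /MC_tuple liftK. Qed.

Section ClassSum.
Variables (K : fieldType) (X Z Y : topologicalType) (emb : X -> Z) (f : Z -> Y) (F : sheaf K X).
Notation C1 := (sections (gode1 (push emb F))).
Notation num := (slab_num f).
Notation mk := (mk f).
Implicit Type sg : C1.

Lemma mk_sub_eq0 sg sg' y : num sg y -> num sg' y -> mk (-1 *: sg + sg') y = 0 -> mk sg y = mk sg' y.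
Proof.
move=> N N'; have := mkP (-1) N N'.
move: (mk sg y) (mk sg' y) (mk _ y); move: (R1 f (push emb F) y : lmodType K) => V m m' ? -> /eqP.
by rewrite scaleN1r addrC subr_eq0 => /eqP.
Qed.

Lemma mk0 y : mk (0 : C1) y = 0.
Proof.
have N : num (0 : C1) y by exact: sub0.
have := mkP (-1) N N; rewrite scaler0 addr0.
move: (mk _ y); move: (R1 f (push emb F) y : lmodType K) => V m ->.
by rewrite scaleN1r addNr.
Qed.

Lemma mk_sum n (c : 'I_n -> K) (sg : 'I_n -> C1) y : (forall i, num (sg i) y) ->
  num (\sum_i c i *: sg i) y /\ mk (\sum_i c i *: sg i) y = \sum_i c i *: mk (sg i) y.
Proof.
move=> N; elim/big_rec2: _ => [|i m s _ [Ns <-]]; first by split; [exact: sub0 | exact: mk0].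
by split; [exact: slab_numP | exact: mkP].
Qed.
End ClassSum.

(** * Local triviality of the direct image *)

Section LocalSystem.
Variables (R : realType) (p : nat) (x : 'I_p -> (R[i])^o) (u0 : U x) (K : fieldType) (F : sheaf K (U x)).
Hypothesis lF : local_system F.
Notation RF := (R1 (@pr2bar R p x) (push (@emb R p x) F)).
Notation num := (slab_num (@pr2bar R p x)).
Notation mk := (mk (@pr2bar R p x)).
Notation C1 := (sections (gode1 (push (@emb R p x) F))).
Notation lcR := (direct_image_lc u0 lF).

Lemma direct_image_basis y z : has_basis (RF y) -> has_basis (RF z).
Proof.
have [g [cg g0 g1]] := U1_path y z => By.
pose rel (v : RF z) (w : RF y) := tr (S := sheaf_et RF) g (PT RF y w) (PT RF z v).
have tot v : exists w, rel v w.
  have [a ay ta] := tr_total (g := path_inv g) (a := PT RF z v) lcR (cpath_inv cg) ltac:(by rewrite /= /path_inv subr0 g1).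
  have ay' : projT1 a = y by rewrite ay /path_inv subrr g0.
  by exists (tot_at a y); have := tr_inv ta; rewrite path_invK (tot_tot_at ay') tot_atE.
have lin a v v' w w' : rel v w -> rel v' w' -> rel (a *: v + v') (a *: w + w') by exact: tr_linear.
have r0 : rel 0 0.
  have f0 : flat (S := sheaf_et RF) setT id (fun w => PT RF w 0).
    by move=> w _; exists 0; [exact: secat0 | exact: near_all].
  by have := flat_tr f0 cg (fun _ _ => I); rewrite g0 g1.
have uniq v w w' : rel v w -> rel v w' -> w = w' by move=> t t'; exact: tot_inj (tr_uniql lcR cg t t').
have [f Hf] := linear_of_rel tot lin (fun w t => uniq _ _ _ t r0).
apply: (has_basis_inj (f := f)) By => v v' E; have H := Hf v; rewrite E in H.
exact: tot_inj (tr_uniq lcR cg H (Hf v')).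
Qed.

Lemma mk_nearby_eq (sg sg' : C1) (y1 y y' : U1 x) (r : R) : 0 < r ->
  (forall i, 4 * r <= nC (\val y1 - x i)) ->
  (forall w : U1 x, nearby (\val y1) r (\val w) -> num sg w) ->
  (forall w : U1 x, nearby (\val y1) r (\val w) -> num sg' w) ->
  nearby (\val y1) r (\val y) -> nearby (\val y1) r (\val y') ->
  mk sg y = mk sg' y -> mk sg y' = mk sg' y'.
Proof.
move=> r0 yr N N' Ny Ny' E; apply: mk_sub_eq0; [exact: N | exact: N' |].
have H w : nearby (\val y1) r (\val w) -> num (-1 *: sg + sg') w.
  by move=> Nw; apply: slab_numP; [exact: N | exact: N'].
apply: (mk_eq0_nearby u0 lF r0 yr H Ny Ny').
by apply: mk_sub0 => //; [exact: N | exact: N'].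
Qed.

(** A basis at [z] is represented over a fixed disc. Equality of classes passes between any two
    points of the disc ([mk_nearby_eq]), so the same coordinates serve at every point. *)
Lemma direct_image_local_system y : has_basis (RF y) -> local_system RF.
Proof.
move=> By z; have [n [b Hb]] := direct_image_basis z By.
have [r [r0 yr _]] := small_ball (near_all z (fun _ => I)); have Nz := nearby_center (\val z) r0.
have /choice[sg Hsg] : forall i, exists sg : C1,
    (forall w : U1 x, nearby (\val z) r (\val w) -> num sg w) /\ mk sg z = b i.
  by move=> i; exact: (class_extension u0 lF (b i) r0 yr Nz).
have sumE c w : nearby (\val z) r (\val w) -> num (\sum_i c i *: sg i) w /\
    mk (\sum_i c i *: sg i) w = \sum_i c i *: mk (sg i) w.
  by move=> Nw; apply: mk_sum => i; exact: (Hsg i).1.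
have sumN c w Nw := (sumE c w Nw).1.
have sumz c : mk (\sum_i c i *: sg i) z = \sum_i c i *: b i.
  by rewrite (sumE c z Nz).2; apply: eq_bigr => i _; rewrite (Hsg i).2.
exists n, (fun i w => mk (sg i) w).
apply: filterS (nearby_near z r0) => w Nw; split=> [i|m]; first exact: (mk_secat ((Hsg i).1 w Nw)).
have [th [Nth Eth]] := class_extension u0 lF m r0 yr Nw.
have [c [Ec uc]] := Hb (mk th z); exists c; split.
  rewrite -(sumE c w Nw).2 -Eth.
  by apply: (mk_nearby_eq r0 yr Nth (sumN c) Nz Nw); rewrite sumz.
move=> d Ed; apply: uc; rewrite -sumz.
apply: (mk_nearby_eq r0 yr Nth (sumN d) Nw Nz).
by rewrite Eth (sumE d w Nw).2.
Qed.
End LocalSystem.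

Section Main.
Variables (R : realType) (K : fieldType) (p : nat) (x : 'I_p -> (R[i])^o) (u0 : U x)
  (alpha : 'I_p.+1 -> R -> U0 u0) (delta : 'I_p -> R -> S0 u0) (lambda : K) (L : sheaf K (Gm R)).
Hypotheses (lambda0 : lambda != 0) (lambda1 : lambda != 1) (kL : kummer lambda L).
Hypotheses (ab : alpha_base alpha) (db : delta_base alpha delta).
Variable V : sheaf K (U1 x).
Hypothesis lV : local_system V.
Variable A : 'I_p.+1 -> GL (V (pr1 u0)).
Hypothesis mA : monodromy_tuple (alphaU1 alpha) A.
Notation y := (pr2 u0).
Variable phi : {linear MC L V y -> submodT (MC_W lambda A)}.
Hypotheses (phib : bijective phi) (phiE : forall m, stalk_rel alpha kL m (val (phi m))).

Let lF : local_system (conv_sheaf L V) := coeff_local_system kL lV.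

(** Finite rank comes from the embedding by [phi] of one stalk into a power of a stalk of [V]. *)
Lemma MC_local_system : local_system (MC L V).
Proof.
apply: (direct_image_local_system u0 lF (y := y)).
apply: (has_basis_inj (f := phi) (bij_inj phib)).
have [n tV] := lV (pr1 u0).
apply: (has_basis_inj (f := (val : submodT (MC_W lambda A) -> _)) val_inj).
exact: has_basis_power (trivial_near_basis tV).
Qed.

Lemma MC_monodromy : exists B : 'I_p.+1 -> GL (MC L V y), monodromy_tuple (deltaU1 delta) B /\
  forall j m, phi (B j m) = MC_tuple lambda0 A j (phi m).
Proof.
have [c Hc] := gl_conj phib; have phii := bij_inj phib.
exists (fun j => c (MC_tuple lambda0 A j)); split=> [|j m]; last exact: Hc.
split=> [i m|m].
  have [_ dl _ _ _] := db; have [_ d0 d1] := dl i.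
  have dp : is_path (deltaU1 delta i) y y.
    have cd : cpath (deltaU1 delta i).
      move=> t; apply: (for_continuous_comp (@is_path_cpath _ _ _ _ _ (dl i) t)).
      by apply: corestr_continuous => z; exact: val_continuous.
    have := cpath_is_path cd; rewrite /deltaU1 /= d0 d1.
    suff -> : to_U1 (baseS0 u0) = y by [].
    exact: val_inj.
  have [m' tm] := bt_total (direct_image_lc u0 lF) m dp.
  suff <- : m' = c (MC_tuple lambda0 A (fintype.lift ord_max i)) m by exact/monodromyE.
  apply: phii; rewrite Hc; apply: val_inj; rewrite MC_tupleE.
  apply: (stalk_rel_uniq lambda1 ab lV (phiE m')).
  exact: (delta_action lambda0 lambda1 ab db lV mA ((monodromyE _ _ _).2 tm) (phiE m)).
apply: phii; rewrite Hc MC_tuple_infty; apply/esym/gl_conj_inv => {}m.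
by rewrite (map_comp c) gl_conj_prod.
Qed.
End Main.

Theorem theorem1p6p2 (R : realType) (K : fieldType) (p : nat)
    (x : 'I_p -> (R[i])^o) (u0 : U x)
    (alpha : 'I_p.+1 -> R -> U0 u0) (delta : 'I_p -> R -> S0 u0)
    (lambda : K) (lambda0 : lambda != 0) (L : sheaf K (Gm R)) :
  injective x -> alpha_base alpha -> delta_base alpha delta ->
  lambda != 1 -> kummer lambda L ->
  exists phi : forall (V : sheaf K (U1 x)) (A : 'I_p.+1 -> GL (V (pr1 u0))),
      {linear MC L V (pr2 u0) -> submodT (MC_W lambda A)},
    (forall (V : sheaf K (U1 x)) (A : 'I_p.+1 -> GL (V (pr1 u0))),
      in_T A -> monodromy_tuple (alphaU1 alpha) A ->
      [/\ local_system (MC L V),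
          bijective (phi V A)
        & exists B : 'I_p.+1 -> GL (MC L V (pr2 u0)),
            monodromy_tuple (deltaU1 delta) B /\
            forall j m, phi V A (B j m) = MC_tuple lambda0 A j (phi V A m)]) /\
    (forall (V V' : sheaf K (U1 x)) (A : 'I_p.+1 -> GL (V (pr1 u0)))
        (A' : 'I_p.+1 -> GL (V' (pr1 u0))) (f : shom V V'),
      in_T A -> monodromy_tuple (alphaU1 alpha) A ->
      in_T A' -> monodromy_tuple (alphaU1 alpha) A' ->
      forall m i, val (phi V' A' (MC_hom L f (pr2 u0) m)) i =
                  f (pr1 u0) (val (phi V A m) i)).
Proof.
move=> _ ab db lambda1 kL.
have ex (V : sheaf K (U1 x)) (A : 'I_p.+1 -> GL (V (pr1 u0))) :
    exists phi : {linear MC L V (pr2 u0) -> submodT (MC_W lambda A)},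
    local_system V /\ monodromy_tuple (alphaU1 alpha) A ->
    bijective phi /\ forall m, stalk_rel alpha kL m (val (phi m)).
  have [[lV mA]|N] := pselect (local_system V /\ monodromy_tuple (alphaU1 alpha) A); last first.
    (* The zero map is the default outside the hypotheses, so that [phi] can be chosen for all [V]
       and [A] at once. *)
    by exists (GRing.null_fun _).
  by have [phi H] := stalk_map_exists lambda0 lambda1 kL ab lV mA; exists phi.
exists (fun V A => projT1 (cid (ex V A))); split=> [V A [lV _ _] mA|V V' A A' f [lV _ _] mA [lV' _ _] mA' m].
  case: cid => /= phi /(_ (conj lV mA))[phib phiE].
  split=> //; first exact: MC_local_system phib.
  exact: (MC_monodromy lambda0 lambda1 ab db lV mA phib phiE).
have [_ phiE] := projT2 (cid (ex V A)) (conj lV mA).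
have [_ phiE'] := projT2 (cid (ex V' A')) (conj lV' mA') => i.
(* Both sides are cocycles of the image class under [MC_hom L f], and a class has only one
   cocycle. *)
have E := stalk_rel_uniq lambda1 ab lV' (phiE' (MC_hom L f (pr2 u0) m)) (stalk_rel_hom f (phiE m)).
exact: (congr1 (fun w : prodM (fun _ : 'I_p => V' (pr1 u0)) => w i) E).
Qed.
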